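(* Let $\Omega\subset\mathbb{R}^2$ be an open bounded domain of class $C^2$ and let $f\in L^2(\Omega)$ (with values in $\mathbb{R}^2$). Then there exists at least one $u\in V(\Omega)$ such that $$\int_\Omega ((u\cdot\nabla)u)\cdot w\,dx+\int_\Omega \nu\,\mathbf{D}(u):\mathbf{D}(w)\,dx=\int_\Omega f\cdot w\,dx\qquad\text{for all } w\in V(\Omega),$$ and there exists a function $p\in L^2(\Omega)$ such that $(u\cdot\nabla)u-\mathrm{div}\,[\nu(x)\mathbf{D}u]+\nabla p=f$ is satisfied in $\Omega$ (in the sense of distributions).
   Context: $S\subset\Omega$ is a fixed domain (the region occupied by the obstacle), and the viscosity is the discontinuous function $\nu(x)=1$ for $x\in\Omega\setminus S$, $\nu(x)=m$ for $x\in S$, where $m\ge 1$ is a constant. $\mathbf{D}u$ is the symmetric tensor with components $\mathbf{D}_{ij}u=\frac12\left(\frac{\partial u_i}{\partial x_j}+\frac{\partial u_j}{\partial x_i}\right)$, and $\xi:\eta=\sum_{i,j}\xi_{ij}\eta_{ij}$. $V(\Omega)$ is the closure in $H^1_0(\Omega)$ of $\{v\in C_0^\infty(\Omega,\mathbb{R}^2): \mathrm{div}\,v=0\}$. *)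

(* Defs.v *)
From HB Require Import structures.
From mathcomp Require Import all_boot all_order all_algebra.
From mathcomp Require Import all_classical all_reals all_analysis.
Set Implicit Arguments.
Unset Strict Implicit.
Unset Printing Implicit Defensive.
Import Order.TTheory GRing.Theory Num.Theory.
Import numFieldNormedType.Exports.
Local Open Scope classical_set_scope.
Local Open Scope ring_scope.

Section Defs.
Variable R : realType.

(* Scalar fields and vector fields are total functions; only their values on
   the domain under consideration matter, up to null sets for elements of
   Lebesgue and Sobolev spaces. A vector field is given by its components. *)
Definition sfield : Type := (R * R)%type -> R.
Definition vfield : Type := 'I_2 -> sfield.

(* Two-dimensional Lebesgue measure (on Borel sets). *)
Definition leb2 :
    {measure set (measurableTypeR R * measurableTypeR R) -> \bar R} :=
  (@lebesgue_measure R \x @lebesgue_measure R)%E.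

Definition is_domain (A : set (R * R)) := [/\ open A, A !=set0 & connected A].

Definition C2_fun (g : R -> R) :=
  [/\ forall x, derivable g x 1, forall x, derivable (derive1 g) x 1
    & continuous (derive1n 2 g)].

(* Near each boundary point, in suitable Cartesian coordinates (the axes being
   rotated by the angle with cosine a and sine b), A is the region strictly
   above the graph of a C^2 function. The translation of the origin is absorbed
   in g. *)
Definition C2_boundary (A : set (R * R)) :=
  forall x0, (closure A `\` interior A) x0 ->
  exists a b r : R, exists g : R -> R,
    [/\ a ^+ 2 + b ^+ 2 = 1, 0 < r, C2_fun g
      & forall x, ball x0 r x ->
          (A x <-> g (a * x.1 + b * x.2) < - b * x.1 + a * x.2)].

Definition unit_vec (i : 'I_2) : R * R := ((i == 0)%:R, (i == 1)%:R).

Definition partial (i : 'I_2) (phi : sfield) : sfield :=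
  fun x => 'D_(unit_vec i) phi x.

Fixpoint Ck (k : nat) (phi : sfield) : Prop :=
  continuous phi /\
  if k is k'.+1 then
    forall i, (forall x, derivable phi x (unit_vec i)) /\ Ck k' (partial i phi)
  else True.

(* C_0^oo(A) *)
Definition test_fun (A : set (R * R)) (phi : sfield) :=
  [/\ forall k, Ck k phi,
      compact (closure [set x | phi x != 0])
    & closure [set x | phi x != 0] `<=` A].

Definition test_field (A : set (R * R)) : set vfield :=
  [set phi | forall i, test_fun A (phi i)].

Definition solenoidal_test_field (A : set (R * R)) : set vfield :=
  [set phi | test_field A phi /\ forall x, \sum_i partial i (phi i) x = 0].

(* L^2(A): the extension by zero of g outside A is in L^2 of the plane. *)
Definition L2 (A : set (R * R)) (g : sfield) := g \_ A \in Lfun leb2 2%:E.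

Definition is_weak_partial (A : set (R * R)) (i : 'I_2) (g h : sfield) :=
  L2 A h /\
  forall phi, test_fun A phi ->
    \int[leb2]_(x in A) (g x * partial i phi x) =
    - \int[leb2]_(x in A) (h x * phi x).

(* The weak partial derivative of an element of H^1(A): a representative, which
   is unique up to a null subset of A. It is a junk value if there is none. *)
Definition wpartial (A : set (R * R)) (i : 'I_2) (g : sfield) : sfield :=
  get [set h | is_weak_partial A i g h].

Definition H1 (A : set (R * R)) : set vfield :=
  [set u | forall i, L2 A (u i) /\ forall j, exists h, is_weak_partial A j (u i) h].

Definition H1norm (A : set (R * R)) (u : vfield) : \bar R :=
  ((\int[leb2]_(x in A)
     (\sum_i (u i x ^+ 2 + \sum_j wpartial A j (u i) x ^+ 2))%:E) `^ 2^-1)%E.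

Definition H1closure (A : set (R * R)) (B : set vfield) : set vfield :=
  [set u | H1 A u /\ forall e : R, 0 < e ->
     exists2 v, B v & (H1norm A (fun i x => (u i x - v i x)%R) < e%:E)%E].

Definition H10 (A : set (R * R)) : set vfield := H1closure A (test_field A).

Definition V (A : set (R * R)) : set vfield :=
  H10 A `&` H1closure A (solenoidal_test_field A).

Definition visc (S : set (R * R)) (m : R) : sfield :=
  fun x => if x \in S then m else 1.

Definition symgrad (A : set (R * R)) (u : vfield) (i j : 'I_2) : sfield :=
  fun x => 2^-1 * (wpartial A j (u i) x + wpartial A i (u j) x).

Definition convection (A : set (R * R)) (u : vfield) : vfield :=
  fun i x => \sum_j u j x * wpartial A j (u i) x.

Definition dot (u v : vfield) : sfield := fun x => \sum_i u i x * v i x.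

Definition double_dot (s t : 'I_2 -> 'I_2 -> sfield) : sfield :=
  fun x => \sum_i \sum_j s i j x * t i j x.

(* Distributions, seen as functionals to be tested on C_0^oo(A). *)
Definition distrib : Type := sfield -> R.

Definition regular_distrib (A : set (R * R)) (g : sfield) : distrib :=
  fun phi => \int[leb2]_(x in A) (g x * phi x).

Definition distrib_partial (i : 'I_2) (T : distrib) : distrib :=
  fun phi => - T (partial i phi).

Definition momentum_eq (A : set (R * R)) (nu : sfield) (f u : vfield)
    (p : sfield) :=
  forall i phi, test_fun A phi ->
    regular_distrib A (convection A u i) phi
    - \sum_j distrib_partial j (regular_distrib A (fun x => nu x * symgrad A u i j x)) phi
    + distrib_partial i (regular_distrib A p) phi
    = regular_distrib A (f i) phi.

End Defs.

(* Main.v *)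
(* The weak solution is a limit of Galerkin approximations. The finite-dimensional
   problems are solved by the Poincare-Miranda theorem, itself a consequence of the
   nonvanishing modulo 2 of a cup product on a triangulated cube. The energy estimate
   comes from Korn's identity, the convection term being skew-symmetric; it passes to
   the limit because its quadratic part is compact in L^2 (Rellich), and extends from
   solenoidal test fields to V because V embeds in L^4 (Ladyzhenskaya's inequality).

   Spaces are completed as late as possible: Riesz representation and the Galerkin
   method produce sequences of test fields which are Cauchy for the energy, and only
   their limits are taken in L^2. An ultrafilter replaces weak subsequences.

   For the pressure, the residual of the weak equation vanishes on solenoidal test
   fields and is bounded by the Dirichlet norm. It is therefore bounded by the L^2 norm
   of the divergence as soon as every test function of integral zero is the divergence
   of a test field whose Dirichlet norm it controls. Locally, above a C^2 graph, the
   domain contains translated cones and the field is Bogovskii's integral with a tensor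
   product kernel all of whose first moments vanish: its gradient is an integral over
   scales dr/r of products of two averages at scale r, one of them of mean zero, and a
   square function estimate (integration over one line at a time) replaces the theory
   of singular integrals. A chain of such neighbourhoods globalizes the construction. *)
Require Import Defs.
From HB Require Import structures.
From mathcomp Require Import all_boot all_order all_algebra fingroup perm.
From mathcomp Require Import all_classical all_reals all_analysis.
From mathcomp Require Import measurable_realfun ring lra zify.
Set Implicit Arguments.
Unset Strict Implicit.
Unset Printing Implicit Defensive.
Import Order.TTheory GRing.Theory Num.Theory.
Import numFieldNormedType.Exports.
Local Open Scope classical_set_scope.
Local Open Scope ring_scope.

(** * Integration *)

(** The obstacle is the gradient bound for Bogovskii's field. Its kernel is the convolution square
    of a tensor product [a], kept as an integral over pairs of displacements [w], [w']: in a duality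
    pairing at scale [r], one copy of [a] acts on the function and the other on the dual function.
    The derivative is thrown on the first copy, at the cost of [1 / r], and the weight [w_i + w'_i]
    of the homotopy formula on the second. A derivative has mean zero, and the first moment of [a]
    is zero by construction, so both sides have the cancellation that a square function estimate
    requires. Nearly all operators are instances of a single one, [Avg], convolution with the image
    of a weighted measure; its smoothness and its L^2 bound are proved once. Derivatives come from
    quadratic remainder bounds, because such bounds can be integrated over parameters. Estimates are
    proved for smooth functions of bounded support, whose integrability is automatic; Sobolev fields
    are extended by zero, so that integrals are over the plane. Weak derivatives are chosen up to
    null sets, whence the fundamental lemma. *)

Section Plane.
Variable R : realType.
Local Notation R2 := (measurableTypeR R * measurableTypeR R)%type.

(** Balls of the product norm are squares, so an open set is a union of countably many rational
    squares. This ties the topology of the plane to its product sigma-algebra. *)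
Lemma open_measurable_plane (U : set (R * R)) : open U -> measurable (U : set R2).
Proof.
move=> oU.
pose B (q : rat * rat * nat) : set R2 :=
  (ball (ratr q.1.1 : R) (q.2.+1%:R^-1)) `*` (ball (ratr q.1.2 : R) (q.2.+1%:R^-1)).
have -> : U = \bigcup_q (if pselect (B q `<=` U) then B q else set0).
  apply/seteqP; split=> [x Ux|x [q _]]; last by case: pselect => // h; apply: h.
  have [e [e0 He]] : exists e : R, 0 < e /\ ball x e `<=` U.
    by have /nbhs_ballP[e /= e0 He] := open_nbhs_nbhs (conj oU Ux); exists e.
  pose n := Num.trunc (2 / e).
  have ne : (n.+1%:R)^-1 < e / 2.
    rewrite -[ltRHS]invrK ltf_pV2 ?posrE ?invr_gt0 ?divr_gt0// invf_div.
    exact: truncnS_gt.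
  have ee : n.+1%:R^-1 + n.+1%:R^-1 <= e by move: (n.+1%:R^-1) ne => t ne; lra.
  have n0 : (0 : R) < n.+1%:R^-1 by rewrite invr_gt0.
  have rat_ball (y t : R) : 0 < t -> exists q : rat, ball (ratr q : R) t y.
    move=> t0; have /rat_in_itvoo[q] : y < y + t by rewrite ltrDl.
    rewrite in_itv/= => /andP[yq qt]; exists q; rewrite /ball/= ltr_norml.
    by move: (ratr q : R) yq qt => r yq qt; lra.
  have [[q1 Hq1] [q2 Hq2]] := (rat_ball x.1 _ n0, rat_ball x.2 _ n0).
  exists (q1, q2, n) => //.
  have Bx : B (q1, q2, n) x by split.
  case: pselect => // -[] y [/= y1 y2]; apply: He.
  by split; apply: (le_ball ee); [exact: ball_triangle (ball_sym Hq1) y1|exact: ball_triangle (ball_sym Hq2) y2].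
apply: countable_bigcupT_measurable => // q; case: pselect => [?|?]; last exact: measurable0.
apply: measurableX; exact: measurable_realfun.measurable_ball.
Qed.

Lemma continuous_measurable_plane (f : R * R -> R) : continuous f ->
  measurable_fun (setT : set R2) (f : R2 -> R).
Proof.
move=> /continuousP cf; apply: (measurability _ (RGenOpens.measurableE R)).
move=> _ [_ [a [b ->] <-]]; rewrite setTI; apply: open_measurable_plane.
exact/cf/interval_open.
Qed.

(** By uniqueness of Lebesgue measure, invariance is checked on half-open intervals. *)
Lemma lebesgue_measure_shift (c : R) (A : set (measurableTypeR R)) : measurable A ->
  lebesgue_measure ((fun x : R => x + c) @^-1` A) = lebesgue_measure A.
Proof.
move=> mA.
have mc : measurable_fun setT (fun x : measurableTypeR R => (x + c : measurableTypeR R)).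
  by apply: measurable_funD => //; exact: measurable_id.
symmetry; apply: (@lebesgue_measure_unique R (pushforward lebesgue_measure (fun x : measurableTypeR R => (x + c : measurableTypeR R)))) => //.
move=> _ [[a b] _ <-]; rewrite /pushforward.
rewrite [X in _ = lebesgue_measure X](_ : _ = [set` `](a - c), (b - c)]]); last first.
  by apply/seteqP; split => x /=; rewrite !in_itv/=; lra.
rewrite !lebesgue_measure_itv/= !lte_fin ltrD2r.
by case: ifP => // _; rewrite -!EFinB; congr (_ %:E); ring.
Qed.

Lemma leb2_shift (h : R * R) (A : set R2) : measurable A ->
  leb2 R ((fun x => x + h) @^-1` A) = leb2 R A.
Proof.
move=> mA.
have mh : measurable_fun setT (fun x : R2 => ((x : R * R) + h : R2)).
  by apply: measurable_fun_pair; apply: measurable_funD.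
symmetry; rewrite /leb2.
apply: (@product_measure_unique _ _ _ _ _ _ _ (pushforward (leb2 R) (fun x : R2 => ((x : R * R) + h : R2)))) => //.
move=> B C mB mC.
change (leb2 R (((fun x : R => x + h.1) @^-1` B) `*` ((fun x : R => x + h.2) @^-1` C))
  = (lebesgue_measure B * lebesgue_measure C)%E).
have mc c (D : set (measurableTypeR R)) : measurable D ->
    measurable ((fun x : R => x + c) @^-1` D : set (measurableTypeR R)).
  move=> mD; rewrite -[X in measurable X]setTI.
  have : measurable_fun setT (fun x : measurableTypeR R => (x + c : measurableTypeR R)).
    by apply: measurable_funD => //; exact: measurable_id.
  exact.
etransitivity; first exact: product_measure1E (mc _ _ mB) (mc _ _ mC).
exact: (congr2 (fun a b => a * b)%E (lebesgue_measure_shift _ mB) (lebesgue_measure_shift _ mC)).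
Qed.

End Plane.

(** * Calculus of integrals of real-valued functions over a whole space *)

Section IntegralToolkit.
Context d (T : measurableType d) (R : realType).
Variable mu : {measure set T -> \bar R}.
Implicit Types f g k : T -> R.

(** [J] is total but meaningful under [ig]; hence the integrability side conditions of the linear
    rules. Integrals over a domain are expressed by functions vanishing outside it. *)
Definition ig f := mu.-integrable setT (EFin \o f).
Definition J f : R := \int[mu]_x f x.

Lemma ig_meas f : ig f -> measurable_fun setT f.
Proof. by move=> /measurable_int/measurable_EFinP. Qed.

Lemma eq_ig f g : f =1 g -> ig f -> ig g.
Proof. by move=> /funext ->. Qed.

Lemma eq_J f g : f =1 g -> J f = J g.
Proof. by move=> /funext ->. Qed.

Lemma ig_le f g : measurable_fun setT f -> (forall x, `|f x| <= g x) -> ig g -> ig f.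
Proof.
move=> mf fg; apply: le_integrable => //; first exact/measurable_EFinP.
by move=> x _; rewrite /= lee_fin (le_trans (fg x))// ler_norm.
Qed.

Lemma ig_0 : ig (fun=> 0).
Proof. exact: integrable0. Qed.

Lemma igD f g : ig f -> ig g -> ig (fun x => f x + g x).
Proof. by move=> *; apply: (@integrableD _ _ _ mu setT _ (EFin \o f) (EFin \o g)). Qed.

Lemma igZ c f : ig f -> ig (fun x => c * f x).
Proof. by move=> *; apply: (@integrableZl _ _ _ mu setT _ c (EFin \o f)). Qed.

Lemma igZr c f : ig f -> ig (fun x => f x * c).
Proof. by move=> /(igZ c); apply: eq_ig => x; rewrite mulrC. Qed.

Lemma igN f : ig f -> ig (fun x => - f x).
Proof. by move=> /(igZ (-1)); apply: eq_ig => x; rewrite mulN1r. Qed.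

Lemma igB f g : ig f -> ig g -> ig (fun x => f x - g x).
Proof. by move=> *; apply: igD => //; exact: igN. Qed.


Lemma ig_norm f : ig f -> ig (fun x => `|f x|).
Proof. by move=> /integrable_abse; apply: eq_integrable. Qed.

Lemma ig_sum (I : finType) (F : I -> T -> R) :
  (forall i, ig (F i)) -> ig (fun x => \sum_i F i x).
Proof.
move=> h; suff H (s : seq I) : ig (fun x => \sum_(i <- s) F i x) by exact: H.
elim: s => [|i s IH].
  by apply: eq_ig ig_0 => x; rewrite big_nil.
by apply: eq_ig (igD (h i) IH) => x; rewrite big_cons.
Qed.

Lemma ig_mulb C f k : measurable_fun setT k -> (forall x, `|k x| <= C) ->
  ig f -> ig (fun x => f x * k x).
Proof.
move=> mk kC hf; apply: (@ig_le _ (fun x => C * `|f x|)).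
- by apply: measurable_funM => //; exact: ig_meas.
- by move=> x; rewrite normrM mulrC ler_wpM2r.
- exact/igZ/ig_norm.
Qed.

Lemma JD f g : ig f -> ig g -> J (fun x => f x + g x) = J f + J g.
Proof. by move=> *; rewrite /J RintegralD. Qed.

Lemma JB f g : ig f -> ig g -> J (fun x => f x - g x) = J f - J g.
Proof. by move=> *; rewrite /J RintegralB. Qed.

Lemma JZ c f : ig f -> J (fun x => c * f x) = c * J f.
Proof. by move=> *; rewrite /J RintegralZl. Qed.

Lemma JZr c f : ig f -> J (fun x => f x * c) = J f * c.
Proof. by move=> *; rewrite /J RintegralZr. Qed.

Lemma J0 : J (fun=> 0) = 0.
Proof. by rewrite -[RHS](mul0r (J (fun=> 0))) -JZ; [apply: eq_J => x; rewrite mul0r|exact: ig_0]. Qed.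

Lemma JN f : ig f -> J (fun x => - f x) = - J f.
Proof. by move=> h; rewrite -mulN1r -JZ//; apply: eq_J => x; rewrite mulN1r. Qed.

Lemma J_sum (I : finType) (F : I -> T -> R) :
  (forall i, ig (F i)) -> J (fun x => \sum_i F i x) = \sum_i J (F i).
Proof.
move=> h.
suff H (s : seq I) : ig (fun x => \sum_(i <- s) F i x) /\
    J (fun x => \sum_(i <- s) F i x) = \sum_(i <- s) J (F i) by have [_] := H (index_enum I).
elim: s => [|i s [IH1 IH2]].
  by rewrite big_nil; split; [apply: eq_ig ig_0|rewrite -[RHS]J0; apply: eq_J] => x; rewrite big_nil.
rewrite big_cons -IH2 -JD//; split; first by apply: eq_ig (igD (h i) IH1) => x; rewrite big_cons.
by apply: eq_J => x; rewrite big_cons.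
Qed.

Lemma J_ge0 f : (forall x, 0 <= f x) -> 0 <= J f.
Proof. by move=> f0; apply: Rintegral_ge0. Qed.

Lemma J_le f g : ig f -> ig g -> (forall x, f x <= g x) -> J f <= J g.
Proof. by move=> hf hg fg; apply: le_Rintegral. Qed.

Lemma J_norm f : ig f -> `|J f| <= J (fun x => `|f x|).
Proof. by move=> hf; apply: le_normr_Rintegral. Qed.

Lemma J_le_norm f g : ig f -> ig g -> (forall x, `|f x| <= g x) -> `|J f| <= J g.
Proof.
by move=> hf hg fg; apply: le_trans (J_norm hf) _; apply: J_le => //; exact: ig_norm.
Qed.

Lemma J_mulb C f k : 0 <= C -> measurable_fun setT k -> (forall x, `|k x| <= C) ->
  ig f -> `|J (fun x => f x * k x)| <= C * J (fun x => `|f x|).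
Proof.
move=> C0 mk kC hf; rewrite -JZ; last exact: ig_norm.
apply: J_le_norm; [exact: ig_mulb kC hf|exact/igZ/ig_norm|].
by move=> x; rewrite normrM mulrC ler_wpM2r.
Qed.

Lemma EFin_J f : ig f -> (J f)%:E = (\int[mu]_x (f x)%:E)%E.
Proof. by move=> h; rewrite /J /Rintegral fineK//; exact: integrable_fin_num. Qed.

Lemma ig_ge0P f : measurable_fun setT f -> (forall x, 0 <= f x) ->
  (\int[mu]_x (f x)%:E < +oo)%E -> ig f.
Proof.
move=> mf f0 h; apply/integrableP; split; first exact/measurable_EFinP.
by rewrite (eq_integral (fun x => (f x)%:E))// => x _; rewrite /= ger0_norm.
Qed.

Lemma ae_eq_ig (f1 f2 : T -> \bar R) : measurable_fun setT f1 -> ae_eq mu setT f1 f2 ->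
  mu.-integrable setT f2 -> mu.-integrable setT f1.
Proof.
move=> mf1 E /integrableP[mf2 h2]; apply/integrableP; split => //.
have -> : (\int[mu]_x `|f1 x| = \int[mu]_x `|f2 x|)%E => //.
apply: ae_eq_integral => //; try exact: measurableT_comp.
by move: E; apply: filterS => x /= + _ => ->.
Qed.

Lemma ig_mul f g : measurable_fun setT f -> measurable_fun setT g ->
  ig (fun x => f x ^+ 2) -> ig (fun x => g x ^+ 2) -> ig (fun x => f x * g x).
Proof.
move=> mf mg hf hg.
apply: (@ig_le _ (fun x => f x ^+ 2 + g x ^+ 2)); last exact: igD.
  exact: measurable_funM.
move=> x; rewrite normrM -(real_normK (num_real (f x))) -(real_normK (num_real (g x))).
have := normr_ge0 (f x); have := normr_ge0 (g x).
move: `|f x| `|g x| => a b; nra.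
Qed.

Lemma J_CS f g : measurable_fun setT f -> measurable_fun setT g ->
  ig (fun x => f x ^+ 2) -> ig (fun x => g x ^+ 2) ->
  (J (fun x => f x * g x)) ^+ 2 <= J (fun x => f x ^+ 2) * J (fun x => g x ^+ 2).
Proof.
move=> mf mg hf hg; have hfg := ig_mul mf mg hf hg.
set a := J _; set b := J (fun x => f x ^+ 2); set c := J _.
have H s t : 0 <= s ^+ 2 * b + 2 * s * t * a + t ^+ 2 * c.
  have -> : s ^+ 2 * b + 2 * s * t * a + t ^+ 2 * c = J (fun x => (s * f x + t * g x) ^+ 2).
    have [[h1 h2] h3] := (igZ (s ^+ 2) hf, igZ (2 * s * t) hfg, igZ (t ^+ 2) hg).
    rewrite -(JZ _ hf) -(JZ _ hfg) -(JZ _ hg) -(JD h1 h2) -(JD (igD h1 h2) h3).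
    by apply: eq_J => x; ring.
  by apply: J_ge0 => x; exact: sqr_ge0.
have c0 : 0 <= c by apply: J_ge0 => x; exact: sqr_ge0.
have b0 : 0 <= b by apply: J_ge0 => x; exact: sqr_ge0.
(* If [c = 0], the form is affine in [t] once [s = 1], and [t = - (b + 1) / (2 a)] would give it the
   value -1. Otherwise [s = c], [t = - a] yield [c (b c - a ^ 2) >= 0]. *)
have [c00|c1] := eqVneq c 0.
  have := H 1; rewrite c00 mulr0 => H1.
  suff -> : a = 0 by rewrite expr0n.
  apply/eqP; apply/negP => /negP a0.
  have := H1 (- (b + 1) / (2 * a)); rewrite !mulr1 mulr0 addr0 expr1n mul1r.
  have -> : 2 * (- (b + 1) / (2 * a)) * a = - (b + 1) by field.
  lra.
have := H c (- a); have : 0 < c by rewrite lt_neqAle eq_sym c1.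
nra.
Qed.

End IntegralToolkit.

(** * Iterated integrals *)

Section FubiniToolkit.
Context d1 d2 (T1 : measurableType d1) (T2 : measurableType d2) (R : realType).
Variables (m1 : {sigma_finite_measure set T1 -> \bar R}) (m2 : {sigma_finite_measure set T2 -> \bar R}).

(** A copy of the product measure that carries a sigma-finite structure, so that products can be
    iterated. *)
Definition prod_meas : set (T1 * T2)%type -> \bar R := (m1 \x m2)%E.

HB.instance Definition _ := Measure.copy prod_meas (m1 \x m2)%E.

Lemma prod_meas_sigma_finite : sigma_finite setT prod_meas.
Proof.
have /sigma_finiteP[F [TF ndF Foo]] := sigma_finiteT m1.
have /sigma_finiteP[G [TG ndG Goo]] := sigma_finiteT m2.
exists (fun n => F n `*` G n).
 rewrite -setXTT TF TG predeqE => -[x y]; split.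
    move=> [/= [n _ Fnx] [k _ Gky]]; exists (maxn n k) => //; split.
    - by move: x Fnx; exact/subsetPset/ndF/leq_maxl.
    - by move: y Gky; exact/subsetPset/ndG/leq_maxr.
  by move=> [n _ []/= ? ?]; split; exists n.
move=> k; have [? ?] := Foo k; have [? ?] := Goo k.
split; first exact: measurableX.
by rewrite /prod_meas product_measure1E// lte_mul_pinfty// ge0_fin_numE.
Qed.

HB.instance Definition _ :=
  Measure_isSigmaFinite.Build _ _ _ prod_meas prod_meas_sigma_finite.

Definition prodm : {sigma_finite_measure set (T1 * T2)%type -> \bar R} := prod_meas.

Lemma ig_prod (f : T1 -> R) (g : T2 -> R) : ig m1 f -> ig m2 g ->
  ig prodm (fun z => f z.1 * g z.2).
Proof.
move=> hf hg; have mf := ig_meas hf; have mg := ig_meas hg.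
have mfg : measurable_fun setT (fun z : T1 * T2 => f z.1 * g z.2).
  by apply: measurable_funM; apply: measurableT_comp.
apply/(integrable12ltyP _).
  exact/measurable_EFinP.
under eq_integral => x _.
  under eq_integral => y _ do rewrite /= normrM EFinM.
  rewrite ge0_integralZl_EFin//; last by apply/measurable_EFinP; exact: measurableT_comp.
  rewrite -(EFin_J (ig_norm hg)) -EFinM.
  over.
rewrite /=.
have h : ig m1 (fun x => `|f x| * J m2 (fun y => `|g y|)) by apply/igZr/ig_norm.
by rewrite -(EFin_J h) ltry.
Qed.

(** The inner [J] is the [fine] part of the integral of a section, so it agrees with [fubini_F] off
    the null set of the non-integrable sections. The identity is therefore obtained from an almost
    everywhere equality. *)
Lemma J_fubini1 (F : T1 * T2 -> R) : ig prodm F ->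
  ig m1 (fun x => J m2 (fun y => F (x, y))) /\
  J m1 (fun x => J m2 (fun y => F (x, y))) = J prodm F.
Proof.
move=> hF.
have H1 := integrable_fubini_F hF.
have H2 := integral12_prod_meas1 hF.
have E : ae_eq m1 setT (EFin \o (fun x => J m2 (fun y => F (x, y)))) (fubini_F m2 (EFin \o F)).
  have := ae_integrable1 hF; apply: filterS => x /= hx _.
  by rewrite /fubini_F -EFin_J.
have mE : measurable_fun setT (EFin \o (fun x => J m2 (fun y => F (x, y)))).
  apply/measurable_EFinP; rewrite /J /Rintegral.
  exact: (measurableT_comp (fine_measurable measurableT) (measurable_fubini_F hF)).
split.
  exact: (ae_eq_ig mE E H1).
rewrite {1}/J /Rintegral /J /Rintegral -H2; congr fine.
by apply: ae_eq_integral E => //; exact: measurable_int H1.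
Qed.

Lemma J_fubini2 (F : T1 * T2 -> R) : ig prodm F ->
  ig m2 (fun y => J m1 (fun x => F (x, y))) /\
  J m2 (fun y => J m1 (fun x => F (x, y))) = J prodm F.
Proof.
move=> hF.
have H1 : m2.-integrable setT (fubini_G m1 (EFin \o F)).
  have mF := measurable_int _ hF.
  have m2F := measurable_fun_fubini_tonelli_G (abse \o (EFin \o F)) (measurableT_comp (@abse_measurable R setT) mF) (fun=> abse_ge0 _).
  apply/integrableP; split; first exact: (measurable_fubini_G hF).
  apply: le_lt_trans ((integrable21ltyP m1 m2 mF).1 hF).
  apply: ge0_le_integral => //; first by apply: measurableT_comp => //; exact: (measurable_fubini_G hF).
    exact: m2F.
  by move=> y _; apply: le_abse_integral => //; exact: measurableT_comp.
have H2 := integral21_prod_meas1 hF.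
have E : ae_eq m2 setT (EFin \o (fun y => J m1 (fun x => F (x, y)))) (fubini_G m1 (EFin \o F)).
  have := ae_integrable2 hF; apply: filterS => x /= hx _.
  by rewrite /fubini_G -EFin_J.
have mE : measurable_fun setT (EFin \o (fun y => J m1 (fun x => F (x, y)))).
  apply/measurable_EFinP; rewrite /J /Rintegral.
  exact: (measurableT_comp (fine_measurable measurableT) (measurable_fubini_G hF)).
split.
  exact: (ae_eq_ig mE E H1).
rewrite {1}/J /Rintegral /J /Rintegral -H2; congr fine.
by apply: ae_eq_integral E => //; exact: measurable_int H1.
Qed.

Lemma J_exchange (F : T1 -> T2 -> R) : ig prodm (fun z => F z.1 z.2) ->
  J m1 (fun x => J m2 (fun y => F x y)) = J m2 (fun y => J m1 (fun x => F x y)).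
Proof. by move=> h; rewrite (J_fubini1 h).2 (J_fubini2 h).2. Qed.

End FubiniToolkit.

(** * Test functions of the plane *)

Section TestFunctions.
Variable R : realType.
Local Notation R2 := (measurableTypeR R * measurableTypeR R)%type.
Implicit Types (phi psi : R * R -> R) (x h : R * R) (i j : 'I_2).

(** The measure [leb2] of the statement, packaged as sigma-finite so that it can enter further
    products. *)
Definition lebs : {sigma_finite_measure set R2 -> \bar R} :=
  prodm (@lebesgue_measure R) (@lebesgue_measure R).

Definition I2 (phi : R * R -> R) : R := J lebs phi.

Lemma I2_shift phi h : measurable_fun (setT : set R2) phi ->
  I2 (fun x => phi (x + h)) = I2 phi.
Proof.
move=> mf.
have mh : measurable_fun setT (fun x : R2 => ((x : R * R) + h : R2)).
  by apply: measurable_fun_pair; apply: measurable_funD.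
have E (g : R2 -> \bar R) : measurable_fun setT g -> (forall x, 0 <= g x)%E ->
   (\int[lebs]_x g ((x : R * R) + h)%R = \int[lebs]_x g x)%E.
  move=> mg g0.
  have := @ge0_integral_pushforward _ _ _ _ _ _ mh lebs setT g measurableT mg (fun y _ => g0 y).
  rewrite preimage_setT => <-.
  apply: eq_measure_integral => A mA _; exact: leb2_shift.
rewrite /I2 /J /Rintegral; congr fine; rewrite [LHS]integralE [RHS]integralE.
congr (_ - _)%E.
  rewrite -(E (EFin \o phi)^\+%E)//; first by apply: eq_integral => x _; rewrite !funeposE.
  by apply: measurable_funepos; exact/measurable_EFinP.
rewrite -(E (EFin \o phi)^\-%E)//; first by apply: eq_integral => x _; rewrite !funenegE.
by apply: measurable_funeneg; exact/measurable_EFinP.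
Qed.

Definition bsupp phi := exists M : R, 0 < M /\ forall x, M < `|x| -> phi x = 0.
Definition cc phi := continuous phi /\ bsupp phi.

Lemma continuous_shift phi h : continuous phi -> continuous (fun x => phi (x + h)).
Proof.
move=> cp x; apply: (@continuous_comp _ _ _ (fun y : R * R => y + h) phi); last exact: cp.
by apply: cvgD; [exact: cvg_id|exact: cvg_cst].
Qed.

Lemma compact_box (M : R) : compact [set x : R * R | `|x| <= M].
Proof.
have -> : [set x : R * R | `|x| <= M] = `[- M, M]%classic `*` `[- M, M]%classic.
  apply/seteqP; split=> [[a b]|[a b]] /=; rewrite prod_normE/= ge_max !in_itv/= -!ler_norml.
    by move/andP.
  by move/andP.
by apply: compact_setX; exact: segment_compact.
Qed.

Lemma cc_bounded phi : cc phi -> exists C : R, 0 < C /\ forall x, `|phi x| <= C.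
Proof.
move=> [cp [M [M0 pM]]].
have := continuous_compact (continuous_subspaceT cp) (@compact_box M).
move=> /compact_bounded[N [_ HN]].
exists (`|N| + 1); split; first by have := normr_ge0 N; lra.
move=> x; have [xM|xM] := lerP `|x| M; last by rewrite pM// normr0; have := normr_ge0 N; lra.
apply: (HN (`|N| + 1)); last by exists x.
by have := ler_norm N; lra.
Qed.

Lemma ig_box (M : R) : ig lebs (\1_[set x : R * R | `|x| <= M] : R * R -> R).
Proof.
have h : ig (@lebesgue_measure R) (\1_`[- M, M]%classic : R -> R).
  apply: ig_ge0P; [by apply: measurable_indic; exact: measurable_itv|by move=> x; rewrite indicE|].
  rewrite integral_indic// setIT.
  have := @lebesgue_measure_itv R `[- M, M]; rewrite /= => E.
  apply: (@le_lt_trans _ _ (lebesgue_measure (`[- M, M]%classic : set R))) => //.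
  by rewrite E; case: ifP => _; rewrite ?ltry// -EFinB ltry.
apply: eq_ig (ig_prod h h) => x /=; rewrite !indicE.
rewrite -natrM mulnb; congr (_%:R)%R; congr nat_of_bool.
apply/andP/idP => [[/set_mem h1 /set_mem h2]|/set_mem].
  apply/mem_set; move: h1 h2; rewrite /= !in_itv/= prod_normE ge_max -!ler_norml => -> ->//.
by rewrite /= prod_normE ge_max => /andP[h1 h2]; split; apply/mem_set; rewrite /= in_itv/= -ler_norml.
Qed.

Lemma cc_meas phi : cc phi -> measurable_fun (setT : set R2) phi.
Proof. by move=> [+ _]; exact: continuous_measurable_plane. Qed.

Lemma cc_ig phi : cc phi -> ig lebs phi.
Proof.
move=> h; have [C [C0 HC]] := cc_bounded h.
have [_ [M [M0 HM]]] := h.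
apply: (ig_le (cc_meas h) _ (igZ C (ig_box M))) => x.
rewrite indicE; have [xM|xM] := boolP (x \in _); first by rewrite mulr1.
by move: xM; rewrite notin_setE/= => /negP; rewrite -ltNge => /HM ->; rewrite normr0 mulr0.
Qed.

Lemma ccD phi psi : cc phi -> cc psi -> cc (fun x => phi x + psi x).
Proof.
move=> [c1 [M [M0 HM]]] [c2 [N [N0 HN]]]; split.
  by move=> x; apply: cvgD; [exact: c1|exact: c2].
exists (Num.max M N); split; first by rewrite lt_max M0.
by move=> x; rewrite gt_max => /andP[/HM -> /HN ->]; rewrite addr0.
Qed.

Lemma ccM phi psi : cc phi -> continuous psi -> cc (fun x => phi x * psi x).
Proof.
move=> [c1 [M [M0 HM]]] c2; split.
  by move=> x; apply: cvgM; [exact: c1|exact: c2].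
by exists M; split => // x /HM ->; rewrite mul0r.
Qed.

Lemma ccZ c phi : cc phi -> cc (fun x => c * phi x).
Proof.
move=> [c1 [M [M0 HM]]]; split.
  by move=> x; apply: cvgM; [exact: cvg_cst|exact: c1].
by exists M; split => // x /HM ->; rewrite mulr0.
Qed.

Lemma cc_shift phi h : cc phi -> cc (fun x => phi (x + h)).
Proof.
move=> [c1 [M [M0 HM]]]; split; first exact: continuous_shift.
exists (M + `|h|); split; first by apply: ltr_wpDr.
move=> x xM; apply: HM; have := ler_normB (x + h) h; rewrite addrK; lra.
Qed.

Lemma line_is_derive phi x h : (forall y, derivable phi y h) ->
  forall t : R, is_derive t 1 (fun t => phi (x + t *: h)) ('D_h phi (x + t *: h)).
Proof.
move=> dp t; set g := fun t => phi (x + t *: h).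
have E : (fun e : R => e^-1 *: ((g \o shift t) (e *: 1) - g t)) =
         (fun e : R => e^-1 *: ((phi \o shift (x + t *: h)) (e *: h) - phi (x + t *: h))).
  apply/funext => e; rewrite /g /= /shift /= [e%:A](_ : _ = e) ?[RHS]/=; last by rewrite /GRing.scale/= mulr1.
  by congr (_ *: (phi _ - _)); rewrite scalerDl addrCA addrC.
by apply: DeriveDef; rewrite /derivable /derive E; [exact: dp|].
Qed.

Lemma line_mvt phi x h : (forall y, derivable phi y h) ->
  forall t : R, exists s : R, `|s| <= `|t| /\ phi (x + t *: h) - phi x = t * 'D_h phi (x + s *: h).
Proof.
move=> dp t; have dl := line_is_derive x dp.
have cl : continuous (fun t : R => phi (x + t *: h)).
  by move=> s; apply: differentiable_continuous; apply/derivable1_diffP; apply: ex_derive.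
have [t0|t0|->] := ltrgt0P t; last first.
- by exists 0; rewrite normr0 scale0r addr0 subrr mul0r.
- have [s /itvP sI E] := MVT t0 (fun s _ => dl s) (continuous_subspaceT cl).
  exists s; split; first by rewrite !ltr0_norm ?sI// lerN2 ?sI.
  move: E; rewrite scale0r addr0 sub0r mulrN => E.
  by rewrite [RHS]mulrC -[RHS]opprK -E opprB. 
- have [s /itvP sI E] := MVT t0 (fun s _ => dl s) (continuous_subspaceT cl).
  exists s; split; first by rewrite !gtr0_norm ?sI.
  by move: E; rewrite scale0r addr0 subr0 mulrC.
Qed.


Definition smooth phi := forall k, Ck k phi.

Lemma CkW k phi : Ck k.+1 phi -> Ck k phi.
Proof.
elim: k phi => [|k IH] phi; first by case.
move=> [cp H]; split => // i; have [d1 d2] := H i; split => //.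
exact: IH.
Qed.

Lemma Ck_derivable k phi i x : Ck k.+1 phi -> derivable phi x (unit_vec R i).
Proof. by move=> [_ /(_ i)[]]. Qed.

Lemma Ck_partial k phi i : Ck k.+1 phi -> Ck k (partial i phi).
Proof. by move=> [_ /(_ i)[]]. Qed.

Lemma smooth_continuous phi : smooth phi -> continuous phi.
Proof. by move=> /(_ 0)[]. Qed.

Lemma smooth_derivable phi i x : smooth phi -> derivable phi x (unit_vec R i).
Proof. by move=> /(_ 1)/Ck_derivable. Qed.

Lemma smooth_partial phi i : smooth phi -> smooth (partial i phi).
Proof. by move=> h k; exact: Ck_partial (h k.+1). Qed.

Lemma partialD phi psi i x : derivable phi x (unit_vec R i) -> derivable psi x (unit_vec R i) ->
  partial i (fun x => phi x + psi x) x = partial i phi x + partial i psi x.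
Proof. by move=> *; exact: deriveD. Qed.

Lemma partialM phi psi i x : derivable phi x (unit_vec R i) -> derivable psi x (unit_vec R i) ->
  partial i (fun x => phi x * psi x) x = partial i phi x * psi x + phi x * partial i psi x.
Proof.
move=> d1 d2; etransitivity; first exact: deriveM d1 d2.
by rewrite addrC /GRing.scale/= [X in X + _]mulrC.
Qed.

Lemma partial_cst c i x : partial i (fun=> c) x = 0.
Proof. exact: derive_cst. Qed.

Lemma CkD k phi psi : Ck k phi -> Ck k psi -> Ck k (fun x => phi x + psi x).
Proof.
elim: k phi psi => [|k IH] phi psi [c1 h1] [c2 h2]; split => //.
- by move=> x; apply: cvgD; [exact: c1|exact: c2].
- by move=> x; apply: cvgD; [exact: c1|exact: c2].
move=> i; have [[d1 e1] [d2 e2]] := (h1 i, h2 i); split.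
  by move=> x; exact: derivableD.
have -> : partial i (fun x => phi x + psi x) = (fun x => partial i phi x + partial i psi x).
  by apply/funext => x; exact: partialD.
exact: IH.
Qed.

Lemma CkM k phi psi : Ck k phi -> Ck k psi -> Ck k (fun x => phi x * psi x).
Proof.
elim: k phi psi => [|k IH] phi psi h1 h2; have [[c1 H1] [c2 H2]] := (h1, h2); split => //.
- by move=> x; apply: cvgM; [exact: c1|exact: c2].
- by move=> x; apply: cvgM; [exact: c1|exact: c2].
move=> i; have [[d1 e1] [d2 e2]] := (H1 i, H2 i); split.
  by move=> x; exact: derivableM.
have -> : partial i (fun x => phi x * psi x) =
    (fun x => partial i phi x * psi x + phi x * partial i psi x).
  by apply/funext => x; exact: partialM.
by apply: CkD; apply: IH => //; exact: CkW.
Qed.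

Lemma Ck_cst k c : Ck k (fun=> c : R).
Proof.
elim: k c => [|k IH] c; split => //; try by move=> x; exact: cvg_cst.
move=> i; split; first by move=> x; exact: derivable_cst.
have -> : partial i (fun=> c : R) = fun=> 0 by apply/funext => x; exact: partial_cst.
exact: IH.
Qed.

Lemma partial_shift phi h i x : partial i (fun x => phi (x + h)) x = partial i phi (x + h).
Proof.
rewrite /partial /derive; suff -> : (fun e : R => e^-1 *: (((fun x => phi (x + h)) \o shift x) (e *: unit_vec R i) - phi (x + h)))
  = (fun e : R => e^-1 *: ((phi \o shift (x + h)) (e *: unit_vec R i) - phi (x + h))) by [].
by apply/funext => e /=; rewrite /shift /= addrA.
Qed.

Lemma derivable_shift phi h x v : derivable phi (x + h) v -> derivable (fun x => phi (x + h)) x v.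
Proof.
rewrite /derivable; suff -> : (fun e : R => e^-1 *: (((fun x => phi (x + h)) \o shift x) (e *: v) - phi (x + h)))
  = (fun e : R => e^-1 *: ((phi \o shift (x + h)) (e *: v) - phi (x + h))) by [].
by apply/funext => e /=; rewrite /shift /= addrA.
Qed.

Lemma Ck_shift k phi h : Ck k phi -> Ck k (fun x => phi (x + h)).
Proof.
elim: k phi => [|k IH] phi [c1 h1]; split => //; try exact: continuous_shift.
move=> i; have [d1 e1] := h1 i; split; first by move=> x; exact: derivable_shift.
have -> : partial i (fun x => phi (x + h)) = (fun x => partial i phi (x + h)).
  by apply/funext => x; exact: partial_shift.
exact: IH.
Qed.

Lemma smoothD phi psi : smooth phi -> smooth psi -> smooth (fun x => phi x + psi x).
Proof. by move=> h1 h2 k; apply: CkD. Qed.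

Lemma smoothM phi psi : smooth phi -> smooth psi -> smooth (fun x => phi x * psi x).
Proof. by move=> h1 h2 k; apply: CkM. Qed.

Lemma smooth_cst c : smooth (fun=> c : R).
Proof. by move=> k; exact: Ck_cst. Qed.

Lemma smoothZ c phi : smooth phi -> smooth (fun x => c * phi x).
Proof. by move=> h; apply: smoothM => //; exact: smooth_cst. Qed.

Lemma smooth_shift phi h : smooth phi -> smooth (fun x => phi (x + h)).
Proof. by move=> h1 k; apply: Ck_shift. Qed.

Lemma partialZ c phi i x : smooth phi -> partial i (fun x => c * phi x) x = c * partial i phi x.
Proof.
move=> h; rewrite partialM; last 2 first.
- exact: smooth_derivable (smooth_cst c).
- exact: smooth_derivable.
by rewrite partial_cst mul0r add0r.
Qed.

(** Test functions of the whole plane: supports are bounded but attached to no domain. Membership in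
    [test_fun O] is recovered afterwards, from a compact subset of [O] containing the support. *)
Definition tf phi := smooth phi /\ bsupp phi.

Lemma tf_cc phi : tf phi -> cc phi.
Proof. by move=> [/smooth_continuous]. Qed.

Lemma bsupp_partial phi i : bsupp phi -> bsupp (partial i phi).
Proof.
move=> [M [M0 HM]]; exists M; split => // x xM.
have N : \forall y \near x, phi y = 0.
  have : \forall y \near x, M < `|y|.
    have /cvgrPdist_lt/(_ (`|x| - M)) := @norm_continuous _ _ x.
    rewrite subr_gt0 => /(_ xM); apply: filterS => y h.
    by have := le_lt_trans (ler_norm _) h; lra.
  by apply: filterS => y; exact: HM.
by rewrite /partial (near_eq_derive _ N) derive_cst.
Qed.

Lemma tf_partial phi i : tf phi -> tf (partial i phi).
Proof. by move=> [h1 h2]; split; [exact: smooth_partial|exact: bsupp_partial]. Qed.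

Lemma tfD phi psi : tf phi -> tf psi -> tf (fun x => phi x + psi x).
Proof.
move=> h1 h2; split; first by apply: smoothD; [case: h1|case: h2].
by have [] := ccD (tf_cc h1) (tf_cc h2).
Qed.

Lemma tfM phi psi : tf phi -> smooth psi -> tf (fun x => phi x * psi x).
Proof.
move=> h1 h2; split; first by apply: smoothM => //; case: h1.
by have [] := ccM (tf_cc h1) (smooth_continuous h2).
Qed.

Lemma tf_shift phi h : tf phi -> tf (fun x => phi (x + h)).
Proof.
move=> h1; split; first by apply: smooth_shift; case: h1.
by have [] := cc_shift h (tf_cc h1).
Qed.

Lemma tf_bounded phi : tf phi -> exists C : R, 0 < C /\ forall x, `|phi x| <= C.
Proof. by move=> /tf_cc/cc_bounded. Qed.

Lemma tf_lip phi i : tf phi -> exists C : R, 0 < C /\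
  forall x t, `|phi (x + t *: unit_vec R i) - phi x| <= C * `|t|.
Proof.
move=> h; have [C [C0 HC]] := tf_bounded (tf_partial i h).
exists C; split => // x t.
have [s [_ ->]] := line_mvt x (fun y => @smooth_derivable phi i y h.1) t.
by rewrite normrM mulrC ler_wpM2r//; exact: HC.
Qed.

(** The constant is uniform in [x]: in this form differentiability passes under integral signs,
    through [is_derive_quad]. *)
Lemma tf_taylor1 phi i : tf phi -> exists C : R, 0 < C /\
  forall x t, `|phi (x + t *: unit_vec R i) - phi x - t * partial i phi x| <= C * t ^+ 2.
Proof.
move=> h; have [C [C0 HC]] := tf_lip i (tf_partial i h).
exists C; split => // x t.
have [s [st ->]] := line_mvt x (fun y => @smooth_derivable phi i y h.1) t.
rewrite -mulrBr normrM -[X in _ <= X](_ : `|t| * (C * `|t|) = _).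
  rewrite ler_wpM2l//; apply: le_trans (HC _ _) _.
  by rewrite ler_wpM2l// ltW.
by rewrite mulrCA -normrM -expr2 ger0_norm// sqr_ge0.
Qed.

(** Move along axis 0, then along axis 1; replacing [partial 1 phi] at the intermediate point by its
    value at [x] costs [C2 |a| |b|]. *)
Lemma tf_taylor phi : tf phi -> exists C : R, 0 < C /\
  forall x a b, `|phi (x + (a, b)) - phi x - a * partial 0 phi x - b * partial 1 phi x| <= C * (`|a| + `|b|) ^+ 2.
Proof.
move=> h; have [C0 [C00 H0]] := tf_taylor1 0 h.
have [C1 [C10 H1]] := tf_taylor1 1 h.
have [C2 [C20 H2]] := tf_lip 0 (tf_partial 1 h).
exists (C0 + C1 + C2); split; first by lra.
move=> x a b.
have E : x + (a, b) = x + a *: unit_vec R 0 + b *: unit_vec R 1.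
  rewrite -addrA; congr (_ + _); rewrite /unit_vec /=.
  by rewrite /GRing.scale/= /GRing.add/= /scale_pair /add_pair/= /GRing.scale/=; congr pair; ring.
rewrite E.
have := H0 x a; have := H1 (x + a *: unit_vec R 0) b; have := H2 x a.
move: (phi _) (phi _) (phi _) (partial 0 phi x) (partial 1 phi x) (partial 1 phi _) => p1 p2 p3 q r s.
move=> h2 h1 h0.
have -> : p3 - p1 - a * q - b * r = (p2 - p1 - a * q) + (p3 - p2 - b * s) + b * (s - r) by ring.
apply: le_trans (ler_normD _ _) _; rewrite normrM.
apply: le_trans (lerD (ler_normD _ _) (lexx _)) _.
have := ler_wpM2l (normr_ge0 b) h2.
rewrite -(real_normK (num_real a)) in h0; rewrite -(real_normK (num_real b)) in h1.
have := normr_ge0 a; have := normr_ge0 b; move: (`|a| : R) (`|b| : R) h0 h1 h2 => A B h0 h1 h2 B0 A0 h3.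
have AB := mulr_ge0 A0 B0; have AA := sqr_ge0 A; have BB := sqr_ge0 B.
have := (mulr_ge0 (ltW C00) AB, mulr_ge0 (ltW C10) AB, mulr_ge0 (ltW C20) AB).
have := (mulr_ge0 (ltW C00) BB, mulr_ge0 (ltW C10) AA, mulr_ge0 (ltW C20) AA, mulr_ge0 (ltW C20) BB).
move=> [[[k1 k2] k3] k4] [[k5 k6] k7].
have -> : (C0 + C1 + C2) * (A + B) ^+ 2 = C0 * A ^+ 2 + C1 * B ^+ 2 + B * (C2 * A) +
  (C0 * B ^+ 2 + 2 * (C0 * (A * B)) + C1 * A ^+ 2 + 2 * (C1 * (A * B)) + C2 * A ^+ 2 + C2 * B ^+ 2 + C2 * (A * B)) by ring.
lra.
Qed.

End TestFunctions.

(** * Differentiation and integration by parts for test functions *)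

Section TestCalculus.
Variable R : realType.
Local Notation R2 := (measurableTypeR R * measurableTypeR R)%type.
Implicit Types (phi psi : R * R -> R) (x h : R * R) (i j : 'I_2).

Lemma le_eps (a b : R) : (forall e : R, 0 < e -> a <= b + e) -> a <= b.
Proof. by move=> h; apply/ler_addgt0Pr. Qed.

(** A quadratic remainder bound survives integration over a parameter. This criterion thus replaces
    dominated convergence wherever an integral is differentiated. *)
Lemma is_derive_quad (V : normedModType R) (F : V -> R) (x v : V) (D K : R) :
  (forall e : R, `|F (e *: v + x) - F x - e * D| <= K * e ^+ 2) -> is_derive x v F D.
Proof.
move=> H.
have K0 : 0 <= K by have := le_trans (normr_ge0 _) (H 1); rewrite expr1n mulr1.
have C : e^-1 *: ((F \o shift x) (e *: v) - F x) @[e --> 0^'] --> D.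
  apply/cvgrPdist_le => r r0.
  have r1 : 0 < r / (K + 1) by rewrite divr_gt0//; lra.
  near=> e.
  have e0 : e != 0 by near: e; exact: nbhs_dnbhs_neq.
  have er : `|e| < r / (K + 1).
    near: e; apply: dnbhs0_lt; exact: r1.
  rewrite /= /shift /=.
  have -> : D - e^-1 *: (F (e *: v + x) - F x) = - (e^-1 * (F (e *: v + x) - F x - e * D)).
    by rewrite /GRing.scale/=; field.
  rewrite normrN normrM normfV ler_pdivrMl ?normr_gt0//.
  apply: le_trans (H e) _.
  rewrite -(real_normK (num_real e)) expr2 mulrCA ler_wpM2l//.
  apply: le_trans (_ : (K + 1) * `|e| <= _); first by rewrite ler_wpM2r//; lra.
  rewrite mulrC -ler_pdivlMr; [exact: ltW|lra].
apply: DeriveDef.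
  by apply/cvg_ex; exists D.
exact: cvg_lim C.
Unshelve. all: by end_near. Qed.

Lemma pairE (x : R * R) : x = x.1 *: unit_vec R 0 + x.2 *: unit_vec R 1.
Proof.
rewrite [LHS]surjective_pairing /unit_vec /=.
by rewrite /GRing.scale/= /GRing.add/= /scale_pair /add_pair/= /GRing.scale/=; congr pair; ring.
Qed.

Lemma norm_fst (x : R * R) : `|x.1| <= `|x|.
Proof. by rewrite prod_normE le_max lexx. Qed.
Lemma norm_snd (x : R * R) : `|x.2| <= `|x|.
Proof. by rewrite prod_normE le_max lexx orbT. Qed.

Lemma tf_lipschitz phi : tf phi -> exists C : R, 0 < C /\
  forall x h, `|phi (x + h) - phi x| <= C * `|h|.
Proof.
move=> hp; have [C0 [C00 H0]] := tf_lip 0 hp; have [C1 [C10 H1]] := tf_lip 1 hp.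
exists (C0 + C1); split; first by lra.
move=> x h; rewrite [h in phi (x + h)]pairE addrA.
have := H0 x h.1; have := H1 (x + h.1 *: unit_vec R 0) h.2.
set a := phi _; set b := phi _; set c := phi x => h1 h2.
have -> : a - c = (a - b) + (b - c) by ring.
apply: le_trans (ler_normD _ _) _; rewrite mulrDl addrC.
apply: lerD; [apply: le_trans h2 _|apply: le_trans h1 _]; rewrite ler_wpM2l ?(ltW C00) ?(ltW C10)//.
  exact: norm_fst.
exact: norm_snd.
Qed.

Lemma lipschitz_continuous (V : normedModType R) (phi : V -> R) (C : R) :
  (forall x h : V, `|phi (x + h) - phi x| <= C * `|h|) -> continuous phi.
Proof.
move=> H x; apply/cvgrPdist_le => e e0.
have C1 : 0 < `|C| + 1 by have := normr_ge0 C; lra.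
near=> y.
have xy : `|x - y| < e / (`|C| + 1).
  by near: y; apply: cvgr_dist_lt => //; apply: divr_gt0.
rewrite distrC -[y](subrK x) [y - x + x]addrC.
apply: le_trans (H _ _) _; rewrite distrC.
apply: le_trans (_ : (`|C| + 1) * `|x - y| <= _).
  by rewrite ler_wpM2r//; have := ler_norm C; lra.
by rewrite mulrC -ler_pdivlMr// ltW.
Unshelve. all: by end_near. Qed.

Lemma tf_chain phi x h : tf phi -> forall r : R,
  is_derive r 1 (fun r : R => phi (x + r *: h))
    (h.1 * partial 0 phi (x + r *: h) + h.2 * partial 1 phi (x + r *: h)).
Proof.
move=> hp r; have [C [C0 H]] := tf_taylor hp.
apply: (@is_derive_quad R (fun r : R => phi (x + r *: h)) r 1 _ (C * (`|h.1| + `|h.2|) ^+ 2)).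
move=> e; have := H (x + r *: h) (e * h.1) (e * h.2).
have -> : x + (e%:A + r) *: h = x + r *: h + (e * h.1, e * h.2).
  rewrite scalerDl addrCA [RHS]addrC; congr (_ + _).
  rewrite [e%:A](_ : _ = e)//; by rewrite /GRing.scale/= mulr1.
rewrite !normrM -mulrDr exprMn (real_normK (num_real e)) mulrA mulrAC => h1.
move: h1; set A := phi _; set B := phi _ => h1.
by congr (`|_| <= _): h1; ring.
Qed.

(** Written over the whole line with an indicator, so as to be exchanged with other integrals by
    Fubini. *)
Lemma tf_ftc phi x h : tf phi -> phi (x + h) - phi x =
  J (@lebesgue_measure R) (fun r : R => \1_`[0, 1]%classic r *
    (h.1 * partial 0 phi (x + r *: h) + h.2 * partial 1 phi (x + r *: h))).
Proof.
move=> hp; have D := tf_chain x h hp.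
pose f := fun r : R => h.1 * partial 0 phi (x + r *: h) + h.2 * partial 1 phi (x + r *: h).
have cF : continuous (fun r : R => phi (x + r *: h)).
  by move=> s; apply: differentiable_continuous; apply/derivable1_diffP; apply: ex_derive.
have cl (q : R * R -> R) : continuous q -> continuous (fun r : R => q (x + r *: h)).
  move=> cq r; apply: (@continuous_comp _ _ _ (fun r : R => x + r *: h) q); last exact: cq.
  by apply: cvgD; [exact: cvg_cst|exact: scalel_continuous].
have cf : continuous f.
  move=> r; apply: cvgD; apply: cvgM; try exact: cvg_cst.
    exact: (cl _ (smooth_continuous (@smooth_partial _ _ 0 hp.1))).
  exact: (cl _ (smooth_continuous (@smooth_partial _ _ 1 hp.1))).
have := @continuous_FTC2 R f (fun r : R => phi (x + r *: h)) 0 1 ltr01 (continuous_subspaceT cf).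
have h1 : derivable_oo_LRcontinuous (fun r : R => phi (x + r *: h)) 0 1.
  split; first by move=> r _; apply: ex_derive.
    exact: cvg_at_right_filter (cF 0).
  exact: cvg_at_left_filter (cF 1).
have h2 : {in `]0, 1[, (fun r : R => phi (x + r *: h))^`()%classic =1 f}.
  by move=> r _; rewrite derive1E; apply: derive_val.
move=> /(_ h1 h2).
rewrite scale1r scale0r addr0 => E.
transitivity (\int[lebesgue_measure]_(r in `[0, 1]) f r); first by rewrite /Rintegral E.
rewrite Rintegral_mkcond /J; apply: eq_Rintegral => r _.
by rewrite patchE indicE; case: ifPn => _; rewrite ?mul1r ?mul0r.
Qed.

Lemma I2D phi psi : cc phi -> cc psi -> I2 (fun x => phi x + psi x) = I2 phi + I2 psi.
Proof. by move=> /cc_ig h1 /cc_ig h2; exact: JD. Qed.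

Lemma I2Z c phi : cc phi -> I2 (fun x => c * phi x) = c * I2 phi.
Proof. by move=> /cc_ig h1; exact: JZ. Qed.

Lemma ccN phi : cc phi -> cc (fun x => - phi x).
Proof. by move=> /(ccZ (-1)); rewrite (_ : (fun x => -1 * _) = fun x => - phi x)//; apply/funext => x; rewrite mulN1r. Qed.

Lemma ccB phi psi : cc phi -> cc psi -> cc (fun x => phi x - psi x).
Proof. by move=> h1 h2; apply: ccD => //; exact: ccN. Qed.

Lemma I2B phi psi : cc phi -> cc psi -> I2 (fun x => phi x - psi x) = I2 phi - I2 psi.
Proof. by move=> /cc_ig h1 /cc_ig h2; exact: JB. Qed.

Lemma cc_sqr phi : cc phi -> cc (fun x => phi x ^+ 2).
Proof. by move=> h; apply: ccM => //; case: h. Qed.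

Lemma I2_CS phi psi : cc phi -> cc psi ->
  (I2 (fun x => phi x * psi x)) ^+ 2 <= I2 (fun x => phi x ^+ 2) * I2 (fun x => psi x ^+ 2).
Proof.
by move=> h1 h2; apply: J_CS; [exact: cc_meas|exact: cc_meas|exact/cc_ig/cc_sqr|exact/cc_ig/cc_sqr].
Qed.

Lemma I2_young (l : R) phi psi : 0 < l -> cc phi -> cc psi ->
  2 * `|I2 (fun x => phi x * psi x)| <= l * I2 (fun x => phi x ^+ 2) + l^-1 * I2 (fun x => psi x ^+ 2).
Proof.
move=> l0 h1 h2; have := I2_CS h1 h2.
have : 0 <= I2 (fun x => psi x ^+ 2) by apply: J_ge0 => x; exact: sqr_ge0.
have : 0 <= I2 (fun x => phi x ^+ 2) by apply: J_ge0 => x; exact: sqr_ge0.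
move: (I2 _) (I2 _) (I2 _) => C B A A0 B0 H.
have sq : (2 * `|C|) ^+ 2 <= (l * A + l^-1 * B) ^+ 2.
  have -> : (l * A + l^-1 * B) ^+ 2 = (l * A - l^-1 * B) ^+ 2 + 4 * (A * B) by field; rewrite gt_eqF.
  rewrite exprMn (real_normK (num_real C)).
  have := sqr_ge0 (l * A - l^-1 * B); lra.
rewrite -ler_sqr// nnegrE; first by apply: mulr_ge0.
by apply: addr_ge0; apply: mulr_ge0 => //; [exact: ltW|rewrite invr_ge0 ltW].
Qed.

(** By translation invariance the increment [phi (x + t e_i) - phi x] has integral zero; it differs
    from [t * partial i phi x] by [O(t ^ 2)] on a fixed box. Divide by [t] and let it tend to 0. *)
Lemma I2_partial phi i : tf phi -> I2 (partial i phi) = 0.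
Proof.
move=> hp; have [C [C0 H]] := tf_taylor1 i hp.
have [_ [M [M0 HM]]] := hp; have [_ [N [N0 HN]]] := tf_partial i hp.
set b : R * R -> R := \1_[set x : R * R | `|x| <= M + N + 1].
have u1 : `|unit_vec R i| <= 1.
  by rewrite prod_normE ge_max /unit_vec/=; case: (i == 0); case: (i == 1); rewrite ?normr0 ?normr1 ?lexx ?ler01.
have K (t : R) : 0 < t -> t <= 1 -> `|I2 (partial i phi)| <= t * (C * I2 b).
  move=> t0 t1.
  have c1 := cc_shift (t *: unit_vec R i) (tf_cc hp).
  have c2 := tf_cc hp; have c3 := ccZ t (tf_cc (tf_partial i hp)).
  have E : I2 (fun x => phi (x + t *: unit_vec R i) - phi x - t * partial i phi x) = - (t * I2 (partial i phi)).
    rewrite I2B//; last exact: ccB.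
    rewrite I2B// I2Z; last exact: tf_cc (tf_partial i hp).
    by rewrite I2_shift ?subrr ?sub0r//; exact: cc_meas.
  have := @J_le_norm _ _ _ (@lebs R) _ (fun x => C * t ^+ 2 * b x) (cc_ig (ccB (ccB c1 c2) c3)) (igZ _ (ig_box _)).
  rewrite -/(I2 _) E normrN normrM gtr0_norm// => h.
  suff : t * `|I2 (partial i phi)| <= t * (t * (C * I2 b)) by rewrite ler_pM2l.
  rewrite [leRHS]mulrA -expr2; apply: le_trans (h _) _; last first.
    have -> : J (lebs R) (fun x => C * t ^+ 2 * b x) = C * t ^+ 2 * I2 b by exact: JZ (ig_box _).
    by rewrite [leLHS](_ : _ = t ^+ 2 * (C * I2 b))//; ring.
  move=> x; rewrite /b indicE; have [xM|xM] := boolP (x \in _); first by rewrite mulr1.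
  move: xM; rewrite notin_setE/= => /negP; rewrite -ltNge => xM.
  have tu : t * `|unit_vec R i| <= 1 by rewrite -[leRHS]mul1r ler_pM// ltW.
  have nx : `|x| - t * `|unit_vec R i| <= `|x + t *: unit_vec R i|.
    by have := ler_normB (x + t *: unit_vec R i) (t *: unit_vec R i); rewrite addrK normrZ gtr0_norm//; lra.
  rewrite (HM x) ?(HM (x + _)) ?HN ?(mulr0, subr0, normr0)//.
  - by move: (`|x| : R) xM => z; lra.
  - by move: (`|x| : R) (`|x + _| : R) (t * _ : R) xM tu nx => z z' k; lra.
  - by move: (`|x| : R) xM => z; lra.
have b0 : 0 <= I2 b by apply: J_ge0 => x; rewrite /b indicE.
apply/eqP; rewrite -normr_le0; apply: le_eps => e e0; rewrite add0r.
set D := C * I2 b in K; have D0 : 0 <= D by apply: mulr_ge0 => //; exact: ltW.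
have t0 : 0 < Num.min 1 (e / (D + 1)) by rewrite lt_min ltr01 divr_gt0//; lra.
apply: le_trans (K _ t0 _) _; first by rewrite ge_min lexx.
apply: le_trans (_ : e / (D + 1) * D <= _); first by rewrite ler_wpM2r// ge_min lexx orbT.
rewrite mulrAC ler_pdivrMr; last lra.
by rewrite ler_pM2l//; lra.
Qed.

Lemma I2_parts phi psi i : tf phi -> smooth psi ->
  I2 (fun x => partial i phi x * psi x) = - I2 (fun x => phi x * partial i psi x).
Proof.
move=> h1 h2; apply/eqP; rewrite -addr_eq0; apply/eqP.
rewrite -I2D; last 2 first.
- by apply: ccM; [exact: tf_cc (tf_partial i h1)|exact: smooth_continuous].
- by apply: ccM; [exact: tf_cc|exact: (smooth_continuous (@smooth_partial _ _ i h2))].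
rewrite -(I2_partial i (tfM h1 h2)); apply: eq_J => x; rewrite partialM//.
  by apply: smooth_derivable; case: h1.
exact: smooth_derivable.
Qed.

(** The second difference of step [t] is symmetric in the two directions, and equals [t ^ 2] times
    either mixed derivative up to [O(t ^ 3)]. *)
Lemma partial_comm phi i j x : tf phi -> partial i (partial j phi) x = partial j (partial i phi) x.
Proof.
move=> hp.
have key (a b : 'I_2) : exists C : R, 0 < C /\ forall t : R,
    `|phi (x + t *: unit_vec R a + t *: unit_vec R b) - phi (x + t *: unit_vec R a)
      - phi (x + t *: unit_vec R b) + phi x - t ^+ 2 * partial b (partial a phi) x| <= C * `|t| ^+ 3.
  have [C1 [C10 H1]] := tf_taylor1 b (tf_partial a hp).
  have [C2 [C20 H2]] := tf_lip a (tf_partial b (tf_partial a hp)).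
  exists (C1 + C2); split; first by lra.
  move=> t.
  pose g y := phi (y + t *: unit_vec R b) - phi y.
  have hg : smooth g.
    rewrite (_ : g = fun y => phi (y + t *: unit_vec R b) + (-1) * phi y).
      apply: smoothD; first by apply: smooth_shift; case: hp.
      by apply: smoothZ; case: hp.
    by apply/funext => y; rewrite mulN1r.
  have [s [st E]] := line_mvt x (fun y => @smooth_derivable R g a y hg) t.
  have Eg : partial a g (x + s *: unit_vec R a) = partial a phi (x + s *: unit_vec R a + t *: unit_vec R b) - partial a phi (x + s *: unit_vec R a).
    rewrite -(partial_shift phi).
    rewrite (_ : g = fun y => phi (y + t *: unit_vec R b) + (-1) * phi y); last first.
      by apply/funext => y; rewrite mulN1r.
    rewrite partialD ?partialZ ?mulN1r//; try by case: hp.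
      by apply: smooth_derivable; apply: smooth_shift; case: hp.
    by apply: smooth_derivable; apply: smoothZ; case: hp.
  rewrite -/(partial a g _) Eg in E.
  have := H1 (x + s *: unit_vec R a) t; have := H2 x s.
  move: E; rewrite /g.
  set p1 := phi _; set p2 := phi _; set p3 := phi (x + t *: unit_vec R b).
  set q1 := partial a phi _; set q2 := partial a phi _.
  set w1 := partial b (partial a phi) _; set w2 := partial b (partial a phi) _.
  move=> E h2 h1.
  have -> : p1 - p2 - p3 + phi x - t ^+ 2 * w2 = t * (q1 - q2 - t * w1) + t ^+ 2 * (w1 - w2).
    have -> : p1 - p2 - p3 + phi x = p1 - p2 - (p3 - phi x) by ring.
    by rewrite E; ring.
  apply: le_trans (ler_normD _ _) _; rewrite !normrM mulrDl; apply: lerD.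
    rewrite exprS mulrCA ler_wpM2l//.
    by rewrite (real_normK (num_real t)).
  rewrite [leRHS](_ : _ = `|t| * `|t| * (C2 * `|t|)); last by ring.
  rewrite ler_wpM2l ?mulr_ge0//.
  by apply: le_trans h2 _; rewrite ler_wpM2l// ltW.
have [C [C0 HC]] := key i j; have [D [D0 HD]] := key j i.
apply/eqP; rewrite -subr_eq0 -normr_le0; apply: le_eps => e e0; rewrite add0r.
(* At this step the total cubic error [(C + D) t ^ 3] is exactly [t ^ 2 e]. *)
pose t := e / (C + D).
have t0 : 0 < t by rewrite divr_gt0// addr_gt0.
have := HC t; have := HD t.
rewrite -[x + _ + _]addrA [t *: unit_vec R j + _]addrC addrA.
set p1 := phi _; set p2 := phi _; set p3 := phi _; set w1 := partial i _ _; set w2 := partial j _ _.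
rewrite (gtr0_norm t0) => h1 h2.
have h3 : `|t ^+ 2 * (w1 - w2)| <= (C + D) * t ^+ 3.
  have -> : t ^+ 2 * (w1 - w2) = (p1 - p3 - p2 + phi x - t ^+ 2 * w2) - (p1 - p2 - p3 + phi x - t ^+ 2 * w1) by ring.
  by apply: le_trans (ler_normB _ _) _; rewrite mulrDl; apply: lerD.
have t2 : 0 < t ^+ 2 by rewrite exprn_gt0.
have CDt : (C + D) * t = e by rewrite /t mulrCA divff ?mulr1// gt_eqF// addr_gt0.
move: h3; rewrite normrM (gtr0_norm t2) (_ : (C + D) * t ^+ 3 = t ^+ 2 * e); last by rewrite -CDt; ring.
by rewrite ler_pM2l.
Qed.

End TestCalculus.

(** * Averages, and primitives for the divergence *)

Section Averages.
Variable R : realType.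
Local Notation R2 := (measurableTypeR R * measurableTypeR R)%type.
Context d (T : measurableType d) (mu : {sigma_finite_measure set T -> \bar R}).
Implicit Types (phi psi : R * R -> R) (x : R * R) (i j : 'I_2) (g : T -> R) (h : T -> R * R).

(** Convolution of [phi] with the image under [h] of the signed measure of density [g]. Mollifiers,
    averages along an axis and the Bogovskii integral are all of this form. *)
Definition Avg g h phi : R * R -> R := fun x => J mu (fun t => g t * phi (x - h t)).

Lemma mfun_shift h x : measurable_fun setT (h : T -> R2) ->
  measurable_fun setT (fun t => x - h t : R2).
Proof.
move=> mh; have /measurable_fun_pairP [m1 m2] := mh.
by apply: measurable_fun_pair => /=; apply: measurable_funB.
Qed.

Section Weight.
Variables (g : T -> R) (h : T -> R * R).
Hypotheses (ig_g : ig mu g) (mh : measurable_fun setT (h : T -> R2)).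
Let mg := ig_meas ig_g.
Let G := J mu (fun t => `|g t|).

Lemma G_ge0 : 0 <= G. Proof. by apply: J_ge0 => t; exact: normr_ge0. Qed.

Lemma ig_avg phi x : cc phi -> ig mu (fun t => g t * phi (x - h t)).
Proof.
move=> hp; have [C [C0 HC]] := cc_bounded hp.
apply: (@ig_mulb _ _ _ _ C g) => //.
apply: (measurableT_comp (continuous_measurable_plane hp.1)); exact: mfun_shift.
Qed.

Lemma avg_le phi x (C : R) : cc phi -> (forall y, `|phi y| <= C) -> `|Avg g h phi x| <= C * G.
Proof.
move=> hp H; rewrite /Avg /G -JZ; last exact: ig_norm.
apply: J_le_norm; [exact: ig_avg|exact/igZ/ig_norm|].
by move=> t; rewrite normrM mulrC ler_wpM2r.
Qed.

Lemma avgZ c phi x : cc phi -> Avg g h (fun y => c * phi y) x = c * Avg g h phi x.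
Proof.
move=> h1; rewrite /Avg -JZ; last exact: ig_avg.
by apply: eq_J => t; rewrite mulrCA.
Qed.

Lemma avgB phi psi x : cc phi -> cc psi ->
  Avg g h (fun y => phi y - psi y) x = Avg g h phi x - Avg g h psi x.
Proof.
move=> h1 h2; rewrite /Avg -JB; [|exact: ig_avg|exact: ig_avg].
by apply: eq_J => t; rewrite mulrBr.
Qed.

Lemma avg_shift phi v x : Avg g h phi (x + v) = Avg g h (fun y => phi (y + v)) x.
Proof. by apply: eq_J => t; rewrite addrAC. Qed.

Lemma avg_continuous phi : tf phi -> continuous (Avg g h phi).
Proof.
move=> hp; have [C [C0 HC]] := tf_lipschitz hp.
apply: (@lipschitz_continuous R _ _ (C * G)) => x v.
rewrite avg_shift -avgB; [|exact: cc_shift (tf_cc hp)|exact: tf_cc].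
rewrite mulrAC; apply: avg_le => [|y]; first by apply: ccB; [exact: cc_shift (tf_cc hp)|exact: tf_cc].
exact: HC.
Qed.

Lemma avg_is_derive phi i x : tf phi ->
  is_derive x (unit_vec R i) (Avg g h phi) (Avg g h (partial i phi) x).
Proof.
move=> hp; have [C [C0 HC]] := tf_taylor1 i hp.
apply: (@is_derive_quad R _ _ x _ _ (C * G)) => e.
have hp1 := tf_cc hp; have hp2 := cc_shift (e *: unit_vec R i) hp1.
have hp3 := tf_cc (tf_partial i hp).
rewrite (addrC (e *: unit_vec R i) x) avg_shift -(avgB x hp2 hp1) -(avgZ e x hp3) -avgB; [|exact: ccB|exact: ccZ].
rewrite mulrAC; apply: avg_le; first by apply: ccB; [exact: ccB|exact: ccZ].
by move=> y; exact: HC.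
Qed.

Lemma partial_avg phi i : tf phi -> partial i (Avg g h phi) = Avg g h (partial i phi).
Proof. by move=> hp; apply/funext => x; case: (avg_is_derive i x hp). Qed.

Lemma avg_smooth phi : tf phi -> smooth (Avg g h phi).
Proof.
move=> hp k; elim: k phi hp => [|k IH] phi hp; split => //; try exact: avg_continuous.
move=> i; split; first by move=> x; case: (avg_is_derive i x hp).
by rewrite partial_avg//; apply: IH; exact: tf_partial.
Qed.

Variable H : R.
Hypothesis hH : forall t, g t != 0 -> `|h t| <= H.

Lemma avg_bsupp phi : bsupp phi -> bsupp (Avg g h phi).
Proof.
move=> [M [M0 HM]]; exists (M + `|H|); split; first by apply: ltr_wpDr.
move=> x xM; rewrite /Avg -[RHS](J0 mu); apply: eq_J => t.
have [->|g0] := eqVneq (g t) 0; first by rewrite mul0r.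
rewrite HM ?mulr0//.
have := ler_normB (x - h t) (- h t); rewrite opprK subrK normrN.
have := le_trans (hH g0) (ler_norm H).
move: (`|x| : R) (`|h t| : R) (`|x - h t| : R) (`|H| : R) xM => a b c e; lra.
Qed.

Lemma avg_tf phi : tf phi -> tf (Avg g h phi).
Proof. by move=> hp; split; [exact: avg_smooth|apply: avg_bsupp; case: hp]. Qed.

Lemma avg_fubini_ig phi psi : cc phi -> cc psi ->
  ig (prodm (lebs R) mu) (fun z => psi z.1 * g z.2 * phi (z.1 - h z.2)).
Proof.
move=> hp hq; have [C [C0 HC]] := cc_bounded hp.
have K := ig_prod (cc_ig hq) ig_g.
have /measurable_fun_pairP [m1 m2] := mh.
have M : measurable_fun setT (fun z : R2 * T => phi (z.1 - h z.2)).
  apply: (measurableT_comp (continuous_measurable_plane hp.1)).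
  have e1 : measurable_fun setT (fun z : R2 * T => z.1.1 - (h z.2).1).
    by apply: measurable_funB; apply: measurableT_comp => //; apply: measurableT_comp.
  have e2 : measurable_fun setT (fun z : R2 * T => z.1.2 - (h z.2).2).
    by apply: measurable_funB; apply: measurableT_comp => //; apply: measurableT_comp.
  exact: (measurable_fun_pair e1 e2).
exact: (ig_mulb M (fun z => HC _) K).
Qed.

Lemma avg_fubini phi psi : cc phi -> cc psi ->
  ig mu (fun t => g t * I2 (fun x => phi (x - h t) * psi x)) /\
  I2 (fun x => Avg g h phi x * psi x) = J mu (fun t => g t * I2 (fun x => phi (x - h t) * psi x)).
Proof.
move=> hp hq; have F := avg_fubini_ig hp hq.
have E t : J (lebs R) (fun x => psi x * g t * phi (x - h t)) = g t * I2 (fun x => phi (x - h t) * psi x).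
  rewrite -JZ; last by apply/cc_ig/ccM; [exact: cc_shift|case: hq].
  by apply: eq_J => x; ring.
split; first by apply: eq_ig (J_fubini2 F).1 => t; exact: E.
transitivity (J (lebs R) (fun x => J mu (fun t => psi x * g t * phi (x - h t)))).
  apply: eq_J => x; rewrite /Avg -JZr; last exact: ig_avg.
  by apply: eq_J => t; ring.
by rewrite (J_exchange F); apply: eq_J => t; exact: E.
Qed.

Lemma avg_dual phi psi (B : R) : cc phi -> cc psi ->
  (forall t, `|I2 (fun x => phi (x - h t) * psi x)| <= B) ->
  `|I2 (fun x => Avg g h phi x * psi x)| <= G * B.
Proof.
move=> hp hq HB; have [F ->] := avg_fubini hp hq.
rewrite /G -JZr; last exact: ig_norm.
apply: J_le_norm => //; first exact/igZr/ig_norm.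
by move=> t; rewrite normrM ler_wpM2l.
Qed.

(** Young's inequality for convolutions, by duality: the squared norm is the pairing of the average
    with itself, and [avg_dual] bounds it by the pairings of the translates of [phi], whose norm is
    that of [phi]. *)
Lemma avg_L2 phi : tf phi ->
  I2 (fun x => Avg g h phi x ^+ 2) <= G ^+ 2 * I2 (fun x => phi x ^+ 2).
Proof.
move=> hp; have ha := tf_cc (avg_tf hp); have hc := tf_cc hp.
set N := I2 _; set A := I2 _.
have N0 : 0 <= N by apply: J_ge0 => x; exact: sqr_ge0.
have A0 : 0 <= A by apply: J_ge0 => x; exact: sqr_ge0.
have H1 l : 0 < l -> 2 * N <= G * (l * A + l^-1 * N).
  move=> l0; have -> : N = I2 (fun x => Avg g h phi x * Avg g h phi x).
    by apply: eq_J => x; rewrite expr2.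
  apply: le_trans (_ : 2 * `|I2 (fun x => Avg g h phi x * Avg g h phi x)| <= _).
    by rewrite ler_pM2l// ler_norm.
  rewrite -ler_pdivlMl// mulrCA.
  apply: (avg_dual hc ha) => t; rewrite ler_pdivlMl//.
  apply: le_trans (I2_young l0 (cc_shift _ hc) ha) _.
  rewrite (@I2_shift R (fun x => phi x ^+ 2))//; exact: cc_meas (cc_sqr hc).
have := G_ge0; rewrite le_eqVlt => /orP[/eqP G0|G0].
  have := H1 1 ltr01; rewrite -G0 mul0r expr0n mul0r; lra.
(* With [l = G] the inequality reads [2 N <= G ^ 2 A + N]. *)
have := H1 G G0; rewrite mulrDr mulrA -expr2 mulrA divff ?gt_eqF// mul1r.
lra.
Qed.

End Weight.
End Averages.

(** * The homotopy operator, a primitive for the divergence *)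

Section Homotopy.
Variable R : realType.
Local Notation R2 := (measurableTypeR R * measurableTypeR R)%type.
Local Notation R1 := (measurableTypeR R).
Local Notation leb := (@lebesgue_measure R).
Context d (T : measurableType d) (mu : {sigma_finite_measure set T -> \bar R}).
Variables (g : T -> R) (h : T -> R * R) (H : R).
Hypotheses (ig_g : ig mu g) (mh : measurable_fun setT (h : T -> R2)).
Hypothesis hH : forall t, g t != 0 -> `|h t| <= H.

Definition coord (i : 'I_2) (v : R * R) : R := if i == 0 then v.1 else v.2.

Lemma ig_I01 : ig leb (\1_`[0, 1]%classic : R1 -> R).
Proof.
apply: ig_ge0P; [by apply: measurable_indic; exact: measurable_itv|by move=> x; rewrite indicE|].
rewrite integral_indic// setIT.
have := @lebesgue_measure_itv R `[0, 1]; rewrite /= => E.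
apply: (@le_lt_trans _ _ (lebesgue_measure (`[0, 1]%classic : set R))) => //.
by rewrite E lte01 -EFinB ltry.
Qed.

Lemma J_I01 : J leb (\1_`[0, 1]%classic : R1 -> R) = 1.
Proof.
rewrite /J /Rintegral integral_indic// setIT.
have := @lebesgue_measure_itv R `[0, 1]; rewrite /= => E.
transitivity (fine (lebesgue_measure (`[0, 1]%classic : set R))) => //.
by rewrite E lte01 -EFinB /= subr0.
Qed.

Lemma abs_coord i v : `|coord i v| <= `|v|.
Proof. by rewrite /coord; case: ifP => _; [exact: norm_fst|exact: norm_snd]. Qed.

Lemma mcoord i : measurable_fun setT (coord i \o h).
Proof. by have /measurable_fun_pairP [m1 m2] := mh; rewrite /coord /=; case: (i == 0). Qed.

Lemma ig_gh i : ig mu (fun t => g t * coord i (h t)).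
Proof.
apply: (@ig_le _ _ _ _ _ (fun t => H * `|g t|)); last exact/igZ/ig_norm.
  by apply: measurable_funM; [exact: ig_meas ig_g|exact: mcoord].
move=> t; have [->|g0] := eqVneq (g t) 0; first by rewrite mul0r normr0 mulr0.
by rewrite normrM mulrC ler_wpM2r// (le_trans (abs_coord _ _))// hH.
Qed.

(* The weight and displacement, over (r, t), of the field whose divergence is
   (int g) phi - Avg g h phi. *)
Definition hw i (z : R1 * T) : R := \1_`[0, 1]%classic z.1 * (g z.2 * coord i (h z.2)).
Definition hh (z : R1 * T) : R * R := z.1 *: h z.2.
Definition hfield phi i : R * R -> R := Avg (prodm leb mu) (hw i) hh phi.

Lemma ig_hw i : ig (prodm leb mu) (hw i).
Proof. exact: ig_prod ig_I01 (ig_gh i). Qed.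

Lemma mhh : measurable_fun setT (hh : _ -> R2).
Proof.
have /measurable_fun_pairP [m1 m2] := mh.
have e1 : measurable_fun setT (fun z : R1 * T => z.1 * (h z.2).1).
  exact: (measurable_funM measurable_fst (measurableT_comp m1 measurable_snd)).
have e2 : measurable_fun setT (fun z : R1 * T => z.1 * (h z.2).2).
  exact: (measurable_funM measurable_fst (measurableT_comp m2 measurable_snd)).
exact: (measurable_fun_pair e1 e2).
Qed.

Lemma hhH i z : hw i z != 0 -> `|hh z| <= H.
Proof.
rewrite /hw /hh indicE; have [/set_mem|] := boolP (z.1 \in _); last by rewrite mul0r eqxx.
rewrite /= in_itv/= => /andP[z0 z1]; rewrite mul1r mulf_eq0 negb_or => /andP[g0 _].
rewrite normrZ ger0_norm//; apply: le_trans (hH g0).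
by rewrite ler_piMl.
Qed.

Lemma hfield_tf phi i : tf phi -> tf (hfield phi i).
Proof. exact: avg_tf (ig_hw i) mhh _ (@hhH i) _. Qed.

Lemma partial_hfield phi i j : tf phi -> partial j (hfield phi i) = hfield (partial j phi) i.
Proof. by move=> hp; exact: partial_avg (ig_hw i) mhh _ _ hp. Qed.

(** The indicator of [[0, 1]] has integral 1, so the L^1 norm of the weight [hw] is the first
    absolute moment of [g] along [i]. All later gains come from the smallness of this moment. *)
Lemma hfield_L2 phi i : tf phi ->
  I2 (fun x => hfield phi i x ^+ 2) <= (J mu (fun t => `|g t * coord i (h t)|)) ^+ 2 * I2 (fun x => phi x ^+ 2).
Proof.
move=> hp; apply: le_trans (avg_L2 (ig_hw i) mhh (@hhH i) hp) _.
rewrite le_eqVlt; apply/orP; left; apply/eqP; congr (_ ^+ 2 * _).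
have F : ig (prodm leb mu) (fun z => \1_`[0, 1]%classic z.1 * `|g z.2 * coord i (h z.2)|).
  exact: (ig_prod ig_I01 (ig_norm (ig_gh i))).
transitivity (J (prodm leb mu) (fun z => \1_`[0, 1]%classic z.1 * `|g z.2 * coord i (h z.2)|)).
  by apply: eq_J => z; rewrite /hw normrM ger0_norm// indicE.
rewrite -(J_fubini1 F).2 /=.
under eq_J do rewrite JZ ?(ig_norm (ig_gh i))//.
by rewrite JZr ?ig_I01// J_I01 mul1r.
Qed.

(** For each [t], [phi x - phi (x - h t)] is the integral over [r] in [[0, 1]] of the derivative of
    [phi] along [h t] at [x - r h t]. It remains to integrate against [g]. *)
Lemma hfield_div phi x : tf phi ->
  \sum_i partial i (hfield phi i) x = J mu g * phi x - Avg mu g h phi x.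
Proof.
move=> hp; rewrite big_ord_recl (big_ord_recl 0) big_ord0 addr0.
rewrite !partial_hfield//.
have F i : ig (prodm leb mu) (fun z => hw i z * partial i phi (x - hh z)).
  exact: ig_avg (ig_hw i) mhh _ _ (tf_cc (tf_partial i hp)).
rewrite /hfield /Avg -JD//.
have F2 := igD (F ord0) (F (lift ord0 ord0)).
rewrite -(J_fubini2 F2).2 -JZr// -JB; [|exact: igZr|exact: ig_avg ig_g mh _ _ (tf_cc hp)].
apply: eq_J => t; rewrite /hw /hh /coord /=.
rewrite -mulrBr -[phi x - _]opprB.
rewrite [phi (x - h t) - phi x](tf_ftc x (- h t) hp).
have hpp (i : 'I_2) : ig leb (fun r : R => \1_`[0, 1]%classic r * partial i phi (x + r *: - h t)).
  have [C [C0 HC]] := tf_bounded (tf_partial i hp).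
  apply: (@ig_mulb _ _ _ _ C); [|by move=> r; exact: HC|exact: ig_I01].
  apply: (measurableT_comp (continuous_measurable_plane (smooth_continuous (@smooth_partial _ _ i hp.1)))).
  by apply: measurable_fun_pair => /=; apply: measurable_funD => //; apply: measurable_funM.
have hs : ig leb (fun r : R => \1_`[0, 1]%classic r *
    ((- h t).1 * partial 0 phi (x + r *: - h t) + (- h t).2 * partial 1 phi (x + r *: - h t))).
  apply: eq_ig (igD (igZ (- h t).1 (hpp 0)) (igZ (- h t).2 (hpp 1))) => r; ring.
rewrite -(JN hs) -(JZ _ (igN hs)).
apply: eq_J => r /=.
rewrite (_ : lift ord0 ord0 = 1); last exact/val_inj.
rewrite (_ : ord0 = 0); last exact/val_inj.
by rewrite scalerN; ring.
Qed.

End Homotopy.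

(** * A square function estimate *)

Section OneDim.
Variable R : realType.
Local Notation R1 := (measurableTypeR R).
Local Notation leb := (@lebesgue_measure R).
Implicit Types (a b c : R -> R).

Definition cc1 a := continuous a /\ exists M : R, 0 < M /\ forall x, M < `|x| -> a x = 0.

Lemma cc1_bounded a : cc1 a -> exists C : R, 0 < C /\ forall x, `|a x| <= C.
Proof.
move=> [ca [M [M0 HM]]].
have := continuous_compact (continuous_subspaceT ca) (@segment_compact R (- M) M).
move=> /compact_bounded[N [_ HN]].
exists (`|N| + 1); split; first by have := normr_ge0 N; lra.
move=> x; have [xM|xM] := lerP `|x| M; last by rewrite HM// normr0; have := normr_ge0 N; lra.
apply: (HN (`|N| + 1)); first by have := ler_norm N; lra.
by exists x => //; rewrite /= in_itv/= -ler_norml.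
Qed.

Lemma ig_itv (l u : R) : ig leb (\1_`[l, u]%classic : R1 -> R).
Proof.
apply: ig_ge0P; [by apply: measurable_indic; exact: measurable_itv|by move=> x; rewrite indicE|].
rewrite integral_indic// setIT.
have := @lebesgue_measure_itv R `[l, u]; rewrite /= => E.
apply: (@le_lt_trans _ _ (lebesgue_measure (`[l, u]%classic : set R))) => //.
by rewrite E; case: ifP => _; rewrite ?ltry// -EFinB ltry.
Qed.

Lemma cont1_meas a : continuous a -> measurable_fun (setT : set R1) a.
Proof. exact: continuous_measurable_fun. Qed.

Lemma cc1_ig a : cc1 a -> ig leb a.
Proof.
move=> h; have [C [C0 HC]] := cc1_bounded h; have [ca [M [M0 HM]]] := h.
apply: (ig_le (cont1_meas ca) _ (igZ C (ig_itv (- M) M))) => x.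
rewrite indicE; have [xM|xM] := boolP (x \in _); first by rewrite mulr1.
move: xM; rewrite notin_setE/= in_itv/= -ler_norml => /negP; rewrite -ltNge => /HM ->.
by rewrite normr0 mulr0.
Qed.

Lemma leb_opp (A : set R1) : measurable A -> leb ((fun x : R => - x) @^-1` A) = leb A.
Proof.
move=> mA.
have mN : measurable_fun setT (fun x : R1 => (- x : R1)) by exact: oppr_measurable.
symmetry; apply: (@lebesgue_measure_unique R (pushforward leb (fun x : R1 => (- x : R1)))) => //.
move=> _ [[a b] _ <-]; rewrite /pushforward.
rewrite [X in _ = lebesgue_measure X](_ : _ = [set` `[(- b), (- a)[]); last first.
  by apply/seteqP; split => x /=; rewrite !in_itv/=; lra.
rewrite !lebesgue_measure_itv/= !lte_fin ltrN2.
by case: ifP => // _; rewrite -!EFinB; congr (_ %:E); ring.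
Qed.

Lemma J1_preserve (t : R -> R) (f : R -> R) : measurable_fun (setT : set R1) (t : R1 -> R1) ->
  (forall A : set R1, measurable A -> leb (t @^-1` A) = leb A) ->
  ig leb f -> ig leb (f \o t) /\ J leb (f \o t) = J leb f.
Proof.
move=> mt ht hf.
have E (g : R1 -> \bar R) : measurable_fun setT g -> (forall x, 0 <= g x)%E ->
   (\int[leb]_x g (t x) = \int[leb]_x g x)%E.
  move=> mg g0.
  have := @ge0_integral_pushforward _ _ _ _ _ _ mt leb setT g measurableT mg (fun y _ => g0 y).
  rewrite preimage_setT => <-.
  apply: eq_measure_integral => A mA _; exact: ht.
have mf := ig_meas hf.
have hft : ig leb (f \o t).
  apply/integrableP; split; first by apply/measurable_EFinP; exact: measurableT_comp.
  have := E (fun x => `|f x|%:E); move=> /(_ _ _)/= ->.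
  - by have /integrableP[] := hf.
  - by apply/measurable_EFinP; exact: measurableT_comp.
  - by move=> x; rewrite lee_fin.
split => //.
have pn (g : R -> R) : ig leb g -> J leb g = J leb (fun x => Num.max (g x) 0) - J leb (fun x => Num.max (- g x) 0).
  move=> hg; have mg := ig_meas hg; rewrite -JB.
  - apply: eq_J => x; have [?|?] := leP (g x) 0; have [?|?] := leP (- g x) 0; lra.
  - apply: (ig_le _ _ (ig_norm hg)); first exact: measurable_maxr.
    by move=> x; have [?|?] := leP (g x) 0; rewrite ?normr0 ?normr_ge0.
  - apply: (ig_le _ _ (ig_norm hg)); first by apply: measurable_maxr => //; exact: measurableT_comp.
    by move=> x; have [?|?] := leP (- g x) 0; rewrite ?normr0 ?normrN ?normr_ge0.
rewrite pn// [RHS]pn//; congr (_ - _); rewrite /J /Rintegral; congr fine.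
- apply: (E (fun x => (Num.max (f x) 0)%:E)); last by move=> x; rewrite lee_fin le_max lexx orbT.
  by apply/measurable_EFinP; exact: measurable_maxr.
- apply: (E (fun x => (Num.max (- f x) 0)%:E)); last by move=> x; rewrite lee_fin le_max lexx orbT.
  by apply/measurable_EFinP; apply: measurable_maxr => //; exact: measurableT_comp.
Qed.

Lemma J1_shift (f : R -> R) (s : R) : ig leb f ->
  ig leb (fun x => f (x + s)) /\ J leb (fun x => f (x + s)) = J leb f.
Proof.
move=> hf; apply: (@J1_preserve (fun x => x + s)) => //.
  by apply: measurable_funD => //; exact: measurable_id.
exact: lebesgue_measure_shift.
Qed.

Lemma J1_opp (f : R -> R) : ig leb f ->
  ig leb (fun x => f (- x)) /\ J leb (fun x => f (- x)) = J leb f.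
Proof. by move=> hf; apply: (@J1_preserve (fun x => - x)) => //; [exact: oppr_measurable|exact: leb_opp]. Qed.

(** One exceptional point is tolerated because the logarithmic bounds below fail where two variables
    coincide. *)
Lemma J1_le_but (f g : R -> R) (p : R) : ig leb f -> ig leb g ->
  (forall x, x != p -> `|f x| <= g x) -> (forall x, 0 <= g x) -> `|J leb f| <= J leb g.
Proof.
move=> hf hg H g0.
pose f' x : R := if x == p then 0 else f x.
have mf' : measurable_fun (setT : set R1) f'.
  have -> : f' = fun x => f x * \1_(~` [set p]) x.
    apply/funext => x; rewrite /f' indicE; case: eqVneq => [->|xp].
      by rewrite memNset ?mulr0//=; exact.
    by rewrite mem_set ?mulr1//=; exact/eqP.
  apply: measurable_funM; first exact: ig_meas hf.
  by apply: measurable_indic; apply: measurableC.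
have hf' : ig leb f'.
  by apply: (ig_le mf' _ hg) => x; rewrite /f'; case: eqVneq => [_|xp]; rewrite ?normr0//; exact: H.
have -> : J leb f = J leb f'.
  rewrite /J /Rintegral; congr fine; apply: ae_eq_integral => //; [by apply/measurable_EFinP; exact: (ig_meas hf)|exact/measurable_EFinP|].
  exists [set p]; split => //; first exact: lebesgue_measure_set1.
  move=> x /= nx; apply: contrapT => xp; apply: nx => _.
  by rewrite /f'; case: eqVneq xp => // ->.
apply: J_le_norm => // x; rewrite /f'; case: eqVneq => [_|xp]; first by rewrite normr0.
exact: H.
Qed.

Definition l1 (u : R) : R := if (0 < u) && (u <= 1) then - ln u else 0.

Lemma l1_ge0 u : 0 <= l1 u.
Proof. by rewrite /l1; case: ifP => // /andP[u0 u1]; rewrite oppr_ge0 ln_le0. Qed.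

Lemma ln_le_l1 u : 0 < u -> `|ln u| <= l1 u + u.
Proof.
move=> u0; rewrite /l1 u0 /=; case: (leP u 1) => u1.
  by rewrite ler0_norm ?ln_le0// lerDl ltW.
rewrite add0r ger0_norm ?ln_ge0 ?ltW//.
have := @le_ln1Dx R (u - 1).
rewrite addrCA subrr addr0 => /(_ _); lra.
Qed.

Lemma measurable_l1 : measurable_fun (setT : set R1) l1.
Proof.
have -> : l1 = fun u => \1_(`]0, 1]%classic) u * - ln u.
  apply/funext => u; rewrite /l1 indicE; case: ifP => h.
    by rewrite mem_set ?mul1r//= in_itv.
  by rewrite memNset ?mul0r//= in_itv/= h.
apply: measurable_funM; first by apply: measurable_indic; exact: measurable_itv.
by apply: measurableT_comp => //; exact: measurable_ln.
Qed.

(** Monotone convergence along the intervals [[1 / (n + 2), 1]], with the primitive [u - u ln u] of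
    [- ln u]; all these integrals are at most 1. *)
Lemma ig_l1 : ig leb l1.
Proof.
apply: ig_ge0P; [exact: measurable_l1|exact: l1_ge0|].
pose A (n : nat) : set R1 := `[n.+2%:R^-1, 1]%classic.
have mA n : measurable (A n) by exact: measurable_itv.
have ndA : nondecreasing_seq A.
  move=> n m nm; apply/subsetPset => x; rewrite /A /= !in_itv/= => /andP[h1 ->]; rewrite andbT.
  by apply: le_trans h1; rewrite lef_pV2 ?posrE// ler_nat.
have ml : measurable_fun (setT : set R1) (EFin \o l1).
  by apply/measurable_EFinP; exact: measurable_l1.
have E : (\int[leb]_x (l1 x)%:E = \int[leb]_(x in \bigcup_n A n) (l1 x)%:E)%E.
  rewrite [RHS]integral_mkcond; apply: eq_integral => x _; rewrite patchE.
  case: ifPn => // /negP xA; congr (_ %:E); rewrite /l1; case: ifPn => // /andP[x0 x1].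
  exfalso; apply: xA; apply/mem_set; exists (Num.trunc x^-1) => //=.
  rewrite /A /= in_itv/= x1 andbT -[leRHS]invrK lef_pV2 ?posrE ?invr_gt0//.
  apply: le_trans (ltW (truncnS_gt _)) _; by rewrite ler_nat.
rewrite E.
have C := @ge0_nondecreasing_set_cvg_integral _ _ _ A (EFin \o l1) leb ndA mA.
have C1 := C (fun n => measurable_funS measurableT (@subsetT _ _) ml) (fun n x _ => l1_ge0 x).
apply: (@le_lt_trans _ _ 1%E); last exact: ltry.
have := cvg_lim (@ereal_hausdorff R) C1 => <-.
apply: lime_le; first by apply/cvg_ex; eexists; exact: C1.
apply: nearW => n; rewrite /A.
set dl : R := n.+2%:R^-1.
have d0 : 0 < dl by rewrite invr_gt0.
have d1 : dl < 1 by rewrite invf_lt1// ltr1n.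
have -> : (\int[leb]_(x in `[dl, 1%R]) (EFin \o l1) x = \int[leb]_(x in `[dl, 1%R]) (- ln x)%:E)%E.
  apply: eq_integral => u /set_mem; rewrite /= in_itv/= => /andP[u0 u1]; rewrite /l1 u1.
  by rewrite (lt_le_trans d0 u0).
pose F (u : R) := u - u * ln u.
have dF (u : R) : 0 < u -> is_derive u 1 F (- ln u).
  move=> u0; have dl1 := is_derive1_ln u0.
  apply: is_derive_eq; rewrite /GRing.scale/= !mulr1 divff ?gt_eqF//; ring.
have cF (u : R) : 0 < u -> {for u, continuous F}.
  by move=> u0; apply: differentiable_continuous; apply/derivable1_diffP; case: (dF _ u0).
rewrite (@continuous_FTC2 R (fun u => - ln u) F dl 1 d1).
- rewrite -EFinB lee_fin /F ln1 mulr0 subr0 lerBlDr lerDl subr_ge0.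
  by apply: le_trans (ltW d0); rewrite mulr_ge0_le0// ?(ltW d0)// ln_le0// ltW.
- apply: continuous_in_subspaceT => u /set_mem; rewrite /= in_itv/= => /andP[u0 _].
  by apply: cvgN; apply: continuous_ln; exact: lt_le_trans u0.
- split.
  + by move=> u; rewrite in_itv/= => /andP[u0 _]; case: (dF u (lt_trans d0 u0)).
  + by apply: cvg_at_right_filter; exact: cF.
  + by apply: cvg_at_left_filter; exact: cF.
- move=> u; rewrite in_itv/= => /andP[u0 _]; rewrite derive1E.
  by case: (dF u (lt_trans d0 u0)).
Qed.

(** The scale invariant measure [dr / r], cut off below at [e] so as to be finite. *)
Definition wr (e r : R) : R := \1_`[e, 1]%classic r * r^-1.

Lemma ig_wr e : 0 < e -> ig leb (wr e).
Proof.
move=> e0; apply: (ig_le _ _ (igZ e^-1 (ig_itv e 1))).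
  have -> : wr e = fun r => \1_`[e, 1]%classic r * (Num.max e r)^-1.
    apply/funext => r; rewrite /wr indicE; have [|] := boolP (r \in _); last by rewrite !mul0r.
    by move=> /set_mem; rewrite /= in_itv/= => /andP[/max_idPr -> _].
  apply: measurable_funM; first by apply: measurable_indic; exact: measurable_itv.
  apply: cont1_meas => r; apply: cvgV; first by rewrite gt_eqF// lt_max e0.
  by apply: continuous_max => //; exact: cvg_cst.
move=> r; rewrite /wr indicE; have [|] := boolP (r \in _); last by rewrite !(mul0r, mulr0) normr0.
move=> /set_mem; rewrite /= in_itv/= => /andP[h _]; rewrite mul1r mulr1.
have r0 := lt_le_trans e0 h.
by rewrite gtr0_norm ?invr_gt0// lef_pV2.
Qed.

Lemma wr_ge0 (e r : R) : 0 < e -> 0 <= wr e r.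
Proof.
move=> e0; rewrite /wr indicE; have [|] := boolP (r \in _); last by rewrite mul0r.
move=> /set_mem; rewrite /= in_itv/= => /andP[h r1]; rewrite mul1r invr_ge0.
exact: le_trans (ltW e0) h.
Qed.

Section Frullani.
Variables (c c' : R -> R) (M K e : R).
Hypotheses (dc : forall t : R, is_derive t 1 c (c' t)) (cc' : continuous c').
Hypotheses (cM : forall t, `|c t| <= M) (c'M : forall t, `|c' t| <= K).
Hypothesis cK : forall t s : R, `|c (t + s) - c t - s * c' t| <= K * s ^+ 2.
Hypotheses (e0 : 0 < e) (e1 : e < 1).

(* Once differentiated in [u], [Lf] telescopes to [(c u - c (e u)) / u]: this bounds it
   uniformly in the cutoff [e], up to [|ln u|]. *)
Definition Lf (u : R) : R := J leb (fun r => wr e r * c (r * u)).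

Lemma c_cont : continuous c.
Proof. by move=> t; apply: differentiable_continuous; apply/derivable1_diffP; case: (dc t). Qed.

Lemma ig_wrc (u : R) : ig leb (fun r => wr e r * c (r * u)).
Proof.
apply: (ig_mulb _ (fun r => cM _) (ig_wr e0)).
apply: cont1_meas => r; apply: (@continuous_comp _ _ _ (fun r : R => r * u) c); last exact: c_cont.
exact: mulrr_continuous.
Qed.

Lemma Lf_derive (u : R) : is_derive u 1 Lf (J leb (fun r => \1_`[e, 1]%classic r * c' (r * u))).
Proof.
have K0 : 0 <= K by exact: le_trans (c'M 0).
have i3 v : ig leb (fun r => \1_`[e, 1]%classic r * c' (r * v)).
  apply: (ig_mulb _ (fun r => c'M _) (ig_itv e 1)).
  apply: cont1_meas => r; apply: (@continuous_comp _ _ _ (fun r : R => r * v) c'); last exact: cc'.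
  exact: mulrr_continuous.
apply: (@is_derive_quad R _ Lf u 1 _ (K * J leb (\1_`[e, 1]%classic : R -> R))) => s.
have i1 := ig_wrc (s%:A + u); have i2 := ig_wrc u.
rewrite /Lf -(JZ s (i3 u)) -(JB i1 i2) -(JB (igB i1 i2) (igZ s (i3 u))).
rewrite mulrAC -(JZ _ (ig_itv e 1)).
apply: J_le_norm; [exact: igB (igB i1 i2) (igZ s (i3 u))|exact/igZ/ig_itv|].
move=> r; rewrite /wr indicE; have [|] := boolP (r \in _); last first.
  by rewrite !(mul0r, mulr0, subrr) normr0.
move=> /set_mem; rewrite /= in_itv/= => /andP[h r1]; rewrite !mul1r mulr1.
have r0 := lt_le_trans e0 h.
have := cK (r * u) (r * s).
have -> : r * (s%:A + u) = r * u + r * s by rewrite /GRing.scale/= mulr1; ring.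
move=> hh; have -> : r^-1 * c (r * u + r * s) - r^-1 * c (r * u) - s * c' (r * u) =
  r^-1 * (c (r * u + r * s) - c (r * u) - r * s * c' (r * u)) by field; rewrite gt_eqF.
rewrite normrM gtr0_norm ?invr_gt0// ler_pdivrMl//.
apply: le_trans hh _; rewrite exprMn mulrCA expr2 -mulrA ler_wpM2l ?(ltW r0)//.
by rewrite ler_piMl// mulr_ge0// sqr_ge0.
Qed.

(** [u * c' (r u)] is the derivative of [c (r u)] with respect to [r], so the integral over scales
    is that of a derivative. *)
Lemma Lf_deriveE (u : R) : u != 0 ->
  J leb (fun r => \1_`[e, 1]%classic r * c' (r * u)) = u^-1 * (c u - c (e * u)).
Proof.
move=> u0.
have cl : continuous (fun r : R => c' (r * u) * u).
  move=> r; apply: cvgM; last exact: cvg_cst.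
  apply: (@continuous_comp _ _ _ (fun r : R => r * u) c'); last exact: cc'.
  exact: mulrr_continuous.
have dcu (r : R) : is_derive r 1 (fun r : R => c (r * u)) (c' (r * u) * u).
  have := @is_derive1_comp R c (fun r => r * u) r u (c' (r * u)) _ _.
  have h1 : is_derive r 1 (fun r : R => r * u) u.
    by apply: is_derive_eq; rewrite /GRing.scale/= mulr0 add0r mulr1.
  exact: (fun f => f (dc _) h1).
have cc (r : R) : {for r, continuous (fun r : R => c (r * u))}.
  by apply: differentiable_continuous; apply/derivable1_diffP; case: (dcu r).
have := @continuous_FTC2 R _ (fun r : R => c (r * u)) e 1 e1 (continuous_subspaceT cl).
have h1 : derivable_oo_LRcontinuous (fun r : R => c (r * u)) e 1.
  split; first by move=> r _; case: (dcu r).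
    exact: cvg_at_right_filter (cc e).
  exact: cvg_at_left_filter (cc 1).
have h2 : {in `]e, 1[, (fun r : R => c (r * u))^`()%classic =1 (fun r : R => c' (r * u) * u)}.
  by move=> r _; rewrite derive1E; case: (dcu r).
move=> /(_ h1 h2) E; rewrite mul1r in E.
have i3 v : ig leb (fun r => \1_`[e, 1]%classic r * c' (r * v)).
  apply: (ig_mulb _ (fun r => c'M _) (ig_itv e 1)).
  apply: cont1_meas => r; apply: (@continuous_comp _ _ _ (fun r : R => r * v) c'); last exact: cc'.
  exact: mulrr_continuous.
apply: (mulIf u0); rewrite -(JZr _ (i3 u)) mulrAC mulVf// mul1r.
transitivity (\int[lebesgue_measure]_(r in `[e, 1]) (c' (r * u) * u)); last by rewrite /Rintegral E.
rewrite Rintegral_mkcond /J; apply: eq_Rintegral => r _.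
by rewrite patchE indicE; case: ifPn => _; rewrite ?mul1r ?mul0r.
Qed.

(** The derivative of [Lf] at [x] is at most [2 M / x] in absolute value, so [2 M ln x - s * Lf x]
    is nondecreasing for [s = 1] and [s = -1]. *)
Lemma Lf_mono (a b : R) : 0 < a -> a < b -> `|Lf b - Lf a| <= 2 * M * (ln b - ln a).
Proof.
move=> a0 ab.
have D (s : R) (x : R) : 0 < x -> is_derive x 1 (fun x => 2 * M * ln x - s * Lf x)
    (2 * M * x^-1 - s * (x^-1 * (c x - c (e * x)))).
  move=> x0; have dl := is_derive1_ln x0; have dL := Lf_derive x.
  rewrite Lf_deriveE ?gt_eqF// in dL.
  by apply: is_derive_eq; rewrite /GRing.scale/=; ring.
have P (s : R) : `|s| <= 1 -> 2 * M * ln a - s * Lf a <= 2 * M * ln b - s * Lf b.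
  move=> s1.
  have cG (x : R) : 0 < x -> {for x, continuous (fun x => 2 * M * ln x - s * Lf x)}.
    by move=> x0; apply: differentiable_continuous; apply/derivable1_diffP; case: (D s x x0).
  have dx (x : R) : x \in `]a, b[ -> is_derive x 1 (fun x => 2 * M * ln x - s * Lf x)
      (2 * M * x^-1 - s * (x^-1 * (c x - c (e * x)))).
    by rewrite in_itv/= => /andP[ax _]; apply: D; exact: lt_trans ax.
  have [|x] := MVT ab dx.
  - apply: continuous_in_subspaceT => u /set_mem; rewrite /= in_itv/= => /andP[u0 _].
    by apply: cG; exact: lt_le_trans u0.
  rewrite in_itv/= => /andP[ax xb] E.
  rewrite -subr_ge0 E; apply: mulr_ge0; last by rewrite subr_ge0 ltW.
  have x0 := lt_trans a0 ax.
  have -> : 2 * M * x^-1 - s * (x^-1 * (c x - c (e * x))) = x^-1 * (2 * M - s * (c x - c (e * x))) by ring.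
  rewrite mulr_ge0 ?invr_ge0 ?(ltW x0)// subr_ge0.
  apply: le_trans (ler_norm _) _; rewrite normrM.
  apply: le_trans (_ : 1 * `|c x - c (e * x)| <= _); first by rewrite ler_wpM2r.
  rewrite mul1r; apply: le_trans (ler_normB _ _) _.
  by have := cM x; have := cM (e * x); lra.
have := P 1; have := P (-1); rewrite normrN normr1 lexx => /(_ isT) h1 /(_ isT) h2.
rewrite ler_norml; apply/andP; split; lra.
Qed.

Lemma Lf_log (u : R) : 0 < u -> `|Lf u - Lf 1| <= 2 * M * `|ln u|.
Proof.
move=> u0; have [u1|u1|->] := ltgtP u 1.
- have := Lf_mono u0 u1; rewrite ln1 sub0r distrC => h; apply: le_trans h _.
  rewrite ler_wpM2l//; last by rewrite -normrN ler_norm.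
  by apply: mulr_ge0 => //; exact: le_trans (cM 0).
- have := Lf_mono ltr01 u1; rewrite ln1 subr0 => h; apply: le_trans h _.
  rewrite ler_wpM2l//; last by rewrite ler_norm.
  by apply: mulr_ge0 => //; exact: le_trans (cM 0).
- by rewrite subrr normr0 ln1 normr0 mulr0.
Qed.

Lemma Lf_bound u : `|Lf u| <= M * J leb (wr e).
Proof.
rewrite /Lf -(JZ _ (ig_wr e0)); apply: J_le_norm; [exact: ig_wrc|exact/igZ/ig_wr|].
by move=> r; rewrite normrM mulrC (ger0_norm (wr_ge0 _ e0)) ler_wpM2r// wr_ge0.
Qed.

Lemma Lf_cont : continuous Lf.
Proof.
move=> u; apply: differentiable_continuous; apply/derivable1_diffP.
by case: (Lf_derive u).
Qed.

End Frullani.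

End OneDim.

(** * Averages along one axis and their square function *)

Section SquareFunction.
Variable R : realType.
Local Notation R2 := (measurableTypeR R * measurableTypeR R)%type.
Local Notation R1 := (measurableTypeR R).
Local Notation leb := (@lebesgue_measure R).
Variables (i : 'I_2) (al : R -> R).
Hypotheses (hal : cc1 al) (al0 : J leb al = 0).
Implicit Types (psi : R * R -> R).

Definition dil (r s : R) : R * R := (r * s) *: unit_vec R i.
Definition Av (r : R) psi : R * R -> R := Avg leb al (dil r) psi.
(** Autocorrelation along axis [i]. It is even and bounded by the squared norm of [psi], and
    [Av_sqr] expresses the squared norms of all averages [Av r psi] by it, which does away with
    Fourier analysis. *)
Definition acor psi (t : R) : R := I2 (fun x => psi (x - t *: unit_vec R i) * psi x).

Lemma norm_unit_vec : `|unit_vec R i| <= 1.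
Proof.
by rewrite prod_normE ge_max /unit_vec/=; case: (i == 0); case: (i == 1);
  rewrite ?normr0 ?normr1 ?lexx ?ler01.
Qed.

Lemma measurable_dil r : measurable_fun (setT : set R1) (dil r : R -> R2).
Proof.
have h (k : R) : measurable_fun (setT : set R1) (fun s : R => r * s * k).
  by apply: cont1_meas => s; apply: cvgM; [apply: cvgM; [exact: cvg_cst|exact: cvg_id]|exact: cvg_cst].
exact: (measurable_fun_pair (h _) (h _)).
Qed.

Lemma dil_bound r : exists H : R, forall s, al s != 0 -> `|dil r s| <= H.
Proof.
have [_ [M [M0 HM]]] := hal; exists (`|r| * M) => s s0.
rewrite /dil normrZ -[leRHS]mulr1 ler_pM//; last exact: norm_unit_vec.
rewrite normrM ler_wpM2l// leNgt; apply/negP => /HM sM.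
by rewrite sM eqxx in s0.
Qed.

Lemma Av_tf r psi : tf psi -> tf (Av r psi).
Proof. by have [H HH] := dil_bound r; exact: avg_tf (cc1_ig hal) (measurable_dil r) _ HH _. Qed.

Lemma acor_le psi t : cc psi -> `|acor psi t| <= I2 (fun x => psi x ^+ 2).
Proof.
move=> h; have := I2_young ltr01 (cc_shift (- (t *: unit_vec R i)) h) h.
rewrite (@I2_shift R (fun x => psi x ^+ 2)) ?invr1 ?mul1r; last exact: cc_meas (cc_sqr h).
by rewrite /acor; lra.
Qed.

Lemma acor_opp psi t : cc psi -> acor psi (- t) = acor psi t.
Proof.
move=> h; rewrite /acor -(@I2_shift R _ (- (t *: unit_vec R i))); last first.
  by apply: cc_meas; apply: ccM; [exact: cc_shift|case: h].
by apply: eq_J => x; rewrite scaleNr opprK subrK mulrC.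
Qed.

Definition acor' psi (t : R) : R := - I2 (fun x => partial i psi (x - t *: unit_vec R i) * psi x).

(** [K] depends on derivatives of [psi]. It allows [Lf] to be differentiated, but the resulting
    bounds involve the supremum of the autocorrelation, so [K] is absent from the final estimate. *)
Lemma acor_props psi : tf psi -> exists K : R,
  [/\ forall t : R, is_derive t 1 (acor psi) (acor' psi t), continuous (acor' psi),
      forall t, `|acor' psi t| <= K &
      forall t s : R, `|acor psi (t + s) - acor psi t - s * acor' psi t| <= K * s ^+ 2].
Proof.
move=> hp; have hc := tf_cc hp; have hq := tf_cc (tf_partial i hp).
have [C [C0 HC]] := tf_taylor1 i hp.
have [C1 [C10 HC1]] := tf_bounded (tf_partial i hp).
have [C2 [C20 HC2]] := tf_lip i (tf_partial i hp).
pose N := I2 (fun x => `|psi x|).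
have N0 : 0 <= N by apply: J_ge0 => x; exact: normr_ge0.
have bnd (f : R * R -> R) (D : R) : continuous f -> (forall x, `|f x| <= D) ->
    `|I2 (fun x => f x * psi x)| <= D * N.
  move=> cf fD; have D0 : 0 <= D by exact: le_trans (fD 0).
  have -> : I2 (fun x => f x * psi x) = J (lebs R) (fun x => psi x * f x).
    by apply: eq_J => x; rewrite mulrC.
  by apply: J_mulb => //; [exact: continuous_measurable_plane|exact: cc_ig].
have cs (f : R * R -> R) (t : R) : cc f -> cc (fun x => f (x - t *: unit_vec R i) * psi x).
  by move=> hf; apply: ccM; [exact: cc_shift|case: hc].
have cN : continuous (fun x => partial i psi x) by case: hq.
have sub (f g : R * R -> R) : continuous f -> continuous g -> continuous (fun x => f x - g x).
  by move=> cf cg x; apply: cvgB; [exact: cf|exact: cg].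
have csc (k : R) (f : R * R -> R) : continuous f -> continuous (fun x => k * f x).
  by move=> cf x; apply: cvgM; [exact: cvg_cst|exact: cf].
have Q (t s : R) : `|acor psi (t + s) - acor psi t - s * acor' psi t| <= C * N * s ^+ 2.
  have -> : acor psi (t + s) - acor psi t - s * acor' psi t =
    I2 (fun x => (psi (x - t *: unit_vec R i + (- s) *: unit_vec R i) - psi (x - t *: unit_vec R i)
       - (- s) * partial i psi (x - t *: unit_vec R i)) * psi x).
    rewrite /acor /acor' mulrN opprK -I2Z; last exact: cs.
    rewrite -I2B; [|exact: cs|exact: cs].
    rewrite -I2D; [|by apply: ccB; exact: cs|by apply: ccZ; exact: cs].
    apply: eq_J => x.
    have -> : x - (t + s) *: unit_vec R i = x - t *: unit_vec R i + (- s) *: unit_vec R i.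
      by rewrite scalerDl opprD addrA scaleNr.
    by ring.
  rewrite mulrAC; apply: bnd; last by move=> x; rewrite -(sqrrN s); exact: HC.
  refine (sub _ _ _ _); last by apply: csc; exact: continuous_shift.
  refine (sub _ _ _ _); last by apply: continuous_shift; case: hc.
  refine (@continuous_shift R (fun y => psi (y + - s *: unit_vec R i)) _ _).
  by apply: continuous_shift; case: hc.
exists (C * N + C1 * N); split.
- move=> t; apply: (@is_derive_quad R _ (acor psi) t 1 _ (C * N)) => s.
  have -> : s *: 1 + t = t + s by rewrite /GRing.scale/= mulr1 addrC.
  exact: Q.
- have L (t s : R) : `|acor' psi (t + s) - acor' psi t| <= C2 * N * `|s|.
    have -> : acor' psi (t + s) - acor' psi t =
      - I2 (fun x => (partial i psi (x - t *: unit_vec R i + (- s) *: unit_vec R i) - partial i psi (x - t *: unit_vec R i)) * psi x).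
      rewrite /acor' -opprB opprK addrC; congr (- _).
      rewrite -I2B; [|exact: cs|exact: cs].
      apply: eq_J => x.
      have -> : x - (t + s) *: unit_vec R i = x - t *: unit_vec R i + (- s) *: unit_vec R i.
        by rewrite scalerDl opprD addrA scaleNr.
      by ring.
    rewrite normrN mulrAC; apply: bnd; last by move=> x; rewrite -(normrN s); exact: HC2.
    refine (sub _ _ _ _); last by apply: continuous_shift.
    refine (@continuous_shift R (fun y => partial i psi (y + - s *: unit_vec R i)) _ _).
    exact: continuous_shift.
  exact: (@lipschitz_continuous R R (acor' psi) (C2 * N)).
- move=> t; rewrite /acor' normrN; apply: le_trans (bnd _ C1 _ _) _.
  + exact: continuous_shift.
  + by move=> x; exact: HC1.
  + by rewrite lerDr; apply: mulr_ge0 => //; exact: ltW.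
- move=> t s; apply: le_trans (Q t s) _; rewrite ler_wpM2r ?sqr_ge0// lerDl.
  by apply: mulr_ge0 => //; exact: ltW.
Qed.

Lemma Av_sqr psi r : tf psi -> I2 (fun x => Av r psi x ^+ 2) =
  J leb (fun s => al s * J leb (fun s' => al s' * acor psi (r * (s' - s)))).
Proof.
move=> hp; have hc := tf_cc hp; have ha := tf_cc (Av_tf r hp).
have [H HH] := dil_bound r.
transitivity (I2 (fun x => Av r psi x * Av r psi x)); first by apply: eq_J => x; rewrite expr2.
rewrite (avg_fubini (cc1_ig hal) (measurable_dil r) hc ha).2.
apply: eq_J => s; congr (_ * _).
transitivity (I2 (fun x => Av r psi x * psi (x - dil r s))); first by apply: eq_J => x; rewrite mulrC.
rewrite (avg_fubini (cc1_ig hal) (measurable_dil r) hc (cc_shift _ hc)).2.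
apply: eq_J => s'; congr (_ * _).
rewrite /acor -(@I2_shift R _ (dil r s)); last first.
  by apply: cc_meas; apply: ccM; [exact: cc_shift|exact: continuous_shift hc.1].
have V (x : R * R) : x + dil r s - dil r s' = x - (r * (s' - s)) *: unit_vec R i.
  have -> : r * (s' - s) = r * s' - r * s by ring.
  by rewrite scalerBl opprB -addrA.
by apply: eq_J => x; rewrite addrK V.
Qed.

Let eq_J1 (f g : R -> R) : f =1 g -> J leb f = J leb g.
Proof. by move=> /funext ->. Qed.

Let eq_Jp (f g : R * R -> R) : f =1 g -> J (prodm leb leb) f = J (prodm leb leb) g.
Proof. by move=> /funext ->. Qed.

(** By [Av_sqr] and Fubini the left side is the double integral of [al s * al s' * L (s' - s)],
    where [L u] integrates the autocorrelation at [r u] against [dr / r]. As [al] has mean zero,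
    [L 1] can be subtracted; [L u - L 1] is at most [2 M |ln u|] whatever the cutoff [e], and the
    logarithm is integrable. *)
Lemma square_function : exists C : R, 0 < C /\
  forall psi, tf psi -> forall e : R, 0 < e -> e < 1 ->
  ig leb (fun r => wr e r * I2 (fun x => Av r psi x ^+ 2)) /\
  J leb (fun r => wr e r * I2 (fun x => Av r psi x ^+ 2)) <= C * I2 (fun x => psi x ^+ 2).
Proof.
have [_ [A [A0 HA]]] := hal.
have [B [B0 HB]] := cc1_bounded hal.
have ia := cc1_ig hal.
pose G := J leb (fun s => `|al s|).
have G0 : 0 <= G by apply: J_ge0 => s; exact: normr_ge0.
(* [al] is at most [B] near the logarithmic singularity, which has two sides, and [|s' - s|] is at
   most [2 A] on its support. *)
pose K0 := 2 * B * J leb (@l1 R) + 2 * A * G.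
have l10 : 0 <= J leb (@l1 R) by apply: J_ge0 => s; exact: l1_ge0.
have K00 : 0 <= K0.
  by rewrite /K0; apply: addr_ge0; apply: mulr_ge0 => //; apply: mulr_ge0 => //; exact: ltW.
exists (2 * K0 * G + 1); split.
  by have := mulr_ge0 K00 G0; rewrite -mulrA; move: (K0 * G) => k; lra.
move=> psi hp e e0 e1.
have hc := tf_cc hp.
have [K [dc cc' c'K cK]] := acor_props hp.
pose M := I2 (fun x => psi x ^+ 2).
have M0 : 0 <= M by apply: J_ge0 => x; exact: sqr_ge0.
have cM t : `|acor psi t| <= M by exact: acor_le.
have cac := c_cont dc.
have Lc := Lf_cont dc cc' cM c'K cK e0.
pose L := Lf (acor psi) e.
have LN (u : R) : L (- u) = L u.
  by apply: eq_J => r; rewrite mulrN acor_opp.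
have Llog (u : R) : u != 0 -> `|L u - L 1| <= 2 * M * (l1 u + l1 (- u) + `|u|).
  move=> u0; have M2 : 0 <= 2 * M by exact: mulr_ge0.
  have [up|un|uz] := ltrgt0P u; last by rewrite uz eqxx in u0.
  - apply: le_trans (Lf_log dc cc' cM c'K cK e0 e1 up) _; rewrite ler_wpM2l//.
    by apply: le_trans (ln_le_l1 up) _; rewrite -addrA lerD2l lerDr l1_ge0.
  - have up : 0 < - u by rewrite oppr_gt0.
    rewrite -LN; apply: le_trans (Lf_log dc cc' cM c'K cK e0 e1 up) _; rewrite ler_wpM2l//.
    by have := ln_le_l1 up; have := l1_ge0 u; lra.
have mdiff : measurable_fun setT (fun z : R1 * R1 => z.2 - z.1).
  by apply: measurable_funB.
have F2 (r : R) : ig (prodm leb leb) (fun z => al z.1 * al z.2 * acor psi (r * (z.2 - z.1))).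
  apply: (ig_mulb _ (fun z => cM _) (ig_prod ia ia)).
  apply: (measurableT_comp (cont1_meas cac)).
  exact: (measurable_funM (measurable_cst r) mdiff).
have F3 : ig (prodm leb (prodm leb leb)) (fun z => wr e z.1 * (al z.2.1 * al z.2.2) * acor psi (z.1 * (z.2.2 - z.2.1))).
  apply: (ig_mulb _ (fun z => cM _) (ig_prod (ig_wr e0) (ig_prod ia ia))).
  apply: (measurableT_comp (cont1_meas cac)).
  exact: (measurable_funM measurable_fst (measurableT_comp mdiff measurable_snd)).
have Lcont : continuous L by exact: Lc.
have LB (u : R) : `|L u| <= M * J leb (wr e) by exact: Lf_bound dc cM e0 u.
have iac (r s : R) : ig leb (fun s' => al s' * acor psi (r * (s' - s))).
  apply: (ig_mulb _ (fun z => cM _) ia); apply: (measurableT_comp (cont1_meas cac)).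
  by apply: measurable_funM => //; apply: measurable_funB.
have E (r : R) : wr e r * I2 (fun x => Av r psi x ^+ 2) =
    J (prodm leb leb) (fun z => wr e r * (al z.1 * al z.2) * acor psi (r * (z.2 - z.1))).
  transitivity (J (prodm leb leb) (fun z => wr e r * (al z.1 * al z.2 * acor psi (r * (z.2 - z.1))))); last first.
    by apply: eq_J => z; rewrite mulrA.
  rewrite Av_sqr// (JZ _ (F2 r)) -(J_fubini1 (F2 r)).2; congr (_ * _); apply: eq_J => s.
  by rewrite -(JZ _ (iac r s)); apply: eq_J => s' /=; rewrite mulrA.
split; first by apply: eq_ig (J_fubini1 F3).1 => r; rewrite E.
rewrite (eq_J1 E) (J_fubini1 F3).2 -(J_fubini2 F3).2.
have iw (u : R) := ig_wrc dc cM e0 u.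
have E4 (z : R1 * R1) : J leb (fun r => wr e r * (al z.1 * al z.2) * acor psi (r * (z.2 - z.1))) =
    al z.1 * al z.2 * L (z.2 - z.1).
  by rewrite /L /Lf -(JZ _ (iw _)); apply: eq_J => r; ring.
clearbody L.
have H4 : ig (prodm leb leb) (fun z => al z.1 * al z.2 * L (z.2 - z.1)).
  by apply: eq_ig (J_fubini2 F3).1 => z; exact: E4.
rewrite (eq_Jp E4) -(J_fubini1 H4).2.
(* The constant [L 1] is subtracted at no cost, the mean of [al] being zero. *)
pose Q (s : R) := J leb (fun s' => al s' * (L (s' - s) - L 1)).
have iL (s : R) : ig leb (fun s' => al s' * L (s' - s)).
  apply: (ig_mulb _ (fun z => LB _) ia); apply: (measurableT_comp (cont1_meas Lcont)).
  by apply: measurable_funB.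
have iQ (s : R) : ig leb (fun s' => al s' * (L (s' - s) - L 1)).
  by apply: eq_ig (igB (iL s) (igZr (L 1) ia)) => s'; rewrite mulrBr.
have EQ (s : R) : J leb (fun s' => al s * al s' * L (s' - s)) = al s * Q s.
  have -> : Q s = J leb (fun s' => al s' * L (s' - s)).
    transitivity (J leb (fun s' => al s' * L (s' - s) - al s' * L 1)); first by apply: eq_J => s'; rewrite mulrBr.
    have j0 : J leb (fun s' => al s' * L 1) = 0.
      by apply: etrans (JZr _ ia) _; rewrite al0 mul0r.
    exact: etrans (JB (iL s) (igZr (L 1) ia)) (etrans (congr1 (fun z => _ - z) j0) (subr0 _)).
  by rewrite -(JZ _ (iL s)); apply: eq_J => s'; rewrite mulrA.
have iaQ : ig leb (fun s => al s * Q s).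
  by apply: eq_ig (J_fubini1 H4).1 => s; exact: EQ.
rewrite (eq_J1 EQ).
have Qb (s : R) : `|s| <= A -> `|Q s| <= 2 * M * K0.
  move=> sA.
  have il1 := @ig_l1 R.
  have [i1 j1] := J1_shift (- s) il1.
  have [i2' j2'] := J1_opp il1.
  have [i2 j2] := J1_shift (- s) i2'.
  have i3 := igZ (2 * A) (ig_norm ia).
  have i12 := igZ B (igD i1 i2).
  have ig3 := igZ (2 * M) (igD i12 i3).
  apply: le_trans (J1_le_but (p := s) (iQ s) ig3 _ _) _.
  - move=> s' ss'; rewrite normrM.
    have u0 : s' - s != 0 by rewrite subr_eq0.
    have [s'A|s'A] := lerP `|s'| A; last first.
      rewrite HA// normr0 !mul0r; apply: mulr_ge0; first exact: mulr_ge0.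
      rewrite mulr0 addr0; apply: mulr_ge0; first exact: ltW.
      by apply: addr_ge0; exact: l1_ge0.
    apply: le_trans (ler_wpM2l (normr_ge0 _) (Llog _ u0)) _.
    rewrite mulrCA ler_wpM2l//; first exact: mulr_ge0.
    rewrite mulrDr [2 * A * _]mulrC; apply: lerD.
      by rewrite ler_wpM2r ?HB// addr_ge0// l1_ge0.
    rewrite ler_wpM2l//; apply: le_trans (ler_normB _ _) _.
    by rewrite (_ : 2 * A = A + A); [exact: lerD|ring].
  - move=> x; apply: mulr_ge0; first exact: mulr_ge0.
    apply: addr_ge0; apply: mulr_ge0 => //; try exact: ltW; last by apply: mulr_ge0 => //; exact: ltW.
    by apply: addr_ge0; exact: l1_ge0.
  rewrite (JZ _ (igD i12 i3)) (JD i12 i3) (JZ _ (igD i1 i2)) (JD i1 i2) (JZ _ (ig_norm ia)).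
  rewrite j1 j2 j2' -/G; rewrite le_eqVlt; apply/orP; left; apply/eqP.
  by rewrite /K0; ring.
apply: le_trans (ler_norm _) _.
apply: le_trans (J_le_norm iaQ (igZr (2 * M * K0) (ig_norm ia)) _) _.
  move=> s; rewrite normrM; have [sA|sA] := lerP `|s| A; first by rewrite ler_wpM2l// Qb.
  by rewrite HA// normr0 !mul0r.
rewrite (JZr _ (ig_norm ia)) -/G -/M.
rewrite (_ : G * (2 * M * K0) = 2 * K0 * G * M); last by ring.
by rewrite [leRHS]mulrDl mul1r lerDl.
Qed.

End SquareFunction.

(** * Tensor product kernels and the gradient of Bogovskii's field *)

Section TensorKernels.
Variable R : realType.
Local Notation R2 := (measurableTypeR R * measurableTypeR R)%type.
Local Notation R1 := (measurableTypeR R).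
Local Notation leb := (@lebesgue_measure R).
Implicit Types (phi psi : R * R -> R) (a b : 'I_2 -> R -> R) (i j k : 'I_2).

Lemma J1_deriv (f f' : R -> R) : cc1 f -> cc1 f' ->
  (forall s : R, is_derive s 1 f (f' s)) -> J leb f' = 0.
Proof.
move=> [cf [M [M0 HM]]] [cf' [N [N0 HN]]] D.
pose u : R := M + N + 1.
have u0 : - u < u by rewrite /u; lra.
have := @continuous_FTC2 R f' f (- u) u u0 (continuous_subspaceT cf').
have h1 : derivable_oo_LRcontinuous f (- u) u.
  split; first by move=> r _; case: (D r).
    exact: cvg_at_right_filter (cf _).
  exact: cvg_at_left_filter (cf _).
have h2 : {in `](- u), u[, f^`()%classic =1 f'}.
  by move=> r _; rewrite derive1E; case: (D r).
move=> /(_ h1 h2).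
have un : `|u| = u by apply: ger0_norm; rewrite /u; lra.
rewrite !HM ?normrN ?un; [|by rewrite /u; lra|by rewrite /u; lra].
rewrite -EFinB subrr => E.
transitivity (\int[lebesgue_measure]_(r in `[(- u), u]) f' r); last by rewrite /Rintegral E.
rewrite Rintegral_mkcond /J; apply: eq_Rintegral => r _.
rewrite patchE; case: ifPn => //; rewrite notin_setE/= in_itv/= -ler_norml => /negP; rewrite -ltNge => ru.
by apply: HN; apply: le_lt_trans ru; rewrite /u; lra.
Qed.

Lemma cc1M (f g : R -> R) : cc1 f -> continuous g -> cc1 (fun s => f s * g s).
Proof.
move=> [cf [M [M0 HM]]] cg; split; first by move=> s; apply: cvgM; [exact: cf|exact: cg].
by exists M; split => // s sM; rewrite HM// mul0r.
Qed.

Lemma cc1D (f g : R -> R) : cc1 f -> cc1 g -> cc1 (fun s => f s + g s).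
Proof.
move=> [cf [M [M0 HM]]] [cg [N [N0 HN]]]; split; first by move=> s; apply: cvgD; [exact: cf|exact: cg].
exists (M + N); split; first by lra.
by move=> s sM; rewrite HM ?HN ?addr0//; lra.
Qed.

(** Integration by parts on a line: up to sign, [r * partial k phi] at [x - dil k r s] is the
    derivative in [s] of [phi (x - dil k r s)]. The derivative passes to the kernel and one factor
    [r] is used up. *)
Lemma Av_partial k (al al' : R -> R) (r : R) phi x : cc1 al -> cc1 al' ->
  (forall s : R, is_derive s 1 al (al' s)) -> tf phi ->
  r * Av k al r (partial k phi) x = Av k al' r phi x.
Proof.
move=> ha ha' D hp.
pose q (s : R) := phi (x - dil k r s).
pose q' (s : R) := - r * partial k phi (x - dil k r s).
have cd : continuous (fun s : R => x - dil k r s).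
  move=> s; apply: cvgB; first exact: cvg_cst.
  apply: (@continuous_comp _ _ _ (fun s : R => r * s) (fun u : R => u *: unit_vec R k)).
    by apply: cvgM; [exact: cvg_cst|exact: cvg_id].
  exact: scalel_continuous.
have cc (f : R * R -> R) : continuous f -> continuous (fun s : R => f (x - dil k r s)).
  by move=> cf s; apply: (@continuous_comp _ _ _ (fun s : R => x - dil k r s) f); [exact: cd|exact: cf].
have cp := cc _ (smooth_continuous (@smooth_partial _ _ k hp.1)).
have cq := cc _ (smooth_continuous hp.1).
have dq (s : R) : is_derive s 1 q (q' s).
  have [C [C0 HC]] := tf_taylor1 k hp.
  apply: (@is_derive_quad R R q s 1 (q' s) (C * r ^+ 2)) => e.
  have -> : e *: 1 + s = s + e by rewrite /GRing.scale/= mulr1 addrC.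
  have := HC (x - dil k r s) (- r * e).
  have -> : x - dil k r s + (- r * e) *: unit_vec R k = x - dil k r (s + e).
    by rewrite /dil mulNr scaleNr mulrDr scalerDl opprD addrA.
  rewrite /q /q' exprMn sqrrN mulrA => h.
  by rewrite mulrA [e * _]mulrC.
have iaq' : ig leb (fun s => al s * partial k phi (x - dil k r s)).
  by apply: cc1_ig; exact: cc1M.
have ia'q : ig leb (fun s => al' s * phi (x - dil k r s)).
  by apply: cc1_ig; exact: cc1M.
have := @J1_deriv (fun s => al s * q s) (fun s => al' s * q s + al s * q' s) (cc1M ha cq).
have h1 : cc1 (fun s => al' s * q s + al s * q' s).
  apply: cc1D; [exact: cc1M|apply: cc1M => //].
  by move=> s; apply: cvgM; [exact: cvg_cst|exact: cp].
have h2 (s : R) : is_derive s 1 (fun s => al s * q s) (al' s * q s + al s * q' s).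
  have := is_deriveM (D s) (dq s).
  by rewrite /GRing.scale/= addrC [q s * _]mulrC.
move=> /(_ h1 h2).
have h3 : ig leb (fun s => al s * q' s).
  by apply: eq_ig (igZ (- r) iaq') => s; rewrite /q'; ring.
rewrite (JD ia'q h3).
have -> : J leb (fun s => al s * q' s) = - r * J leb (fun s => al s * partial k phi (x - dil k r s)).
  by rewrite -(JZ _ iaq'); apply: eq_J => s; rewrite /q'; ring.
by rewrite /Av /Avg; lra.
Qed.

Definition tens a (w : R2) : R := a 0 w.1 * a 1 w.2.
Definition Tv a (r : R) phi : R * R -> R := Avg (lebs R) (tens a) (fun w : R2 => r *: (w : R * R)) phi.

Lemma ig_tens a : (forall i, cc1 (a i)) -> ig (lebs R) (tens a).
Proof. by move=> h; exact: ig_prod (cc1_ig (h 0)) (cc1_ig (h 1)). Qed.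

Lemma tens_bound a (r : R) : (forall i, cc1 (a i)) ->
  exists H : R, forall w : R2, tens a w != 0 -> `|r *: (w : R * R)| <= H.
Proof.
move=> h; have [_ [M [M0 HM]]] := h 0; have [_ [N [N0 HN]]] := h 1.
exists (`|r| * (M + N)) => -[u v] /=; rewrite /tens mulf_eq0 negb_or /= => /andP[u0 v0].
rewrite normrZ ler_wpM2l// prod_normE ge_max /=; apply/andP; split.
  apply: le_trans (_ : M <= _); last by rewrite lerDl ltW.
  by rewrite leNgt; apply: contra_neqN u0 => /HM.
apply: le_trans (_ : N <= _); last by rewrite lerDr ltW.
by rewrite leNgt; apply: contra_neqN v0 => /HN.
Qed.

Lemma measurable_scale2 (r : R) : measurable_fun (setT : set R2) (fun w : R2 => r *: (w : R * R) : R2).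
Proof.
apply: (measurable_fun_pair (f := fun w : R2 => r * w.1) (g := fun w : R2 => r * w.2)).
  by apply: measurable_funM => //; exact: measurable_fst.
by apply: measurable_funM => //; exact: measurable_snd.
Qed.

Lemma Tv_tf a r phi : (forall i, cc1 (a i)) -> tf phi -> tf (Tv a r phi).
Proof.
move=> ha; have [H HH] := tens_bound r ha.
exact: avg_tf (ig_tens ha) (measurable_scale2 r) _ HH _.
Qed.

Lemma dil_pair (r : R) (w : R2) : r *: (w : R * R) = dil 0 r w.1 + dil 1 r w.2.
Proof.
case: w => u v; rewrite /dil /unit_vec /=.
by rewrite /GRing.scale/= /GRing.add/= /scale_pair /add_pair/= /GRing.scale/=; congr pair; ring.
Qed.

(** Fubini for a tensor product, with a free choice of the axis treated first; [1 - k] is the other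
    axis, computed modulo 2 in ['I_2]. *)
Lemma Tv_Av k a r phi : (forall i, cc1 (a i)) -> tf phi ->
  Tv a r phi = Av (1 - k) (a (1 - k)) r (Av k (a k) r phi).
Proof.
move=> ha hp; apply/funext => x.
have F : ig (lebs R) (fun w => tens a w * phi (x - r *: (w : R * R))).
  exact: ig_avg (ig_tens ha) (measurable_scale2 r) _ _ (tf_cc hp).
have ia i s : ig leb (fun t => a i t * phi (x - s - dil i r t)).
  exact: (ig_avg (cc1_ig (ha i)) (measurable_dil i r) _ (tf_cc hp)).
have : k = 0 \/ k = 1.
  by case: k => -[|[|//]] h; [left|right]; exact/val_inj.
case => ->.
  rewrite (_ : 1 - 0 = 1 :> 'I_2); last exact/val_inj.
  rewrite /Tv /Avg -(J_fubini2 F).2; apply: eq_J => v.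
  rewrite /Av /Avg -(JZ _ (ia 0 _)); apply: eq_J => u.
  by rewrite /tens dil_pair /= opprD addrA [x - _ - _]addrAC; ring.
rewrite (_ : 1 - 1 = 0 :> 'I_2); last exact/val_inj.
rewrite /Tv /Avg -(J_fubini1 F).2; apply: eq_J => u.
rewrite /Av /Avg -(JZ _ (ia 1 _)); apply: eq_J => v.
by rewrite /tens dil_pair /= opprD addrA; ring.
Qed.

(** The average along the other axis costs its L^1 norm at each scale; the average along [k] is kept
    for the square function. *)
Lemma Tv_L2 k a r phi : (forall i, cc1 (a i)) -> tf phi ->
  I2 (fun x => Tv a r phi x ^+ 2) <=
  (J leb (fun s => `|a (1 - k) s|)) ^+ 2 * I2 (fun x => Av k (a k) r phi x ^+ 2).
Proof.
move=> ha hp; rewrite (Tv_Av k)//.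
have [H HH] := dil_bound (1 - k) (ha (1 - k)) r.
have := @avg_L2 R _ _ leb _ _ (cc1_ig (ha (1 - k))) (measurable_dil (1 - k) r) _ HH _ (Av_tf k (ha k) r hp).
by [].
Qed.

(** The autocorrelation is even. The adjoint of an average at scale [r] is an average at scale
    [- r], which this brings back to [r]. *)
Lemma Av_opp k (al : R -> R) (r : R) phi : cc1 al -> tf phi ->
  I2 (fun x => Av k al (- r) phi x ^+ 2) = I2 (fun x => Av k al r phi x ^+ 2).
Proof.
move=> ha hp; have hc := tf_cc hp.
apply: etrans (Av_sqr k ha (- r) hp) (etrans _ (esym (Av_sqr k ha r hp))).
apply: eq_J => s; apply: (congr1 (fun z => al s * z)).
apply: eq_J => s'; apply: (congr1 (fun z => al s' * z)).
by rewrite mulNr acor_opp.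
Qed.


Section TwoAverages.
Context d (T : measurableType d) (mu : {sigma_finite_measure set T -> \bar R}).
Variables (g1 g2 : T -> R) (h : T -> R * R).
Hypotheses (ig1 : ig mu g1) (ig2 : ig mu g2) (mh : measurable_fun setT (h : T -> R2)).

(** Of the two displacements, one stays on [phi] and the other is moved to [psi] by a translation of
    the plane, with its sign reversed. The sum of the displacements being symmetric, the two weights
    can be exchanged. *)
Lemma two_avg phi psi : cc phi -> tf psi -> tf (Avg mu g2 h phi) ->
  tf (Avg mu g1 (fun t => - h t) psi) ->
  let F (f1 f2 : T -> R) (z : T * T) := f1 z.1 * f2 z.2 * I2 (fun x => phi (x - (h z.1 + h z.2)) * psi x) in
  let X := I2 (fun x => Avg mu g2 h phi x * Avg mu g1 (fun t => - h t) psi x) in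
  [/\ ig (prodm mu mu) (F g1 g2), J (prodm mu mu) (F g1 g2) = X,
      ig (prodm mu mu) (F g2 g1) & J (prodm mu mu) (F g2 g1) = X].
Proof.
move=> hp hq h1 h2.
have igg := ig_prod ig1 ig2.
have mhh2 : measurable_fun setT (fun z : T * T => h z.1 + h z.2 : R2).
  have /measurable_fun_pairP [m1 m2] := mh.
  apply: (measurable_fun_pair (f := fun z : T * T => (h z.1).1 + (h z.2).1) (g := fun z : T * T => (h z.1).2 + (h z.2).2)).
    by apply: measurable_funD; [exact: (measurableT_comp m1 measurable_fst)|exact: (measurableT_comp m1 measurable_snd)].
  by apply: measurable_funD; [exact: (measurableT_comp m2 measurable_fst)|exact: (measurableT_comp m2 measurable_snd)].
have mhN : measurable_fun setT (fun t => - h t : R2).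
  have /measurable_fun_pairP [m1 m2] := mh.
  apply: (measurable_fun_pair (f := fun t => - (h t).1) (g := fun t => - (h t).2)).
    exact: (measurableT_comp (@oppr_measurable _ _) m1).
  exact: (measurableT_comp (@oppr_measurable _ _) m2).
have [F _] := avg_fubini igg mhh2 hp (tf_cc hq).
have [F' _] := avg_fubini (ig_prod ig2 ig1) mhh2 hp (tf_cc hq).
move=> FF X.
have E : J (prodm mu mu) (FF g2 g1) = J (prodm mu mu) (FF g1 g2).
  rewrite -(J_fubini1 F').2 -(J_fubini2 F).2; apply: eq_J => s; apply: eq_J => t /=.
  by rewrite [g2 s * _]mulrC [h s + _]addrC.
suff E1 : J (prodm mu mu) (FF g1 g2) = X by split => //; exact: etrans E E1.
rewrite -(J_fubini1 F).2.
transitivity (I2 (fun x => Avg mu g1 (fun t => - h t) psi x * Avg mu g2 h phi x)); last first.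
  by apply: eq_J => x; rewrite mulrC.
rewrite (avg_fubini ig1 mhN (tf_cc hq) (tf_cc h1)).2.
apply: eq_J => t /=.
have [F2 E2] := avg_fubini ig2 mh hp (cc_shift (h t) (tf_cc hq)).
transitivity (g1 t * J mu (fun s => g2 s * I2 (fun x => phi (x - h s) * psi (x + h t)))).
  rewrite -(JZ _ F2); apply: eq_J => s /=; rewrite -mulrA; congr (_ * (_ * _)).
  rewrite -[LHS](@I2_shift R _ (h t)).
    by apply: eq_J => x; rewrite opprD addrA addrK.
  by apply: cc_meas; apply: ccM; [exact: cc_shift|exact: smooth_continuous hq.1].
rewrite -E2; congr (_ * _).
by apply: eq_J => x; rewrite opprK mulrC.
Qed.

End TwoAverages.


Section HomotopyGradient.
Variables (a a' : 'I_2 -> R -> R).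
Hypotheses (ha : forall i, cc1 (a i)) (ha' : forall i, cc1 (a' i)).
Hypothesis da : forall i (s : R), is_derive s 1 (a i) (a' i s).
Hypothesis am : forall i, J leb (fun s => a i s * s) = 0.

(** Weight and displacement of the convolution of [tens a] with itself. The convolution is not
    carried out, because [kfield_dual] needs the two displacements apart. *)
Definition kerG (z : R2 * R2) : R := tens a z.1 * tens a z.2.
Definition kerH (z : R2 * R2) : R * R := (z.1 : R * R) + z.2.
Local Notation mu4 := (prodm (lebs R) (lebs R)).
Definition kfield phi i : R * R -> R := hfield mu4 kerG kerH phi i.

Lemma ig_kerG : ig mu4 kerG.
Proof. exact: ig_prod (ig_tens ha) (ig_tens ha). Qed.

Lemma mkerH : measurable_fun setT (kerH : R2 * R2 -> R2).
Proof.
apply: (measurable_fun_pair (f := fun z : R2 * R2 => z.1.1 + z.2.1) (g := fun z : R2 * R2 => z.1.2 + z.2.2)).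
  by apply: measurable_funD; exact: measurableT_comp.
by apply: measurable_funD; exact: measurableT_comp.
Qed.

Lemma kerH_bound : exists H : R, forall z, kerG z != 0 -> `|kerH z| <= H.
Proof.
have [H HH] := tens_bound 1 ha; exists (H + H) => -[w w'] /=.
rewrite /kerG /kerH /= mulf_eq0 negb_or => /andP[w0 w0'].
apply: le_trans (ler_normD _ _) _; apply: lerD.
  by have := HH _ w0; rewrite scale1r.
by have := HH _ w0'; rewrite scale1r.
Qed.

Lemma kfield_tf phi i : tf phi -> tf (kfield phi i).
Proof. by have [H HH] := kerH_bound; move=> hp; exact: (@hfield_tf _ _ _ _ _ _ _ ig_kerG mkerH HH). Qed.

(** The kernel with an extra coordinate factor along [i], and below it the kernel differentiated
    along [j]. The altered one-dimensional factor has mean zero in both cases: by [am], and as a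
    derivative. *)
Definition wmom i : 'I_2 -> R -> R := fun k => if k == i then fun s => a k s * s else a k.
Definition wder j : 'I_2 -> R -> R := fun k => if k == j then a' k else a k.

Lemma wmom_cc i k : cc1 (wmom i k).
Proof. by rewrite /wmom; case: ifP => _ //; apply: cc1M => // s; exact: cvg_id. Qed.

Lemma wder_cc i k : cc1 (wder i k).
Proof. by rewrite /wder; case: ifP. Qed.

Lemma I2_case i : i = 0 \/ i = 1.
Proof. by case: i => -[|[|//]] h; [left|right]; exact/val_inj. Qed.

Lemma tens_wmom i (w : R2) : tens (wmom i) w = tens a w * coord i w.
Proof. by case: (I2_case i) => ->; rewrite /tens /wmom /coord /=; ring. Qed.

Lemma Tv_wder j r phi x : tf phi -> r * Tv a r (partial j phi) x = Tv (wder j) r phi x.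
Proof.
move=> hp; have hq := tf_partial j hp.
rewrite (Tv_Av j _ ha hq) (Tv_Av j _ (wder_cc j) hp).
have -> : wder j (1 - j) = a (1 - j).
  by rewrite /wder; case: (I2_case j) => ->.
rewrite -(@avgZ _ _ _ leb _ _ (cc1_ig (ha (1 - j))) (measurable_dil (1 - j) r) r _ _ (tf_cc (Av_tf j (ha j) r hq))).
congr (Av _ _ _ _ _); apply/funext => y.
by rewrite /wder eqxx; apply: Av_partial.
Qed.

(** At scale [r] the homotopy weight carries [w_i + w'_i]; by [two_avg] both terms give the same
    pairing, whence the factor 2. *)
Lemma kfield_dual phi psi i j : tf phi -> tf psi ->
  let Z r := 2 * I2 (fun x => Tv a r (partial j phi) x * Tv (wmom i) (- r) psi x) in
  ig leb (fun r => \1_`[0, 1]%classic r * Z r) /\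
  I2 (fun x => partial j (kfield phi i) x * psi x) = J leb (fun r => \1_`[0, 1]%classic r * Z r).
Proof.
move=> hp hq Z.
have [H HH] := kerH_bound.
have hp' := tf_partial j hp.
have := avg_fubini (ig_hw ig_kerG mkerH HH i) (mhh mkerH) (tf_cc hp') (tf_cc hq).
rewrite (_ : Avg _ _ _ (partial j phi) = partial j (kfield phi i)); last first.
  by rewrite /kfield (partial_hfield ig_kerG mkerH HH).
move=> [F ->].
suff E (r : R) : J mu4 (fun z => hw kerG kerH i (r, z) * I2 (fun x => partial j phi (x - hh kerH (r, z)) * psi x)) =
    \1_`[0, 1]%classic r * Z r.
  split; first by apply: eq_ig (J_fubini1 F).1 => r; exact: E.
  by rewrite -(J_fubini1 F).2; apply: eq_J => r; exact: E.
have := @two_avg _ _ (lebs R) _ _ _ (ig_tens (wmom_cc i)) (ig_tens ha) (measurable_scale2 r) (partial j phi) psi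
  (tf_cc hp') hq (Tv_tf r ha hp') _.
rewrite (_ : (fun t : R2 => - (r *: (t : R * R))) = (fun t : R2 => (- r) *: (t : R * R))); last first.
  by apply/funext => t; rewrite scaleNr.
move=> /(_ (Tv_tf _ (wmom_cc i) hq)) [i1 E1 i2 E2].
rewrite /Z mulr_natl mulr2n -{1}E1 -E2 -(JD i1 i2).
rewrite -(JZ _ (igD i1 i2)); apply: eq_J => z.
rewrite /hw /hh /kerG /kerH /= scalerDr !tens_wmom.
have -> : coord i ((z.1 : R * R) + z.2) = coord i z.1 + coord i z.2 by rewrite /coord; case: ifP.
by ring.
Qed.

Lemma J_itv0 (e : R) : 0 < e -> J leb (\1_`[0, e]%classic : R1 -> R) = e.
Proof.
move=> e0; rewrite /J /Rintegral integral_indic// setIT.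
have := @lebesgue_measure_itv R `[0, e]; rewrite /= => E.
transitivity (fine (lebesgue_measure (`[0, e]%classic : set R))) => //.
by rewrite E lte_fin e0 -EFinB /= subr0.
Qed.

Lemma I2_young1 phi psi : cc phi -> cc psi ->
  2 * `|I2 (fun x => phi x * psi x)| <= I2 (fun x => phi x ^+ 2) + I2 (fun x => psi x ^+ 2).
Proof. by move=> h1 h2; have := I2_young ltr01 h1 h2; rewrite invr1 !mul1r. Qed.

Lemma wder_mean j : J leb (wder j j) = 0.
Proof. by rewrite /wder eqxx; exact: J1_deriv (ha j) (ha' j) (da j). Qed.

Lemma wmom_mean i : J leb (wmom i i) = 0.
Proof. by rewrite /wmom eqxx; exact: am. Qed.

(* Both kernels under the integral over the scale r have a factor of mean zero,
   so that the square function estimate compensates for the singular factor 1/r. *)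
Lemma kfield_H1 i j : exists C : R, 0 < C /\ forall phi, tf phi ->
  I2 (fun x => partial j (kfield phi i) x ^+ 2) <= C * I2 (fun x => phi x ^+ 2).
Proof.
have [C1 [C10 H1]] := square_function j (wder_cc j j) (wder_mean j).
have [C2 [C20 H2]] := square_function i (wmom_cc i i) (wmom_mean i).
pose G1 := J leb (fun s => `|wder j (1 - j) s|) ^+ 2.
pose G2 := J leb (fun s => `|wmom i (1 - i) s|) ^+ 2.
have G10 : 0 <= G1 by exact: sqr_ge0.
have G20 : 0 <= G2 by exact: sqr_ge0.
(* Large enough for [l^-1 * G2 * C2] to be at most 1/2: the term in [N] is then absorbed by the
   left-hand side. *)
pose l := 2 * (G2 * C2) + 1.
have GC : 0 <= G2 * C2 by apply: mulr_ge0 => //; exact: ltW.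
have GC1 : 0 <= G1 * C1 by apply: mulr_ge0 => //; exact: ltW.
have l0 : 0 < l by rewrite /l; lra.
exists (2 * (l * (G1 * C1)) + 1); split.
  by have := mulr_ge0 (ltW l0) GC1; lra.
move=> phi hp.
pose psi := partial j (kfield phi i).
have hq : tf psi by exact/tf_partial/kfield_tf.
have hp' := tf_partial j hp.
have [F E] := kfield_dual i j hp hq.
pose N := I2 (fun x => psi x ^+ 2).
pose M := I2 (fun x => phi x ^+ 2).
have M0 : 0 <= M by apply: J_ge0 => x; exact: sqr_ge0.
have N0 : 0 <= N by apply: J_ge0 => x; exact: sqr_ge0.
have EN : N = I2 (fun x => partial j (kfield phi i) x * psi x).
  by apply: eq_J => x; rewrite expr2.
rewrite -/psi -/N -/M.
clearbody psi.
pose Z r := 2 * I2 (fun x => Tv a r (partial j phi) x * Tv (wmom i) (- r) psi x).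
(* A crude bound, with derivatives of [phi] but no factor [1 / r]: it serves for the scales below
   the cutoff [e], where it is multiplied by [e]. *)
pose K := J (lebs R) (fun w => `|tens a w|) ^+ 2 * I2 (fun x => partial j phi x ^+ 2) +
          J (lebs R) (fun w => `|tens (wmom i) w|) ^+ 2 * N.
have ZK r : `|Z r| <= K.
  have [B1 HB1] := tens_bound r ha; have [B2 HB2] := tens_bound (- r) (wmom_cc i).
  have t1 := Tv_tf r ha hp'; have t2 := Tv_tf (- r) (wmom_cc i) hq.
  rewrite normrM (gtr0_norm (ltr0Sn _ 1)); apply: le_trans (I2_young1 (tf_cc t1) (tf_cc t2)) _.
  apply: lerD.
    exact: (@avg_L2 _ _ _ (lebs R) _ _ (ig_tens ha) (measurable_scale2 r) _ HB1).
  exact: (@avg_L2 _ _ _ (lebs R) _ _ (ig_tens (wmom_cc i)) (measurable_scale2 (- r)) _ HB2).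
have K0 : 0 <= K by exact: le_trans (ZK 0).
pose X r := I2 (fun x => Av j (wder j j) r phi x ^+ 2).
pose Y r := I2 (fun x => Av i (wmom i i) r psi x ^+ 2).
have ZW r : 0 < r -> `|Z r| <= r^-1 * (l * (G1 * X r) + l^-1 * (G2 * Y r)).
  move=> r0.
  have t1 := Tv_tf r (wder_cc j) hp; have t2 := Tv_tf (- r) (wmom_cc i) hq.
  have -> : Z r = r^-1 * (2 * I2 (fun x => Tv (wder j) r phi x * Tv (wmom i) (- r) psi x)).
    rewrite mulrCA /Z; congr (2 * _).
    rewrite -I2Z; last by apply: ccM; [exact: tf_cc|case: (tf_cc t2)].
    apply: eq_J => x; rewrite -(Tv_wder j r x hp) !mulrA mulVf ?mul1r//; exact: lt0r_neq0.
  rewrite normrM (gtr0_norm (_ : 0 < r^-1)) ?invr_gt0// ler_wpM2l ?invr_ge0 ?(ltW r0)//.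
  rewrite normrM (gtr0_norm (ltr0Sn _ 1)).
  apply: le_trans (I2_young l0 (tf_cc t1) (tf_cc t2)) _.
  apply: lerD; rewrite ler_wpM2l ?invr_ge0 ?(ltW l0)//.
    exact: Tv_L2 (wder_cc j) hp.
  rewrite /Y -(Av_opp i r (wmom_cc i i) hq); exact: Tv_L2 (wmom_cc i) hq.
have main e : 0 < e -> e < 1 -> N <= e * K + (l * (G1 * (C1 * M)) + l^-1 * (G2 * (C2 * N))).
  move=> e0 e1.
  have [X1 X2] := H1 phi hp e e0 e1; have [Y1 Y2] := H2 psi hq e e0 e1.
  have iA : ig leb (fun r => \1_`[0, e]%classic r * K) := igZr K (ig_itv 0 e).
  have iX := igZ l (igZ G1 X1); have iY := igZ l^-1 (igZ G2 Y1).
  have iB := igD iA (igD iX iY).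
  apply: (@le_trans _ _ `|J leb (fun r => \1_`[0, 1]%classic r * Z r)|).
    by rewrite EN E; exact: ler_norm.
  apply: le_trans (J_le_norm F iB _) _; last first.
    rewrite (JD iA (igD iX iY)) (JD iX iY) (JZr _ (ig_itv 0 e)) (J_itv0 e0).
    rewrite (JZ _ (igZ G1 X1)) (JZ _ X1) (JZ _ (igZ G2 Y1)) (JZ _ Y1).
    rewrite lerD2l; apply: lerD; rewrite ler_wpM2l ?invr_ge0 ?(ltW l0)// ler_wpM2l//.
  move=> r; rewrite -/(Z r) -/(X r) -/(Y r).
  have X0 : 0 <= X r by apply: J_ge0 => x; exact: sqr_ge0.
  have Y0 : 0 <= Y r by apply: J_ge0 => x; exact: sqr_ge0.
  have W0 : 0 <= l * (G1 * (wr e r * X r)) + l^-1 * (G2 * (wr e r * Y r)).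
    by apply: addr_ge0; rewrite mulr_ge0 ?invr_ge0 ?(ltW l0)// mulr_ge0// mulr_ge0// wr_ge0.
  rewrite normrM !indicE; have [/set_mem|_] := boolP (r \in `[0, 1]%classic); last first.
    by rewrite normr0 mul0r addr_ge0// mulr_ge0.
  rewrite /= in_itv/= normr1 mul1r => /andP[r0 r1].
  have [re|er] := lerP r e.
    rewrite mem_set ?mul1r; last by rewrite /= in_itv/= r0 re.
    by apply: le_trans (ZK r) _; rewrite lerDl.
  apply: le_trans (ZW r (lt_trans e0 er)) _.
  have -> : wr e r = r^-1.
    by rewrite /wr indicE mem_set ?mul1r//= in_itv/= (ltW er) r1.
  apply: le_trans (_ : l * (G1 * (r^-1 * X r)) + l^-1 * (G2 * (r^-1 * Y r)) <= _).
    by rewrite le_eqVlt; apply/orP; left; apply/eqP; ring.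
  by rewrite lerDr mulr_ge0.
(* The cutoff tends to 0, which removes [K]; the constants of the square function do not depend on
   it. *)
have main2 : N <= l * (G1 * (C1 * M)) + l^-1 * (G2 * (C2 * N)).
  apply: le_eps => d d0.
  have K1 : 0 < K + d + 1 by lra.
  have e0 : 0 < d / (K + d + 1) by apply: divr_gt0.
  have e1 : d / (K + d + 1) < 1 by rewrite ltr_pdivrMr// mul1r; lra.
  apply: le_trans (main _ e0 e1) _; rewrite addrC lerD2l.
  by rewrite mulrAC ler_pdivrMr// ler_pM2l//; lra.
have h : l^-1 * (G2 * (C2 * N)) <= 2^-1 * N.
  rewrite ler_pdivrMl// [leLHS]mulrA [leRHS]mulrA ler_wpM2r//.
  by move: (G2 * C2) GC @l l0 {ZW main main2} => q q0 /= _; lra.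
rewrite mulrDl mul1r.
have -> : 2 * (l * (G1 * C1)) * M = 2 * (l * (G1 * (C1 * M))) by ring.
move: (l * (G1 * (C1 * M))) main2 => q main2; lra.
Qed.

End HomotopyGradient.

End TensorKernels.

(** * A right inverse of the divergence *)

Section Bumps.
Variable R : realType.
Local Notation R2 := (measurableTypeR R * measurableTypeR R)%type.
Local Notation R1 := (measurableTypeR R).
Local Notation leb := (@lebesgue_measure R).
Implicit Types (phi psi : R * R -> R) (i j k : 'I_2) (s c r : R).

(** Powers of [1 / s] times [exp (- 1 / s)], extended by 0. Derivatives are linear combinations of
    members of the family, so smoothness is an induction. *)
Definition flat (n : nat) s : R := if 0 < s then s^-1 ^+ n * expR (- s^-1) else 0.

Lemma flat_ge0 n s : 0 <= flat n s.
Proof. by rewrite /flat; case: ifP => // s0; rewrite mulr_ge0 ?expR_ge0// exprn_ge0// invr_ge0 ltW. Qed.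

Lemma flat0_gt0 s : 0 < s -> 0 < flat 0 s.
Proof. by move=> s0; rewrite /flat s0 mul1r expR_gt0. Qed.

(** The exponential dominates the term of degree [n + 2] of its series. Quadratic vanishing at the
    origin gives the derivative 0 there. *)
Lemma flat_le n s : flat n s <= (n.+2)`!%:R * s ^+ 2.
Proof.
rewrite /flat; case: ifPn => [s0|_]; last by rewrite mulr_ge0 ?sqr_ge0.
have u0 : 0 <= s^-1 by rewrite invr_ge0 ltW.
have := expR_ge1Dxn n.+1 u0; set f := (n.+2)`!%:R => h.
have f0 : 0 < f by rewrite ltr0n fact_gt0.
rewrite expRN ler_pdivrMr ?expR_gt0//.
have sn : s != 0 by rewrite gt_eqF.
have -> : s^-1 ^+ n = f * s ^+ 2 * (s^-1 ^+ n.+2 / f).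
  rewrite [s^-1 ^+ n.+2]exprSr [s^-1 ^+ n.+1]exprSr; move: (s^-1 ^+ n) => q.
  by field; rewrite sn gt_eqF.
rewrite ler_wpM2l//; first by rewrite mulr_ge0 ?sqr_ge0 ?(ltW f0).
by apply: le_trans h; rewrite lerDr.
Qed.

Lemma flat_is_derive n s : is_derive s 1 (flat n) (- n%:R * flat n.+1 s + flat n.+2 s).
Proof.
have [s0|s0|s0] := ltrgt0P s.
- pose f y := y^-1 ^+ n * expR (- y^-1) : R.
  apply: (@near_eq_is_derive _ R R f).
    near=> y; rewrite /f /flat ifT//; near: y; exact: lt_nbhsr.
  have sn : s != 0 by rewrite gt_eqF.
  have dV : is_derive s 1 (fun y : R => y^-1) (- s ^- 2).
    have := @is_deriveV R id s 1 1 sn (is_derive_id _ _).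
    by rewrite /GRing.scale/= mulr1.
  have dN : is_derive s 1 (fun y : R => - y^-1) (s ^- 2) by have := is_deriveN dV; rewrite opprK.
  have dE : is_derive s 1 (fun y : R => expR (- y^-1)) (s ^- 2 * expR (- s^-1)).
    have := @is_derive1_comp R expR (fun y : R => - y^-1) s _ _ (is_derive_expR _) dN.
    by rewrite /comp mulrC.
  have dX : is_derive s 1 (fun y : R => y^-1 ^+ n) (- n%:R * s^-1 ^+ n.+1).
    case: n @f => [|m] f.
      rewrite oppr0 mul0r; exact: is_derive_cst.
    have := @is_deriveX R R (fun y : R => y^-1) m.+1 s 1 _ dV.
    rewrite /GRing.scale/= -exprVn => h.
    have -> : (fun y : R => y^-1 ^+ m.+1) = (fun y : R => y^-1) ^+ m.+1.
      by apply/funext => y; rewrite exprfctE.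
    by apply: is_derive_eq h _; rewrite !exprS; ring.
  have := is_deriveM dX dE; rewrite /GRing.scale/= => h.
  apply: is_derive_eq h _; rewrite /flat s0.
  by rewrite -exprVn !exprS; ring.
- apply: (@near_eq_is_derive _ R R (fun=> 0)).
    near=> y; rewrite /flat ifF//; apply/negbTE; rewrite -leNgt ltW//; near: y; exact: lt_nbhsl.
  rewrite /flat ltNge (ltW s0) /= mulr0 addr0; exact: is_derive_cst.
- rewrite s0 /flat ltxx mulr0 addr0.
  apply: (@is_derive_quad R R _ 0 1 0 (n.+2)`!%:R) => e.
  rewrite ltxx mulr0 !subr0 -/(flat n _) addr0.
  rewrite (_ : e *: 1 = e); last by rewrite /GRing.scale/= mulr1.
  by rewrite (ger0_norm (flat_ge0 _ _)) flat_le.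
Unshelve. all: by end_near. Qed.

Lemma flat_cont n : continuous (flat n).
Proof.
move=> s; apply: differentiable_continuous; apply/derivable1_diffP.
by case: (flat_is_derive n s).
Qed.

Lemma flat_aff n (a c s : R) : is_derive s 1 (fun s => flat n (a + c * s))
  (c * (- n%:R * flat n.+1 (a + c * s) + flat n.+2 (a + c * s))).
Proof.
have dA : is_derive s 1 (fun s => a + c * s) c.
  apply: (@is_derive_quad R R (fun s => a + c * s) s 1 c 0) => e.
  rewrite (_ : e *: 1 = e); last by rewrite /GRing.scale/= mulr1.
  by rewrite (_ : _ - _ = 0) ?normr0 ?mul0r//; ring.
have := @is_derive1_comp R (flat n) (fun s => a + c * s) s _ _ (flat_is_derive n _) dA.
by rewrite /comp mulrC.
Qed.

Lemma is_derive_line (V : normedModType R) (f : V -> R) (x v : V) (l : R) :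
  is_derive (0 : R) (1 : R) (fun t : R => f (t *: v + x)) l -> is_derive x v f l.
Proof.
move=> D; have dl := @ex_derive _ _ _ _ _ _ _ D; have dv := @derive_val _ _ _ _ _ _ _ D.
have E : (fun h : R => h^-1 *: ((f \o shift x) (h *: v) - f x)) =
    (fun h : R => h^-1 *: (((fun t : R => f (t *: v + x)) \o shift (0 : R)) (h *: 1) - f (0 *: v + x))).
  by apply/funext => h; rewrite /= scale0r add0r addr0 [h *: 1]mulr1.
by apply: DeriveDef; [rewrite /derivable E|rewrite /derive E].
Qed.

Lemma coord_cont i : continuous (coord i : R * R -> R).
Proof.
move=> x; have [->|->] := I2_case i; rewrite /coord /=.
  exact: cvg_fst.
exact: cvg_snd.
Qed.

Lemma coord_line i j (x : R * R) (t : R) : coord i (t *: unit_vec R j + x) = coord i x + t * (i == j)%:R.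
Proof.
have [->|->] := I2_case i; rewrite /coord /=.
  transitivity (t * (unit_vec R j).1 + x.1) => //.
  by have [->|->] := I2_case j; rewrite /unit_vec /= addrC.
transitivity (t * (unit_vec R j).2 + x.2) => //.
by have [->|->] := I2_case j; rewrite /unit_vec /= addrC.
Qed.

Lemma smooth_flat n i (a c : R) : smooth (fun x => flat n (a + c * coord i x)).
Proof.
have C m : continuous (fun x : R * R => flat m (a + c * coord i x)).
  move=> x; apply: (@continuous_comp _ _ _ (fun x : R * R => a + c * coord i x) (flat m)); last exact: flat_cont.
  by apply: cvgD; [exact: cvg_cst|apply: cvgM; [exact: cvg_cst|exact: coord_cont]].
have D m j (x : R * R) : is_derive x (unit_vec R j) (fun x => flat m (a + c * coord i x))
    ((i == j)%:R * c * (- m%:R * flat m.+1 (a + c * coord i x) + flat m.+2 (a + c * coord i x))).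
  have := flat_aff m (a + c * coord i x) ((i == j)%:R * c) 0.
  rewrite mulr0 addr0 => d.
  have E (h : R) : flat m (a + c * coord i (h *: unit_vec R j + x)) = flat m (a + c * coord i x + (i == j)%:R * c * h).
    by rewrite coord_line; congr (flat _ _); ring.
  by apply: is_derive_line; rewrite (_ : (fun t : R => _) = (fun h : R => flat m (a + c * coord i x + (i == j)%:R * c * h)))//; apply/funext => t; exact: E.
move=> k; elim: k n => [|k IH] n; first by split => //; exact: C.
split; first exact: C.
move=> j; split; first by move=> x; case: (D n j x).
rewrite (_ : partial j _ = fun x => (i == j)%:R * c * (- n%:R * flat n.+1 (a + c * coord i x) + flat n.+2 (a + c * coord i x))).
  apply: CkM; first exact: Ck_cst.
  by apply: CkD => //; apply: CkM => //; exact: Ck_cst.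
by apply/funext => x; case: (D n j x).
Qed.


Section Bump1.
Variables (c r : R).
Hypothesis r0 : 0 < r.

(** The two exponents let the derivatives of the bump [pr 0 0] be written within one family. *)
Definition pr (m n : nat) s : R := flat m (r - c + 1 * s) * flat n (r + c + (-1) * s).
Definition pr' (m n : nat) s : R :=
  - m%:R * pr m.+1 n s + pr m.+2 n s + (n%:R * pr m n.+1 s - pr m n.+2 s).

Lemma pr_derive m n s : is_derive s 1 (pr m n) (pr' m n s).
Proof.
have := is_deriveM (flat_aff m (r - c) 1 s) (flat_aff n (r + c) (-1) s).
by move=> h; apply: is_derive_eq h _; rewrite /GRing.scale/= /pr' /pr; ring.
Qed.

Lemma pr_out m n s : r <= `|s - c| -> pr m n s = 0.
Proof.
rewrite ler_normr /pr /flat => /orP[h|h].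
  by rewrite [X in _ * X](_ : _ = 0) ?mulr0// ifF//; apply/negbTE; rewrite -leNgt; lra.
by rewrite [X in X * _](_ : _ = 0) ?mul0r// ifF//; apply/negbTE; rewrite -leNgt; lra.
Qed.

Lemma pr_cc m n : cc1 (pr m n).
Proof.
split.
  move=> s; apply: differentiable_continuous; apply/derivable1_diffP.
  by case: (pr_derive m n s).
exists (`|c| + r); split; first by apply: ltr_wpDl.
move=> s sM; apply: pr_out; have := ler_normD (s - c) c.
by rewrite subrK; move: (`|s| : R) (`|s - c| : R) (`|c| : R) sM => x y z; lra.
Qed.

Lemma pr_smooth m n i : smooth (fun x => pr m n (coord i x)).
Proof. by apply: smoothM; exact: smooth_flat. Qed.

Lemma pr_ge0 m n s : 0 <= pr m n s.
Proof. by apply: mulr_ge0; exact: flat_ge0. Qed.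

Lemma pr_gt0 s : `|s - c| < r -> 0 < pr 0 0 s.
Proof. by rewrite ltr_norml => /andP[h1 h2]; rewrite mulr_gt0// flat0_gt0//; lra. Qed.

Lemma cc1Z (k : R) (f : R -> R) : cc1 f -> cc1 (fun s => k * f s).
Proof.
move=> [cf [M [M0 HM]]]; split; first by move=> s; apply: cvgM; [exact: cvg_cst|exact: cf].
by exists M; split => // s sM; rewrite HM// mulr0.
Qed.

Lemma cc1_cont (f : R -> R) : cc1 f -> continuous f.
Proof. by case. Qed.

Lemma pr'_cc m n : cc1 (pr' m n).
Proof.
apply: cc1D; first by apply: cc1D; [apply/cc1Z/pr_cc|exact: pr_cc].
apply: cc1D; first exact/cc1Z/pr_cc.
have := cc1Z (-1) (pr_cc m n.+2).
by rewrite (_ : (fun s => -1 * _) = fun s => - pr m n.+2 s)//; apply/funext => s; rewrite mulN1r.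
Qed.

Lemma pr'_smooth m n i : smooth (fun x => pr' m n (coord i x)).
Proof.
rewrite /pr'; apply: smoothD; apply: smoothD; try exact: pr_smooth.
- by apply: smoothZ; exact: pr_smooth.
- by apply: smoothZ; exact: pr_smooth.
- have := smoothZ (-1) (pr_smooth m n.+2 i).
  by rewrite (_ : (fun s : R * R => -1 * _) = fun x : R * R => - pr m n.+2 (coord i x))//; apply/funext => s; rewrite mulN1r.
Qed.

Lemma pr'_out m n s : r <= `|s - c| -> pr' m n s = 0.
Proof. by move=> h; rewrite /pr' !pr_out// !mulr0 subr0 !addr0. Qed.

Lemma J_pr_gt0 : 0 < J leb (pr 0 0).
Proof.
have cm : 0 < pr 0 0 c by apply: pr_gt0; rewrite subrr normr0.
have := cc1_cont (pr_cc 0 0); move=> /(_ c) /cvgrPdist_lt /(_ (pr 0 0 c / 2)).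
move=> /(_ (divr_gt0 cm (ltr0Sn _ 1))) /nbhs_ballP[d /= d0 H].
pose a := c - d / 2; pose b := c + d / 2.
have i1 := igZ (pr 0 0 c / 2) (ig_itv a b).
apply: (@lt_le_trans _ _ (J leb (fun s : R => pr 0 0 c / 2 * \1_`[a, b]%classic s))).
  rewrite (JZ _ (ig_itv a b)); apply: mulr_gt0; first exact: divr_gt0.
  rewrite /J /Rintegral integral_indic// setIT.
  have := @lebesgue_measure_itv R `[a, b]; rewrite /= => E.
  rewrite (_ : fine _ = fine (lebesgue_measure (`[a, b]%classic : set R)))//.
  by rewrite E lte_fin ifT -?EFinB /= /a /b; lra.
apply: J_le i1 (cc1_ig (pr_cc 0 0)) _ => s; rewrite indicE.
have [/set_mem|_] := boolP (s \in _); last by rewrite mulr0 pr_ge0.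
rewrite /= in_itv/= mulr1 => /andP[h1 h2].
have /H : ball c d s by rewrite /ball/= ltr_norml /a /b in h1 h2 *; lra.
by move=> /= /(le_lt_trans (ler_norm _)); move: (pr 0 0 s : R) (pr 0 0 c : R) => x y; lra.
Qed.

(** A multiple of its derivative is added to the bump: the mass is unchanged, while the first
    moment, taken about the origin and not about [c], decreases by that multiple of the mass. Hence
    [al], the ratio of moment to mass. The sign of [p] is lost. *)
Lemma mollifier1 : exists p p' : R -> R,
  [/\ cc1 p, cc1 p', forall s, is_derive s 1 p (p' s), J leb p = 1 & J leb (fun s => p s * s) = 0] /\
  (forall s, p s != 0 -> `|s - c| < r) /\ (forall i, smooth (fun x => p (coord i x))).
Proof.
pose I0 := J leb (pr 0 0); have I0p : 0 < I0 := J_pr_gt0.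
have cid : continuous (fun s : R => s) by move=> s; exact: cvg_id.
have sp := cc1M (pr_cc 0 0) cid; have sp' := cc1M (pr'_cc 0 0) cid.
pose al := J leb (fun s => pr 0 0 s * s) / I0.
(* With both exponents 0 the coefficients of [pr'] vanish, so [pr' 0 0] is [pr 2 0 - pr 0 2] and can
   be differentiated again. *)
have d2 s : is_derive s 1 (pr' 0 0) (pr' 2 0 s - pr' 0 2 s).
  have := is_deriveB (pr_derive 2 0 s) (pr_derive 0 2 s).
  rewrite (_ : pr 2 0 - pr 0 2 = pr' 0 0)//.
  by apply/funext => t; rewrite (_ : (pr 2 0 - pr 0 2) t = pr 2 0 t - pr 0 2 t)// /pr'; ring.
have e1 : J leb (pr' 0 0) = 0 by exact: J1_deriv (pr_cc 0 0) (pr'_cc 0 0) (pr_derive 0 0).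
have e2 : J leb (fun s => pr' 0 0 s * s) = - I0.
  have cq := cc1D sp' (pr_cc 0 0).
  have := @J1_deriv R (fun s => pr 0 0 s * s) (fun s => pr' 0 0 s * s + pr 0 0 s) sp cq.
  rewrite (JD (cc1_ig sp') (cc1_ig (pr_cc 0 0))) => H.
  suff : J leb (fun s => pr' 0 0 s * s) + I0 = 0 by lra.
  apply: H => s; have := is_deriveM (pr_derive 0 0 s) (is_derive_id s 1).
  by move=> h; apply: is_derive_eq h _; rewrite /GRing.scale/= mulr1 addrC mulrC.
have cq := cc1D (pr_cc 0 0) (cc1Z al (pr'_cc 0 0)).
have cq' : cc1 (fun s => I0^-1 * (pr' 0 0 s + al * (pr' 2 0 s - pr' 0 2 s))).
  apply/cc1Z/cc1D; first exact: pr'_cc.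
  apply/cc1Z/cc1D; first exact: pr'_cc.
  have := cc1Z (-1) (pr'_cc 0 2).
  by rewrite (_ : (fun s => -1 * _) = fun s => - pr' 0 2 s)//; apply/funext => s; rewrite mulN1r.
exists (fun s => I0^-1 * (pr 0 0 s + al * pr' 0 0 s)).
exists (fun s => I0^-1 * (pr' 0 0 s + al * (pr' 2 0 s - pr' 0 2 s))).
split; [split => //|split].
- exact: cc1Z.
- move=> s; have := is_deriveM (is_derive_cst I0^-1 s 1) (is_deriveD (pr_derive 0 0 s) (is_deriveM (is_derive_cst al s 1) (d2 s))).
  by move=> h; apply: is_derive_eq h _; rewrite /GRing.scale/=; ring.
- rewrite (JZ _ (cc1_ig cq)) (JD (cc1_ig (pr_cc 0 0)) (igZ al (cc1_ig (pr'_cc 0 0)))).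
  by rewrite (JZ _ (cc1_ig (pr'_cc 0 0))) e1 mulr0 addr0 mulVf// gt_eqF.
- transitivity (J leb (fun s => I0^-1 * (pr 0 0 s * s + al * (pr' 0 0 s * s)))).
    by apply: eq_J => s; ring.
  rewrite (JZ _ (igD (cc1_ig sp) (igZ al (cc1_ig sp')))) (JD (cc1_ig sp) (igZ al (cc1_ig sp'))).
  rewrite (JZ _ (cc1_ig sp')) e2 /al; field; exact: lt0r_neq0.
- move=> s; apply: contra_neqT; rewrite -leNgt => h.
  by rewrite pr_out// pr'_out// mulr0 addr0 mulr0.
- move=> i; apply/smoothZ/smoothD; first exact: pr_smooth.
  exact/smoothZ/pr'_smooth.
Qed.

End Bump1.

Lemma J_tens (a : 'I_2 -> R -> R) : (forall i, cc1 (a i)) ->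
  J (lebs R) (tens a) = J leb (a 0) * J leb (a 1).
Proof.
move=> ha; rewrite -(J_fubini1 (ig_tens ha)).2 -(JZr _ (cc1_ig (ha 0))).
by apply: eq_J => s; rewrite -(JZ _ (cc1_ig (ha 1))); apply: eq_J.
Qed.

Lemma kernel2 (c : R * R) r : 0 < r -> exists a a' : 'I_2 -> R -> R,
  [/\ forall i, cc1 (a i), forall i, cc1 (a' i), forall i s, is_derive s 1 (a i) (a' i s),
      forall i, J leb (a i) = 1 & forall i, J leb (fun s => a i s * s) = 0] /\
  (forall w : R * R, tens a w != 0 -> `|w - c| < r) /\ tf (tens a : R * R -> R).
Proof.
move=> r0.
have [p0 [p0' [[h1 h2 h3 h4 h5] [h6 h7]]]] := mollifier1 c.1 r0.
have [p1 [p1' [[k1 k2 k3 k4 k5] [k6 k7]]]] := mollifier1 c.2 r0.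
exists (fun i => if i == 0 then p0 else p1), (fun i => if i == 0 then p0' else p1').
have S (w : R * R) : p0 w.1 * p1 w.2 != 0 -> `|w - c| < r.
  rewrite mulf_eq0 negb_or => /andP[w0 w1].
  by rewrite prod_normE gt_max /= (h6 _ w0) (k6 _ w1).
split; [by split=> i; case: ifP|split; last split].
- by move=> w; rewrite /tens /=; exact: S.
- rewrite /tens /=; exact: (smoothM (h7 0) (k7 1)).
exists (`|c| + r); split; first by apply: ltr_wpDl.
move=> w; apply: contra_ltP => /eqP/S wr.
have := ler_normD (w - c) c; rewrite subrK.
by move: (`|w| : R) (`|w - c| : R) (`|c| : R) wr => x y z; lra.
Qed.

Lemma unit_bump (x0 : R * R) r : 0 < r -> exists rho : R * R -> R,
  [/\ tf rho, I2 rho = 1 & forall x, rho x != 0 -> `|x - x0| < r].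
Proof.
move=> r0; have [a [a' [[h1 h2 h3 h4 h5] [h6 h7]]]] := kernel2 x0 r0.
by exists (tens a); split => //; rewrite /I2 (J_tens h1) !h4 mulr1.
Qed.

(** The indicator of the ball of radius [3 r / 4], averaged by a kernel of mass 1 supported in the
    ball of radius [r / 4]. The mass alone gives the value 1, although the kernel has no sign. *)
Lemma plateau (x0 : R * R) r : 0 < r -> exists b : R * R -> R,
  [/\ tf b, forall x, `|x - x0| <= r / 2 -> b x = 1 & forall x, b x != 0 -> `|x - x0| < r].
Proof.
move=> r0; have r40 : 0 < r / 4 by lra.
have [a [a' [[h1 h2 h3 h4 h5] [h6 h7]]]] := kernel2 0 r40.
pose g : R2 -> R := \1_[set x : R * R | `|x| <= r / 4 * 3].
pose b := Avg (lebs R) g (fun w : R2 => (w : R * R)) (tens a).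
have gi : ig (lebs R) g := ig_box _.
have mid : measurable_fun setT (fun w : R2 => (w : R * R) : R2) by exact: measurable_id.
have gH (t : R2) : g t != 0 -> `|(t : R * R)| <= r / 4 * 3.
  by rewrite /g indicE; have [/set_mem|_] := boolP (t \in _); rewrite ?eqxx.
have tb : tf b by exact: (avg_tf gi mid gH h7).
exists (fun x => b (x + - x0)); split.
- exact: tf_shift.
- move=> x xr; rewrite /b /Avg.
  pose a2 i (s : R) := a i (coord i (x - x0) - s).
  have ca2 i : cc1 (a2 i).
    have [ca [M [M0 HM]]] := h1 i; split.
      move=> s; apply: (@continuous_comp _ _ _ (fun s : R => coord i (x - x0) - s) (a i)); last exact: ca.
      by apply: cvgB; [exact: cvg_cst|exact: cvg_id].
    exists (`|coord i (x - x0)| + M); split; first by apply: ltr_wpDl.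
    move=> s sM; apply: HM; have := ler_normB (coord i (x - x0)) (coord i (x - x0) - s).
    rewrite opprB addrC subrK; move: (`|coord _ _| : R) (`|s| : R) (`|_ - s| : R) sM => u v w; lra.
  have E i : J leb (a2 i) = 1.
    have [i1 j1] := J1_shift (coord i (x - x0)) (cc1_ig (h1 i)).
    have [i2 j2] := J1_opp i1.
    rewrite -(h4 i) -j1 -j2; apply: eq_J => s /=.
    by rewrite /a2 addrC.
  transitivity (J (lebs R) (tens a2)); last by rewrite (J_tens ca2) !E mulr1.
  apply: eq_J => w; rewrite (_ : tens a2 w = tens a (x - x0 - (w : R * R)))//.
  have [->|ne] := eqVneq (tens a (x - x0 - (w : R * R))) 0; first by rewrite mulr0.
  have := h6 _ ne; rewrite subr0 => wr.
  rewrite /g indicE mem_set ?mul1r//=.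
  have := ler_normB (x - x0) (x - x0 - (w : R * R)).
  rewrite opprB addrC subrK.
  by move: (`|x - x0| : R) (`|(w : R * R)| : R) (`|_ - _| : R) wr xr => u v z; lra.
- move=> x; apply: contra_neqT; rewrite -leNgt => xr.
  rewrite /b /Avg -[RHS](J0 (lebs R)); apply: eq_J => w.
  have [->|g0] := eqVneq (g w) 0; first by rewrite mul0r.
  have [->|ne] := eqVneq (tens a (x + - x0 - (w : R * R))) 0; first by rewrite mulr0.
  have := gH _ g0; have := h6 _ ne; rewrite subr0.
  have := ler_normD (x - x0 - (w : R * R)) (w : R * R); rewrite subrK.
  by move: (`|x - x0| : R) (`|(w : R * R)| : R) (`|_ - _| : R) xr => u v z; lra.
Qed.

End Bumps.

(** * Solving the divergence equation near a point of the closure *)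

Section LocalDivergence.
Variable R : realType.
Local Notation R2 := (measurableTypeR R * measurableTypeR R)%type.
Local Notation R1 := (measurableTypeR R).
Local Notation leb := (@lebesgue_measure R).
Implicit Types (phi psi : R * R -> R) (O K W : set (R * R)) (i j : 'I_2).

Lemma sqrB_le (u v : R) : (u - v) ^+ 2 <= 2 * u ^+ 2 + 2 * v ^+ 2.
Proof.
rewrite -subr_ge0 (_ : _ - _ = (u + v) ^+ 2); last by ring.
exact: sqr_ge0.
Qed.

Lemma test_fun_tf O phi : test_fun O phi -> tf phi.
Proof.
move=> [s c _]; split => //.
have [M [_ HM]] := compact_bounded c.
exists (`|M| + 1); split; first by have := normr_ge0 M; lra.
move=> x xM; apply/eqP; apply: contraTT (xM) => x0.
rewrite -leNgt; apply: HM; first by have := ler_norm M; lra.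
exact: subset_closure.
Qed.

Lemma test_funP O phi K : tf phi -> compact K -> K `<=` O ->
  (forall x, phi x != 0 -> K x) -> test_fun O phi.
Proof.
move=> [s _] cK KO H.
have clK : closed K by apply: compact_closed => //; exact: norm_hausdorff.
have sK : closure [set x | phi x != 0] `<=` K.
  by move/closure_id: clK => ->; exact: closureS.
split => //; last exact: subset_trans sK KO.
exact: (subclosed_compact (@closed_closure _ _) cK sK).
Qed.

Lemma test_funW O O' phi : O `<=` O' -> test_fun O phi -> test_fun O' phi.
Proof. by move=> h [s c k]; split => //; exact: subset_trans k h. Qed.

Lemma test_fun0 O phi x : test_fun O phi -> ~ O x -> phi x = 0.
Proof.
move=> [_ _ h] nO; apply/eqP; apply: contrapT => /negP x0.
by apply/nO/h/subset_closure.
Qed.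

Lemma test_funM O phi psi : test_fun O phi -> smooth psi -> test_fun O (fun x => phi x * psi x).
Proof.
move=> h hq; have ht := test_fun_tf h; case: h => s c k.
apply: (test_funP (K := closure [set x | phi x != 0])) => //; first exact: tfM.
by move=> x; rewrite mulf_eq0 negb_or => /andP[x0 _]; exact: subset_closure.
Qed.

Lemma test_funD O phi psi : test_fun O phi -> test_fun O psi -> test_fun O (fun x => phi x + psi x).
Proof.
move=> h h'; have ht := test_fun_tf h; have ht' := test_fun_tf h'; case: h h' => s c k [s' c' k'].
apply: (test_funP (K := closure [set x | phi x != 0] `|` closure [set x | psi x != 0])) => //.
- exact: tfD.
- exact: compactU.
- by move=> x [/k|/k'].
- move=> x; have [-> |x0 _] := eqVneq (phi x) 0; last by left; exact: subset_closure.
  by rewrite add0r => x0; right; exact: subset_closure.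
Qed.

Lemma test_funZ O c phi : test_fun O phi -> test_fun O (fun x => c * phi x).
Proof.
move=> h; have := test_funM h (smooth_cst c).
by rewrite (_ : (fun x => _ * c) = fun x => c * phi x)//; apply/funext => x; rewrite mulrC.
Qed.

Lemma test_funB O phi psi : test_fun O phi -> test_fun O psi -> test_fun O (fun x => phi x - psi x).
Proof.
move=> h /(test_funZ (-1)) h'; have := test_funD h h'.
by rewrite (_ : (fun x => _ + _) = fun x => phi x - psi x)//; apply/funext => x; rewrite mulN1r.
Qed.

Lemma test_fun_cst0 O : test_fun O (fun=> 0 : R).
Proof.
apply: (test_funP (K := set0)) => //; try exact: compact0.
  by split; [exact: smooth_cst|exists 1; split].
by move=> x; rewrite eqxx.
Qed.

Lemma test_fun_sum O (T : finType) (F : T -> R * R -> R) :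
  (forall a, test_fun O (F a)) -> test_fun O (fun x => \sum_a F a x).
Proof.
move=> h; elim: (index_enum T) => [|a s IH].
  rewrite (_ : (fun x => _) = fun=> 0); first exact: test_fun_cst0.
  by apply/funext => x; rewrite big_nil.
rewrite (_ : (fun x => _) = fun x => F a x + \sum_(b <- s) F b x); first exact: test_funD.
by apply/funext => x; rewrite big_cons.
Qed.

Lemma partial_out phi K x i : closed K -> (forall y, phi y != 0 -> K y) -> ~ K x -> partial i phi x = 0.
Proof.
move=> cK H nK.
have : is_derive x (unit_vec R i) phi 0.
  apply: (@near_eq_is_derive _ (R * R)%type R (fun=> 0)).
  have : nbhs x (~` K) by apply: open_nbhs_nbhs; split => //; exact: closed_openC.
  apply: filterS => y nKy; apply/esym/eqP; apply: contrapT => /negP y0.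
  exact/nKy/H.
by case.
Qed.

Lemma test_fun_partial O phi i : test_fun O phi -> test_fun O (partial i phi).
Proof.
move=> h; have ht := test_fun_tf h; case: h => s c k.
apply: (test_funP (K := closure [set x | phi x != 0])) => //; first exact: tf_partial.
move=> x; apply: contra_neqP => nK; apply: partial_out nK; first exact: closed_closure.
by move=> y y0; exact: subset_closure.
Qed.

Section HfieldSupport.
Context d (T : measurableType d) (mu : {sigma_finite_measure set T -> \bar R}).
Variables (g : T -> R) (h : T -> R * R) (H : R).
Hypotheses (ig_g : ig mu g) (mh : measurable_fun setT (h : T -> R2)).
Hypothesis hH : forall t, g t != 0 -> `|h t| <= H.

Lemma hfield_test O K W phi i : tf phi -> compact K -> compact W ->
  (forall x, phi x != 0 -> K x) -> (forall t, g t != 0 -> W (h t)) ->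
  (forall y w (r : R), K y -> W w -> 0 <= r -> r <= 1 -> O (y + r *: w)) ->
  test_fun O (hfield mu g h phi i).
Proof.
move=> hp cK cW sK sW sO.
pose f (z : (R * R) * (R * (R * R))) := z.1 + z.2.1 *: z.2.2.
have cf : continuous f.
  move=> z; apply: cvgD; first exact: cvg_fst.
  apply: cvgZ.
    by apply: (@continuous_comp _ _ _ snd fst); [exact: cvg_snd|exact: cvg_fst].
  by apply: (@continuous_comp _ _ _ snd snd); [exact: cvg_snd|exact: cvg_snd].
have c1 : @compact ((R * R) * (R * (R * R)))%type (K `*` ((`[0, 1]%classic : set R) `*` W)).
  by apply: compact_setX => //; apply: compact_setX => //; exact: segment_compact.
apply: (test_funP (K := f @` (K `*` (`[0, 1]%classic `*` W)))).
- exact: (hfield_tf ig_g mh hH).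
- by apply: continuous_compact => //; exact: continuous_subspaceT.
- move=> _ [[y [r w]] [/= Ky [r01 Ww]] <-]; move: r01; rewrite /= in_itv/= => /andP[r0 r1].
  exact: sO.
- move=> x; apply: contra_neqP => nx; rewrite /hfield /Avg -[RHS](J0 (prodm leb mu)).
  apply: eq_J => z; rewrite /hw /hh indicE.
  have [/set_mem z01|_] := boolP (z.1 \in _); last by rewrite !mul0r.
  have [->|g0] := eqVneq (g z.2) 0; first by rewrite mul0r mulr0 mul0r.
  have [->|p0] := eqVneq (phi (x - z.1 *: h z.2)) 0; first by rewrite mulr0.
  exfalso; apply: nx; exists (x - z.1 *: h z.2, (z.1, h z.2)); last by rewrite /f /= subrK.
  by split; [exact: sK|split => //; exact: sW].
Qed.

End HfieldSupport.

Lemma J_kerG (a : 'I_2 -> R -> R) : (forall i, cc1 (a i)) -> (forall i, J leb (a i) = 1) ->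
  J (prodm (lebs R) (lebs R)) (kerG a) = 1.
Proof.
move=> ha h1; have E : J (lebs R) (tens a) = 1 by rewrite (J_tens ha) !h1 mulr1.
rewrite -(J_fubini1 (ig_kerG ha)).2.
transitivity (J (lebs R) (fun w => tens a w * 1)).
  by apply: eq_J => w; rewrite /kerG /= (JZ _ (ig_tens ha)) E.
by rewrite (JZr _ (ig_tens ha)) E mulr1.
Qed.

Lemma I2_refl phi x : cc phi -> I2 (fun w => phi (x - w)) = I2 phi.
Proof.
move=> hp.
have hq : cc (fun w => phi (x - w)).
  case: hp => c [M [M0 HM]]; split.
    move=> w; apply: (@continuous_comp _ _ _ (fun w : R * R => x - w) phi); last exact: c.
    by apply: cvgB; [exact: cvg_cst|exact: cvg_id].
  exists (`|x| + M); split; first by apply: ltr_wpDl.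
  move=> w wM; apply: HM; have := ler_normB x (x - w); rewrite opprB addrC subrK.
  by move: (`|x| : R) (`|w| : R) (`|x - w| : R) wM => u v z; lra.
have sl (f : R * R -> R) (s : R) : cc f -> cc1 (fun t => f (s, t)).
  move=> [c [M [M0 HM]]]; split.
    have E : (fun t : R => (s, t)) = (fun t : R => (s, 0) + t *: (0, 1)).
      apply/funext => t; rewrite /GRing.scale/= /GRing.add/= /scale_pair /add_pair/= /GRing.scale/=.
      by rewrite mulr0 mulr1 addr0 add0r.
    move=> t; apply: (@continuous_comp _ _ _ (fun t : R => (s, t)) f); last exact: c.
    by rewrite E; apply: cvgD; [exact: cvg_cst|exact: scalel_continuous].
  exists M; split => // t tM; apply: HM; apply: lt_le_trans tM _.
  exact: (norm_snd (s, t)).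
have refl1 (f : R -> R) (t : R) : ig leb f -> ig leb (fun s => f (t - s)) /\ J leb (fun s => f (t - s)) = J leb f.
  move=> fi; have [i1 j1] := J1_shift t fi; have [i2 j2] := J1_opp i1; split.
    by apply: eq_ig i2 => s /=; rewrite addrC.
  by rewrite -j1 -j2; apply: eq_J => s /=; rewrite addrC.
have [i1 j1] := J_fubini1 (cc_ig hp).
rewrite /I2 -(J_fubini1 (cc_ig hq)).2 -j1.
rewrite -[RHS](refl1 _ x.1 i1).2; apply: eq_J => s.
exact: (refl1 _ x.2 (cc1_ig (sl _ (x.1 - s) hp))).2.
Qed.

(** Read in the other order, the average of [phi] is a superposition, with weights [phi y], of
    translates of one fixed test function, the convolution square of [tens a]. [local_div] moves
    these translates to a common place. *)
Lemma avg_kerG (a : 'I_2 -> R -> R) phi x : (forall i, cc1 (a i)) -> tf (tens a : R * R -> R) -> tf phi ->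
  Avg (prodm (lebs R) (lebs R)) (kerG a) (@kerH R) phi x =
  J (lebs R) (fun y : R2 => phi y * Avg (lebs R) (tens a) (fun w : R2 => (w : R * R)) (tens a) (x - (y : R * R))).
Proof.
move=> ha ta hp; have hc := tf_cc hp; have ct := tf_cc ta.
have [H HH] := kerH_bound ha.
have F := ig_avg (ig_kerG ha) (@mkerH R) x hc.
rewrite /Avg -(J_fubini1 F).2.
have mid : measurable_fun setT (fun w : R2 => (w : R * R) : R2) by exact: measurable_id.
transitivity (J (lebs R) (fun w => J (lebs R) (fun y => tens a w * (phi y * tens a (x - y - w))))).
  apply: eq_J => w; rewrite /kerG /kerH /=.
  have cq : cc (fun y => phi y * tens a (x - w - y)).
    apply: ccM => // y; apply: (@continuous_comp _ _ _ (fun y : R * R => x - w - y) (tens a)); last exact: ct.1.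
    by apply: cvgB; [exact: cvg_cst|exact: cvg_id].
  have e1 : J (lebs R) (fun w' => tens a w' * phi (x - w - (w' : R * R))) = J (lebs R) (fun y => phi y * tens a (x - w - y)).
    apply: etrans _ (I2_refl (x - w) cq); apply: eq_J => y.
    by rewrite /= subKr mulrC.
  transitivity (tens a w * J (lebs R) (fun w' => tens a w' * phi (x - w - (w' : R * R)))).
    rewrite -(JZ _ (ig_avg (ig_tens ha) mid (x - w) hc)); apply: eq_J => w' /=.
    by rewrite opprD addrA; ring.
  rewrite e1.
  rewrite -(JZ _ (cc_ig cq)); apply: eq_J => y.
  by rewrite addrAC.
apply: etrans (@J_exchange _ _ R2 R2 R (lebs R) (lebs R) (fun w y : R2 => tens a w * (phi y * tens a (x - (y : R * R) - (w : R * R)))) _) _; last first.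
  apply: eq_J => y; rewrite -(JZ _ _).
    by apply: eq_J => w; ring.
  exact: (ig_avg (ig_tens ha) mid _ ct).
have [C [C0 HC]] := cc_bounded ct.
have F2 : ig (prodm (lebs R) (lebs R)) (fun z : R2 * R2 => tens a z.1 * phi z.2 * tens a (x - (z.2 : R * R) - (z.1 : R * R))); last first.
  by apply: eq_ig F2 => z; rewrite mulrA.
apply: (@ig_mulb _ _ _ _ C _ _ _ _ (ig_prod (ig_tens ha) (cc_ig hc))).
- apply: (measurableT_comp (continuous_measurable_plane ct.1)).
  have m1 := @mfun_shift R _ _ _ (x : R * R) (@mkerH R).
  apply: eq_measurable_fun m1 => z _; rewrite /kerH /=.
  by rewrite opprD addrA addrAC.
- by move=> z; exact: HC.
Qed.

Lemma compact_ball (c : R * R) (r : R) : compact [set x : R * R | `|x - c| <= r].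
Proof.
have -> : [set x : R * R | `|x - c| <= r] = (fun x => x + c) @` [set x : R * R | `|x| <= r].
  apply/seteqP; split => [x /= h|_ [y /= h <-]]; last by rewrite /= addrK.
  by exists (x - c) => //; rewrite subrK.
apply: continuous_compact; last exact: compact_box.
by apply: continuous_subspaceT => x; apply: cvgD; [exact: cvg_id|exact: cvg_cst].
Qed.

(** A truncated cone of axis [n] and opening [d], common to all points of [O] near [x0]. The value
    [n = 0] is allowed and describes a ball, which suits interior points. *)
Definition cone_at O (x0 : R * R) := exists (n : R * R) (d r : R), [/\ 0 < d, 0 < r &
  forall y, O y -> `|y - x0| < r -> forall (t : R) (w : R * R), 0 < t -> t <= r ->
    `|w - t *: n| <= d * t -> O (y + w)].

Lemma l1_le_l2 phi (x0 : R * R) (r : R) : cc phi -> (forall x, phi x != 0 -> `|x - x0| < r) ->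
  J (lebs R) (fun x => `|phi x|) ^+ 2 <=
  I2 (\1_[set x : R * R | `|x| <= `|x0| + r]) * I2 (fun x => phi x ^+ 2).
Proof.
move=> hp hr; set b : R * R -> R := \1_ _.
have b2 x : b x ^+ 2 = b x.
  by rewrite /b indicE; case: (_ \in _); rewrite /= ?expr1n ?expr0n.
have mp := cc_meas hp.
have ib : ig (lebs R) b := ig_box _.
have := @J_CS _ _ _ (lebs R) (fun x => `|phi x|) b (measurableT_comp (@normr_measurable _ _) mp) (ig_meas ib).
have -> : (fun x : R2 => `|phi x| * b x) = (fun x : R2 => `|phi x|).
  apply/funext => x; have [->|x0'] := eqVneq (phi x) 0; first by rewrite normr0 mul0r.
  rewrite /b indicE mem_set ?mulr1//=.
  have := hr _ x0'; have := ler_normD (x - x0) x0; rewrite subrK.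
  by move: (`|x| : R) (`|x - x0| : R) (`|x0| : R) => u v w; lra.
have -> : (fun x : R2 => `|phi x| ^+ 2) = (fun x : R2 => phi x ^+ 2).
  by apply/funext => x; rewrite real_normK// num_real.
have -> : (fun x : R2 => b x ^+ 2) = b by apply/funext => x; exact: b2.
by move=> /(_ (cc_ig (cc_sqr hp)) ib); rewrite mulrC.
Qed.

(** Two homotopies. Along the cone, [kfield] has divergence [phi] minus its average, and this
    average superposes translates of [rho1] with weights [phi y]. A second field, whose weight is
    [phi] itself, slides the translate at [y] to [y0]; subtracting it replaces the average by
    [I2 phi * rho]. *)
Lemma local_div O (x0 : R * R) : cone_at O x0 -> closure O x0 ->
  exists (r : R) (rho : R * R -> R) (C : R), [/\ 0 < r, 0 < C, test_fun O rho &
  forall phi, test_fun O phi -> (forall x, phi x != 0 -> `|x - x0| < r) ->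
  exists v : 'I_2 -> R * R -> R, [/\ forall i, test_fun O (v i),
    forall x, phi x = \sum_i partial i (v i) x + I2 phi * rho x &
    forall i j, I2 (fun x => partial j (v i) x ^+ 2) <= C * I2 (fun x => phi x ^+ 2)]].
Proof.
move=> [n [d [R0 [d0 R00 cone]]]] clO.
(* The sum of two displacements within [d h / 2] of [h n] is within [d h] of [2 h n], whereas the
   cone at height [2 h = R0] has half-width [2 d h]: a margin [d h] is left for the sliding. *)
pose h := R0 / 2; have h0 : 0 < h by rewrite /h; lra.
pose dh := d * h; have dh0 : 0 < dh by exact: mulr_gt0.
have dh2 : 0 < dh / 2 by lra.
have [a [a' [[ha ha' da a1 am] [ra ta]]]] := kernel2 (h *: n) dh2.
(* [2 r <= d h] keeps the sliding distance [|y - y0|] within this margin. *)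
pose r := Num.min R0 dh / 2.
have r0 : 0 < r by rewrite /r divr_gt0// lt_min R00 dh0.
have rR : r < R0 by rewrite /r; have := ge_min R0 R0 dh; rewrite lexx /= => k; lra.
have rd : 2 * r <= dh by rewrite /r; have := ge_min dh R0 dh; rewrite lexx orbT /= => k; lra.
have [y0 [Oy0 y0r]] : O `&` ball x0 r !=set0 by apply: clO; exact: nbhsx_ballx.
have {}y0r : `|y0 - x0| < r by move: y0r; rewrite -ball_normE /= distrC.
pose rho1 := Avg (lebs R) (tens a) (fun w : R2 => (w : R * R)) (tens a).
have mid : measurable_fun setT (fun w : R2 => (w : R * R) : R2) by exact: measurable_id.
have [Ha HHa] := tens_bound 1 ha.
have HHa1 (w : R2) : tens a w != 0 -> `|(w : R * R)| <= Ha by move=> /HHa; rewrite scale1r.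
have trho1 : tf rho1 := avg_tf (ig_tens ha) mid HHa1 ta.
pose rho (x : R * R) := rho1 (x + - y0).
have trho : tf rho := tf_shift _ trho1.
pose W := [set w : R * R | `|w - (2 * h) *: n| <= dh].
have sW (w w' : R * R) : tens a w != 0 -> tens a w' != 0 -> W (w + w').
  move=> /ra h1 /ra h2; rewrite /W /=.
  have -> : w + w' - (2 * h) *: n = (w - h *: n) + (w' - h *: n).
    by rewrite [2 * h]mulr_natl mulr2n scalerDl opprD addrACA.
  apply: le_trans (ler_normD _ _) _.
  by move: (`|w - _| : R) (`|w' - _| : R) h1 h2 => u v; lra.
have srho1 x : rho1 x != 0 -> W x.
  apply: contra_neqP => nW; rewrite /rho1 /Avg -[RHS](J0 (lebs R)); apply: eq_J => w.
  have [->|w0] := eqVneq (tens a w) 0; first by rewrite mul0r.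
  have [->|w1] := eqVneq (tens a (x - (w : R * R))) 0; first by rewrite mulr0.
  by exfalso; apply: nW; have := sW _ _ w0 w1; rewrite addrC subrK.
have OW (y w e : R * R) : O y -> `|y - x0| < R0 -> W w -> `|e| <= dh -> O (y + (w + e)).
  move=> Oy yr Ww eh; apply: (cone y Oy yr (2 * h)); [lra|rewrite /h; lra|].
  rewrite addrAC; apply: le_trans (ler_normD _ _) _.
  have -> : d * (2 * h) = dh + dh by rewrite /dh; ring.
  exact: lerD.
have cWy : compact [set x : R * R | `|x - (y0 + (2 * h) *: n)| <= dh] by exact: compact_ball.
have srho x : rho x != 0 -> `|x - (y0 + (2 * h) *: n)| <= dh.
  by move=> /srho1; rewrite /W /= opprD addrA.
exists r, rho.
have [C1 HC1] : exists C1 : 'I_2 -> 'I_2 -> R, forall i j, 0 < C1 i j /\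
    forall phi, tf phi -> I2 (fun x => partial j (kfield a phi i) x ^+ 2) <= C1 i j * I2 (fun x => phi x ^+ 2).
  have /choice[F HF] (ij : 'I_2 * 'I_2) := kfield_H1 ha ha' da am ij.1 ij.2.
  by exists (fun i j => F (i, j)) => i j; exact: (HF (i, j)).
pose B := I2 (\1_[set x : R * R | `|x| <= `|x0| + r]).
have B0 : 0 <= B by apply: J_ge0 => x; rewrite indicE.
pose D := \sum_j I2 (fun x => partial j rho x ^+ 2).
have D0 j : 0 <= I2 (fun x => partial j rho x ^+ 2) by apply: J_ge0 => x; exact: sqr_ge0.
have DD0 : 0 <= D by exact: sumr_ge0.
pose CC := \sum_i \sum_j C1 i j.
have CC0 : 0 <= CC by apply: sumr_ge0 => i _; apply: sumr_ge0 => j _; case: (HC1 i j) => /ltW.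
have C1C i j : C1 i j <= CC.
  rewrite /CC (bigD1 i)//= (bigD1 j)//= -addrA lerDl addr_ge0//.
    by apply: sumr_ge0 => k _; case: (HC1 i k) => /ltW.
  by apply: sumr_ge0 => k _; apply: sumr_ge0 => l _; case: (HC1 k l) => /ltW.
pose CV := (2 * r) ^+ 2 * B * D.
have CV0 : 0 <= CV by rewrite /CV mulr_ge0// mulr_ge0// sqr_ge0.
exists (2 * CC + 2 * CV + 1); split => //; first lra.
- apply: (test_funP trho cWy); last exact: srho.
  move=> x /= xW; have -> : x = y0 + (x - y0 + 0) by rewrite addr0 addrC subrK.
  by apply: OW => //; rewrite ?normr0 ?(ltW dh0)// /W /=; [exact: lt_trans y0r rR|rewrite -addrA -opprD].
move=> phi tphi sphi.
have hp := test_fun_tf tphi; have hc := tf_cc hp.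
pose K := closure [set x | phi x != 0].
have cK : compact K by case: tphi.
have KO : K `<=` O by case: tphi.
have Kr y : K y -> `|y - x0| <= r.
  have cl : closed [set x : R * R | `|x - x0| <= r].
    by apply: compact_closed; [exact: norm_hausdorff|exact: compact_ball].
  suff : K `<=` [set x : R * R | `|x - x0| <= r] by apply.
  by move/closure_id: cl => ->; apply: closureS => x /sphi /ltW.
pose shy (y : R2) : R * R := (y : R * R) - y0.
have mshy : measurable_fun setT (shy : R2 -> R2).
  have c1 : continuous (shy : R * R -> R * R).
    by move=> y; apply: cvgB; [exact: cvg_id|exact: cvg_cst].
  apply: (measurable_fun_pair (f := fun y : R2 => y.1 - y0.1) (g := fun y : R2 => y.2 - y0.2)).
    by apply: measurable_funB => //; exact: measurable_fst.
  by apply: measurable_funB => //; exact: measurable_snd.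
have shyr y : `|y - x0| <= r -> `|shy y| <= 2 * r.
  move=> yr; have -> : shy y = (y - x0) - (y0 - x0) by rewrite opprB addrA subrK.
  apply: le_trans (ler_normB _ _) _.
  by move: (`|y - x0| : R) (`|y0 - x0| : R) yr y0r => u v; lra.
have shyH (y : R2) : phi y != 0 -> `|shy y| <= 2 * r by move=> /sphi/ltW/shyr.
have [Hk HHk] := kerH_bound ha.
exists (fun i x => kfield a phi i x - hfield (lebs R) phi shy rho i x); split.
- move=> i; apply: test_funB.
    apply: (@hfield_test _ _ _ _ _ _ (ig_kerG ha) (@mkerH R) HHk O K W phi i hp cK (@compact_ball _ _)).
    + by move=> x x0'; exact: subset_closure.
    + by move=> z; rewrite /kerG mulf_eq0 negb_or => /andP[z1 z2]; exact: sW.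
    + move=> y w s Ky Ww s0 s1.
      have [->|sn] := eqVneq s 0; first by rewrite scale0r addr0; exact: KO.
      have sp : 0 < s by rewrite lt_neqAle eq_sym sn.
      apply: (cone y (KO _ Ky) (le_lt_trans (Kr _ Ky) rR) (s * (2 * h))).
      * by apply: mulr_gt0 => //; lra.
      * rewrite -[leRHS]mul1r; apply: ler_pM => //; rewrite /h; lra.
      * rewrite -scalerA -scalerBr normrZ (ger0_norm s0).
        apply: le_trans (ler_wpM2l s0 Ww) _.
        have -> : d * (s * (2 * h)) = s * dh + s * dh by rewrite /dh; ring.
        by rewrite lerDl mulr_ge0 ?(ltW dh0).
  apply: (@hfield_test _ _ _ _ _ _ (cc_ig hc) mshy shyH O [set x : R * R | `|x - (y0 + (2 * h) *: n)| <= dh]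
    [set w : R * R | `|w - 0| <= 2 * r] rho i trho cWy (@compact_ball _ _)).
  + exact: srho.
  + by move=> y /shyH; rewrite /= subr0.
  + move=> y w s /= yW; rewrite subr0 => wr s0 s1.
    have -> : y + s *: w = y0 + (y - y0 + s *: w) by rewrite addrA [y0 + _]addrC subrK.
    apply: OW => //; [exact: lt_trans y0r rR|by rewrite /W /= -addrA -opprD|].
    rewrite normrZ (ger0_norm s0); apply: le_trans rd; apply: le_trans wr.
    by rewrite ler_piMl.
- move=> x.
  have e1 := hfield_div (ig_kerG ha) (@mkerH R) HHk x hp.
  have e2 := hfield_div (cc_ig hc) mshy shyH x trho.
  have e3 : Avg (lebs R) phi shy rho x = Avg (prodm (lebs R) (lebs R)) (kerG a) (@kerH R) phi x.
    rewrite (avg_kerG x ha ta hp) /Avg; apply: eq_J => y; rewrite /rho /shy.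
    by have -> : x - ((y : R * R) - y0) + - y0 = x - (y : R * R) by rewrite opprB addrA addrAC addrK.
  transitivity (\sum_i (partial i (kfield a phi i) x - partial i (hfield (lebs R) phi shy rho i) x) + I2 phi * rho x); last first.
    congr (_ + _); apply: eq_bigr => i _.
    have s1 : smooth (kfield a phi i) by case: (kfield_tf ha i hp).
    have [s2 _] := hfield_tf (cc_ig hc) mshy shyH i trho.
    have -> : (fun x : R * R => kfield a phi i x - hfield (lebs R) phi shy rho i x) =
       (fun x => kfield a phi i x + (-1) * hfield (lebs R) phi shy rho i x).
      by apply/funext => z; rewrite mulN1r.
    rewrite partialD; [|exact: smooth_derivable|exact: smooth_derivable (smoothZ _ s2)].
    by rewrite partialZ// mulN1r.
  rewrite sumrB e1 e2 (J_kerG ha a1) -e3 -/(I2 phi); ring.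
- move=> i j.
  have t1 := kfield_tf ha i hp; have t2 := hfield_tf (cc_ig hc) mshy shyH i trho.
  have E x : partial j (fun x : R * R => kfield a phi i x - hfield (lebs R) phi shy rho i x) x =
     partial j (kfield a phi i) x - partial j (hfield (lebs R) phi shy rho i) x.
    have -> : (fun x : R * R => kfield a phi i x - hfield (lebs R) phi shy rho i x) =
       (fun x => kfield a phi i x + (-1) * hfield (lebs R) phi shy rho i x).
      by apply/funext => z; rewrite mulN1r.
    rewrite partialD; [|exact: smooth_derivable t1.1|exact: smooth_derivable (smoothZ _ t2.1)].
    by rewrite partialZ ?mulN1r//; case: t2.
  have c1 := cc_sqr (tf_cc (tf_partial j t1)); have c2 := cc_sqr (tf_cc (tf_partial j t2)).
  have b1 := (HC1 i j).2 phi hp.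
  have b2 : I2 (fun x => partial j (hfield (lebs R) phi shy rho i) x ^+ 2) <= CV * I2 (fun x => phi x ^+ 2).
    rewrite (partial_hfield (cc_ig hc) mshy shyH)//.
    apply: le_trans (hfield_L2 (cc_ig hc) mshy shyH i (tf_partial j trho)) _.
    have -> : CV * I2 (fun x => phi x ^+ 2) = (2 * r) ^+ 2 * (B * I2 (fun x => phi x ^+ 2)) * D by rewrite /CV; ring.
    apply: ler_pM; [exact: sqr_ge0|exact: D0| |]; last first.
      by rewrite /D (bigD1 j)//= lerDl; apply: sumr_ge0.
    apply: le_trans (_ : (2 * r * J (lebs R) (fun x => `|phi x|)) ^+ 2 <= _); last first.
      by rewrite exprMn ler_wpM2l ?sqr_ge0//; exact: l1_le_l2.
    rewrite ler_sqr ?nnegrE; last 2 first.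
    + by apply: J_ge0.
    + by apply: mulr_ge0; [lra|apply: J_ge0].
    rewrite -(JZ _ (ig_norm (cc_ig hc))); apply: J_le.
    + exact/ig_norm/(ig_gh (cc_ig hc) mshy shyH).
    + exact/igZ/ig_norm/cc_ig.
    + move=> y; rewrite normrM mulrC; have [->|y1] := eqVneq (phi y) 0; first by rewrite normr0 !mulr0.
      by rewrite ler_wpM2r// (le_trans (abs_coord _ _))// shyH.
  apply: le_trans (_ : I2 (fun x => 2 * partial j (kfield a phi i) x ^+ 2 + 2 * partial j (hfield (lebs R) phi shy rho i) x ^+ 2) <= _).
    apply: J_le.
    + apply: eq_ig (cc_ig (cc_sqr (ccB (tf_cc (tf_partial j t1)) (tf_cc (tf_partial j t2))))) => x.
      by rewrite E.
    + exact/cc_ig/(ccD (ccZ 2 c1) (ccZ 2 c2)).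
    + move=> x; rewrite E; exact: sqrB_le.
  rewrite (I2D (ccZ 2 c1) (ccZ 2 c2)) (I2Z _ c1) (I2Z _ c2).
  have M0 : 0 <= I2 (fun x => phi x ^+ 2) by apply: J_ge0 => x; exact: sqr_ge0.
  have b3 := le_trans b1 (ler_wpM2r M0 (C1C i j)).
  apply: le_trans (lerD (ler_wpM2l _ b3) (ler_wpM2l _ b2)) _ => //.
  by rewrite -subr_ge0 (_ : _ - _ = I2 (fun x => phi x ^+ 2))//; ring.
Qed.

End LocalDivergence.

(** * From local to global solutions of the divergence equation *)

Section GlobalDivergence.
Variable R : realType.
Local Notation R2 := (measurableTypeR R * measurableTypeR R)%type.
Implicit Types (phi psi f : R * R -> R) (O K : set (R * R)) (i j : 'I_2) (v : 'I_2 -> R * R -> R).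

Definition dvg O f (B : R) := exists v, [/\ forall i, test_fun O (v i),
  forall x, f x = \sum_i partial i (v i) x &
  forall i j, I2 (fun x => partial j (v i) x ^+ 2) <= B].

Lemma partialB phi psi i x : smooth phi -> smooth psi ->
  partial i (fun x => phi x - psi x) x = partial i phi x - partial i psi x.
Proof.
move=> s1 s2; have -> : (fun x => phi x - psi x) = (fun x => phi x + (-1) * psi x).
  by apply/funext => z; rewrite mulN1r.
by rewrite partialD ?partialZ ?mulN1r//; apply: smooth_derivable => //; exact: smoothZ.
Qed.

Lemma I2_sqrD phi psi : cc phi -> cc psi ->
  I2 (fun x => (phi x + psi x) ^+ 2) <= 2 * I2 (fun x => phi x ^+ 2) + 2 * I2 (fun x => psi x ^+ 2).
Proof.
move=> h1 h2; have c1 := cc_sqr h1; have c2 := cc_sqr h2.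
rewrite -(I2Z _ c1) -(I2Z _ c2) -(I2D (ccZ 2 c1) (ccZ 2 c2)); apply: J_le.
- exact/cc_ig/cc_sqr/ccD.
- exact/cc_ig/(ccD (ccZ 2 c1) (ccZ 2 c2)).
- by move=> x; have := sqrB_le (phi x) (- psi x); rewrite opprK sqrrN.
Qed.

Lemma dvgD O f g B B' : dvg O f B -> dvg O g B' -> dvg O (fun x => f x + g x) (2 * B + 2 * B').
Proof.
move=> [v [tv ev bv]] [w [tw ew bw]].
have D i j : partial j (fun x => v i x + w i x) = fun x => partial j (v i) x + partial j (w i) x.
  have [s1 _] := test_fun_tf (tv i); have [s2 _] := test_fun_tf (tw i).
  by apply/funext => x; rewrite partialD//; exact: smooth_derivable.
exists (fun i x => v i x + w i x); split.
- by move=> i; exact: test_funD.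
- by move=> x; rewrite ev ew -big_split; apply: eq_bigr => i _; rewrite D.
- move=> i j; rewrite D; have t1 := tf_partial j (test_fun_tf (tv i)); have t2 := tf_partial j (test_fun_tf (tw i)).
  by apply: le_trans (I2_sqrD (tf_cc t1) (tf_cc t2)) _; apply: lerD; rewrite ler_wpM2l.
Qed.

Lemma dvgZ O f B c : dvg O f B -> dvg O (fun x => c * f x) (c ^+ 2 * B).
Proof.
move=> [v [tv ev bv]].
have D i j : partial j (fun x => c * v i x) = fun x => c * partial j (v i) x.
  by apply/funext => x; rewrite partialZ//; case: (test_fun_tf (tv i)).
exists (fun i x => c * v i x); split.
- by move=> i; exact: test_funZ.
- by move=> x; rewrite ev mulr_sumr; apply: eq_bigr => i _; rewrite D.
- move=> i j; have t1 := tf_partial j (test_fun_tf (tv i)).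
  have -> : (fun x => partial j (fun x => c * v i x) x ^+ 2) = (fun x => c ^+ 2 * partial j (v i) x ^+ 2).
    by apply/funext => x; rewrite D exprMn.
  by rewrite (I2Z _ (cc_sqr (tf_cc t1))) ler_wpM2l ?sqr_ge0.
Qed.

Lemma dvg_ext O f g B B' : f =1 g -> B <= B' -> dvg O f B -> dvg O g B'.
Proof.
move=> e le [v [tv ev bv]]; exists v; split => //; first by move=> x; rewrite -e.
by move=> i j; exact: le_trans le.
Qed.

Lemma dvgB O f g B B' : dvg O f B -> dvg O g B' -> dvg O (fun x => f x - g x) (2 * B + 2 * B').
Proof.
move=> h /(dvgZ (-1)) h'; apply: dvg_ext (dvgD h h'); first by move=> x; rewrite mulN1r.
by rewrite sqrrN expr1n mul1r.
Qed.

Lemma dvg0 O : dvg O (fun=> 0) 0.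
Proof.
exists (fun i x => 0); split; first by move=> i; exact: test_fun_cst0.
- by move=> x; rewrite big1// => i _; exact: partial_cst.
- move=> i j; rewrite (_ : (fun x => _) = fun=> 0) ?[I2 _]J0//.
  by apply/funext => x; rewrite partial_cst expr0n.
Qed.

Section Graph.
Variables (g : R -> R).
Hypothesis hg : C2_fun g.

Lemma graph_lipschitz (u l : R) : exists L : R, 0 <= L /\
  forall s t : R, u <= s -> s <= l -> u <= t -> t <= l -> `|g t - g s| <= L * `|t - s|.
Proof.
have [d1 d2 _] := hg.
have cg' : continuous (derive1 g).
  by move=> s; apply: differentiable_continuous; apply/derivable1_diffP.
have cg : continuous g by move=> s; apply: differentiable_continuous; apply/derivable1_diffP.
have [L HL] : exists L : R, forall s : R, u <= s -> s <= l -> `|derive1 g s| <= L.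
  have := @compact_bounded _ _ (derive1 g @` `[u, l]%classic).
  move=> /(_ (continuous_compact (continuous_subspaceT cg') (@segment_compact _ _ _))) [M [_ HM]].
  exists (`|M| + 1) => s us sl; apply: HM; first by have := ler_norm M; lra.
  by exists s => //; rewrite /= in_itv/= us sl.
exists `|L|; split => //.
have W s t : u <= s -> s < t -> t <= l -> `|g t - g s| <= `|L| * `|t - s|.
  move=> us st tl.
  have dg (x : R) : x \in `]s, t[ -> is_derive x 1 g (derive1 g x).
    by move=> _; rewrite derive1E; apply: DeriveDef.
  have [c] := MVT st dg (continuous_subspaceT cg).
  rewrite in_itv/= => /andP[sc ct] ->; rewrite normrM ler_wpM2r//.
  apply: le_trans (ler_norm L); apply: HL; first exact: le_trans us (ltW sc).
  exact: le_trans (ltW ct) tl.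
move=> s t us sl ut tl; have [st|] := ltP s t; first exact: W.
rewrite le_eqVlt => /orP[/eqP->|ts]; first by rewrite !subrr normr0 mulr0.
by rewrite distrC [ `|t - s|]distrC; exact: W.
Qed.

End Graph.

(** At a boundary point the axis is the vertical direction [(- b, a)] of the rotated coordinates
    [s], [q], and the opening is dictated by the Lipschitz constant of the graph near [s x0]. *)
Lemma cone_closure O : open O -> C2_boundary O -> forall x0, closure O x0 -> cone_at O x0.
Proof.
move=> oO bO x0 cx0.
have [Ox0|nOx0] := pselect (O x0).
  have /nbhs_ballP[e /= e0 H] : nbhs x0 O by exact: open_nbhs_nbhs.
  exists 0, 1, (e / 2); split => //; first by rewrite divr_gt0.
  move=> y _ yx t w t0 te; rewrite scaler0 subr0 mul1r => wt.
  apply: H; rewrite -ball_normE /= opprD addrA distrC opprB.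
  have := ler_normD w (y - x0).
  by move: (`|w| : R) (`|y - x0| : R) (`|w + _| : R) wt yx => p q s; lra.
have : (closure O `\` interior O) x0 by split => //= /interior_subset.
move=> /bO [a [b [r [g [ab r0 hg Hg]]]]].
have n1 (c : R) : c ^+ 2 <= 1 -> `|c| <= 1.
  by rewrite -(real_normK (num_real c)) -[leRHS](expr1n _ 2) ler_sqr// nnegrE.
have a1 : `|a| <= 1 by apply: n1; rewrite -ab lerDl sqr_ge0.
have b1 : `|b| <= 1 by apply: n1; rewrite -ab lerDr sqr_ge0.
pose s (x : R * R) := a * x.1 + b * x.2.
pose q (x : R * R) := - b * x.1 + a * x.2.
have sD x y : s (x + y) = s x + s y by rewrite /s /=; ring.
have qD x y : q (x + y) = q x + q y by rewrite /q /=; ring.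
have sle x : `|s x| <= 2 * `|x|.
  apply: le_trans (ler_normD _ _) _; rewrite mulr_natl mulr2n !normrM; apply: lerD.
    by rewrite -[leRHS]mul1r ler_pM// norm_fst.
  by rewrite -[leRHS]mul1r ler_pM// norm_snd.
have qle x : `|q x| <= 2 * `|x|.
  apply: le_trans (ler_normD _ _) _; rewrite mulr_natl mulr2n !normrM normrN; apply: lerD.
    by rewrite -[leRHS]mul1r ler_pM// norm_fst.
  by rewrite -[leRHS]mul1r ler_pM// norm_snd.
have [L [L0 HL]] := graph_lipschitz hg (s x0 - 2 * r) (s x0 + 2 * r).
(* In the maximum norm [s] and [q] at most double lengths: a deviation [d t] raises the graph by at
   most [2 L d t] and lowers the point by at most [2 d t], which add up to exactly [t]. *)
pose d := (2 * (L + 1))^-1.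
have L1 : 0 < 2 * (L + 1) by lra.
have d0 : 0 < d by rewrite invr_gt0.
have dL : 2 * d * (L + 1) = 1 by rewrite /d; field; lra.
have d1 : d <= 1.
  have := mulr_ge0 (ltW d0) L0; lra.
pose n : R * R := (- b, a).
have nn1 : `|n| <= 1 by rewrite prod_normE ge_max /= normrN b1 a1.
have sn t : s (t *: n) = 0 by rewrite /s /= /GRing.scale/=; ring.
have qn t : q (t *: n) = t.
  by rewrite /q /= /GRing.scale/= -[RHS]mulr1 -ab; ring.
(* [|w| <= 2 t <= r / 2], so [y + w] stays in the ball where the graph describes [O]. *)
exists n, d, (r / 4); split => //; first by rewrite divr_gt0.
move=> y Oy yx t w t0 tr wt.
pose e := w - t *: n; have we : w = t *: n + e by rewrite /e addrC subrK.
have en : `|e| <= d * t by [].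
clearbody e.
have wn : `|w| <= 2 * t.
  rewrite we; apply: le_trans (ler_normD _ _) _; rewrite normrZ (gtr0_norm t0) mulr_natl mulr2n.
  apply: lerD; first by rewrite ler_piMr// ltW.
  by apply: le_trans en _; rewrite ler_piMl// ltW.
have yb : ball x0 r y.
  by rewrite -ball_normE /= distrC; move: (`|y - x0| : R) yx => z; lra.
have ywx : `|y + w - x0| < r.
  rewrite addrAC; apply: le_lt_trans (ler_normD _ _) _.
  by move: (`|y - x0| : R) (`|w| : R) yx wn => z z'; lra.
have ywb : ball x0 r (y + w) by rewrite -ball_normE /= distrC.
apply/(Hg _ ywb).2; rewrite -/(s _) -/(q _) we !(sD, qD) sn qn add0r.
have := (Hg _ yb).1 Oy; rewrite -/(s _) -/(q _) => gy.
have sx z : `|z - x0| < r -> s x0 - 2 * r <= s z /\ s z <= s x0 + 2 * r.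
  move=> zr; have := sle (z - x0); rewrite sD (_ : s (- x0) = - s x0); last by rewrite /s /=; ring.
  rewrite ler_norml => /andP[h1 h2]; split; move: (`|z - x0| : R) zr h1 h2 => k; lra.
have [s1 s2] : s x0 - 2 * r <= s y /\ s y <= s x0 + 2 * r.
  by apply: sx; move: (`|y - x0| : R) yx => k; lra.
have := sx _ ywx; rewrite we !sD sn add0r => -[s3 s4].
have := HL _ _ s1 s2 s3 s4; rewrite [s y + s e - s y]addrAC subrr add0r => lip.
have := sle e; have := qle e => qe se.
have := le_trans (ler_norm _) lip => {lip} lip.
have le2 : L * `|s e| <= L * (2 * (d * t)).
  by apply: ler_wpM2l => //; apply: le_trans se _; rewrite ler_pM2l.
have qe2 : - (2 * (d * t)) <= q e.
  move: qe; rewrite ler_norml => /andP[h _]; apply: le_trans h.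
  by rewrite lerN2 ler_pM2l.
have tt : L * (2 * (d * t)) + 2 * (d * t) = t.
  transitivity (2 * d * (L + 1) * t); first by ring.
  by rewrite dL mul1r.
lra.
Qed.

(** The filter of finite sequences of points of [K], directed by inclusion, turns the near-covering
    form of compactness into the choice of finitely many centers. *)
Lemma finite_balls K (r : R * R -> R) : compact K -> (forall x, K x -> 0 < r x) ->
  exists s : seq (R * R), (forall x, x \in s -> K x) /\
    forall y, K y -> exists2 x, x \in s & `|y - x| < r x.
Proof.
move=> /compact_near_coveringP nc r0.
pose F : set_system (seq (R * R)) := [set A : set (seq (R * R)) | exists s0 : seq (R * R),
  (forall x, x \in s0 -> K x) /\ forall s : seq (R * R), {subset s0 <= s} -> A s].
have FF : Filter F.
  split.
  - by exists [::].
  - move=> A B [s [h1 h2]] [t [h3 h4]]; exists (s ++ t); split.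
      by move=> x; rewrite mem_cat => /orP[/h1|/h3].
    by move=> u su; split; [apply: h2|apply: h4] => x xs; apply: su; rewrite mem_cat xs ?orbT.
  - by move=> A B AB [s [h1 h2]]; exists s; split => // t /h2 /AB.
have [x cx|s [h1 h2]] := nc _ F (fun s y => exists2 x, x \in s & `|y - x| < r x) FF.
  exists (ball x (r x), [set s : seq (R * R) | x \in s]) => /=.
    split; first exact: nbhsx_ballx (r0 _ cx).
    by exists [:: x]; split => [y|s]; [rewrite inE => /eqP ->|apply; rewrite inE].
  move=> [y s] /= [xy xs]; exists x => //; rewrite distrC.
  by move: xy; rewrite -ball_normE.
by exists s; split => // y cy; exact: (h2 s).
Qed.

Section Chain.
Variable O : set (R * R).
Hypotheses (oO : open O) (neO : O !=set0) (conO : connected O) (cO : compact (closure O)).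
Hypothesis coneO : forall x0, closure O x0 -> cone_at O x0.

Definition dv f := exists B, dvg O f B.

Lemma dvB f h : dv f -> dv h -> dv (fun x => f x - h x).
Proof. by move=> [B hB] [B' hB']; exists (2 * B + 2 * B'); exact: dvgB. Qed.

Lemma dv_ext f h : f =1 h -> dv f -> dv h.
Proof. by move=> e [B hB]; exists B; exact: dvg_ext e (lexx B) hB. Qed.

Lemma interior_bump y (s : R) : O y -> 0 < s -> exists rho : R * R -> R,
  [/\ test_fun O rho, I2 rho = 1 & forall x, rho x != 0 -> `|x - y| < s].
Proof.
move=> Oy s0; have /nbhs_ballP[e /= e0 H] : nbhs y O by exact: open_nbhs_nbhs.
pose t := Num.min s e / 2.
have t0 : 0 < t by rewrite divr_gt0// lt_min s0.
have ts : t < s by rewrite /t; have := ge_min s s e; rewrite lexx /= => h; lra.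
have te : t < e by rewrite /t; have := ge_min e s e; rewrite lexx orbT /= => h; lra.
have [rho [tr I1 sr]] := unit_bump y t0.
exists rho; split => //; last by move=> x /sr xt; exact: lt_trans ts.
apply: (test_funP tr (@compact_ball _ y t)) => [x /= xt|x /sr /ltW//].
by apply: H; rewrite -ball_normE /= distrC (le_lt_trans xt).
Qed.

(** Test functions near [x0] are divergences modulo multiples of [theta]. No uniform bound is
    recorded: a step of the chain concerns the single function [rho - theta]. *)
Let glocal x0 (r : R) theta := 0 < r /\ forall phi, test_fun O phi ->
  (forall x, phi x != 0 -> `|x - x0| < r) -> dv (fun x => phi x - I2 phi * theta x).

Lemma local_dv x0 : closure O x0 -> exists (r : R) rho, test_fun O rho /\ glocal x0 r rho.
Proof.
move=> cx; have [r [rho [C [r0 C0 trho H]]]] := local_div (coneO cx) cx.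
exists r, rho; split => //; split => // phi tp sp; have [v [tv ev bv]] := H _ tp sp.
exists (C * I2 (fun x => phi x ^+ 2)), v; split => // x.
by rewrite ev addrK.
Qed.

(** The set [G] of the points near which the fixed [theta] serves is open. If [G] meets a
    neighbourhood where some [rho] serves, a bump of mass 1 in the overlap is equivalent to both
    functions, so [rho - theta] is a divergence and [theta] serves there too. Thus [G] is relatively
    closed, hence all of [O]; boundary points are reached from interior points near them. *)
Lemma chain : exists theta, test_fun O theta /\
  forall x0, closure O x0 -> exists r C, [/\ 0 < r, 0 <= C & forall phi, test_fun O phi ->
    (forall x, phi x != 0 -> `|x - x0| < r) ->
    dvg O (fun x => phi x - I2 phi * theta x) (C * I2 (fun x => phi x ^+ 2))].
Proof.
have [z Oz] := neO.
have [rz [theta [ttheta gz]]] := local_dv (subset_closure Oz).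
exists theta; split => //.
pose G := [set y | O y /\ exists r, glocal y r theta].
have key x0 (r : R) rho : glocal x0 r rho -> forall y, G y -> `|y - x0| < r ->
    dv (fun x => rho x - theta x).
  move=> [r0 g0] y [Oy [ry [ry0 gy]]] yr.
  have s0 : 0 < Num.min ry (r - `|y - x0|) by rewrite lt_min ry0 subr_gt0.
  have [b [tb b1 sb]] := interior_bump Oy s0.
  have h1 := gy b tb; have h2 := g0 b tb.
  have {}h1 : dv (fun x => b x - I2 b * theta x).
    by apply: h1 => x /sb; rewrite lt_min => /andP[].
  have {}h2 : dv (fun x => b x - I2 b * rho x).
    apply: h2 => x /sb; rewrite lt_min => /andP[_ h]; rewrite -(subrK y x) -addrA.
    by apply: le_lt_trans (ler_normD _ _) _; move: (`|x - y| : R) (`|y - x0| : R) h => u w; lra.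
  by apply: dv_ext (dvB h1 h2) => x; rewrite b1 !mul1r; ring.
have loc x0 (r : R) rho : glocal x0 r rho -> forall y, G y -> `|y - x0| < r -> glocal x0 r theta.
  move=> gl y Gy yr; split; first by case: gl.
  move=> phi tp sp.
  have [B1 h1] := key _ _ _ gl _ Gy yr.
  have [B2 h2] := gl.2 _ tp sp.
  exists (2 * B2 + 2 * (I2 phi ^+ 2 * B1)).
  by apply: dvg_ext (dvgD h2 (dvgZ (I2 phi) h1)) => // x; ring.
have GO : G = O.
  apply: conO.
  - by exists z; split => //; exists rz.
  - exists [set y | exists r, glocal y r theta] => //.
    rewrite openE => y [r [r0 gr]]; apply/nbhs_ballP; exists (r / 2) => /=; first exact: divr_gt0.
    move=> y'; rewrite -ball_normE /= => yy'; exists (r / 2); split; first exact: divr_gt0.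
    move=> phi tp sp; apply: gr => // x /sp xy; rewrite -(subrK y' x) -addrA.
    apply: le_lt_trans (ler_normD _ _) _; rewrite [ `|y' - y|]distrC.
    by move: (`|x - y'| : R) (`|y - y'| : R) xy yy' => u w; lra.
  - exists (~` interior (O `\` G)); first by apply: open_closedC; exact: open_interior.
    apply/seteqP; split => [y Gy|y [Oy nI]].
      by split; [case: Gy|move=> /interior_subset [_ nG]].
    apply: contrapT => nG; apply: nI; apply/nbhs_ballP.
    have /nbhs_ballP[e /= e0 H] : nbhs y O by exact: open_nbhs_nbhs.
    have [r [rho [trho gl]]] := local_dv (subset_closure Oy).
    exists (Num.min e r) => /=; first by rewrite lt_min e0; case: gl.
    move=> y'; rewrite -ball_normE /= lt_min => /andP[ye yr]; split.
      by apply: H; rewrite -ball_normE.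
    move=> Gy'; apply: nG; split => //; exists r; refine (loc _ _ _ gl _ Gy' _).
    by rewrite distrC.
move=> x0 cx0.
have [r [rho [C [r0 C0 trho H]]]] := local_div (coneO cx0) cx0.
have [y [Oy yr]] : O `&` ball x0 r !=set0 by apply: cx0; exact: nbhsx_ballx.
have {}yr : `|y - x0| < r by move: yr; rewrite -ball_normE /= distrC.
have gl : glocal x0 r rho.
  split => // phi tp sp; have [v [tv ev bv]] := H _ tp sp.
  exists (C * I2 (fun x => phi x ^+ 2)), v; split => // x.
  by rewrite ev addrK.
have Gy : G y by rewrite GO.
have [B1 h1] := key _ _ _ gl _ Gy yr.
pose B := I2 (\1_[set x : R * R | `|x| <= `|x0| + r]).
have B0 : 0 <= B by apply: J_ge0 => x; rewrite indicE.
exists r, (2 * C + 2 * (B * `|B1|)); split => //.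
  by apply: addr_ge0; apply: mulr_ge0 => //; [exact: ltW|exact: mulr_ge0].
move=> phi tp sp; have [v [tv ev bv]] := H _ tp sp.
have hc := tf_cc (test_fun_tf tp).
have h2 : dvg O (fun x => phi x - I2 phi * rho x) (C * I2 (fun x => phi x ^+ 2)).
  by exists v; split => // x; rewrite ev addrK.
apply: dvg_ext (dvgD h2 (dvgZ (I2 phi) h1)) => [x|]; first by ring.
rewrite [leRHS]mulrDl -[2 * C * _]mulrA -[2 * (B * _) * _]mulrA; apply: lerD => //; rewrite ler_pM2l//.
have m := l1_le_l2 hc sp.
have le : I2 phi ^+ 2 <= B * I2 (fun x => phi x ^+ 2).
  apply: le_trans m; rewrite -(real_normK (num_real (I2 phi))) ler_sqr ?nnegrE//; last by apply: J_ge0.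
  exact: J_norm (cc_ig hc).
apply: le_trans (_ : I2 phi ^+ 2 * `|B1| <= _); first by rewrite ler_wpM2l ?sqr_ge0// ler_norm.
by rewrite [leRHS]mulrAC ler_wpM2r.
Qed.

Lemma I2_bM phi (b : R * R -> R) (M : R) : cc phi -> continuous b -> (forall x, `|b x| <= M) ->
  I2 (fun x => (b x * phi x) ^+ 2) <= M ^+ 2 * I2 (fun x => phi x ^+ 2).
Proof.
move=> hc cb bM; rewrite -(I2Z _ (cc_sqr hc)); apply: J_le.
- have := cc_sqr (ccM hc cb).
  by rewrite (_ : (fun x => (phi x * b x) ^+ 2) = fun x => (b x * phi x) ^+ 2) => [/cc_ig//|]; apply/funext => x; rewrite mulrC.
- exact/cc_ig/ccZ/cc_sqr.
- move=> x; rewrite exprMn ler_wpM2r ?sqr_ge0//.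
  by rewrite -(real_normK (num_real (b x))) ler_sqr ?nnegrE// (le_trans (normr_ge0 _) (bM x)).
Qed.

(** Induction on a finite cover: [b phi] is solved near one center, and [(1 - b) phi] is left to the
    others. The bound involves the L^2 norm of [phi], so a cut-off costs a bounded factor and no
    gradient. The multiples of [theta] add up to [I2 phi * theta], which is zero. *)
Lemma div_solve : exists C, 0 <= C /\ forall phi, test_fun O phi -> I2 phi = 0 ->
  dvg O phi (C * I2 (fun x => phi x ^+ 2)).
Proof.
have [theta [ttheta H]] := chain.
have /choice[rC HrC] (x : R * R) : exists rC : R * R, closure O x -> [/\ 0 < rC.1, 0 <= rC.2 & forall phi, test_fun O phi ->
    (forall y, phi y != 0 -> `|y - x| < rC.1) ->
    dvg O (fun y => phi y - I2 phi * theta y) (rC.2 * I2 (fun x => phi x ^+ 2))].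
  have [cx|ncx] := pselect (closure O x); last by exists 0.
  by have [r [C h]] := H x cx; exists (r, C).
(* Half radii, because the plateau function is 1 on the half ball: what [1 - b] leaves lies in the
   other half balls. *)
have [D [DO cov]] := @finite_balls (closure O) (fun x => (rC x).1 / 2) cO
  (fun x cx => let: And3 r0 _ _ := HrC x cx in divr_gt0 r0 (ltr0Sn _ 1)).
have S (s : seq (R * R)) : (forall x, x \in s -> closure O x) -> exists C, 0 <= C /\ forall phi, test_fun O phi ->
    (forall y, phi y != 0 -> exists2 x, x \in s & `|y - x| < (rC x).1 / 2) ->
    dvg O (fun y => phi y - I2 phi * theta y) (C * I2 (fun x => phi x ^+ 2)).
  elim: s => [|x s IH] sO.
    exists 0; split => // phi tp sp.
    have p0 y : phi y = 0 by apply/eqP; apply: contrapT => /negP /sp[].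
    apply: dvg_ext (dvg0 O) => [y|]; last by rewrite mul0r.
    by rewrite p0 (_ : phi = fun=> 0) ?[I2 _]J0 ?mul0r ?subr0//; apply/funext.
  have [C [C0 HC]] : exists C, 0 <= C /\ forall phi, test_fun O phi ->
      (forall y, phi y != 0 -> exists2 x, x \in s & `|y - x| < (rC x).1 / 2) ->
      dvg O (fun y => phi y - I2 phi * theta y) (C * I2 (fun x => phi x ^+ 2)).
    by apply: IH => y ys; apply: sO; rewrite inE ys orbT.
  have cx : closure O x by apply: sO; rewrite inE eqxx.
  have [r0 C10 H1] := HrC x cx.
  have [b [tb b1 sb]] := plateau x r0.
  have [M [M0 bM]] := tf_bounded tb.
  exists (2 * ((rC x).2 * M ^+ 2) + 2 * (C * (1 + M) ^+ 2)); split.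
    by apply: addr_ge0; apply: mulr_ge0 => //; apply: mulr_ge0 => //; exact: sqr_ge0.
  move=> phi tp sp.
  have s1 : smooth (fun y => 1 - b y).
    have := smoothD (smooth_cst 1) (smoothZ (-1) tb.1).
    by rewrite (_ : (fun y : R * R => 1 + _) = fun y => 1 - b y)//; apply/funext => y; rewrite mulN1r.
  have comm (c : R * R -> R) : (fun y => phi y * c y) = (fun y => c y * phi y).
    by apply/funext => y; rewrite mulrC.
  have t1 : test_fun O (fun y => b y * phi y) by rewrite -comm; exact: test_funM tb.1.
  have t2 : test_fun O (fun y => (1 - b y) * phi y) by rewrite -comm; exact: test_funM.
  have h1 := H1 _ t1.
  have {}h1 : dvg O (fun y => b y * phi y - I2 (fun y => b y * phi y) * theta y) ((rC x).2 * I2 (fun y => (b y * phi y) ^+ 2)).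
    by apply: h1 => y; rewrite mulf_eq0 negb_or => /andP[/sb].
  have h2 := HC _ t2.
  have {}h2 : dvg O (fun y => (1 - b y) * phi y - I2 (fun y => (1 - b y) * phi y) * theta y) (C * I2 (fun y => ((1 - b y) * phi y) ^+ 2)).
    apply: h2 => y; rewrite mulf_eq0 negb_or => /andP[b1y /sp[x']].
    rewrite inE => /orP[/eqP -> xr|xs xr]; last by exists x'.
    by move: b1y; rewrite b1 ?subrr ?eqxx// ltW.
  have hc := tf_cc (test_fun_tf tp).
  apply: dvg_ext (dvgD h1 h2) => [y|].
    have E : I2 phi = I2 (fun y => b y * phi y) + I2 (fun y => (1 - b y) * phi y).
      rewrite -(I2D (tf_cc (test_fun_tf t1)) (tf_cc (test_fun_tf t2))); apply: eq_J => z; ring.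
    by rewrite E; ring.
  rewrite [leRHS]mulrDl -[2 * ((rC x).2 * _) * _]mulrA -[2 * (C * _) * _]mulrA -[(rC x).2 * _ * _]mulrA -[C * _ * _]mulrA.
  apply: lerD; rewrite ler_pM2l// ler_wpM2l//.
    by apply: I2_bM => //; exact: smooth_continuous tb.1.
  apply: I2_bM => //; first exact: smooth_continuous.
  move=> y; apply: le_trans (ler_normB _ _) _; rewrite normr1 lerD2l; exact: bM.
have [C [C0 HC]] := S D DO.
exists C; split => // phi tp p0.
apply: dvg_ext (HC phi tp _) => // [y|y y0]; first by rewrite p0 mul0r subr0.
apply: cov; apply: subset_closure; apply: contrapT => nO.
by rewrite (test_fun0 tp nO) eqxx in y0.
Qed.

End Chain.

End GlobalDivergence.

(** * Sobolev inequalities *)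

Section SobolevInequalities.
Variable R : realType.
Local Notation R2 := (measurableTypeR R * measurableTypeR R)%type.
Local Notation R1 := (measurableTypeR R).
Local Notation leb := (@lebesgue_measure R).
Implicit Types (phi psi : R * R -> R) (i j : 'I_2).

Definition sqn phi : R := I2 (fun x => phi x ^+ 2).
Definition grn phi : R := \sum_i sqn (partial i phi).

Lemma sum_I2 (F : 'I_2 -> R) : \sum_i F i = F 0 + F 1.
Proof.
rewrite big_ord_recl (big_ord_recl 0) big_ord0 addr0.
by congr (_ + F _); exact/val_inj.
Qed.

Lemma norm_unit1 i : `|unit_vec R i| = 1.
Proof.
by rewrite prod_normE /unit_vec /=; have [->|->] := I2_case i;
  rewrite /= normr0 normr1; [apply: max_l|apply: max_r].
Qed.

Lemma line_far i (x : R * R) (r : R) : `|r| <= `|x| + `|x + r *: unit_vec R i|.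
Proof.
have := ler_normB (x + r *: unit_vec R i) x.
by rewrite addrC addKr normrZ norm_unit1 mulr1 addrC.
Qed.

Lemma line_pair0 (a b t : R) : (a, b) + t *: unit_vec R 0 = (a + t, b).
Proof.
rewrite /unit_vec /= /GRing.scale/= /GRing.add/= /scale_pair /add_pair/= /GRing.scale/=.
by rewrite mulr1 mulr0 addr0.
Qed.

Lemma line_pair1 (a b t : R) : (a, b) + t *: unit_vec R 1 = (a, b + t).
Proof.
rewrite /unit_vec /= /GRing.scale/= /GRing.add/= /scale_pair /add_pair/= /GRing.scale/=.
by rewrite mulr1 mulr0 addr0.
Qed.

Lemma cc_line f i (x : R * R) : cc f -> cc1 (fun s : R => f (x + s *: unit_vec R i)).
Proof.
move=> [c [M [M0 HM]]]; split.
  move=> r; apply: (@continuous_comp _ _ _ (fun r : R => x + r *: unit_vec R i) f); last exact: c.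
  by apply: cvgD; [exact: cvg_cst|exact: scalel_continuous].
exists (`|x| + M); split; first by apply: ltr_wpDl.
move=> r rN; apply: HM; have := line_far i x r.
by move: (`|x| : R) (`|x + _| : R) (`|r| : R) rN => u v w; lra.
Qed.

Lemma sqn_ge0 phi : 0 <= sqn phi.
Proof. by apply: J_ge0 => x; exact: sqr_ge0. Qed.

Lemma grn_ge0 phi : 0 <= grn phi.
Proof. by apply: sumr_ge0 => i _; exact: sqn_ge0. Qed.

(** Nonnegativity, which [unit_bump] does not provide, makes the L^1 norm equal to the mass and
    bounds the first absolute moment by the extent of the support. *)
Lemma mass_bump (x0 : R * R) (r : R) : 0 < r -> exists rho : R * R -> R,
  [/\ tf rho, forall x, 0 <= rho x, I2 rho = 1 & forall x, rho x != 0 -> `|x - x0| < r].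
Proof.
move=> r0; pose a i (s : R) := (J leb (pr (coord i x0) r 0 0))^-1 * pr (coord i x0) r 0 0 s.
have J0 i : 0 < J leb (pr (coord i x0) r 0 0) by exact: J_pr_gt0.
have ha i : cc1 (a i) by apply: cc1Z; exact: pr_cc.
have S (x : R * R) : tens a x != 0 -> `|x - x0| < r.
  rewrite /tens mulf_eq0 negb_or => /andP[h0 h1].
  rewrite prod_normE gt_max; apply/andP; split.
    by rewrite ltNge; apply: contra_neqN h0 => h; rewrite /a pr_out ?mulr0.
  by rewrite ltNge; apply: contra_neqN h1 => h; rewrite /a pr_out ?mulr0.
exists (tens a); split => //.
- split.
    exact: (smoothM (smoothZ _ (pr_smooth _ _ 0 0 0)) (smoothZ _ (pr_smooth _ _ 0 0 1))).
  exists (`|x0| + r); split; first by apply: ltr_wpDl.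
  move=> x; apply: contra_ltP => /eqP/S xr.
  have := ler_normD (x - x0) x0; rewrite subrK.
  by move: (`|x| : R) (`|x - x0| : R) (`|x0| : R) xr => u v w; lra.
- move=> x; have a0 i t : 0 <= a i t by rewrite /a mulr_ge0 ?invr_ge0 ?(ltW (J0 _))// pr_ge0.
  exact: mulr_ge0.
- rewrite /I2 (J_tens ha) /a !(JZ _ (cc1_ig (@pr_cc _ _ _ _ 0 0)))//.
  by rewrite (mulVf (lt0r_neq0 (J0 0))) (mulVf (lt0r_neq0 (J0 1))) mulr1.
Qed.

(** The homotopy formula writes the error as a divergence, and the derivative of [hfield phi i] is
    the same operator applied to a derivative of [phi]. Its norm is at most the first absolute
    moment of [rho], hence at most [d]. *)
Lemma smoothing_error (rho : R * R -> R) (d : R) phi : tf rho -> (forall x, 0 <= rho x) -> I2 rho = 1 ->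
  (forall x, rho x != 0 -> `|x| <= d) -> tf phi ->
  sqn (fun x => phi x - Avg (lebs R) rho (fun w : R2 => (w : R * R)) phi x) <= 2 * d ^+ 2 * grn phi.
Proof.
move=> tr r0 r1 rd hp.
have ir := cc_ig (tf_cc tr).
have mid : measurable_fun setT (fun w : R2 => (w : R * R) : R2) by exact: measurable_id.
have E x : phi x - Avg (lebs R) rho (fun w : R2 => (w : R * R)) phi x =
    hfield (lebs R) rho (fun w : R2 => (w : R * R)) (partial 0 phi) 0 x +
    hfield (lebs R) rho (fun w : R2 => (w : R * R)) (partial 1 phi) 1 x.
  have := hfield_div ir mid rd x hp.
  rewrite -/(I2 rho) r1 mul1r => <-.
  rewrite sum_I2 !(partial_hfield ir mid rd)//.
rewrite /sqn (_ : (fun x => _) = fun x => (hfield (lebs R) rho (fun w : R2 => (w : R * R)) (partial 0 phi) 0 x +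
    hfield (lebs R) rho (fun w : R2 => (w : R * R)) (partial 1 phi) 1 x) ^+ 2); last first.
  by apply/funext => x; rewrite E.
have t i : tf (hfield (lebs R) rho (fun w : R2 => (w : R * R)) (partial i phi) i).
  by apply: (hfield_tf ir mid rd); exact: tf_partial.
apply: le_trans (I2_sqrD (tf_cc (t 0)) (tf_cc (t 1))) _.
have b i : I2 (fun x => hfield (lebs R) rho (fun w : R2 => (w : R * R)) (partial i phi) i x ^+ 2) <=
    d ^+ 2 * sqn (partial i phi).
  apply: le_trans (hfield_L2 ir mid rd i (tf_partial i hp)) _.
  rewrite ler_wpM2r ?sqn_ge0//.
  have le : J (lebs R) (fun t : R2 => `|rho t * coord i (t : R * R)|) <= d.
    rewrite -[leRHS]mulr1 -r1 -(JZ _ ir); apply: J_le; [exact/ig_norm/(ig_gh ir mid rd)|exact: igZ|].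
    move=> w; rewrite normrM (ger0_norm (r0 _)); have [->|w0] := eqVneq (rho w) 0; first by rewrite mul0r mulr0.
    by rewrite mulrC ler_wpM2r// (le_trans (abs_coord _ _))// rd.
  rewrite ler_sqr ?nnegrE//; last by apply: le_trans le; apply: J_ge0.
  by apply: J_ge0.
rewrite /grn sum_I2.
rewrite -mulrA -mulrDr ler_pM2l// mulrDr; apply: lerD; exact: b.
Qed.

(** Mollification by a bump carried beyond distance [2 M]: the average of [phi] vanishes on the
    support of [phi], so the norm of [phi] is at most that of the smoothing error. *)
Lemma poincare (M : R) : 0 < M -> exists C, 0 <= C /\ forall phi, tf phi ->
  (forall x, M < `|x| -> phi x = 0) -> sqn phi <= C * grn phi.
Proof.
move=> M0.
have [rho [tr r0 r1 rs]] := mass_bump (2 * M + 1, 0) ltr01.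
have rd x : rho x != 0 -> `|x| <= 2 * M + 2.
  move=> /rs h; have := ler_normD (x - (2 * M + 1, 0)) (2 * M + 1, 0); rewrite subrK.
  rewrite [X in _ + X](_ : _ = 2 * M + 1); last first.
    rewrite prod_normE /= normr0 ger0_norm; last by lra.
    by apply: max_l; lra.
  by move: (`|x| : R) (`|x - _| : R) h => u v; lra.
exists (8 * (2 * M + 2) ^+ 2); split; first by rewrite mulr_ge0 ?sqr_ge0.
move=> phi hp sp.
have ir := cc_ig (tf_cc tr).
have mid : measurable_fun setT (fun w : R2 => (w : R * R) : R2) by exact: measurable_id.
pose A := Avg (lebs R) rho (fun w : R2 => (w : R * R)) phi.
have tA : tf A := avg_tf ir mid rd hp.
have z x : phi x * A x = 0.
  have [->|p0] := eqVneq (phi x) 0; first by rewrite mul0r.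
  have xM : `|x| <= M by rewrite leNgt; apply: contra_neqN p0 => /sp.
  rewrite /A /Avg [J _ _](_ : _ = 0) ?mulr0// -[RHS](J0 (lebs R)); apply: eq_J => w.
  have [->|w0] := eqVneq (rho w) 0; first by rewrite mul0r.
  rewrite sp ?mulr0//.
  have := rs _ w0; have := norm_fst ((w : R * R) - (2 * M + 1, 0)); have := norm_fst (x - (w : R * R)).
  have := norm_fst x => /= h1 h2 h3 h4.
  apply: lt_le_trans h2; move: (le_lt_trans h3 h4); rewrite ltr_norml => /andP[h5 h6].
  have := le_trans h1 xM; rewrite ler_norml => /andP[h7 h8].
  by rewrite ltr_normr; apply/orP; right; lra.
have e := smoothing_error tr r0 r1 rd hp.
have sq : sqn phi <= sqn (fun x => phi x - A x).
  apply: J_le; [exact/cc_ig/cc_sqr/tf_cc|exact/cc_ig/cc_sqr/ccB/tf_cc/tA/tf_cc|].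
  move=> x; rewrite sqrrB z mul0rn subr0 lerDl; exact: sqr_ge0.
apply: le_trans sq _; apply: le_trans e _.
by rewrite ler_wpM2r ?grn_ge0// ler_wpM2r ?sqr_ge0// ler_nat.
Qed.

(* Compactness in quantitative form: no completion being available, finitely many
   functionals with continuous representers play the part of weak convergence. *)
Lemma rellich (M e : R) : 0 < M -> 0 < e -> exists (K : R) (s : seq (R * R -> R)),
  [/\ 0 <= K, forall k, (k < size s)%N -> cc (nth (fun=> 0) s k) & forall phi, tf phi -> (forall x, M < `|x| -> phi x = 0) ->
    sqn phi <= e * grn phi + K * \sum_(k < size s) I2 (fun x => phi x * nth (fun=> 0) s k x) ^+ 2].
Proof.
move=> M0 e0.
have [P [P0 HP]] := poincare M0.
(* Mollification radius: twice the smoothing error is at most [4 d ^ 2 * grn phi], hence at most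
   [e / 2 * grn phi]. *)
pose d := Num.min 1 (e / 8).
have d0 : 0 < d by rewrite lt_min ltr01 divr_gt0.
have d1 : d <= 1 by rewrite /d ge_min lexx.
have de : d <= e / 8 by rewrite /d ge_min lexx orbT.
have [rho [tr r0 r1 rs]] := mass_bump 0 d0.
have rd x : rho x != 0 -> `|x| <= d by move=> /rs; rewrite subr0 => /ltW.
have ir := cc_ig (tf_cc tr).
have mid : measurable_fun setT (fun w : R2 => (w : R * R) : R2) by exact: measurable_id.
have [L [L0 HL]] := tf_lipschitz tr.
pose bx (u : R) : R * R -> R := \1_[set x : R * R | `|x| <= u].
have ib u : ig (lebs R) (bx u) := ig_box u.
pose B1 := I2 (bx (M + 1)); pose B2 := I2 (bx (`|0 : R * R| + (M + 1))).
have B10 : 0 <= B1 by apply: J_ge0 => x; rewrite /bx indicE.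
have B20 : 0 <= B2 by apply: J_ge0 => x; rewrite /bx indicE.
pose Q := 4 * (B1 * (L ^+ 2 * (B2 * P))).
have Q0 : 0 <= Q by rewrite /Q mulr_ge0// mulr_ge0// mulr_ge0 ?sqr_ge0// mulr_ge0.
(* Mesh of the net on which the mollified function is sampled. [Q] collects its Lipschitz constant,
   the areas and the Poincare constant; the sampling error is at most [Q * eta ^ 2 * grn phi]. *)
pose eta := Num.min 1 (e / 2 / (Q + 1)).
have Q1 : 0 < Q + 1 by lra.
have eta0 : 0 < eta by rewrite lt_min ltr01 divr_gt0// divr_gt0.
have eta1 : eta <= 1 by rewrite /eta ge_min lexx.
have etaQ : Q * eta ^+ 2 <= e / 2.
  apply: le_trans (_ : (Q + 1) * eta <= _).
    by rewrite expr2 mulrA; apply: ler_pM => //; [exact/mulr_ge0/ltW|exact: ltW|apply: le_trans (_ : Q * 1 <= _); [exact: ler_wpM2l|lra]].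
  by rewrite mulrC -ler_pdivlMr// /eta ge_min lexx orbT.
have [s [sB sC]] := @finite_balls R [set x : R * R | `|x| <= M + 1] (fun=> eta) (@compact_box R _) (fun _ _ => eta0).
(* The mollified function at [x] is the pairing of [phi] with [chi x]: its samples on the net are
   the functionals sought. *)
pose chi (x : R * R) : R * R -> R := fun y => rho (x - y).
pose A phi := Avg (lebs R) rho (fun w : R2 => (w : R * R)) phi.
have cchi x : continuous (chi x).
  have trc : continuous rho := smooth_continuous tr.1.
  move=> y; apply: (@continuous_comp _ _ _ (fun y : R * R => x - y) rho); last exact: trc.
  by apply: cvgB; [exact: cvg_cst|exact: cvg_id].
have bchi x : cc (chi x).
  split => //; exists (`|x| + d); split; first by apply: ltr_wpDl.
  move=> y; apply: contra_ltP => /eqP/rd xr; have := ler_normB x (x - y); rewrite subKr.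
  by move: (`|x| : R) (`|x - y| : R) (`|y| : R) xr => u v w; lra.
have AE phi x : cc phi -> A phi x = I2 (fun y => phi y * chi x y).
  move=> hc; have h := ccM hc (cchi x).
  rewrite -(I2_refl x h); apply: eq_J => w; by rewrite /chi subKr mulrC.
exists (4 * B1), [seq chi x | x <- s]; split => //; first exact: mulr_ge0.
  by move=> k; rewrite size_map => ks; rewrite (nth_map 0).
move=> phi hp sp.
have hc := tf_cc hp.
pose S := \sum_(k < size [seq chi x | x <- s]) I2 (fun x => phi x * nth (fun=> 0) [seq chi x | x <- s] k x) ^+ 2.
have S0 : 0 <= S by apply: sumr_ge0 => k _; exact: sqr_ge0.
have AS x : x \in s -> A phi x ^+ 2 <= S.
  move=> /(nthP 0) [k ks <-]; have ks' : (k < size [seq chi x | x <- s])%N by rewrite size_map.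
  rewrite /S (bigD1 (Ordinal ks'))//= (nth_map 0)// -AE// lerDl.
  by apply: sumr_ge0 => l _; exact: sqr_ge0.
have nl : J (lebs R) (fun x => `|phi x|) ^+ 2 <= B2 * sqn phi.
  apply: l1_le_l2 => // x; rewrite subr0 => x0; apply: le_lt_trans (_ : M < _); last lra.
  by rewrite leNgt; apply: contra_neqN x0 => /sp.
have tA : tf (A phi) := avg_tf ir mid rd hp.
pose T := 2 * S + 2 * ((L * eta) ^+ 2 * (B2 * sqn phi)).
have T0 : 0 <= T.
  by apply: addr_ge0; apply: mulr_ge0 => //; apply: mulr_ge0; [exact: sqr_ge0|apply: mulr_ge0 => //; exact: sqn_ge0].
have pw x : A phi x ^+ 2 <= T * bx (M + 1) x.
  rewrite /bx indicE; have [/set_mem/= xM|] := boolP (x \in _); last first.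
    rewrite notin_setE /= => /negP; rewrite -ltNge => xM.
    rewrite mulr0 (_ : A phi x = 0) ?expr0n// /A /Avg -[RHS](J0 (lebs R)); apply: eq_J => w.
    have [->|w0] := eqVneq (rho w) 0; first by rewrite mul0r.
    rewrite sp ?mulr0//; have := rd _ w0; have := ler_normD (x - (w : R * R)) (w : R * R); rewrite subrK.
    by move: (`|x| : R) (`|x - _| : R) (`|(w : R * R)| : R) xM => u v z; lra.
  have [y ys xy] := sC x xM.
  have dif : (A phi x - A phi y) ^+ 2 <= (L * eta) ^+ 2 * (B2 * sqn phi).
    have Le0 : 0 <= L * eta by apply: mulr_ge0; exact: ltW.
    apply: le_trans (_ : (L * eta) ^+ 2 * J (lebs R) (fun x => `|phi x|) ^+ 2 <= _); last first.
      by rewrite ler_wpM2l ?sqr_ge0.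
    rewrite -exprMn -(real_normK (num_real (A phi x - A phi y))) ler_sqr ?nnegrE//; last by apply: mulr_ge0 => //; apply: J_ge0.
    rewrite !AE// -I2B; [|exact: ccM|exact: ccM].
    rewrite (_ : (fun x0 => _) = fun z => phi z * (chi x z - chi y z)); last by apply/funext => z; rewrite mulrBr.
    apply: (@J_mulb _ _ _ (lebs R) (L * eta)) (cc_ig hc) => //.
      by apply: measurable_funB; exact: cc_meas.
    move=> z; rewrite /chi; have := HL (y - z) (x - y).
    rewrite (_ : y - z + (x - y) = x - z); last by rewrite addrC addrA subrK.
    by move=> h; apply: le_trans h _; rewrite ler_wpM2l ?(ltW L0)// ltW.
  rewrite mulr1 /T; have h := sqrB_le (A phi y) (A phi y - A phi x); rewrite subKr in h.
  apply: le_trans h _; apply: lerD; rewrite ler_pM2l//; first exact: AS.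
  by rewrite -sqrrN opprB.
have sqA : sqn (A phi) <= T * B1.
  rewrite /sqn /B1 /I2 -(JZ _ (ib _)); apply: J_le; [exact/cc_ig/cc_sqr/tf_cc|exact/igZ/ib|exact: pw].
have err := smoothing_error tr r0 r1 rd hp; rewrite -/(A phi) in err.
have sq2 : sqn phi <= 2 * sqn (fun x => phi x - A phi x) + 2 * sqn (A phi).
  have := I2_sqrD (ccB hc (tf_cc tA)) (tf_cc tA).
  by rewrite (_ : (fun x => (phi x - A phi x + A phi x) ^+ 2) = fun x => phi x ^+ 2)//; apply/funext => x; rewrite subrK.
apply: le_trans sq2 _; rewrite -/S.
have g0 := grn_ge0 phi.
have h1 : 2 * sqn (fun x => phi x - A phi x) <= e / 2 * grn phi.
  apply: le_trans (_ : 2 * (2 * d ^+ 2 * grn phi) <= _); first by rewrite ler_pM2l.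
  rewrite mulrA ler_wpM2r//.
  apply: le_trans (_ : 4 * d <= _); last lra.
  rewrite mulrA (_ : 2 * 2 = 4 :> R); last by ring.
  by rewrite ler_pM2l// expr2 ler_piMl// ltW.
have h2 : 2 * sqn (A phi) <= 4 * B1 * S + e / 2 * grn phi.
  apply: le_trans (_ : 2 * (T * B1) <= _); first by rewrite ler_pM2l.
  have -> : 2 * (T * B1) = 4 * B1 * S + 4 * (B1 * (L ^+ 2 * (B2 * sqn phi))) * eta ^+ 2 by rewrite /T; ring.
  rewrite lerD2l; apply: le_trans (_ : Q * eta ^+ 2 * grn phi <= _); last by rewrite ler_wpM2r.
  have -> : Q * eta ^+ 2 * grn phi = 4 * (B1 * (L ^+ 2 * (B2 * (P * grn phi)))) * eta ^+ 2 by rewrite /Q; ring.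
  rewrite ler_wpM2r ?sqr_ge0// ler_pM2l// ler_wpM2l// ler_wpM2l ?sqr_ge0// ler_wpM2l//.
  by apply: HP.
have -> : e * grn phi = e / 2 * grn phi + e / 2 * grn phi by field.
move: (e / 2 * grn phi) (4 * B1 * S) h1 h2 => u v h1 h2.
by apply: le_trans (lerD h1 h2) _; rewrite (_ : u + (v + u) = u + u + v)//; ring.
Qed.

Lemma line_le phi i x : tf phi -> `|phi x| <= J leb (fun r : R => `|partial i phi (x + r *: unit_vec R i)|).
Proof.
move=> hp; have [_ [M [M0 HM]]] := hp.
pose T := `|x| + M + 1.
have T0 : 0 < T by rewrite /T; move: (`|x| : R) (normr_ge0 x) => u; lra.
pose f := fun r : R => partial i phi (x + r *: unit_vec R i).
pose F := fun r : R => phi (x + r *: unit_vec R i).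
have cl (q : R * R -> R) : continuous q -> continuous (fun r : R => q (x + r *: unit_vec R i)).
  move=> cq r; apply: (@continuous_comp _ _ _ (fun r : R => x + r *: unit_vec R i) q); last exact: cq.
  by apply: cvgD; [exact: cvg_cst|exact: scalel_continuous].
have cf : continuous f := cl _ (smooth_continuous (@smooth_partial _ _ i hp.1)).
have cF : continuous F := cl _ (smooth_continuous hp.1).
have D (r : R) : is_derive r 1 F (f r) by apply: line_is_derive => y; exact: smooth_derivable hp.1.
have := @continuous_FTC2 R f F 0 T T0 (continuous_subspaceT cf).
have h1 : derivable_oo_LRcontinuous F 0 T.
  split; first by move=> r _; apply: ex_derive.
    exact: cvg_at_right_filter (cF 0).
  exact: cvg_at_left_filter (cF T).
have h2 : {in `]0, T[, F^`()%classic =1 f}.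
  by move=> r _; rewrite derive1E; apply: derive_val.
move=> /(_ h1 h2).
have FT : F T = 0.
  apply: HM; have := line_far i x T; rewrite (gtr0_norm T0) {1}/T.
  by move: (`|x| : R) (`|_ + _| : R) => u v; lra.
have F0 : F 0 = phi x by rewrite /F scale0r addr0.
rewrite FT F0 => E.
have i1 : ig leb (fun r : R => f r).
  exact/cc1_ig/cc_line/tf_cc/tf_partial.
have i2 : ig leb (fun r : R => f r * \1_`[0, T]%classic r).
  apply: (ig_mulb (C := 1) _ _ i1); first exact: ig_meas (ig_itv 0 T).
  by move=> r; rewrite indicE; case: (_ \in _); rewrite ?normr1 ?normr0.
have -> : phi x = - J leb (fun r : R => f r * \1_`[0, T]%classic r).
  transitivity (- \int[lebesgue_measure]_(r in `[0, T]) f r); first by rewrite /Rintegral E -EFinB /= sub0r opprK.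
  congr (- _); rewrite Rintegral_mkcond /J; apply: eq_Rintegral => r _.
  by rewrite patchE indicE; case: ifPn => _; rewrite ?mulr1 ?mulr0.
rewrite normrN; apply: J_le_norm i2 (ig_norm i1) _ => r.
by rewrite normrM indicE; case: (_ \in _); rewrite ?normr1 ?normr0 ?mulr1 ?mulr0.
Qed.

Lemma mul_le_half (a b u v : R) : a ^+ 2 <= 4 * u -> b ^+ 2 <= 4 * v -> a * b <= 2 * (u + v).
Proof. by move=> h1 h2; have := sqr_ge0 (a - b); rewrite sqrrB mulr2n; lra. Qed.

(** [phi ^ 2] at [x] is at most [A x.2] and at most [B x.1], the integrals of its derivative along
    the two axis-parallel lines through [x]. So the integral of [phi ^ 4] is at most the product of
    the integrals of [A] and [B], each bounded by Cauchy-Schwarz. *)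
Lemma ladyzhenskaya phi : tf phi -> I2 (fun x => phi x ^+ 4) <= 2 * (sqn phi * grn phi).
Proof.
move=> hp; pose psi x := phi x ^+ 2.
have tp : tf psi.
  by have := tfM hp hp.1; rewrite (_ : (fun x => phi x * phi x) = psi)//; apply/funext => x; rewrite /psi expr2.
have dpsi i x : partial i psi x = 2 * (phi x * partial i phi x).
  rewrite (_ : psi = fun x => phi x * phi x); last by apply/funext => y; rewrite /psi expr2.
  by rewrite partialM; [ring|exact: smooth_derivable hp.1|exact: smooth_derivable hp.1].
pose q i (z : R2) := `|partial i psi z|.
have iq i : ig (prodm leb leb) (q i) := ig_norm (cc_ig (tf_cc (tf_partial i tp))).
pose A (y : R1) := J leb (fun s : R1 => q 0 (s, y)).
pose B (s : R1) := J leb (fun y : R1 => q 1 (s, y)).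
have [iA jA] : ig leb A /\ J leb A = J (prodm leb leb) (q 0) := J_fubini2 (iq 0).
have [iB jB] : ig leb B /\ J leb B = J (prodm leb leb) (q 1) := J_fubini1 (iq 1).
have psi0 x : 0 <= psi x by exact: sqr_ge0.
have cc1q i : cc (q i).
  have [c [M [M0 HM]]] := tf_cc (tf_partial i tp); split.
    by move=> x; apply: (@continuous_comp _ _ _ (partial i psi) (fun z : R => `|z|)); [exact: c|exact: norm_continuous].
  by exists M; split => // x /HM h; rewrite /q h normr0.
have lin i x : cc1 (fun s : R => q i (x + s *: unit_vec R i)) by exact: cc_line.
have psiA (x : R * R) : psi x <= A x.2.
  apply: le_trans (ler_norm _) _; apply: le_trans (line_le 0 x tp) _.
  have [_ <-] := J1_shift (- x.1) (cc1_ig (lin 0 x)).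
  rewrite le_eqVlt; apply/orP; left; apply/eqP; apply: eq_J => s; rewrite /q; congr (`|partial 0 psi _|).
  by case: x {lin} => x1 x2; rewrite line_pair0 /= addrCA subrr addr0.
have psiB (x : R * R) : psi x <= B x.1.
  apply: le_trans (ler_norm _) _; apply: le_trans (line_le 1 x tp) _.
  have [_ <-] := J1_shift (- x.2) (cc1_ig (lin 1 x)).
  rewrite le_eqVlt; apply/orP; left; apply/eqP; apply: eq_J => s; rewrite /q; congr (`|partial 1 psi _|).
  by case: x {lin} => x1 x2; rewrite line_pair1 /= addrCA subrr addr0.
clearbody A B.
have iBA := ig_prod iB iA.
have le1 : I2 (fun x => phi x ^+ 4) <= J leb B * J leb A.
  have -> : J leb B * J leb A = J (prodm leb leb) (fun z => B z.1 * A z.2).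
    rewrite -(J_fubini1 iBA).2 -(JZr _ iB); apply: eq_J => s.
    by rewrite -(JZ _ iA); apply: eq_J.
  apply: J_le => //.
    apply: eq_ig (cc_ig (cc_sqr (tf_cc tp))) => x; by rewrite /psi -exprM.
  move=> x; apply: le_trans (ler_pM (psi0 x) (psi0 x) (psiB x) (psiA x)).
  by rewrite -expr2 /psi -exprM.
apply: le_trans le1 _; rewrite jA jB.
have bq i : J (prodm leb leb) (q i) ^+ 2 <= 4 * (sqn phi * sqn (partial i phi)).
  have h1 := tf_cc hp; have h2 := tf_cc (tf_partial i hp).
  have ab (f : R * R -> R) : (fun x => `|f x| ^+ 2) = fun x => f x ^+ 2.
    by apply/funext => x; rewrite real_normK// num_real.
  have := @J_CS _ _ _ (lebs R) (fun x => `|phi x|) (fun x => `|partial i phi x|)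
    (measurableT_comp (@normr_measurable _ _) (cc_meas h1)) (measurableT_comp (@normr_measurable _ _) (cc_meas h2)).
  rewrite !ab => /(_ (cc_ig (cc_sqr h1)) (cc_ig (cc_sqr h2))) => h.
  have -> : J (prodm leb leb) (q i) = 2 * J (lebs R) (fun x => `|phi x| * `|partial i phi x|).
    rewrite -JZ; last first.
      by apply: eq_ig (ig_norm (cc_ig (ccM h1 h2.1))) => x; rewrite normrM.
    by apply: eq_J => x; rewrite /q dpsi !normrM (gtr0_norm (ltr0Sn _ 1)).
  by rewrite exprMn -natrX ler_pM2l.
have G2 : grn phi = sqn (partial 0 phi) + sqn (partial 1 phi).
  exact: sum_I2.
rewrite G2 mulrDr [X in _ <= 2 * X]addrC; exact: mul_le_half (bq 1) (bq 0).
Qed.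

End SobolevInequalities.

(** * Zeros of coercive maps *)

Section CupProduct.
Variable pt : Type.
Local Notation F := 'F_2.
Implicit Types (f d : pt -> F) (v : nat -> pt) (fs hd tl : seq (pt -> F)).

Lemma F2xx (x : F) : x + x = 0.
Proof. by case: x => -[|[|//]] i; exact/val_inj. Qed.

Definition shv v : nat -> pt := fun j => v j.+1.

(* The Alexander-Whitney cup product, modulo 2, of the coboundaries of the 0-cochains
   [fs], evaluated on the simplex with vertices [v]. *)
Fixpoint cup fs v : F := if fs is f :: fs' then (f (v 0%N) + f (v 1%N)) * cup fs' (shv v) else 1.

(** The product in which [d] itself, and not its coboundary, stands between the factors [hd] and
    [tl]. *)
Fixpoint cupd hd d tl v : F :=
  if hd is f :: hd' then (f (v 0%N) + f (v 1%N)) * cupd hd' d tl (shv v) else d (v 0%N) * cup tl v.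

Definition face (i : nat) v : nat -> pt := fun j => v (bump i j).

Lemma face0 v : face 0 v = shv v.
Proof. by apply/funext => j; rewrite /face /shv /bump leq0n. Qed.

Lemma shv_face i v : shv (face i.+1 v) = face i (shv v).
Proof. by apply/funext => j; rewrite /face /shv /bump ltnS addnS. Qed.

Lemma F2_eq (x y : F) : x + y = 0 -> x = y.
Proof. by move=> h; rewrite -[LHS]addr0 -(F2xx y) addrA h add0r. Qed.

(** Leibniz rule for one more factor: faces 0 and 1 combine because the two occurrences of [f (v 2)]
    cancel modulo 2, and the other faces keep the first edge. *)
Lemma coface_step (G : (nat -> pt) -> F) f m v :
  \sum_(i < m.+2) (f (face i v 0%N) + f (face i v 1%N)) * G (shv (face i v)) =
  (f (v 0%N) + f (v 1%N)) * \sum_(i < m.+1) G (face i (shv v)).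
Proof.
rewrite big_ord_recl big_ord_recl [in RHS]big_ord_recl mulrDr addrA; congr (_ + _).
  rewrite (_ : nat_of_ord (lift ord0 ord0) = 1%N)// !face0 shv_face face0 -mulrDl; congr (_ * _).
  transitivity (f (v 1%N) + f (v 2%N) + (f (v 0%N) + f (v 2%N))) => //.
  have e := F2xx (f (v 2%N)); rewrite [f (v 0%N) + f (v 2%N)]addrC -addrA [f (v 2%N) + (_ + _)]addrA e add0r.
  by rewrite addrC.
by rewrite mulr_sumr; apply: eq_bigr => i _; rewrite -shv_face.
Qed.

Lemma cup_closed fs v : \sum_(i < (size fs).+2) cup fs (face i v) = 0.
Proof.
elim: fs v => [|f fs IH] v; first by rewrite /= !big_ord_recl big_ord0 /= addr0 F2xx.
by rewrite /= coface_step IH mulr0.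
Qed.

Lemma cupd_coboundary hd d tl v :
  \sum_(i < (size hd + size tl).+2) cupd hd d tl (face i v) = cup (hd ++ d :: tl) v.
Proof.
elim: hd v => [|f hd IH] v /=; last by rewrite coface_step IH.
rewrite add0n big_ord_recl /= face0.
have := cup_closed tl v; rewrite big_ord_recl /= face0 => /F2_eq e.
under eq_bigr do rewrite /face /bump /=.
by rewrite -mulr_sumr -e -mulrDl addrC.
Qed.

Lemma cup_add hd f f' tl v : cup (hd ++ (fun p => f p + f' p) :: tl) v =
  cup (hd ++ f :: tl) v + cup (hd ++ f' :: tl) v.
Proof. by elim: hd v => [|g hd IH] v /=; rewrite ?IH -?mulrDr// -mulrDl addrACA. Qed.

Lemma cup_neq0 f0 fs v : cup fs v != 0 ->
  forall l, (l < size fs)%N -> nth f0 fs l (v l) != nth f0 fs l (v l.+1).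
Proof.
elim: fs v => [|f fs IH] v //=; rewrite mulf_eq0 negb_or => /andP[h1 h2] [|l] /= ls.
  by apply: contra h1 => /eqP ->; rewrite F2xx.
exact: IH h2 l ls.
Qed.

Lemma cup_eq1 f0 fs v : (forall l, (l < size fs)%N -> nth f0 fs l (v l) != nth f0 fs l (v l.+1)) ->
  cup fs v = 1.
Proof.
have N (x y : F) : x != y -> x + y = 1.
  by case: x => -[|[|//]] i; case: y => -[|[|//]] j => // _; exact/val_inj.
elim: fs v => [|f fs IH] v //= h; rewrite N ?mul1r; last exact: (h 0%N).
by apply: IH => l ls; exact: (h l.+1).
Qed.

Lemma cup_const f0 fs l v : (l < size fs)%N -> (forall j j', nth f0 fs l (v j) = nth f0 fs l (v j')) ->
  cup fs v = 0.
Proof.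
move=> ls h; apply/eqP; apply: contraT => /(cup_neq0 f0) /(_ l ls).
by rewrite (h l l.+1) eqxx.
Qed.

Lemma cupd_const f0 hd d tl l v : (forall j, d (v j) = 0) \/
  ((l < size (hd ++ tl))%N /\ (forall j j', nth f0 (hd ++ tl) l (v j) = nth f0 (hd ++ tl) l (v j'))) ->
  cupd hd d tl v = 0.
Proof.
elim: hd l v => [|f hd IH] l v /= [h|[ls h]].
- by rewrite h mul0r.
- by rewrite (cup_const ls h) mulr0.
- by rewrite (IH 0%N) ?mulr0//; left => j; exact: h.
- case: l ls h => [|l] ls h; first by have /= -> := h 0%N 1%N; rewrite F2xx mul0r.
  by rewrite (IH l) ?mulr0//; right; split => // j j'; exact: h.
Qed.

Lemma cupd_ext hd d tl v v' : (forall j, (j <= size hd + size tl)%N -> v j = v' j) ->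
  cupd hd d tl v = cupd hd d tl v'.
Proof.
have C fs u u' : (forall j, (j <= size fs)%N -> u j = u' j) -> cup fs u = cup fs u'.
  elim: fs u u' => [|f fs IH] u u' h //=; rewrite !h//; congr (_ * _).
  by apply: IH => j js; exact: h.
elim: hd v v' => [|f hd IH] v v' h /=.
  by rewrite h// (C tl v v').
rewrite !h//.
by congr (_ * _); apply: IH => j js; exact: h.
Qed.

End CupProduct.

(** * The triangulated cube modulo 2 *)

Section Freudenthal.
Variables (n' N' : nat).
Local Notation n := n'.+1.
Local Notation N := N'.+1.
Local Notation pt := ('I_n -> nat).
Local Notation F := 'F_2.
Implicit Types (x : {ffun 'I_n -> 'I_N}) (p : pt) (s : 'S_n).

(* The path from [p] to [p + (1,...,1)] that increments the coordinates in the order [s]: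
   these are the simplices of the Freudenthal triangulation. *)
Definition vtx p s : nat -> pt := fun j a => (p a + (s a < j))%N.
Definition pnt x : pt := fun a => x a.

(** Evaluation on the fundamental chain of a cube cut into [N] cells along each axis. *)
Definition total (fs : seq (pt -> F)) : F := \sum_s \sum_x cup fs (vtx (pnt x) s).

Definition up p (a : 'I_n) : pt := fun b => (p b + (b == a))%N.

(** A transposition exchanges even and odd permutations without changing [G], so the terms are equal
    in pairs and cancel modulo 2. *)
Lemma sum_flip (G : 'S_n -> F) (i j : 'I_n) : i != j -> (forall s, G (s * tperm i j)%g = G s) ->
  \sum_s G s = 0.
Proof.
move=> ij h; rewrite (bigID (@odd_perm _)) /=.
rewrite (reindex_inj (@mulIg _ (tperm i j))) /=.
under eq_bigl do rewrite odd_permM odd_tperm ij addbT.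
under eq_bigr do rewrite h.
exact: F2xx.
Qed.

(** Two paths whose orders differ by exchanging positions [i - 1] and [i] agree except at vertex
    [i]: intermediate faces are shared by two simplices of the same cell. *)
Lemma face_mid (i : nat) p s (i0 : (0 < i)%N) (iN : (i < n)%N) :
  face i (vtx p (s * tperm (inord i.-1) (inord i))%g) = face i (vtx p s).
Proof.
have v1 : (inord i.-1 : 'I_n) = i.-1 :> nat by rewrite inordK//; lia.
have v2 : (inord i : 'I_n) = i :> nat by rewrite inordK.
apply/funext => j; apply/funext => a; rewrite /face /vtx permM; congr (_ + nat_of_bool _)%N.
case: tpermP => [->|->|//]; rewrite ?v1 ?v2 /bump; lia.
Qed.

(** Stokes' formula inside each cell: the intermediate faces cancel in pairs, leaving the first and
    the last. *)
Lemma total_coboundary hd d tl : (size hd + size tl)%N = n' ->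
  \sum_s \sum_x (cupd hd d tl (face 0 (vtx (pnt x) s)) + cupd hd d tl (face n (vtx (pnt x) s)))
    = total (hd ++ d :: tl).
Proof.
move=> hs; rewrite /total.
under [RHS]eq_bigr do under eq_bigr do rewrite -cupd_coboundary hs big_ord_recl big_ord_recr /=.
rewrite [RHS](eq_bigr (fun s => \sum_x (cupd hd d tl (face 0 (vtx (pnt x) s)) + cupd hd d tl (face n (vtx (pnt x) s)))
   + \sum_x \sum_(i < n') cupd hd d tl (face (bump 0 i) (vtx (pnt x) s)))); last first.
  move=> s _; rewrite -big_split; apply: eq_bigr => x _ /=.
  by rewrite -addrA; congr (_ + _); rewrite addrC.
rewrite big_split /= [X in _ + X](_ : _ = 0) ?addr0//.
rewrite exchange_big big1// => x _; rewrite exchange_big big1// => i _.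
have i0 : (0 < bump 0 i)%N by rewrite /bump.
have iN : (bump 0 i < n)%N by rewrite /bump add1n ltnS.
apply: (@sum_flip _ (inord (bump 0 i).-1) (inord (bump 0 i))).
  have ln := ltn_ord i; rewrite -val_eqE /= /bump leq0n add1n /= !inordK; lia.
by move=> s; rewrite face_mid.
Qed.

Lemma ord_pred_inj : injective (@ord_pred n).
Proof. exact: can_inj (@ord_predK n). Qed.

Definition rotp : 'S_n := perm ord_pred_inj.

(** Dropping the first vertex means starting one step further in the direction incremented first,
    with the order rotated. So face 0 of a simplex is the last face of a simplex in the neighbouring
    cell. *)
Lemma vtx_rot p s j : (j < n)%N ->
  vtx p s j.+1 = vtx (up p ((s^-1)%g ord0)) (s * rotp)%g j.
Proof.
move=> jn; apply/funext => a; rewrite /vtx /up -addnA; congr (_ + _)%N.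
have -> : (a == (s^-1)%g ord0) = (s a == ord0) by rewrite -[LHS](inj_eq (@perm_inj _ s)) permKV.
rewrite permM [rotp _]permE.
case: (s a) => t tn; rewrite -val_eqE /=.
case: t tn => [|t] tn; rewrite /= ?add0n.
  by rewrite modn_small//; lia.
by rewrite modnDr modn_small; lia.
Qed.

(** Vertices are frozen from [n'] on: the direction incremented last then never moves, and the two
    descriptions of a shared facet have the same form. *)
Definition truncv (v : nat -> pt) : nat -> pt := fun j => v (minn j n').

Lemma cupd_face hd d tl p : (size hd + size tl)%N = n' -> forall s,
  cupd hd d tl (face n (vtx p s)) = cupd hd d tl (truncv (vtx p s)) /\
  cupd hd d tl (face 0 (vtx p s)) = cupd hd d tl (truncv (vtx (up p ((s^-1)%g ord0)) (s * rotp)%g)).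
Proof.
move=> hs s; split; apply: cupd_ext => j; rewrite hs => jn; rewrite /truncv (minn_idPl jn).
  by rewrite /face /bump ltnNge jn.
by rewrite /face /bump leq0n add1n vtx_rot.
Qed.

Section Vanish.
Variables (hd tl : seq (pt -> F)) (d : pt -> F).
Hypothesis hs : (size hd + size tl)%N = n'.
(** The direction incremented last is constant on the facet, which therefore lies in a face of the
    cube: the assumption concerns the boundary of the cube. *)
Hypothesis hv : forall p s, p ((s^-1)%g ord_max) = 0%N \/ p ((s^-1)%g ord_max) = N ->
  cupd hd d tl (truncv (vtx p s)) = 0.

Let shx (a : 'I_n) x : {ffun 'I_n -> 'I_N} := [ffun b => if b == a then ordS (x b) else x b].

(** Facets orthogonal to [a] are shifted by one cell. The shift is cyclic, so as to permute the
    cells; where it wraps around, both facets lie on the boundary and contribute 0. *)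
Lemma shift_sum s : let a := (s^-1)%g ord_max in
  \sum_x cupd hd d tl (truncv (vtx (up (pnt x) a) s)) = \sum_x cupd hd d tl (truncv (vtx (pnt x) s)).
Proof.
move=> a.
have inj : injective (shx a).
  move=> x y /ffunP e; apply/ffunP => b; have := e b; rewrite !ffunE.
  by case: ifP => _ // /(can_inj (@ordSK N)).
rewrite [RHS](reindex_inj inj); apply: eq_bigr => x _.
have [xa|xa] := ltnP (x a).+1 N.
  congr (cupd _ _ _ (truncv (vtx _ _))); apply/funext => b; rewrite /up /pnt ffunE.
  case: eqP => [->|_]; last by rewrite addn0.
  by rewrite /= modn_small// addn1.
have xN : (x a).+1 = N by apply/eqP; rewrite eqn_leq ltn_ord.
rewrite !hv//.
  by left; rewrite /pnt ffunE eqxx /= xN modnn.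
by right; rewrite /up /pnt eqxx addn1.
Qed.

(** Each interior facet is counted twice, as the first face of one simplex and the last face of
    another; boundary facets contribute 0 by [hv]. *)
Lemma total_vanish : total (hd ++ d :: tl) = 0.
Proof.
rewrite -total_coboundary//.
under eq_bigr do rewrite big_split /=.
rewrite big_split /=.
have e1 : \sum_s \sum_x cupd hd d tl (face 0 (vtx (pnt x) s)) =
    \sum_s \sum_x cupd hd d tl (truncv (vtx (pnt x) s)).
  rewrite [RHS](eq_bigr _ (fun s _ => esym (shift_sum s))).
  rewrite [RHS](reindex_inj (@mulIg _ rotp)) /=; apply: eq_bigr => s _; apply: eq_bigr => x _.
  rewrite (cupd_face d (pnt x) hs s).2; congr (cupd _ _ _ (truncv (vtx (up _ _) _))).
  rewrite invMg permM; congr (_ _).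
  apply: (@perm_inj _ rotp); rewrite permKV permE; apply: val_inj => /=.
  by rewrite modn_small//; lia.
have e2 : \sum_s \sum_x cupd hd d tl (face n (vtx (pnt x) s)) =
    \sum_s \sum_x cupd hd d tl (truncv (vtx (pnt x) s)).
  by apply: eq_bigr => s _; apply: eq_bigr => x _; rewrite (cupd_face d (pnt x) hs s).1.
by rewrite e1 e2 F2xx.
Qed.

End Vanish.

Implicit Types g : 'I_n -> pt -> F.

Definition bdry (f : pt -> F) (k : 'I_n) := forall p, (p k = 0%N -> f p = 0) /\ (p k = N -> f p = 1).

(** The difference [g k + f] vanishes on the two faces orthogonal to [k]; on any other face of the
    cube one of the remaining factors is constant. So [total_vanish] applies to it. *)
Lemma total_replace g k (f : pt -> F) : (forall i, bdry (g i) i) -> bdry f k ->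
  total [seq g i | i <- enum 'I_n] = total [seq (if i == k then f else g i) | i <- enum 'I_n].
Proof.
move=> hg hf.
have un := enum_uniq 'I_n; have sz := size_enum_ord n.
have kin : k \in enum 'I_n by rewrite mem_enum.
have all_in a : a \in enum 'I_n by rewrite mem_enum.
case/splitPr: kin all_in sz un => L1 L2 all_in sz un.
pose F2 i := if i == k then f else g i.
have nk i : i \in L1 ++ L2 -> i != k.
  move=> iL; apply/eqP => ik; move: un; rewrite -cat1s uniq_catCA cat1s cons_uniq -ik iL//.
have m1 : map F2 L1 = map g L1.
  by apply/eq_in_map => i iL; rewrite /F2 (negbTE (nk _ _))// mem_cat iL.
have m2 : map F2 L2 = map g L2.
  by apply/eq_in_map => i iL; rewrite /F2 (negbTE (nk _ _))// mem_cat iL orbT.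
rewrite !map_cat /= -/(F2 _) m1 m2 {1}/F2 eqxx.
apply: F2_eq.
rewrite /total -big_split /=.
under eq_bigr do (rewrite -big_split /=; under eq_bigr do rewrite -cup_add).
apply: (@total_vanish (map g L1) (map g L2) (fun p => g k p + f p)).
  move: sz; rewrite !size_map size_cat /= addnS => -[] //.
move=> p s; set a := (s^-1)%g ord_max => pa.
(* Direction [a] has the last rank in [s], so the first [n] vertices leave it at [p a]. *)
have tv j : truncv (vtx p s) j a = p a.
  rewrite /truncv /vtx /a permKV /= (_ : _ < _ = false)%N ?addn0//.
  by apply/negbTE; rewrite -leqNgt geq_minr.
have [ak|ak] := eqVneq a k.
  apply: (@cupd_const _ (fun=> 0) _ _ _ 0%N); left => j.
  have := tv j; rewrite ak => tvk.
  case: pa; rewrite ak => pk.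
    by rewrite ((hg k _).1 _) ?((hf _).1 _) ?addr0// tvk.
  by rewrite ((hg k _).2 _) ?((hf _).2 _) ?F2xx// tvk.
have aL : a \in L1 ++ L2.
  by have := all_in a; rewrite !mem_cat inE (negbTE ak).
apply: (@cupd_const _ (fun=> 0) _ _ _ (index a (L1 ++ L2))); right.
rewrite -map_cat size_map index_mem; split => // j j'.
rewrite (nth_map a) ?index_mem// nth_index//.
by case: pa => pk; [rewrite !((hg a _).1 _)|rewrite !((hg a _).2 _)]; rewrite ?tv.
Qed.

Definition std (i : 'I_n) (p : pt) : F := (0 < p i)%N%:R.

Lemma std_bdry i : bdry (std i) i.
Proof. by move=> p; split=> h; rewrite /std h. Qed.

(** A single simplex is detected, the one at the origin with the identity order: coordinate [l] has
    to leave 0 exactly at step [l]. *)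
Lemma total_std : total [seq std i | i <- enum 'I_n] = 1.
Proof.
pose x0 : {ffun 'I_n -> 'I_N} := [ffun=> ord0].
have S (l : nat) (ln : (l < n)%N) : nth (fun=> 0) [seq std i | i <- enum 'I_n] l = std (Ordinal ln).
  rewrite (nth_map ord0) ?size_enum_ord//; congr std; apply: val_inj => /=.
  by rewrite nth_enum_ord.
have K s x : cup [seq std i | i <- enum 'I_n] (vtx (pnt x) s) != 0 -> s = 1%g /\ x = x0.
  move=> /(cup_neq0 (fun=> 0)); rewrite size_map size_enum_ord => h.
  have H (l : 'I_n) : x l = 0%N :> nat /\ s l = l :> nat.
    have := h l (ltn_ord l); rewrite S /std /vtx /pnt.
    rewrite (_ : Ordinal _ = l); last exact: val_inj.
    case: (ltnP 0 (x l)) => [xl|]; first by rewrite !addn_gt0 xl eqxx.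
    rewrite leqn0 => /eqP ->; rewrite !add0n => h'; split => //.
    apply/eqP; rewrite eqn_leq; move: h'; rewrite ltnS.
    by case: (ltngtP (s l) l) => //; rewrite eqxx.
  split; first by apply/permP => l; rewrite perm1; apply: val_inj; case: (H l).
  by apply/ffunP => l; rewrite ffunE; apply: val_inj; case: (H l).
rewrite /total (bigD1 1%g)//= [X in _ + X]big1 ?addr0; last first.
  move=> s s1; apply: big1 => x _; apply/eqP; apply: contraNT s1 => /K[-> _]; exact: eqxx.
rewrite (bigD1 x0)//= [X in _ + X]big1 ?addr0; last first.
  by move=> x xx; apply/eqP; apply: contraNT xx => /K[_ ->]; exact: eqxx.
apply: (@cup_eq1 _ (fun=> 0)); rewrite size_map size_enum_ord => l ln.
by rewrite S /std /vtx /pnt !ffunE perm1 /= ltnn ltnSn.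
Qed.

(** The given cochains are exchanged for the standard ones one at a time, [total] being unchanged at
    each exchange. *)
Lemma total_bdry g : (forall i, bdry (g i) i) -> total [seq g i | i <- enum 'I_n] = 1.
Proof.
move=> hg; pose h (m : nat) (i : 'I_n) := if (i < m)%N then std i else g i.
have hb m i : bdry (h m i) i by rewrite /h; case: ifP => _ //; exact: std_bdry.
suff H m : (m <= n)%N -> total [seq g i | i <- enum 'I_n] = total [seq h m i | i <- enum 'I_n].
  rewrite (H n)// -total_std; congr total; apply: eq_map => i.
  by rewrite /h ltn_ord.
elim: m => [_|m IH mn].
  by congr total; apply: eq_map => i; rewrite /h ltn0.
apply: etrans (IH (ltnW mn)) _.
apply: etrans (@total_replace _ (Ordinal mn) (std (Ordinal mn)) (hb m) (std_bdry _)) _.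
congr total; apply: eq_map => i; rewrite /h ltnS [(i <= m)%N]leq_eqVlt -val_eqE /=.
by case: eqP => //= e; congr std; exact: val_inj.
Qed.

(** The total is 1, so the product is nonzero on some simplex, along whose [i]-th edge label [i]
    changes. *)
Lemma discrete_miranda (b : 'I_n -> pt -> bool) :
  (forall i p, (p i = 0%N -> b i p = false) /\ (p i = N -> b i p = true)) ->
  exists p : pt, (forall i, (p i < N)%N) /\ forall i, exists q q' : pt,
    [/\ b i q, ~~ b i q' & forall a, ((p a <= q a <= (p a).+1) && (p a <= q' a <= (p a).+1))%N].
Proof.
move=> hb; pose g i p : F := (b i p)%:R.
have hg i : bdry (g i) i by move=> p; have [h1 h2] := hb i p; split => [/h1|/h2] e; rewrite /g e.
have := total_bdry hg; rewrite /total => T.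
have [s [x sx]] : exists s x, cup [seq g i | i <- enum 'I_n] (vtx (pnt x) s) != 0.
  apply: contrapT => nex; move: T; rewrite big1 => [/eqP|s _]; first by rewrite eq_sym oner_eq0.
  apply: big1 => x _; apply: contrapT => /eqP h; apply: nex; by exists s, x.
exists (pnt x); split; first by move=> i; exact: ltn_ord.
move=> i; have := cup_neq0 (fun=> 0) sx; rewrite size_map size_enum_ord => /(_ i (ltn_ord i)).
rewrite (nth_map ord0) ?size_enum_ord// (_ : nth ord0 (enum 'I_n) i = i); last by apply: val_inj; rewrite /= nth_enum_ord.
have B j a : (pnt x a <= vtx (pnt x) s j a <= (pnt x a).+1)%N.
  by rewrite /vtx leq_addr /= -[(pnt x a).+1]addn1 leq_add2l leq_b1.
rewrite /g; case e1 : (b i _); case e2 : (b i _); rewrite ?eqxx// => _.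
  by exists (vtx (pnt x) s i), (vtx (pnt x) s i.+1); rewrite e1 e2; split => // a; rewrite !B.
by exists (vtx (pnt x) s i.+1), (vtx (pnt x) s i); rewrite e1 e2; split => // a; rewrite !B.
Qed.

End Freudenthal.

(** * Passage from grids to continuous maps *)

Section PoincareMiranda.
Variable R : realType.

(* Each coordinate has a sign change on a small simplex of every grid; a cluster
   point of such simplices satisfies xi_k P_k(xi) <= 0 for all k. *)
Lemma coercive_zero (n : nat) (P : 'rV[R]_n.+1 -> 'I_n.+1 -> R) (M : R) : 0 < M ->
  (forall k, continuous (P^~ k)) ->
  (forall x : 'rV[R]_n.+1, (forall k, `|x ord0 k| <= M) -> (exists k, `|x ord0 k| = M) ->
     0 < \sum_k x ord0 k * P x k) ->
  exists x : 'rV[R]_n.+1, forall k, P x k = 0.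
Proof.
move=> M0 cP coer.
pose pos (N : nat) (p : 'I_n.+1 -> nat) : 'rV[R]_n.+1 := \row_k (- M + 2 * M * ((p k)%:R / N.+1%:R)).
(* The sign of [P_k], overruled on the two faces orthogonal to [k] to meet the boundary conditions;
   hence the second alternatives in [H1] and [H2]. *)
pose b N (k : 'I_n.+1) (p : 'I_n.+1 -> nat) := (p k == N.+1) || ((p k != 0%N) && (0 < P (pos N p) k)).
have hb N k (p : 'I_n.+1 -> nat) : (p k = 0%N -> b N k p = false) /\ (p k = N.+1 -> b N k p = true).
  by split => h; rewrite /b h ?eqxx.
have D N := discrete_miranda (hb N).
have [p Hp] := choice D.
pose K : set 'rV[R]_n.+1 := [set v | forall k, `[- M, M]%classic (v ord0 k)].
have cK : compact K by apply: (@rV_compact R n.+1 (fun=> `[- M, M]%classic)) => k; exact: segment_compact.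
have N0 (N : nat) : 0 < N.+1%:R :> R by rewrite ltr0n.
have posK N (q : 'I_n.+1 -> nat) : (forall k, (q k <= N.+1)%N) -> K (pos N q).
  move=> h k; rewrite /pos mxE /= in_itv/=.
  have h0 : 0 <= (q k)%:R / N.+1%:R :> R by rewrite divr_ge0.
  have h1 : (q k)%:R / N.+1%:R <= 1 :> R by rewrite ler_pdivrMr// mul1r ler_nat.
  have := mulr_ge0 (ltW M0) h0; have := ler_wpM2l (ltW M0) h1.
  rewrite -[2 * M * _]mulrA; move: (M * _) => z; lra.
have [xi [Kxi cl]] : K `&` cluster ((fun N => pos N (p N)) @ \oo) !=set0.
  apply: cK; exists 0%N => // N _; apply: posK => k; exact: ltnW ((Hp N).1 k).
(* Cells have side [2 M / (N + 1)], so all vertices of a cell at a cluster point come close to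
   [xi]. *)
have near_pt (r : R) : 0 < r -> exists N, forall q : 'I_n.+1 -> nat,
    (forall a, (p N a <= q a <= (p N a).+1)%N) -> ball xi r (pos N q).
  move=> r0.
  have r20 : 0 < r / 2 by rewrite divr_gt0.
  pose m := Num.truncn (2 * M / (r / 2)).
  have [y [[N mN <-] By]] : (fun N => pos N (p N)) @` [set N | (m <= N)%N] `&` ball xi (r / 2) !=set0.
    apply: cl; last exact: nbhsx_ballx.
    by exists m => // N mN; exists N.
  exists N => q hq; split => // i j; rewrite (ord1 i).
  have := By.2 ord0 j; rewrite /ball/= /pos !mxE => d1.
  rewrite (_ : r = r / 2 + r / 2); last by field.
  rewrite -(subrK (- M + 2 * M * ((p N j)%:R / N.+1%:R)) (xi ord0 j)) -addrA.
  apply: le_lt_trans (ler_normD _ _) _; apply: ltr_leD => //.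
  have -> : - M + 2 * M * ((p N j)%:R / N.+1%:R) - (- M + 2 * M * ((q j)%:R / N.+1%:R)) =
    - (2 * M / N.+1%:R * ((q j)%:R - (p N j)%:R)) by ring.
  have [hd0 hd1] : 0 <= (q j)%:R - (p N j)%:R :> R /\ (q j)%:R - (p N j)%:R <= 1 :> R.
    have /andP[h1 h2] := hq j; rewrite subr_ge0 ler_nat h1; split => //.
    by rewrite lerBlDr [1 + _]addrC natr1 ler_nat.
  have MN : 2 * M / N.+1%:R <= r / 2.
    have h : 2 * M / (r / 2) <= N.+1%:R.
      by apply: le_trans (ltW (truncnS_gt _)) _; rewrite ler_nat.
    by rewrite ler_pdivrMr// -ler_pdivrMl// mulrC.
  have MN0 : 0 <= 2 * M / N.+1%:R by rewrite divr_ge0// mulr_ge0// ltW.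
  rewrite normrN normrM (ger0_norm MN0) (ger0_norm hd0).
  apply: le_trans MN; exact: ler_piMr.
have H1 k : P xi k <= 0 \/ xi ord0 k = - M.
  have [|Pp] := lerP (P xi k) 0; [by left|right].
  have := Kxi k; rewrite /= in_itv/= => /andP[h1 _].
  move: h1; rewrite le_eqVlt => /orP[/eqP//|h1]; exfalso.
  have /cvgrPdist_lt /(_ _ Pp) /nbhs_ballP [r /= r0 Hr] := cP k xi.
  have : 0 < Num.min r (xi ord0 k + M) by rewrite lt_min r0; lra.
  move=> /near_pt[N HN].
  have [q [q' [bq bq' hq]]] := (Hp N).2 k.
  have B : ball xi (Num.min r (xi ord0 k + M)) (pos N q') by apply: HN => a; have /andP[] := hq a.
  have /Hr /= : ball xi r (pos N q') by apply: le_ball B; rewrite ge_min lexx.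
  have := B.2 ord0 k; rewrite /ball/= lt_min => /andP[_].
  move: bq'; rewrite /b negb_or negb_and negbK -leNgt => /andP[_ /orP[/eqP q0|Pq]].
    rewrite /pos mxE q0 mul0r mulr0 addr0 opprK => /(le_lt_trans (ler_norm _)); lra.
  move=> _ /(le_lt_trans (ler_norm _)); move: Pq; set u := P _ _; set w := P _ _; lra.
have H2 k : 0 <= P xi k \/ xi ord0 k = M.
  have [|Pp] := lerP 0 (P xi k); [by left|right].
  have := Kxi k; rewrite /= in_itv/= => /andP[_ h1].
  move: h1; rewrite le_eqVlt => /orP[/eqP//|h1]; exfalso.
  have Pp' : 0 < - P xi k by rewrite oppr_gt0.
  have /cvgrPdist_lt /(_ _ Pp') /nbhs_ballP [r /= r0 Hr] := cP k xi.
  have : 0 < Num.min r (M - xi ord0 k) by rewrite lt_min r0; lra.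
  move=> /near_pt[N HN].
  have [q [q' [bq bq' hq]]] := (Hp N).2 k.
  have B : ball xi (Num.min r (M - xi ord0 k)) (pos N q) by apply: HN => a; have /andP[] := hq a.
  have /Hr /= : ball xi r (pos N q) by apply: le_ball B; rewrite ge_min lexx.
  have := B.2 ord0 k; rewrite /ball/= lt_min => /andP[_].
  move: bq; rewrite /b => /orP[/eqP q0|/andP[_ Pq]].
    rewrite /pos mxE q0 divff ?gt_eqF// mulr1 distrC => /(le_lt_trans (ler_norm _)); lra.
  move=> _; rewrite distrC => /(le_lt_trans (ler_norm _)); move: Pq; set u := P _ _; set w := P _ _; lra.
exists xi.
have S k : xi ord0 k * P xi k <= 0.
  case: (H1 k) => h1; case: (H2 k) => h2.
  - by rewrite (_ : P xi k = 0) ?mulr0//; apply/eqP; rewrite eq_le h1.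
  - by rewrite h2; have := ler_wpM2l (ltW M0) h1; rewrite mulr0.
  - by rewrite h1 mulNr oppr_le0; exact: mulr_ge0 (ltW M0) h2.
  - by move: M0; rewrite h1 in h2; lra.
have Kn k : `|xi ord0 k| <= M by have := Kxi k; rewrite /= in_itv/= -ler_norml.
(* The products [xi_k P_k] being nonpositive, coercivity keeps [xi] off the boundary of the box,
   which rules out the alternatives left by the faces. *)
have nb k : `|xi ord0 k| <> M.
  move=> h; have := coer xi Kn (ex_intro _ k h).
  by rewrite ltNge sumr_le0// => i _; exact: S.
move=> k; apply/eqP; rewrite eq_le.
have h1 : P xi k <= 0 by case: (H1 k) => // h; exfalso; apply: (nb k); rewrite h normrN gtr0_norm.
have h2 : 0 <= P xi k by case: (H2 k) => // h; exfalso; apply: (nb k); rewrite h gtr0_norm.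
by rewrite h1 h2.
Qed.

End PoincareMiranda.

(** * Approximate solutions without completeness *)

Section AbstractExistence.
Variables (R : realType) (E : lmodType R) (D : E -> Prop) (a : E -> E -> R).
Hypotheses (D0 : D 0) (DL : forall c u v, D u -> D v -> D (c *: u + v)).
Hypotheses (aC : forall u v, D u -> D v -> a u v = a v u)
  (aL : forall c u v w, D u -> D v -> D w -> a (c *: u + v) w = c * a u w + a v w)
  (a0 : forall u, D u -> 0 <= a u u).
Implicit Types (u v w : E) (l : E -> R).

Definition lin l := forall c u v, D u -> D v -> l (c *: u + v) = c * l u + l v.

Lemma lin0 l : lin l -> l 0 = 0.
Proof.
move=> h; have := h 1 0 0 D0 D0; rewrite scaler0 addr0 mul1r => e.
by apply: (addrI (l 0)); rewrite addr0 -e.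
Qed.

Lemma linB l u v : lin l -> D u -> D v -> l (u - v) = l u - l v.
Proof. by move=> h hu hv; rewrite -[- v]scaleN1r addrC h// mulN1r addrC. Qed.

Lemma DB u v : D u -> D v -> D (u - v).
Proof. by move=> hu hv; rewrite -[- v]scaleN1r addrC; exact: DL. Qed.

Lemma lina w : D w -> lin (a^~ w).
Proof. by move=> hw c u v hu hv; exact: aL. Qed.

Lemma aLr c u v w : D u -> D v -> D w -> a w (c *: u + v) = c * a w u + a w v.
Proof. by move=> hu hv hw; rewrite aC ?aL ?(aC hw)//; exact: DL. Qed.

(** Discriminant inequality with a slack [e], the defect of minimality of an almost minimizer. *)
Lemma quad_sqr (g A e : R) : 0 <= A -> 0 <= e -> (forall t : R, - e <= 2 * t * g + t ^+ 2 * A) ->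
  g ^+ 2 <= e * A.
Proof.
move=> A0 e0 h; move: A0; rewrite le_eqVlt => /orP[/eqP A0|A0]; last first.
  have := h (- (g / A)).
  have -> : 2 * - (g / A) * g + (- (g / A)) ^+ 2 * A = - (g ^+ 2 / A) by field; rewrite gt_eqF.
  by rewrite lerN2 ler_pdivrMr.
rewrite -A0 mulr0 leNgt; apply/negP => g0.
have := h (- ((e + 1) / g)); rewrite -A0 mulr0 addr0.
have g1 : g != 0 by apply: contraTneq g0 => ->; rewrite expr0n ltxx.
have -> : 2 * - ((e + 1) / g) * g = - (2 * (e + 1)) by field.
by rewrite lerN2; lra.
Qed.

Lemma a_expand u v (t : R) : D u -> D v ->
  a (t *: v + u) (t *: v + u) = a u u + 2 * t * a u v + t ^+ 2 * a v v.
Proof.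
move=> hu hv; have hd := DL t hv hu.
by rewrite (aL _ hv hu hd) !(aLr _ hv hu)// (aC hv hu); ring.
Qed.

Lemma a_CS u v : D u -> D v -> a u v ^+ 2 <= a u u * a v v.
Proof.
move=> hu hv; apply: quad_sqr; [exact: a0|exact: a0|] => t.
by have := a0 (DL t hv hu); rewrite a_expand//; lra.
Qed.

(* No completeness is available: the representer is the limit of a minimizing
   sequence of a(v,v) - 2 l(v). *)
Lemma riesz_seq l (C : R) : 0 <= C -> lin l -> (forall v, D v -> l v ^+ 2 <= C * a v v) ->
  exists z : nat -> E, (forall n, D (z n)) /\
    forall n w, D w -> (a (z n) w - l w) ^+ 2 <= n.+1%:R^-1 * a w w.
Proof.
move=> C0 hl lC; pose Q v := a v v - 2 * l v.
pose S := [set Q v | v in D].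
have Slb : has_lbound S.
  exists (- C) => _ [v hv <-]; rewrite /Q.
  suff : 2 * l v <= a v v + C by lra.
  rewrite leNgt; apply/negP => h.
  have p : 0 <= a v v + C by rewrite addr_ge0 ?a0.
  have : (a v v + C) ^+ 2 < (2 * l v) ^+ 2 by rewrite ltr_sqr ?nnegrE//; apply: le_trans p (ltW h).
  have := lC v hv; have := sqr_ge0 (a v v - C); rewrite sqrrB sqrrD exprMn mulr2n; move: (a v v * C) (C * a v v) (mulrC C (a v v)) => x y ->; lra.
have Sn : S !=set0 by exists (Q 0), 0.
have /choice[z hz] (n : nat) : exists v, D v /\ Q v <= inf S + n.+1%:R^-1.
  have n0 : 0 < n.+1%:R^-1 :> R by rewrite invr_gt0 ltr0n.
  have [_ [v hv <-] h] := inf_adherent n0 (conj Sn Slb).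
  by exists v; split => //; exact: ltW.
exists z; split => [n|n w hw]; first by case: (hz n).
have [hzn Qn] := hz n.
(* [z n] minimizes [Q] up to [1 / (n + 1)], so the variation of [Q] along any [t *: w] is at least
   minus this error. *)
apply: quad_sqr; [exact: a0|by rewrite invr_ge0|] => t.
have : inf S <= Q (t *: w + z n) by apply: ge_inf => //; exists (t *: w + z n) => //; exact: DL.
rewrite /Q a_expand// hl//; move: Qn; rewrite /Q; set e := n.+1%:R^-1 => Qn h.
clearbody e; move: (a (z n) (z n)) (a (z n) w) (a w w) (l w) (l (z n)) (inf S) Qn h => A B G x y s; lra.
Qed.

(** The two almost representers are tested on their own difference. *)
Lemma riesz_cauchy l (z : nat -> E) : (forall n, D (z n)) -> lin l ->
  (forall n w, D w -> (a (z n) w - l w) ^+ 2 <= n.+1%:R^-1 * a w w) ->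
  forall m n, a (z m - z n) (z m - z n) <= 2 * m.+1%:R^-1 + 2 * n.+1%:R^-1.
Proof.
move=> hz hl H m n; have hd := DB (hz m) (hz n).
have := a0 hd; rewrite le_eqVlt => /orP[/eqP <-|A0].
  by rewrite addr_ge0// mulr_ge0// invr_ge0.
rewrite -(ler_pM2r A0) -expr2 {1}(linB (lina hd))//.
have -> : a (z m) (z m - z n) - a (z n) (z m - z n) =
  (a (z m) (z m - z n) - l (z m - z n)) - (a (z n) (z m - z n) - l (z m - z n)) by ring.
apply: le_trans (sqrB_le _ _) _; rewrite [leRHS]mulrDl -[2 / m.+1%:R * _]mulrA -[2 / n.+1%:R * _]mulrA; apply: lerD; rewrite ler_pM2l//; exact: H.
Qed.

Lemma riesz_bound l (C : R) (z : nat -> E) : 0 <= C -> (forall n, D (z n)) ->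
  (forall v, D v -> l v ^+ 2 <= C * a v v) ->
  (forall n w, D w -> (a (z n) w - l w) ^+ 2 <= n.+1%:R^-1 * a w w) ->
  forall n, a (z n) (z n) <= 2 + 2 * C.
Proof.
move=> C0 hz lC H n; have := a0 (hz n); rewrite le_eqVlt => /orP[/eqP <-|A0].
  by rewrite addr_ge0// mulr_ge0.
rewrite -(ler_pM2r A0) -expr2.
have -> : a (z n) (z n) = (a (z n) (z n) - l (z n)) - (- l (z n)) by ring.
apply: le_trans (sqrB_le _ _) _; rewrite sqrrN.
have -> : a (z n) (z n) - l (z n) - - l (z n) = a (z n) (z n) by ring.
rewrite [leRHS]mulrDl -[2 * C * _]mulrA; apply: lerD; rewrite ler_pM2l//; last exact: lC.
apply: le_trans (H n _ (hz n)) _; rewrite ler_piMl ?(ltW A0)// invf_le1 ?ltr0n// ler1n.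
by [].
Qed.

Variables (b : E -> E -> E -> R) (F : E -> R) (CF : R).
Hypotheses (bL1 : forall c u v w z, D u -> D v -> D w -> D z -> b (c *: u + v) w z = c * b u w z + b v w z)
  (bL2 : forall c u v w z, D u -> D v -> D w -> D z -> b w (c *: u + v) z = c * b w u z + b w v z)
  (bL3 : forall c u v w z, D u -> D v -> D w -> D z -> b w z (c *: u + v) = c * b w z u + b w z v)
  (b0 : forall u, D u -> b u u u = 0)
  (Fl : lin F) (CF0 : 0 < CF) (FC : forall v, D v -> F v ^+ 2 <= CF * a v v).

Lemma D_sum (I : finType) (x : I -> R) (w : I -> E) : (forall i, D (w i)) -> D (\sum_i x i *: w i).
Proof.
move=> hw; elim: (index_enum I) => [|i s IH]; first by rewrite big_nil.
by rewrite big_cons; exact: DL.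
Qed.

Lemma lin_sum l (I : finType) (x : I -> R) (w : I -> E) : lin l -> (forall i, D (w i)) ->
  l (\sum_i x i *: w i) = \sum_i x i * l (w i).
Proof.
move=> hl hw; suff [] : D (\sum_i x i *: w i) /\ l (\sum_i x i *: w i) = \sum_i x i * l (w i) by [].
elim: (index_enum I) => [|i s [IH1 IH2]]; first by rewrite !big_nil; split => //; exact: lin0.
by rewrite !big_cons hl// IH2; split => //; exact: DL.
Qed.

Lemma F_le v : D v -> F v <= a v v + CF / 4.
Proof.
move=> hv; have h := FC hv; have := sqr_ge0 (F v - CF / 2); rewrite sqrrB => h2.
have : CF * (F v) <= CF * (a v v + CF / 4).
  rewrite mulrDr; move: h2; rewrite mulr2n expr_div_n; have -> : F v * (CF / 2) = CF * F v / 2 by ring.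
  have -> : CF * (CF / 4) = CF ^+ 2 / 2 ^+ 2 by field.
  by move: (CF * F v) (CF * a v v) (F v ^+ 2) (CF ^+ 2 / _) h => x y z t; lra.
by rewrite ler_pM2l.
Qed.

(** The term [e x_k] makes the system coercive in the coordinates, even for dependent vectors. As
    [b u u u = 0], pairing the system with its solution bounds [e] times the sum of the [x_k ^ 2] by
    [F u], at most [CF]; so the perturbation [e x_k] has square at most [e CF]. *)
Lemma galerkin (s : seq E) (e : R) : (forall w, w \in s -> D w) -> 0 < e ->
  exists u, [/\ D u, a u u <= CF &
    forall w, w \in s -> (a u w + b u u w - F w) ^+ 2 <= e * CF].
Proof.
(* The vector 0 is prepended so that there is at least one unknown. *)
move=> hs e0; pose t := 0 :: s; pose W (k : 'I_(size s).+1) : E := nth 0 t k.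
have hW k : D (W k).
  by rewrite /W; case: k => -[|k] //= ks; apply/hs/mem_nth.
pose U (x : 'rV[R]_(size s).+1) := \sum_k x ord0 k *: W k.
have hU x : D (U x) by exact: D_sum.
pose P (x : 'rV[R]_(size s).+1) k := a (U x) (W k) + b (U x) (U x) (W k) - F (W k) + e * x ord0 k.
have lb1 x k : lin (fun v => b v (U x) (W k)) by move=> c u v hu hv; exact: bL1.
have lb2 v k : D v -> lin (fun u => b v u (W k)) by move=> h c u w hu hw; exact: bL2.
have lb3 x : lin (fun v => b (U x) (U x) v) by move=> c u v hu hv; exact: bL3.
have cc k : continuous (fun x : 'rV[R]_(size s).+1 => x ord0 k) by exact: coord_continuous.
have PE k : P^~ k = fun x => \sum_i x ord0 i * a (W i) (W k) +
    \sum_i x ord0 i * (\sum_j x ord0 j * b (W i) (W j) (W k)) - F (W k) + e * x ord0 k.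
  apply/funext => x; rewrite /P (lin_sum _ (lina (hW k)) hW) (lin_sum _ (lb1 x k) hW).
  congr (_ + _ - _ + _); apply: eq_bigr => i _; congr (_ * _).
  exact: (lin_sum _ (lb2 (W i) k (hW i)) hW).
have cP k : continuous (P^~ k).
  pose X := 'rV[R]_(size s).+1.
  have cD (f g : X -> R) : continuous f -> continuous g -> continuous (fun x => f x + g x).
    by move=> cf cg x; exact: cvgD (cf x) (cg x).
  have cM (f g : X -> R) : continuous f -> continuous g -> continuous (fun x => f x * g x).
    by move=> cf cg x; exact: cvgM (cf x) (cg x).
  have ck (r : R) : continuous (fun _ : X => r) by exact: cst_continuous.
  have cs (G : 'I_(size s).+1 -> X -> R) : (forall i, continuous (G i)) ->
      continuous (fun x => \sum_i G i x).
    move=> h; elim: (index_enum _) => [|i r IH].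
      by rewrite (_ : (fun x => _) = fun=> 0) //; apply/funext => x; rewrite big_nil.
    rewrite (_ : (fun x => _) = fun x => G i x + \sum_(j <- r) G j x); first exact: cD.
    by apply/funext => x; rewrite big_cons.
  rewrite PE; refine (cD _ _ _ (cM _ _ (ck e) (cc k))).
  refine (cD _ (fun=> - F (W k)) _ (ck _)); refine (cD _ _ (cs _ _) (cs _ _)) => i.
    exact: cM.
  by refine (cM _ _ (cc i) (cs _ _)) => j; exact: cM.
have pair (x : 'rV[R]_(size s).+1) : \sum_k x ord0 k * P x k = a (U x) (U x) - F (U x) + e * \sum_k x ord0 k ^+ 2.
  transitivity (\sum_k (x ord0 k * a (U x) (W k) + x ord0 k * b (U x) (U x) (W k) - x ord0 k * F (W k) + e * x ord0 k ^+ 2)).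
    by apply: eq_bigr => k _; rewrite /P; ring.
  rewrite !big_split /= sumrN mulr_sumr.
  have la : lin (a (U x)) by move=> c u v hu hv; exact: aLr.
  by rewrite -(lin_sum _ la hW) -(lin_sum _ (lb3 x) hW) -(lin_sum _ Fl hW) -/(U x) b0// addr0.
(* Then [e M] exceeds [CF / 4], the loss in [F_le], and [M >= 1] gives [M <= M ^ 2]. *)
pose M := 1 + CF / 4 / e.
have M1 : 0 < CF / 4 / e by rewrite divr_gt0// divr_gt0.
have M0 : 0 < M by rewrite /M; lra.
have [x hx] : exists x, forall k, P x k = 0.
  apply: (@coercive_zero R (size s) P M M0 cP) => x _ [k xk].
  rewrite pair; have := F_le (hU x).
  have sq : M <= \sum_k x ord0 k ^+ 2.
    rewrite (bigD1 k)//= -(real_normK (num_real (x ord0 k))) xk.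
    apply: le_trans (_ : M ^+ 2 <= _).
      rewrite expr2 ler_peMl ?(ltW M0)//; rewrite /M; lra.
    by rewrite lerDl; apply: sumr_ge0 => i _; exact: sqr_ge0.
  have := ler_wpM2l (ltW e0) sq.
  have -> : e * M = e + CF / 4 by rewrite /M; field; rewrite gt_eqF.
  move: (e * _) (F _) (a _ _) => p q r; lra.
have Z : a (U x) (U x) + e * \sum_k x ord0 k ^+ 2 = F (U x).
  have := pair x; rewrite big1 => [|k _]; last by rewrite hx mulr0.
  by move=> h; lra.
have sq0 k : e * x ord0 k ^+ 2 <= e * \sum_k x ord0 k ^+ 2.
  by rewrite ler_pM2l// (bigD1 k)//= lerDl; apply: sumr_ge0 => i _; exact: sqr_ge0.
have ex0 : 0 <= e * \sum_k x ord0 k ^+ 2 by apply: mulr_ge0; [exact: ltW|apply: sumr_ge0 => i _; exact: sqr_ge0].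
have aF : a (U x) (U x) <= F (U x) by lra.
have aCF : a (U x) (U x) <= CF.
  have := a0 (hU x); rewrite le_eqVlt => /orP[/eqP <-|A0]; first exact: ltW.
  rewrite -(ler_pM2r A0) -expr2; apply: le_trans (FC (hU x)).
  by rewrite ler_sqr ?nnegrE ?(ltW A0)//; exact: le_trans (ltW A0) aF.
have FCF : F (U x) <= CF.
  have F0 : 0 <= F (U x) by apply: le_trans (a0 (hU x)) aF.
  rewrite -ler_sqr ?nnegrE ?(ltW CF0)//; apply: le_trans (FC (hU x)) _.
  by rewrite expr2 ler_pM2l.
exists (U x); split => // w /(nthP 0) [k ks <-].
have ks' : (k.+1 < (size s).+1)%N by rewrite ltnS.
have := hx (Ordinal ks'); rewrite /P /W /= => /eqP; rewrite addr_eq0 => /eqP ->.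
rewrite sqrrN exprMn expr2 -mulrA ler_pM2l//.
apply: le_trans (sq0 (Ordinal ks')) _; have := a0 (hU x); lra.
Qed.

Lemma near_all (T : Type) (G : set_system T) (s : seq E) (P : E -> T -> Prop) : Filter G ->
  (forall z, z \in s -> \forall i \near G, P z i) -> \forall i \near G, forall z, z \in s -> P z i.
Proof.
move=> FG; elim: s => [|w s IH] h; first by apply: nearW.
have h1 := h w (mem_head _ _).
have h2 : \forall i \near G, forall z, z \in s -> P z i.
  by apply: IH => z zs; apply: h; rewrite inE zs orbT.
near=> i => z; rewrite inE => /orP[/eqP ->|]; first by near: i.
by move: z; near: i.
Unshelve. all: by end_near. Qed.

(** Weak continuity of the quadratic term on bounded sets, a weak neighbourhood being given by
    finitely many functionals [a _ z]. *)
Hypothesis bcomp : forall w, D w -> forall r d : R, 0 < d -> exists (s : seq E) (eta : R),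
  [/\ 0 < eta, forall z, z \in s -> D z & forall u v, D u -> D v -> a u u <= r -> a v v <= r ->
    (forall z, z \in s -> `|a (u - v) z| <= eta) -> `|b u u w - b v v w| <= d].

(* An ultrafilter on the pairs (test functions, precision) replaces the extraction
   of a weakly convergent subsequence of Galerkin solutions. *)
Lemma weak_solution_seq : exists v : nat -> E, [/\ forall n, D (v n),
  forall m n, a (v m - v n) (v m - v n) <= 2 * m.+1%:R^-1 + 2 * n.+1%:R^-1 &
  forall w, D w -> forall d : R, 0 < d ->
    \forall n \near \oo, `|a (v n) w + b (v n) (v n) w - F w| <= d].
Proof.
pose I := (seq E * nat)%type.
have /choice[u hu] (i : I) : exists u, [/\ D u, a u u <= CF & (forall w, w \in i.1 -> D w) ->
    forall w, w \in i.1 -> (a u w + b u u w - F w) ^+ 2 <= i.2.+1%:R^-1 * CF].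
  have [h|h] := pselect (forall w, w \in i.1 -> D w).
    have n0 : 0 < i.2.+1%:R^-1 :> R by rewrite invr_gt0 ltr0n.
    by have [v [h1 h2 h3]] := galerkin h n0; exists v.
  by exists 0; split => //; rewrite (lin0 (lina D0)) ltW.
have uD i : D (u i) by case: (hu i).
have ua i : a (u i) (u i) <= CF by case: (hu i).
(* The tails: lists containing a given one, with a precision index at least a given one. *)
pose G : set_system I := [set A : set I | exists (s0 : seq E) (n0 : nat), (forall w, w \in s0 -> D w) /\
  forall (s : seq E) (n : nat), (forall w, w \in s -> D w) -> {subset s0 <= s} -> (n0 <= n)%N -> A (s, n)].
have PG : ProperFilter G.
  split; first by move=> [s [n [h1 h2]]]; exact: (h2 s n h1 (fun _ h => h) (leqnn _)).
  split.
  - by exists [::], 0%N.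
  - move=> A B [s [n [h1 h2]]] [t [m [h3 h4]]]; exists (s ++ t), (maxn n m); split.
      by move=> w; rewrite mem_cat => /orP[/h1|/h3].
    move=> r k rD sub; rewrite geq_max => /andP[nk mk]; split; [apply: h2|apply: h4] => // w ws;
    by apply: sub; rewrite mem_cat ws ?orbT.
  - by move=> A B AB [s [n [h1 h2]]]; exists s, n; split => // t m tD sub nm; apply: AB; exact: h2.
have [U [UU GU]] := ultraFilterLemma PG.
have aw w i : D w -> `|a (u i) w| <= CF + a w w.
  move=> hw; have w0 := a0 hw; have K0 : 0 <= CF + a w w by rewrite addr_ge0// ltW.
  rewrite -ler_sqr ?nnegrE// (real_normK (num_real _)); apply: le_trans (a_CS (uD i) hw) _.
  apply: le_trans (_ : CF * a w w <= _); first by rewrite ler_wpM2r.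
  by rewrite expr2; apply: ler_pM; rewrite ?lerDl ?lerDr// ltW.
(* Along the ultrafilter the bounded reals [a (u i) w] converge for every [w] of [D]; the limit
   functional [l] takes the place of a weak limit. *)
have /choice[l hl] (w : E) : exists y : R, D w -> a (u i) w @[i --> U] --> y.
  have [hw|nw] := pselect (D w); last by exists 0.
  have [y [_ cl]] : `[- (CF + a w w), CF + a w w]%classic `&` cluster (a (u i) w @[i --> U]) !=set0.
    by apply: segment_compact; apply: (@nearW _ U) => i; rewrite /= in_itv/=; have := aw w i hw; rewrite ler_norml.
  exists y => _ V nV; case: (in_ultra_setVsetC ((fun i => a (u i) w) @^-1` V) UU) => // h.
  by have [z [nVz Vz]] := cl (~` V) V h nV.
have ll : lin l.
  move=> c v w hv hw; have hd := DL c hv hw.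
  apply: (cvg_unique (@norm_hausdorff R R) (hl _ hd)).
  have -> : (fun i => a (u i) (c *: v + w)) = (fun i => c * a (u i) v + a (u i) w).
    by apply/funext => i; rewrite aLr.
  by apply: cvgD; [apply: cvgM; [exact: cvg_cst|exact: hl]|exact: hl].
have lC v : D v -> l v ^+ 2 <= CF * a v v.
  move=> hv; have cv : (a (u i) v) ^+ 2 @[i --> U] --> l v ^+ 2.
    by rewrite expr2; apply: cvgM; exact: hl.
  apply: (closed_cvg (fun y => y <= CF * a v v) _ _ _ cv); first exact: closed_le.
  apply: nearW => i; apply: le_trans (a_CS (uD i) hv) _.
  by rewrite ler_wpM2r ?a0.
have CF0' := ltW CF0.
(* The limit functional is almost represented by elements of [D], which [bcomp] can compare with the
   Galerkin solutions. *)
have [z [zD zl]] := riesz_seq CF0' ll lC.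
have zb := riesz_bound CF0' zD lC zl.
exists z; split => //; first exact: riesz_cauchy zl.
move=> w hw d d0; have d4 : 0 < d / 4 by rewrite divr_gt0.
have [s [eta [eta0 sD hs]]] := bcomp hw (2 + 2 * CF) d4.
pose e := Num.min (eta / 2) (d / 4).
have e0 : 0 < e by rewrite lt_min d4 divr_gt0.
have tD z' : z' \in w :: s -> D z' by rewrite inE => /orP[/eqP ->|/sD].
have c1 : \forall i \near U, forall z', z' \in w :: s -> `|l z' - a (u i) z'| < e.
  by apply: near_all => z' /tD /hl /cvgrPdist_lt; apply.
have c2 : \forall n \near \oo, forall z', z' \in w :: s -> `|a (z n) z' - l z'| <= e.
  apply: near_all => z' /tD hz.
  pose K := a z' z' / e ^+ 2.
  near=> n.
  rewrite -ler_sqr ?nnegrE ?(ltW e0)// (real_normK (num_real _)).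
  apply: le_trans (zl n _ hz) _.
  have n0 : 0 < n.+1%:R :> R by rewrite ltr0n.
  rewrite ler_pdivrMl// -ler_pdivrMr ?exprn_gt0// -/K.
  apply: le_trans (ltW (truncnS_gt _)) _; rewrite ler_nat ltnS.
  by near: n; exact: nbhs_infty_ge.
have c3 : \forall i \near U, `|a (u i) w + b (u i) (u i) w - F w| <= d / 4.
  apply: GU; exists [:: w], (Num.truncn (CF / (d / 4) ^+ 2)); split.
    by move=> w'; rewrite inE => /eqP ->.
  move=> s' n sD' ss nn /=; have ws : w \in s' by apply: ss; exact: mem_head.
  have [_ _ /(_ sD' _ ws) h] := hu (s', n).
  rewrite -ler_sqr ?nnegrE ?(ltW d4)// (real_normK (num_real _)); apply: le_trans h _.
  have n0 : 0 < n.+1%:R :> R by rewrite ltr0n.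
  rewrite /= ler_pdivrMl// -ler_pdivrMr ?exprn_gt0//.
  by apply: le_trans (ltW (truncnS_gt _)) _; rewrite ler_nat ltnS.
have [i [i1 i3]] : exists i, (forall z', z' \in w :: s -> `|l z' - a (u i) z'| < e) /\
    `|a (u i) w + b (u i) (u i) w - F w| <= d / 4.
  by have [i [h1 h2]] := filter_ex (filterI c1 c3); exists i.
near=> n.
have nz : forall z', z' \in w :: s -> `|a (z n) z' - l z'| <= e by near: n.
have ee : e <= eta / 2 /\ e <= d / 4 by rewrite /e !ge_min !lexx orbT.
have bd : `|b (u i) (u i) w - b (z n) (z n) w| <= d / 4.
  refine (hs (u i) (z n) (uD i) (zD n) _ (zb n) _); first by apply: le_trans (ua i) _; lra.
  move=> z' zs; have zt : z' \in w :: s by rewrite inE zs orbT.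
  have hz := tD _ zt.
  rewrite (linB (lina hz) (uD i) (zD n)).
  have := i1 _ zt; have := nz _ zt; rewrite distrC => h1 h2.
  have -> : a (u i) z' - a (z n) z' = (l z' - a (z n) z') - (l z' - a (u i) z') by ring.
  apply: le_trans (ler_normB _ _) _; case: ee => ee _; lra.
have := i1 _ (mem_head _ _); have := nz _ (mem_head _ _) => h1 h2.
have -> : a (z n) w + b (z n) (z n) w - F w = (a (z n) w - l w) + (l w - a (u i) w) +
  (a (u i) w + b (u i) (u i) w - F w) - (b (u i) (u i) w - b (z n) (z n) w) by ring.
apply: le_trans (ler_normB _ _) _.
apply: le_trans (lerD (ler_normD _ _) (lexx _)) _.
apply: le_trans (lerD (lerD (ler_normD _ _) (lexx _)) (lexx _)) _.
case: ee => _ ee; move: (`|_| : R) (`|_| : R) (`|_| : R) (`|_| : R) h1 h2 i3 bd => p q r t; lra.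
Unshelve. all: by end_near. Qed.

End AbstractExistence.

(** * Square-integrable functions *)

Section SquareIntegrable.
Context d (T : measurableType d) (R : realType).
Variable mu : {measure set T -> \bar R}.
Implicit Types f g h : T -> R.

Definition sq f := measurable_fun setT f /\ ig mu (fun x => f x ^+ 2).
Definition nsq f := J mu (fun x => f x ^+ 2).

Lemma nsq_ge0 f : 0 <= nsq f.
Proof. by apply: J_ge0 => x; exact: sqr_ge0. Qed.

Lemma sq_meas f : sq f -> measurable_fun setT f. Proof. by case. Qed.

Lemma msq f : measurable_fun setT f -> measurable_fun setT (fun x => f x ^+ 2).
Proof. by move=> mf; exact: measurable_funX. Qed.

Lemma sq_le f g : measurable_fun setT f -> (forall x, `|f x| <= `|g x|) -> sq g -> sq f.
Proof.
move=> mf fg [mg sg]; split => //; apply: (ig_le _ _ sg); first exact: msq.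
by move=> x; rewrite ger0_norm ?sqr_ge0// -(real_normK (num_real (f x))) -(real_normK (num_real (g x))) ler_sqr ?nnegrE.
Qed.

Lemma sqD f g : sq f -> sq g -> sq (fun x => f x + g x).
Proof.
move=> [mf sf] [mg sg]; have m : measurable_fun setT (fun x => f x + g x) by exact: measurable_funD.
split => //; apply: (ig_le _ _ (igD (igZ 2 sf) (igZ 2 sg))); first exact: msq.
by move=> x; rewrite ger0_norm ?sqr_ge0//; have := sqrB_le (f x) (- g x); rewrite opprK sqrrN.
Qed.

Lemma sqZ c f : sq f -> sq (fun x => c * f x).
Proof.
move=> [mf sf]; split; first exact: measurable_funM.
by apply: eq_ig (igZ (c ^+ 2) sf) => x; rewrite exprMn.
Qed.

Lemma sqN f : sq f -> sq (fun x => - f x).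
Proof. by move=> /(sqZ (-1)); rewrite (_ : (fun x => -1 * _) = fun x => - f x)//; apply/funext => x; rewrite mulN1r. Qed.

Lemma sqB f g : sq f -> sq g -> sq (fun x => f x - g x).
Proof. by move=> h1 h2; apply: sqD => //; exact: sqN. Qed.

Lemma sq_mul f g : sq f -> sq g -> ig mu (fun x => f x * g x).
Proof. by move=> [mf sf] [mg sg]; exact: ig_mul. Qed.

Lemma sq_CS f g : sq f -> sq g -> J mu (fun x => f x * g x) ^+ 2 <= nsq f * nsq g.
Proof. by move=> [mf sf] [mg sg]; exact: J_CS. Qed.

Lemma nsqD f g : sq f -> sq g -> nsq (fun x => f x + g x) <= 2 * nsq f + 2 * nsq g.
Proof.
move=> hf hg; have [_ s] := sqD hf hg; have [_ sf] := hf; have [_ sg] := hg.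
rewrite /nsq -(JZ _ sf) -(JZ _ sg) -(JD (igZ 2 sf) (igZ 2 sg)); apply: J_le => //.
  exact: igD (igZ 2 sf) (igZ 2 sg).
by move=> x; have := sqrB_le (f x) (- g x); rewrite opprK sqrrN.
Qed.

Lemma nsqB f g : sq f -> sq g -> nsq (fun x => f x - g x) <= 2 * nsq f + 2 * nsq g.
Proof.
move=> hf hg; apply: le_trans (nsqD hf (sqN hg)) _; rewrite lerD2l.
by rewrite [X in _ * X <= _](_ : _ = nsq g)//; apply: eq_J => x; rewrite sqrrN.
Qed.

Lemma J_sq_lim (fn : nat -> T -> R) f g : sq f -> sq g -> (forall n, sq (fn n)) ->
  (forall e : R, 0 < e -> \forall n \near \oo, nsq (fun x => f x - fn n x) <= e) ->
  (fun n => J mu (fun x => fn n x * g x)) @ \oo --> J mu (fun x => f x * g x).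
Proof.
move=> hf hg hn cv; apply/cvgrPdist_le => e e0.
have G0 := nsq_ge0 g.
have e1 : 0 < e ^+ 2 / (nsq g + 1) by rewrite divr_gt0 ?exprn_gt0//; lra.
have := cv _ e1; apply: filterS => n Hn.
rewrite -(JB (sq_mul hf hg) (sq_mul (hn n) hg)).
have -> : J mu (fun x => f x * g x - fn n x * g x) = J mu (fun x => (f x - fn n x) * g x).
  by apply: eq_J => x; rewrite mulrBl.
rewrite -ler_sqr ?nnegrE ?(ltW e0)// (real_normK (num_real _)).
apply: le_trans (sq_CS (sqB hf (hn n)) hg) _.
apply: le_trans (_ : e ^+ 2 / (nsq g + 1) * nsq g <= _); first by rewrite ler_wpM2r.
rewrite mulrAC ler_pdivrMr; last lra.
by rewrite ler_wpM2l ?sqr_ge0//; lra.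
Qed.

Lemma fatou_sq (hn : nat -> T -> R) h (B : R) : (forall n, sq (hn n)) -> measurable_fun setT h ->
  {ae mu, forall x, hn ^~ x @ \oo --> h x} -> (forall n, nsq (hn n) <= B) ->
  sq h /\ nsq h <= B.
Proof.
move=> sn mh cv bn.
pose f n x := ((hn n x) ^+ 2)%:E.
have mf n : measurable_fun setT (f n).
  by apply/measurable_EFinP; apply: msq; case: (sn n).
have f0 n x : setT x -> (0 <= f n x)%E by move=> _; rewrite lee_fin sqr_ge0.
have := fatou mu measurableT mf f0.
have le1 : (limn_einf (fun n => \int[mu]_x f n x) <= B%:E)%E.
  have e n : (\int[mu]_x f n x)%E = (nsq (hn n))%:E by rewrite /nsq EFin_J//; case: (sn n).
  rewrite (_ : (fun n => _) = (fun n => (nsq (hn n))%:E)); last by apply/funext.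
  apply: le_trans (limn_einf_sup _) _.
  rewrite limn_esup_lim; apply: lime_le; first exact: is_cvg_esups.
  by apply: nearW => n; apply: ub_ereal_sup => _ [m _ <-]; rewrite lee_fin.
have mh2 : measurable_fun setT (fun x => (h x ^+ 2)%:E).
  by apply/measurable_EFinP; exact: msq.
have E : (\int[mu]_x limn_einf (f ^~ x) = \int[mu]_x (h x ^+ 2)%:E)%E.
  apply: ae_eq_integral => //.
    rewrite (_ : (fun x => limn_einf (f ^~ x)) = \- (fun x => limn_esup (fun n => - f n x)))%E.
      apply: (measurableT_comp (@oppe_measurable _ _)); apply: measurable_fun_limn_esup => n.
      exact: (measurableT_comp (@oppe_measurable _ _) (mf n)).
    by apply/funext => x; rewrite /= -(limn_einfN (fun n => - f n x)%E); congr limn_einf; apply/funext => n; exact/esym/oppeK.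
  apply: filterS cv => x cx _.
  apply: (cvg_limn_einf_sup _).1.
  apply: cvg_EFin; first exact: nearW.
  by rewrite /comp /=; rewrite expr2; apply: cvgM.
rewrite E => le2; have le3 := le_trans le2 le1.
have ih : ig mu (fun x => h x ^+ 2).
  apply: ig_ge0P; [exact: msq|by move=> x; exact: sqr_ge0|].
  by apply: le_lt_trans le3 _; rewrite ltry.
by split => //; rewrite -lee_fin /nsq EFin_J.
Qed.

(** Along a fast subsequence a weighted sum of squared increments is integrable, hence finite almost
    everywhere, and then dominates the increments by a geometric sequence. Fatou's lemma turns the
    pointwise limit into a limit in L^2. *)
Lemma L2_complete (fn : nat -> T -> R) : (forall n, sq (fn n)) ->
  (forall e : R, 0 < e -> exists N, forall m n, (N <= m)%N -> (N <= n)%N -> nsq (fun x => fn m x - fn n x) <= e) ->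
  exists f (nk : nat -> nat), [/\ sq f, (forall k, (k <= nk k)%N),
    {ae mu, forall x, (fun k => fn (nk k) x) @ \oo --> f x} &
    forall e : R, 0 < e -> \forall n \near \oo, nsq (fun x => f x - fn n x) <= e].
Proof.
move=> sn cau.
(* The first factor compensates the weight [4 ^ k] of [dd], and the second ones have sum 1. *)
pose w k : R := (4 ^+ k)^-1 * (1 / (2 ^ k.+1)%:R).
have w0 k : 0 < w k by rewrite mulr_gt0 ?invr_gt0 ?exprn_gt0// divr_gt0// ltr0n expn_gt0.
have /choice[Nk hN] k := cau _ (w0 k).
pose nk k := (k + \sum_(j < k.+1) Nk j)%N.
have nkN k : (Nk k <= nk k)%N by rewrite /nk big_ord_recr /= addnA leq_addl.
have nkk k : (k <= nk k)%N by rewrite leq_addr.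
have nkS k : (nk k <= nk k.+1)%N.
  by rewrite /nk [in leqRHS]big_ord_recr /= addSn ltnW// ltnS leq_add2l leq_addr.
pose g k := fn (nk k).
pose dd k x := (4 ^+ k * (g k.+1 x - g k x) ^+ 2).
have sg k : sq (g k) by exact: sn.
have sdd k : ig mu (dd k) by apply: igZ; case: (sqB (sg k.+1) (sg k)).
have dd0 k x : 0 <= dd k x by rewrite mulr_ge0 ?sqr_ge0// exprn_ge0.
have mdd k : measurable_fun setT (fun x => (dd k x)%:E) by apply/measurable_EFinP; exact: ig_meas (sdd k).
pose S x := (\sum_(0 <= k <oo) (dd k x)%:E)%E.
have mS : measurable_fun setT S by apply: (ge0_emeasurable_sum (P := xpredT)) => // k x _ _; rewrite lee_fin.
have S0 x : (0 <= S x)%E by apply: nneseries_ge0 => k _ _; rewrite lee_fin.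
have iS : mu.-integrable setT S.
  apply/integrableP; split => //.
  rewrite (eq_integral S); last by move=> x _; rewrite gee0_abs.
  rewrite integral_nneseries//; last by move=> k x _; rewrite lee_fin.
  apply: (@le_lt_trans _ _ 1%E); last by rewrite ltry.
  apply: le_trans (@epsilon_trick0 R 1 xpredT ler01).
  apply: lee_nneseries => [k _ _|k _]; first by apply: integral_ge0 => x _; rewrite lee_fin.
  rewrite -EFin_J// lee_fin /dd.
  have [_ sgk] := sqB (sg k.+1) (sg k).
  rewrite (JZ _ sgk) -ler_pdivlMl ?exprn_gt0//.
  by apply: (hN k); [apply: leq_trans (nkN k) (nkS k)|exact: nkN].
have aeS := integrable_ae measurableT iS.
have cvS x : S x \is a fin_num -> cvgn (g ^~ x).
  move=> fS; pose M := fine (S x); have M0 : 0 <= M by exact: fine_ge0.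
  have dM k : dd k x <= M.
    rewrite -lee_fin /M fineK//.
    apply: le_trans (@nneseries_lim_ge R (fun k => (dd k x)%:E) xpredT 0 k.+1 _); last by move=> n _ _; rewrite lee_fin.
    rewrite big_mkord big_ord_recr /=; apply: leeDr; apply: sume_ge0 => i _; rewrite lee_fin//.
  pose De k := g k.+1 x - g k x.
  have DM k : `|De k| <= geometric (M + 1) (2^-1) k.
    have p2 : 0 < 2^-1 ^+ k :> R by rewrite exprn_gt0// invr_gt0.
    have M1 : 0 <= M + 1 by lra.
    rewrite /geometric /= -ler_sqr ?nnegrE ?mulr_ge0 ?(ltW p2)// (real_normK (num_real _)) exprMn.
    have -> : (2^-1 ^+ k) ^+ 2 = (4 ^+ k)^-1 :> R.
      by rewrite -exprM mulnC exprM -exprVn; congr (_ ^+ k); field.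
    rewrite -ler_pdivrMr ?invr_gt0 ?exprn_gt0// invrK mulrC.
    apply: le_trans (dM k) _; rewrite expr2; nra.
  have cD : cvgn (series De).
    apply: normed_cvg; apply: (@series_le_cvg _ _ (geometric (M + 1) 2^-1)) => //.
    - by move=> k; exact: normr_ge0.
    - by move=> k; exact: le_trans (normr_ge0 _) (DM k).
    - by apply: is_cvg_geometric_series; rewrite ger0_norm ?invr_ge0// invf_lt1// ltr1n.
  have -> : g ^~ x = (fun n => g 0%N x + series De n).
    apply/funext => n; rewrite /series /= /De telescope_sumr// addrC subrK//.
  by apply: is_cvgD => //; exact: is_cvg_cst.
pose C : set T := [set x | S x \is a fin_num].
have mC : measurable C.
  rewrite (_ : C = setT `&` S @^-1` [set y | y \is a fin_num]); last by rewrite setTI.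
  exact: (emeasurable_fin_num measurableT mS).
(* Set to 0 where [S] is infinite, so as to converge everywhere and have a measurable limit. *)
pose gc k x := g k x * \1_C x.
have mgc k : measurable_fun setT (gc k).
  by apply: measurable_funM; [case: (sg k)|exact: measurable_indic].
pose f x := limn (gc ^~ x).
have cf x : gc ^~ x @ \oo --> f x.
  suff : cvgn (gc ^~ x) by [].
  rewrite /gc indicE; have [xC|xC] := boolP (x \in C).
    rewrite (_ : (fun k => _) = g ^~ x); first exact/cvS/set_mem.
    by apply/funext => k; rewrite mulr1.
  rewrite (_ : (fun k => _) = fun=> 0); first exact: is_cvg_cst.
  by apply/funext => k; rewrite mulr0.
have mf : measurable_fun setT f by apply: (measurable_fun_cvg mgc) => x _; exact: cf.
have aef : {ae mu, forall x, g ^~ x @ \oo --> f x}.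
  apply: filterS aeS => x /(_ I) Sx; have := cf x; rewrite /gc indicE mem_set//.
  by rewrite (_ : (fun k => _) = g ^~ x)//; apply/funext => k; rewrite mulr1.
have main (e : R) : 0 < e -> \forall n \near \oo, sq (fun x => f x - fn n x) /\ nsq (fun x => f x - fn n x) <= e.
  move=> e0; have [N HN] := cau e e0; exists N => // n /= Nn.
  apply: (@fatou_sq (fun k x => g (k + N)%N x - fn n x)).
  - by move=> k; exact: sqB.
  - by apply: measurable_funB => //; case: (sn n).
  - apply: filterS aef => x cx; apply: cvgB; last exact: cvg_cst.
    by rewrite (cvg_shiftn N (g ^~ x)).
  - move=> k; apply: HN => //; apply: leq_trans (nkk _); exact: leq_addl.
exists f, nk; split => //.
- have [n [h _]] := filter_ex (main _ ltr01).
  by have := sqD h (sn n); rewrite (_ : (fun x => _ + _) = f)//; apply/funext => x; rewrite subrK.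
- by move=> e e0; apply: filterS (main _ e0) => n [].
Qed.

Lemma J_ae f g : measurable_fun setT f -> measurable_fun setT g -> {ae mu, forall x, f x = g x} -> J mu f = J mu g.
Proof.
move=> mf mg fg; rewrite /J /Rintegral; congr fine; apply: ae_eq_integral => //; try exact/measurable_EFinP.
by apply: filterS fg => x ->.
Qed.

Lemma nsq_ae f : sq f -> nsq f = 0 -> {ae mu, forall x, f x = 0}.
Proof.
move=> [mf sf] f0.
have m2 : measurable_fun setT (fun x => (f x ^+ 2)%:E) by apply/measurable_EFinP; exact: msq.
have : (\int[mu]_x `|(f x ^+ 2)%:E| = 0)%E.
  rewrite (eq_integral (fun x => (f x ^+ 2)%:E)); last by move=> x _; rewrite gee0_abs// lee_fin sqr_ge0.
  by rewrite -EFin_J// -/(nsq f) f0.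
move=> /(ae_eq_integral_abs _ measurableT m2) h.
by apply: filterS h => x /(_ I) [] /eqP; rewrite sqrf_eq0 => /eqP.
Qed.

End SquareIntegrable.

(** * The fundamental lemma of the calculus of variations *)

Section FundamentalLemma.
Variable R : realType.
Local Notation R2 := (measurableTypeR R * measurableTypeR R)%type.
Implicit Types (O U : set (R * R)) (h phi : R * R -> R).

Let opens : set (set R2) := [set U | open (U : set (R * R))].

(** Open sets are stable under intersection; generation by them gives access to Dynkin's
    argument. *)
Lemma measurable_plane_opens : @measurable _ R2 = <<s opens >>.
Proof.
apply/seteqP; split; last first.
  apply: smallest_sub; first exact: sigma_algebra_measurable.
  by move=> U oU; exact: open_measurable_plane.
have coord_meas (f : R * R -> R) : continuous f -> forall A : set (measurableTypeR R), measurable A -> <<s opens >> (f @^-1` A).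
  move=> /continuousP cf A mA.
  have mf : measurable_fun setT (f : g_sigma_algebraType opens -> measurableTypeR R).
    apply: (measurability _ (RGenOpens.measurableE R)) => _ [_ [a [b ->] <-]]; rewrite setTI.
    by apply: sub_sigma_algebra; exact/cf/interval_open.
  by have := mf measurableT A mA; rewrite setTI.
rewrite measurable_prod_measurableType; apply: smallest_sub; first exact: smallest_sigma_algebra.
move=> _ [A mA [B mB <-]].
have -> : A `*` B = ((fst : R * R -> R) @^-1` A) `&` ((snd : R * R -> R) @^-1` B) by [].
have c1 : continuous (fst : R * R -> R) by move=> x; exact: cvg_fst.
have c2 : continuous (snd : R * R -> R) by move=> x; exact: cvg_snd.
have m1 := coord_meas fst c1 A mA; have m2 := coord_meas snd c2 B mB.
exact: (@measurableI _ (g_sigma_algebraType opens) _ _ m1 m2).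
Qed.

(** Indicators of the points at distance at least [r n] from the complement of [U], mollified at
    half that distance. *)
Lemma open_exhaustion U (M : R) : open U -> (forall x, U x -> `|x| <= M) ->
  exists phi : nat -> R * R -> R, [/\ forall n, test_fun U (phi n), forall n x, `|phi n x| <= 1 &
    forall x, phi ^~ x @ \oo --> (\1_U x : R)].
Proof.
move=> oU UM.
pose r n : R := n.+1%:R^-1.
have r0 n : 0 < r n by rewrite invr_gt0.
pose W (e : R) : set (R * R) := [set x | forall y, ~ U y -> e <= `|x - y|].
have clW e : closed (W e).
  have -> : W e = \bigcap_(y in ~` U) [set x | e <= `|x - y|] by apply/seteqP; split=> x h y /h.
  apply: closed_bigI => y _.
  apply: (@closed_comp _ _ (fun x : R * R => `|x - y|) [set t | e <= t]); last exact: closed_ge.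
  move=> x _; apply: (@continuous_comp _ _ _ (fun z : R * R => z - y) (fun z => `|z|)); last exact: norm_continuous.
  by apply: continuousB; [exact: cvg_id|exact: cvg_cst].
have WU e x : 0 < e -> W e x -> U x.
  by move=> e0 Wx; apply: contrapT => /Wx; rewrite subrr normr0 => /(lt_le_trans e0); rewrite ltxx.
have mW e : measurable (W e : set R2).
  by rewrite -[W e]setCK; apply: measurableC; apply: open_measurable_plane; exact: closed_openC.
have iW e : 0 < e -> ig (lebs R) (\1_(W e) : R2 -> R).
  move=> e0; apply: (@ig_le _ _ _ (lebs R) (\1_(W e) : R2 -> R) (\1_[set x : R * R | `|x| <= M] : R2 -> R)); last exact: ig_box.
    exact: measurable_indic.
  move=> x; rewrite !indicE; have [Wx|nW] := boolP (x \in W e); last by rewrite normr0.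
  by rewrite normr1 mem_set//=; apply: UM; exact: WU e0 (set_mem Wx).
have mid : measurable_fun setT (fun w : R2 => (w : R * R) : R2) by exact: measurable_id.
have r20 n : 0 < r n / 2 by rewrite divr_gt0.
have /choice[rho Hrho] n := mass_bump (0 : R * R) (r20 n).
pose phi n := Avg (lebs R) (\1_(W (r n)) : R2 -> R) (fun w : R2 => (w : R * R)) (rho n).
have Rt n : tf (rho n) by case: (Hrho n).
have R0 n x : 0 <= rho n x by case: (Hrho n).
have R1 n x : I2 (fun w => rho n (x - w)) = 1.
  by rewrite I2_refl; [case: (Hrho n)|exact: tf_cc].
have Rs n x : rho n x != 0 -> `|x| < r n / 2.
  by case: (Hrho n) => _ _ _ h /h; rewrite subr0.
have Rc n x : ig (lebs R) (fun w : R2 => rho n (x - (w : R * R))).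
  apply: cc_ig; have [c [L [L0 HL]]] : cc (rho n) := tf_cc (Rt n); split.
    move=> w; apply: (@continuous_comp _ _ _ (fun z : R * R => x - z) (rho n)); last exact: c.
    by apply: continuousB; [exact: cvg_cst|exact: cvg_id].
  exists (L + `|x|); split; first exact: ltr_wpDr.
  move=> w Hw; apply: HL; have := ler_normB x (x - w); rewrite subKr.
  by move: (`|x| : R) (`|w| : R) (`|x - w| : R) Hw => a b c'; lra.
have Pt n : tf (phi n).
  apply: (@avg_tf _ _ _ _ _ _ (iW _ (r0 n)) mid M); last exact: Rt.
  by move=> w; rewrite indicE; have [|] := boolP (w \in W (r n)); rewrite ?eqxx// inE => /(WU _ _ (r0 n)) /UM.
have Psupp n x : phi n x != 0 -> W (r n / 2) x.
  move=> Px; apply: contrapT => nW; move/eqP: Px; apply.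
  rewrite /phi /Avg -[RHS](J0 (lebs R)); apply: eq_J => w.
  have [->|/Rs h] := eqVneq (rho n (x - (w : R * R))) 0; first by rewrite mulr0.
  rewrite indicE; have [|] := boolP (w \in W (r n)); last by rewrite mul0r.
  rewrite inE => Ww; exfalso; apply: nW => y /Ww wy.
  have := ler_normB (w - y) (x - w); have := ler_normD (x - y) (w - x); rewrite (distrC w x) (_ : x - y + (w - x) = w - y); last by rewrite addrC addrA subrK.
  by move: (r n) (`|w - y| : R) (`|x - w| : R) (`|x - y| : R) wy h => *; lra.
have Pb n x : 0 <= phi n x <= 1.
  apply/andP; split; first by apply: J_ge0 => w; rewrite mulr_ge0// indicE.
  rewrite -(R1 n x); apply: J_le; [|exact: Rc|].
    exact: (ig_avg (iW _ (r0 n)) mid x (tf_cc (Rt n))).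
  by move=> w /=; rewrite ler_piMl// indicE; case: (_ \in _).
exists phi; split.
- move=> n; apply: (test_funP (K := W (r n / 2) `&` [set x | `|x| <= M])) => //.
  + by rewrite setIC; apply: compact_closedI; [exact: compact_box|exact: clW].
  + by move=> x [/(WU _ _ (r20 n))].
  + by move=> x /Psupp Wx; split => //; exact/UM/(WU _ _ (r20 n) Wx).
- by move=> n x; have /andP[a b] := Pb n x; rewrite ger0_norm.
- move=> x; rewrite indicE; have [Ux|Ux] := pselect (U x); last first.
    rewrite memNset//.
    rewrite (_ : phi ^~ x = fun=> 0); first exact: cvg_cst.
    apply/funext => n; apply/eqP/negP => /negP/Psupp/(WU _ _ (r20 n)); exact: Ux.
  rewrite mem_set//.
  have [de [de0 Hde]] : exists de : R, 0 < de /\ ball x de `<=` U.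
    by have /nbhs_ballP[de /= de0 h] := open_nbhs_nbhs (conj oU Ux); exists de.
  apply: cvg_near_cst.
  have rc : \forall n \near \oo, r n < de / 2.
    have := @cvg_harmonic R => /cvgrPdist_lt/(_ (de / 2)); rewrite divr_gt0// => /(_ isT).
    by apply: filterS => n; rewrite /harmonic/= sub0r normrN ger0_norm// ltW.
  apply: filterS rc => n rn /=; rewrite -[RHS](R1 n x); apply: eq_J => w.
  have [->|/Rs h] := eqVneq (rho n (x - (w : R * R))) 0; first by rewrite mulr0.
  rewrite indicE mem_set ?mul1r// => y nUy.
  have xy : de <= `|x - y|.
    by rewrite leNgt; apply/negP => xy; apply/nUy/Hde; rewrite -ball_normE.
  have := ler_normD (x - w) (w - y); rewrite subrKA.
  by move: (r n) (`|w - y| : R) (`|x - w| : R) (`|x - y| : R) rn xy h => *; lra.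
Qed.

(** Dominated convergence along [open_exhaustion] gives integral zero over every open set. The sets
    of integral zero form a Dynkin class, hence contain all measurable sets. *)
Lemma fundamental_lemma O h (M : R) : open O -> (forall x, O x -> `|x| <= M) ->
  ig (lebs R) h -> (forall x, ~ O x -> h x = 0) ->
  (forall phi, test_fun O phi -> I2 (fun x => h x * phi x) = 0) ->
  {ae lebs R, forall x, h x = 0}.
Proof.
move=> oO OM ih h0 H.
have mh := ig_meas ih.
have opn U : open U -> I2 (fun x => h x * \1_U x) = 0.
  move=> oU; pose U' := U `&` O.
  have oU' : open U' by exact: openI.
  have [phi [pt p1 pc]] := open_exhaustion oU' (fun x (hx : U' x) => OM x hx.2).
  have -> : (fun x => h x * \1_U x) = (fun x => h x * \1_U' x).
    apply/funext => x; have [Ox|nO] := pselect (O x); last by rewrite h0// !mul0r.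
    rewrite !indicE; congr (_ * (_ : bool)%:R); apply/idP/idP; rewrite !inE; by [|case].
  have mphi n : measurable_fun setT (fun x : R2 => h x * phi n x).
    apply: measurable_funM => //; apply: continuous_measurable_plane; exact: (tf_cc (test_fun_tf (pt n))).1.
  have ihn : (lebs R).-integrable setT (EFin \o (fun x => `|h x|)) := ig_norm ih.
  have L : (\int[lebs R]_x (h x * phi n x)%:E)%E @[n --> \oo] --> (\int[lebs R]_x (h x * \1_U' x)%:E)%E.
    apply: (@dominated_cvg _ _ _ (lebs R) setT measurableT (fun n x => (h x * phi n x)%:E) (fun x => (h x * \1_U' x)%:E) (fun x => `|h x|%:E)) => //.
  - by move=> n; exact/measurable_EFinP.
  - move=> x _; apply: cvg_EFin; first exact: nearW.
    by rewrite /comp /=; apply: cvgM; [exact: cvg_cst|exact: pc].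
  - by move=> n x _; rewrite lee_fin normrM ler_piMr.
  rewrite /I2 /J /Rintegral.
  have Z n : (\int[lebs R]_x (h x * phi n x)%:E = 0)%E.
    have i : ig (lebs R) (fun x => h x * phi n x) by apply: (@ig_mulb _ _ _ _ 1) => //; apply: continuous_measurable_plane; exact: (tf_cc (test_fun_tf (pt n))).1.
    rewrite -EFin_J//; congr EFin; apply: H; apply: test_funW (pt n); exact: subIsetr.
  have := @cvg_unique _ (@ereal_hausdorff R) _ _ _ _ L (_ : _ --> 0%E).
  by move=> ->//; under eq_fun do rewrite Z; exact: cvg_cst.
pose P : set_system R2 := [set A | (\int[lebs R]_(x in A) (h x)%:E = 0)%E].
have all A : measurable (A : set R2) -> P A.
  rewrite measurable_plane_opens; apply: (@dynkin_induction _ R2 opens P measurable_plane_opens).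
  - by move=> A1 A2; exact: openI.
  - have := opn setT openT; rewrite (_ : (fun x => _) = h); last by apply/funext => x; rewrite indicT mulr1.
    by move=> e; have := congr1 EFin e; rewrite /I2 EFin_J.
  - move=> U oU; rewrite /P/= integral_mkcond -[RHS](congr1 EFin (opn U oU)) EFin_J; last first.
      apply: (@ig_mulb _ _ _ _ 1) => //; first by apply: measurable_indic; exact: open_measurable_plane.
      by move=> x; rewrite indicE; case: (_ \in _); rewrite ?normr1 ?normr0.
    apply: eq_integral => x _; rewrite patchE indicE; case: (_ \in _); by rewrite ?mulr1 ?mulr0.
  - move=> K mK K0.
    have := opn setT openT; rewrite (_ : (fun x => _) = h); last by apply/funext => x; rewrite indicT mulr1.
    move=> e; have := congr1 EFin e; rewrite /I2 EFin_J// -(setUv K) integral_setU//=; last 3 first.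
    + exact: measurableC.
    + by apply/measurable_EFinP; exact: measurable_funTS.
    + by apply/disj_setPCl.
    by rewrite K0 add0e.
  - move=> F mF tF F0; rewrite /P/= integral_bigcup//.
      by rewrite eseries0// => n _ _; exact: F0.
    by apply: integrableS ih => //; exact: bigcup_measurable.
have mh' : measurable_fun setT (EFin \o (fun=> 0 : R) : R2 -> \bar R) by exact: measurable_cst.
have := @integral_ae_eq _ _ _ (lebs R) setT measurableT (EFin \o (fun=> 0)) (EFin \o h) ih mh'.
case; last by move=> N [mN N0 NS]; exists N; split => // x /= hx; apply: NS => /= /(_ I) []; exact: hx.
by move=> E _ mE; rewrite all//= integral0.
Qed.

End FundamentalLemma.

(** * The forms of the Navier-Stokes problem *)

Section Forms.
Variable R : realType.
Local Notation R2 := (measurableTypeR R * measurableTypeR R)%type.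
Implicit Types (G H : 'I_2 -> 'I_2 -> R * R -> R) (u v w : 'I_2 -> R * R -> R) (nu : R * R -> R).

(** The forms below take gradients as independent arguments: the same statements then serve for
    classical gradients of test fields and weak gradients of Sobolev fields. *)
Definition grad u : 'I_2 -> 'I_2 -> R * R -> R := fun i j => partial j (u i).
Definition symm G : 'I_2 -> 'I_2 -> R * R -> R := fun i j x => 2^-1 * (G i j x + G j i x).
Definition visc_form nu G H : R * R -> R := fun x => nu x * double_dot (symm G) (symm H) x.
Definition conv_form u G w : R * R -> R := fun x => \sum_i (\sum_j u j x * G i j x) * w i x.
Definition sq2 G := forall i j, sq (lebs R) (G i j : R2 -> R).
Definition sq1 u := forall i, sq (lebs R) (u i : R2 -> R).
Definition nsq2 G : R := \sum_i \sum_j nsq (lebs R) (G i j : R2 -> R).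
Definition nsq1 u : R := \sum_i nsq (lebs R) (u i : R2 -> R).

Lemma tf_sq (phi : R * R -> R) : tf phi -> sq (lebs R) (phi : R2 -> R).
Proof. by move=> /tf_cc h; split; [exact: cc_meas|exact/cc_ig/cc_sqr]. Qed.

Lemma sq2_grad u : (forall i, tf (u i)) -> sq2 (grad u).
Proof. by move=> h i j; apply/tf_sq/tf_partial. Qed.

Lemma sq2_symm G : sq2 G -> sq2 (symm G).
Proof. by move=> h i j; apply/sqZ/sqD. Qed.

Lemma nsq2_ge0 G : 0 <= nsq2 G.
Proof. by apply: sumr_ge0 => i _; apply: sumr_ge0 => j _; exact: nsq_ge0. Qed.

Lemma nsq1_ge0 u : 0 <= nsq1 u.
Proof. by apply: sumr_ge0 => i _; exact: nsq_ge0. Qed.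

Lemma nsq_le2 G i j : nsq (lebs R) (G i j : R2 -> R) <= nsq2 G.
Proof.
rewrite /nsq2 !sum_I2; have P a b := @nsq_ge0 _ _ _ (lebs R) (G a b : R2 -> R).
have := (P 0 0, P 0 1, P 1 0, P 1 1) => -[[[]]].
by have [->|->] := I2_case i; have [->|->] := I2_case j; move=> *; lra.
Qed.

Lemma nsq_le1 u i : nsq (lebs R) (u i : R2 -> R) <= nsq1 u.
Proof.
rewrite /nsq1 !sum_I2; have P a := @nsq_ge0 _ _ _ (lebs R) (u a : R2 -> R).
have := (P 0, P 1) => -[].
by have [->|->] := I2_case i; move=> *; lra.
Qed.

Lemma visc_formC nu G H x : visc_form nu G H x = visc_form nu H G x.
Proof.
by congr (_ * _); apply: eq_bigr => i _; apply: eq_bigr => j _; rewrite mulrC.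
Qed.

Lemma visc_formE nu G H x : visc_form nu G H x = \sum_i \sum_j (symm G i j x * (nu x * symm H i j x)).
Proof.
by rewrite /visc_form /double_dot mulr_sumr; apply: eq_bigr => i _; rewrite mulr_sumr; apply: eq_bigr => j _; ring.
Qed.

Section Viscosity.
Variables (nu : R * R -> R) (m : R).
Hypotheses (mnu : measurable_fun setT (nu : R2 -> R)) (nu1 : forall x, 1 <= nu x) (num : forall x, nu x <= m).

Let m0 : 0 <= m. Proof. by have := nu1 0; have := num 0; lra. Qed.
Let nu_norm x : `|nu x| <= m.
Proof. by rewrite ger0_norm; [exact: num|have := nu1 x; lra]. Qed.

Lemma sq_nu (h : R * R -> R) : sq (lebs R) (h : R2 -> R) -> sq (lebs R) (fun x : R2 => nu x * h x).
Proof.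
move=> hh; apply: (@sq_le _ _ _ _ _ (fun x : R2 => m * h x)); last exact: sqZ.
  by apply: measurable_funM => //; case: hh.
by move=> x; rewrite !normrM (ger0_norm m0) ler_wpM2r.
Qed.

Lemma visc_form_sum G H : sq2 G -> sq2 H -> ig (lebs R) (visc_form nu G H : R2 -> R) /\
  I2 (visc_form nu G H) = \sum_i \sum_j J (lebs R) (fun x : R2 => symm G i j x * (nu x * symm H i j x)).
Proof.
move=> /sq2_symm hG /sq2_symm hH.
have i0 i j : ig (lebs R) (fun x : R2 => symm G i j x * (nu x * symm H i j x)) by apply: sq_mul => //; exact: sq_nu.
have i1 i : ig (lebs R) (fun x : R2 => \sum_j symm G i j x * (nu x * symm H i j x)) by exact: ig_sum.
split.
  apply: (@eq_ig _ _ _ (lebs R) (fun x : R2 => \sum_i \sum_j (symm G i j x * (nu x * symm H i j x)))); last exact: ig_sum.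
  by move=> x; rewrite visc_formE.
rewrite /I2 (eq_J (lebs R) (visc_formE nu G H)) J_sum//; apply: eq_bigr => i _; by rewrite J_sum.
Qed.

Lemma visc_form_ig G H : sq2 G -> sq2 H -> ig (lebs R) (visc_form nu G H : R2 -> R).
Proof. by move=> h1 h2; case: (visc_form_sum h1 h2). Qed.

Lemma visc_form_lin c G G' H : sq2 G -> sq2 G' -> sq2 H ->
  I2 (visc_form nu (fun i j x => c * G i j x + G' i j x) H) = c * I2 (visc_form nu G H) + I2 (visc_form nu G' H).
Proof.
move=> h1 h2 h3; rewrite /I2 -(JZ _ (visc_form_ig h1 h3)) -(JD (igZ c (visc_form_ig h1 h3)) (visc_form_ig h2 h3)).
apply: eq_J => x; rewrite /visc_form /double_dot /symm !sum_I2; ring.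
Qed.

Lemma visc_form_lower G : sq2 G -> \sum_i \sum_j nsq (lebs R) (symm G i j : R2 -> R) <= I2 (visc_form nu G G).
Proof.
move=> hG; have hs := sq2_symm hG.
have i0 i j : ig (lebs R) (fun x : R2 => symm G i j x ^+ 2) by case: (hs i j).
have i1 i : ig (lebs R) (fun x : R2 => \sum_j symm G i j x ^+ 2) by exact: ig_sum.
rewrite /nsq; under eq_bigr do rewrite -J_sum//; rewrite -J_sum//.
apply: J_le; [exact: ig_sum|exact: visc_form_ig|].
move=> x; have E : double_dot (symm G) (symm G) x = \sum_i \sum_j symm G i j x ^+ 2.
  by apply: eq_bigr => i _; apply: eq_bigr => j _; rewrite expr2.
rewrite /visc_form E.
rewrite -[leLHS]mul1r ler_wpM2r//; apply: sumr_ge0 => i _; apply: sumr_ge0 => j _; exact: sqr_ge0.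
Qed.

Lemma visc_form_ge0 G : sq2 G -> 0 <= I2 (visc_form nu G G).
Proof.
move=> hG; apply: le_trans (visc_form_lower hG); apply: sumr_ge0 => i _; apply: sumr_ge0 => j _; exact: nsq_ge0.
Qed.

Lemma visc_form_lim (Gn : nat -> 'I_2 -> 'I_2 -> R * R -> R) G H : sq2 G -> sq2 H -> (forall n, sq2 (Gn n)) ->
  (forall e : R, 0 < e -> \forall n \near \oo, nsq2 (fun i j x => G i j x - Gn n i j x) <= e) ->
  (fun n => I2 (visc_form nu (Gn n) H)) @ \oo --> I2 (visc_form nu G H).
Proof.
move=> hG hH hn cv.
have hs := sq2_symm hG; have hsn n := sq2_symm (hn n); have hsH := sq2_symm hH.
have L i j : (fun n => J (lebs R) (fun x : R2 => symm (Gn n) i j x * (nu x * symm H i j x))) @ \oo -->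
    J (lebs R) (fun x : R2 => symm G i j x * (nu x * symm H i j x)).
  apply: J_sq_lim; [exact: hs|exact: sq_nu|by move=> n; exact: hsn|].
  move=> e e0; apply: filterS (cv e e0) => n; apply: le_trans.
  have d k l : sq (lebs R) (fun x : R2 => G k l x - Gn n k l x) := sqB (hG k l) (hn n k l).
  have -> : nsq (lebs R) (fun x : R2 => symm G i j x - symm (Gn n) i j x) =
      (2^-1) ^+ 2 * nsq (lebs R) (fun x : R2 => (G i j x - Gn n i j x) + (G j i x - Gn n j i x)).
    rewrite -JZ; last by case: (sqD (d i j) (d j i)).
    by apply: eq_J => x; rewrite /symm -exprMn; congr (_ ^+ 2); ring.
  have := nsqD (d i j) (d j i).
  have := nsq_le2 (fun i j x => G i j x - Gn n i j x) i j.
  have := nsq_le2 (fun i j x => G i j x - Gn n i j x) j i.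
  rewrite /=; set N := nsq2 _; set A := nsq _ _; set B := nsq _ _; set K := nsq _ _.
  by clearbody N A B K => *; lra.
pose K G' i j := J (lebs R) (fun x : R2 => symm G' i j x * (nu x * symm H i j x)).
have E G' : sq2 G' -> I2 (visc_form nu G' H) = K G' 0 0 + K G' 0 1 + (K G' 1 0 + K G' 1 1).
  by move=> h; rewrite (visc_form_sum h hH).2 sum_I2 !sum_I2.
rewrite E//; have -> : (fun n => I2 (visc_form nu (Gn n) H)) = fun n => K (Gn n) 0 0 + K (Gn n) 0 1 + (K (Gn n) 1 0 + K (Gn n) 1 1).
  by apply/funext => n; exact: E.
by apply: cvgD; apply: cvgD; exact: L.
Qed.

End Viscosity.


Section Solenoidal.
Variable O : set (R * R).

Lemma solenoidal_tf u i : solenoidal_test_field O u -> tf (u i).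
Proof. by move=> [h _]; exact: test_fun_tf (h i). Qed.

Lemma solenoidal_lin c u v : solenoidal_test_field O u -> solenoidal_test_field O v ->
  solenoidal_test_field O (c *: (u : 'I_2 -> R * R -> R) + v).
Proof.
move=> hu hv; split; first by move=> i; apply: test_funD; [apply: test_funZ; exact: hu.1|exact: hv.1].
move=> x; have E i : partial i ((c *: (u : 'I_2 -> R * R -> R) + v) i) x = c * partial i (u i) x + partial i (v i) x.
  have [su sv] := ((solenoidal_tf i hu).1, (solenoidal_tf i hv).1).
  rewrite -partialZ// -partialD//; [exact: smooth_derivable (smoothZ c su)|exact: smooth_derivable].
by under eq_bigr do rewrite E; rewrite big_split /= -mulr_sumr hu.2 hv.2 mulr0 addr0.
Qed.

Lemma solenoidal0 : solenoidal_test_field O (0 : 'I_2 -> R * R -> R).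
Proof.
split; first by move=> i; exact: test_fun_cst0.
by move=> x; rewrite big1// => i _; exact: (partial_cst 0).
Qed.

Lemma grad_lin c u v : (forall i, tf (u i)) -> (forall i, tf (v i)) ->
  grad (c *: (u : 'I_2 -> R * R -> R) + v) = fun i j x => c * grad u i j x + grad v i j x.
Proof.
move=> hu hv; apply/funext => i; apply/funext => j; apply/funext => x.
have [su sv] := ((hu i).1, (hv i).1); rewrite /grad -partialZ// -partialD//.
  exact: smooth_derivable (smoothZ c su).
exact: smooth_derivable.
Qed.

Lemma I2_swap_partials (phi psi : R * R -> R) i j : tf phi -> tf psi ->
  I2 (fun x => partial i phi x * partial j psi x) = I2 (fun x => partial j phi x * partial i psi x).
Proof.
move=> hp hq; have [sq1 sq2] := ((tf_partial i hq).1, (tf_partial j hq).1).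
rewrite (I2_parts i hp sq2) (I2_parts j hp sq1).
have E : (fun x : R * R => phi x * partial i (partial j psi) x) = (fun x : R * R => phi x * partial j (partial i psi) x).
  by apply/funext => x; rewrite (partial_comm i j x hq).
exact: (congr1 (fun f => - I2 f) E).
Qed.

(** After an exchange of derivatives, the cross terms [partial j u_i * partial i u_j] have the
    integral of the squared divergence, which is zero. *)
Lemma korn u : solenoidal_test_field O u ->
  \sum_i \sum_j nsq (lebs R) (symm (grad u) i j : R2 -> R) = 2^-1 * \sum_i grn (u i).
Proof.
move=> hu; have t i j : tf (grad u i j) by exact/tf_partial/solenoidal_tf.
have c2 i j k l : cc (fun x => grad u i j x * grad u k l x) by apply: ccM; [exact: tf_cc|exact: (tf_cc (t k l)).1].
pose p i j k l := I2 (fun x => grad u i j x * grad u k l x); pose q i j := sqn (grad u i j).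
pose n i j := nsq (lebs R) (symm (grad u) i j : R2 -> R).
have S i j : n i j = 4^-1 * (q i j + 2 * p i j j i + q j i).
  rewrite /n /p /q /sqn -I2Z// -I2D; [|exact/cc_sqr/tf_cc|exact: ccZ].
  rewrite -I2D; [|apply: ccD; [exact/cc_sqr/tf_cc|exact: ccZ]|exact/cc_sqr/tf_cc].
  rewrite -I2Z; last by apply: ccD; [apply: ccD; [exact/cc_sqr/tf_cc|exact: ccZ]|exact/cc_sqr/tf_cc].
  apply: eq_J => x; by rewrite /symm exprMn; field.
have Z : p 0 0 0 0 + 2 * p 0 0 1 1 + p 1 1 1 1 = 0.
  rewrite /p -I2Z// -I2D//; last exact: ccZ.
  rewrite -I2D//; last by apply: ccD => //; exact: ccZ.
  rewrite -[RHS](J0 (lebs R)); apply: eq_J => x.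
  have := hu.2 x; rewrite sum_I2 /grad => h.
  by transitivity ((partial 0 (u 0) x + partial 1 (u 1) x) ^+ 2); [ring|rewrite h expr0n].
have W : p 0 0 1 1 = p 0 1 1 0 by apply: I2_swap_partials; exact: solenoidal_tf.
have Q i j : p i j i j = q i j by apply: eq_J => x; rewrite expr2.
have W' : p 1 0 0 1 = p 0 1 1 0 by apply: eq_J => x; rewrite mulrC.
have gr i : grn (u i) = q i 0 + q i 1 by rewrite /grn sum_I2.
have T (s : 'I_2 -> 'I_2 -> R) : \sum_i \sum_j s i j = s 0 0 + s 0 1 + (s 1 0 + s 1 1) by rewrite !sum_I2.
rewrite (T n) (sum_I2 (fun i => grn (u i))) (gr 0) (gr 1).
have := (S 0 0, S 0 1, S 1 0, S 1 1, Q 0 0, Q 1 1, Z, W, W').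
clear; clearbody p q n => -[[[[[[[[]]]]]]]].
move: (p 0 0 0 0) (p 1 1 1 1) (p 0 0 1 1) (p 0 1 1 0) (p 1 0 0 1) (q 0 0) (q 0 1) (q 1 0) (q 1 1) (n 0 0) (n 0 1) (n 1 0) (n 1 1) => *; lra.
Qed.

Lemma conv_form_tf u v w : (forall i, tf (u i)) -> (forall i, tf (v i)) -> (forall i, tf (w i)) ->
  tf (conv_form u (grad v) w).
Proof.
move=> hu hv hw.
have t1 i j : tf (fun x => u j x * grad v i j x) by apply: tfM; [exact: hu|case: (tf_partial j (hv i))].
have E : conv_form u (grad v) w = fun x => (u 0 x * grad v 0 0 x + u 1 x * grad v 0 1 x) * w 0 x + (u 0 x * grad v 1 0 x + u 1 x * grad v 1 1 x) * w 1 x.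
  by apply/funext => x; rewrite /conv_form !sum_I2.
by rewrite E; apply: tfD; (apply: tfM; [apply: tfD; exact: t1|case: (hw 0) => //; case: (hw 1)]).
Qed.

(** As [u] is solenoidal, the sum of the two integrands is the divergence of the field
    [(v . w) u]. *)
Lemma conv_form_skew u v w : solenoidal_test_field O u -> (forall i, tf (v i)) -> (forall i, tf (w i)) ->
  I2 (conv_form u (grad v) w) = - I2 (conv_form u (grad w) v).
Proof.
move=> hu hv hw; have tu i := solenoidal_tf i hu.
have [c1 c2] := (tf_cc (conv_form_tf tu hv hw), tf_cc (conv_form_tf tu hw hv)).
apply/eqP; rewrite -addr_eq0 -I2D//; apply/eqP.
pose g x := v 0 x * w 0 x + v 1 x * w 1 x.
have tg : tf g by apply: tfD; apply: tfM => //; [case: (hw 0)|case: (hw 1)].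
have tj j : tf (fun x => u j x * g x) by apply: tfM => //; case: tg.
transitivity (I2 (fun x => partial 0 (fun x => u 0 x * g x) x + partial 1 (fun x => u 1 x * g x) x)).
  apply: eq_J => x.
  have dv i j : derivable (v i) x (unit_vec R j) by apply: smooth_derivable; case: (hv i).
  have dw i j : derivable (w i) x (unit_vec R j) by apply: smooth_derivable; case: (hw i).
  have du i j : derivable (u i) x (unit_vec R j) by apply: smooth_derivable; case: (tu i).
  have dg j : derivable g x (unit_vec R j) by apply: smooth_derivable; case: tg.
  have dvw i j : derivable (fun x => v i x * w i x) x (unit_vec R j) by apply: smooth_derivable; apply: smoothM; [case: (hv i)|case: (hw i)].
  have pg j : partial j g x = partial j (v 0) x * w 0 x + v 0 x * partial j (w 0) x + (partial j (v 1) x * w 1 x + v 1 x * partial j (w 1) x).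
    by rewrite /g partialD// !partialM.
  rewrite !partialM// !pg /conv_form !sum_I2 /grad /g.
  have := hu.2 x; rewrite sum_I2 => h.
  have -> : partial 1 (u 1) x = - partial 0 (u 0) x by apply/eqP; rewrite -addr_eq0 addrC h.
  move: (partial _ _ x) (partial _ _ x) (partial _ _ x) (partial _ _ x) (partial _ _ x) (partial _ _ x) (partial _ _ x) (partial _ _ x) (partial _ _ x) => *.
  move: (u _ x) (u _ x) (v _ x) (v _ x) (w _ x) (w _ x) => *; ring.
by rewrite I2D ?I2_partial ?addr0//; exact/tf_cc/tf_partial.
Qed.

End Solenoidal.

End Forms.

Lemma near_inv (R : realType) (e : R) : 0 < e -> \forall n \near \oo, n.+1%:R^-1 < e.
Proof.
move=> e0; have := @cvg_harmonic R => /cvgrPdist_lt/(_ e e0).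
by apply: filterS => n; rewrite /harmonic/= sub0r normrN ger0_norm// invr_ge0.
Qed.

Lemma rellich_constant (R : realFieldType) (K p q de : R) : 0 <= K -> 0 <= p -> p <= q -> 0 < q -> 0 < de ->
  K * (p * (de / (4 * (K + 1) * q))) <= de / 4.
Proof.
move=> K0 p0 pq q0 de0; have K1 : 0 < K + 1 by lra.
rewrite !mulrA ler_pdivrMr ?mulr_gt0//.
have t1 : K * p <= (K + 1) * q by apply: ler_pM => //; lra.
by have := ler_wpM2r (ltW de0) t1; lra.
Qed.

Lemma gradient_constant (R : realFieldType) (r x de : R) : 0 < r -> 0 < de -> x <= 8 * r -> de / (16 * r) * x <= de / 2.
Proof.
move=> r0 de0 xr; apply: le_trans (_ : de / (16 * r) * (8 * r) <= _).
  by rewrite ler_pM2l// divr_gt0// mulr_gt0.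
by rewrite le_eqVlt; apply/orP; left; apply/eqP; field; rewrite gt_eqF.
Qed.

Lemma weighted_young (R : realFieldType) (h x y : R) : 0 < h -> `|x * y| <= (2 * h)^-1 * x ^+ 2 + h / 2 * y ^+ 2.
Proof.
move=> h0; rewrite -subr_ge0.
have h2 : 0 <= (2 * h)^-1 by rewrite invr_ge0 mulr_ge0// ltW.
rewrite -(real_normK (num_real x)) -(real_normK (num_real y)) normrM.
have -> : (2 * h)^-1 * `|x| ^+ 2 + h / 2 * `|y| ^+ 2 - `|x| * `|y| = (2 * h)^-1 * (`|x| - h * `|y|) ^+ 2.
  by field; rewrite gt_eqF.
by rewrite mulr_ge0// sqr_ge0.
Qed.

(** The differences receive the large factor [1 / h], and compactness will make them small; the
    bounded norms receive the small factor [h]. *)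
Lemma product_difference (R : realFieldType) (W h g p q r s : R) : 0 < h -> `|g| <= W ->
  `|g * (p * q - r * s)| <= W * ((2 * h)^-1 * ((p - r) ^+ 2 + (q - s) ^+ 2) + h / 2 * (q ^+ 2 + r ^+ 2)).
Proof.
move=> h0 gW; rewrite normrM; apply: ler_pM => //.
have -> : p * q - r * s = (p - r) * q + (q - s) * r by ring.
apply: le_trans (ler_normD _ _) _.
have := lerD (weighted_young (p - r) q h0) (weighted_young (q - s) r h0).
by move/le_trans; apply; rewrite le_eqVlt; apply/orP; left; apply/eqP; ring.
Qed.

Lemma conv_difference (R : realFieldType) (W h g00 g01 g10 g11 u0 u1 v0 v1 : R) : 0 < h ->
  `|g00| <= W -> `|g01| <= W -> `|g10| <= W -> `|g11| <= W ->
  `|(u0 * g00 + u1 * g01) * u0 + (u0 * g10 + u1 * g11) * u1 - ((v0 * g00 + v1 * g01) * v0 + (v0 * g10 + v1 * g11) * v1)|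
  <= W * (2 / h * ((u0 - v0) ^+ 2 + (u1 - v1) ^+ 2) + h * (u0 ^+ 2 + u1 ^+ 2 + (v0 ^+ 2 + v1 ^+ 2))).
Proof.
move=> h0 w1 w2 w3 w4.
have -> : (u0 * g00 + u1 * g01) * u0 + (u0 * g10 + u1 * g11) * u1 - ((v0 * g00 + v1 * g01) * v0 + (v0 * g10 + v1 * g11) * v1)
  = (g00 * (u0 * u0 - v0 * v0) + g01 * (u1 * u0 - v1 * v0)) + (g10 * (u0 * u1 - v0 * v1) + g11 * (u1 * u1 - v1 * v1)) by ring.
apply: le_trans (ler_normD _ _) _; apply: le_trans (lerD (ler_normD _ _) (ler_normD _ _)) _.
apply: le_trans (lerD (lerD (product_difference u0 u0 v0 v0 h0 w1) (product_difference u1 u0 v1 v0 h0 w2))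
  (lerD (product_difference u0 u1 v0 v1 h0 w3) (product_difference u1 u1 v1 v1 h0 w4))) _.
by rewrite le_eqVlt; apply/orP; left; apply/eqP; field; rewrite gt_eqF.
Qed.

Lemma rellich_sum (R : realFieldType) (A B X Y Z de : R) : A <= X + Z -> B <= Y + Z -> X + Y <= de / 2 -> Z <= de / 4 -> A + B <= de.
Proof. by move=> *; lra. Qed.

Lemma conv_constant (R : realFieldType) (W c d x y : R) : 0 < W -> 0 <= c -> 0 < d -> x <= c -> y <= c ->
  W * (d / (4 * W * (c + 1)) * (x + y)) <= d / 2.
Proof.
move=> W0 c0 d0 xc yc; have c1 : 0 < c + 1 by lra.
have h0 : 0 < d / (4 * W * (c + 1)) by rewrite divr_gt0// !mulr_gt0.
apply: le_trans (_ : W * (d / (4 * W * (c + 1)) * (2 * (c + 1))) <= _).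
  by rewrite ler_pM2l// ler_pM2l//; lra.
rewrite le_eqVlt; apply/orP; left; apply/eqP; field; by rewrite !gt_eqF.
Qed.

(** * Approximate solutions among solenoidal test fields *)

Section WeakSolutions.
Variable R : realType.
Local Notation R2 := (measurableTypeR R * measurableTypeR R)%type.
Local Notation E := ('I_2 -> R * R -> R).
Implicit Types (u v w : E).
Variables (O : set (R * R)) (M : R) (nu : R * R -> R) (m : R) (f : E).
Hypotheses (M0 : 0 < M) (OM : forall x, O x -> `|x| <= M).
Hypotheses (mnu : measurable_fun setT (nu : R2 -> R)) (nu1 : forall x, 1 <= nu x) (num : forall x, nu x <= m).
Hypothesis (hf : sq1 f).

Let D (u : E) : Prop := solenoidal_test_field O u.
Let a u v := I2 (visc_form nu (grad u) (grad v)).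
Let b u v w := I2 (conv_form u (grad v) w).
Let F w := \sum_i J (lebs R) (fun x : R2 => f i x * w i x).
Let s1 u := \sum_i sqn (u i).

Let Dt u i : D u -> tf (u i). Proof. exact: solenoidal_tf. Qed.
Let Dg u : D u -> sq2 (grad u). Proof. by move=> h; apply: sq2_grad => i; exact: Dt. Qed.
Let Dout u i x : D u -> M < `|x| -> u i x = 0.
Proof.
by move=> h Mx; apply: (test_fun0 (h.1 i)) => /OM; rewrite leNgt Mx.
Qed.

Let D0 : D 0. Proof. exact: solenoidal0. Qed.
Let DL c u v : D u -> D v -> D (c *: u + v). Proof. exact: solenoidal_lin. Qed.
Let aC u v : D u -> D v -> a u v = a v u.
Proof. by move=> hu hv; apply: eq_J => x; exact: visc_formC. Qed.
Let aL c u v w : D u -> D v -> D w -> a (c *: u + v) w = c * a u w + a v w.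
Proof.
move=> hu hv hw; rewrite /a grad_lin; [|by move=> i; exact: Dt|by move=> i; exact: Dt].
exact (visc_form_lin mnu nu1 num c (Dg hu) (Dg hv) (Dg hw)).
Qed.
Let a0 u : D u -> 0 <= a u u.
Proof. by move=> hu; exact: (visc_form_ge0 mnu nu1 num (Dg hu)). Qed.

Lemma energy_lower u : D u -> \sum_i grn (u i) <= 2 * a u u.
Proof.
move=> hu; have := visc_form_lower mnu nu1 num (Dg hu); rewrite (korn hu) -/(a u u) mulrC ler_pdivrMr// mulrC //.
Qed.

Let poincareD : exists C, 0 <= C /\ forall u, D u -> s1 u <= C * a u u.
Proof.
have [C [C0 HC]] := poincare M0; exists (C * 2); split; first by rewrite mulr_ge0.
move=> u hu; rewrite -mulrA; apply: le_trans (ler_wpM2l C0 (energy_lower hu)).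
rewrite mulr_sumr; apply: ler_sum => i _; apply: HC; first exact: Dt.
by move=> x; exact: Dout.
Qed.

Let bt u v w : D u -> D v -> D w -> cc (conv_form u (grad v) w).
Proof. by move=> hu hv hw; apply/tf_cc/conv_form_tf => i; exact: Dt. Qed.

Let conv_lin1 c u v w z x : conv_form (c *: u + v) (grad w) z x = c * conv_form u (grad w) z x + conv_form v (grad w) z x.
Proof.
have e i y : (c *: u + v) i y = c * u i y + v i y by [].
rewrite /conv_form !sum_I2 !e.
move: (u _ x) (u _ x) (v _ x) (v _ x) (grad w _ _ x) (grad w _ _ x) (grad w _ _ x) (grad w _ _ x) (z _ x) (z _ x); clear; move=> *; ring.
Qed.

Let conv_lin3 c u v w z x : conv_form w (grad z) (c *: u + v) x = c * conv_form w (grad z) u x + conv_form w (grad z) v x.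
Proof.
have e i y : (c *: u + v) i y = c * u i y + v i y by [].
rewrite /conv_form !sum_I2 !e.
move: (u _ x) (u _ x) (v _ x) (v _ x) (grad z _ _ x) (grad z _ _ x) (grad z _ _ x) (grad z _ _ x) (w _ x) (w _ x); clear; move=> *; ring.
Qed.

Let conv_lin2 c u v w z x : D u -> D v -> conv_form w (grad (c *: u + v)) z x = c * conv_form w (grad u) z x + conv_form w (grad v) z x.
Proof.
move=> hu hv; rewrite grad_lin; [|by move=> i; exact: Dt|by move=> i; exact: Dt].
rewrite /conv_form !sum_I2.
move: (grad u _ _ x) (grad u _ _ x) (grad u _ _ x) (grad u _ _ x) (grad v _ _ x) (grad v _ _ x) (grad v _ _ x) (grad v _ _ x) (w _ x) (w _ x) (z _ x) (z _ x); clear; move=> *; ring.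
Qed.

Let b_eq (g p q : R * R -> R) (c : R) : cc p -> cc q -> (forall x, g x = c * p x + q x) -> I2 g = c * I2 p + I2 q.
Proof. by move=> hp hq e; rewrite -I2Z// -I2D//; [exact: eq_J|exact: ccZ]. Qed.

Let bL1 c u v w z : D u -> D v -> D w -> D z -> b (c *: u + v) w z = c * b u w z + b v w z.
Proof. by move=> *; apply: b_eq; [exact: bt|exact: bt|move=> x; exact: conv_lin1]. Qed.
Let bL2 c u v w z : D u -> D v -> D w -> D z -> b w (c *: u + v) z = c * b w u z + b w v z.
Proof. by move=> *; apply: b_eq; [exact: bt|exact: bt|move=> x; exact: conv_lin2]. Qed.
Let bL3 c u v w z : D u -> D v -> D w -> D z -> b w z (c *: u + v) = c * b w z u + b w z v.
Proof. by move=> *; apply: b_eq; [exact: bt|exact: bt|move=> x; exact: conv_lin3]. Qed.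
Let bS u v w : D u -> D v -> D w -> b u v w = - b u w v.
Proof. by move=> hu hv hw; exact: (conv_form_skew hu (fun i => Dt i hv) (fun i => Dt i hw)). Qed.
Let b0 u : D u -> b u u u = 0.
Proof. by move=> h; have := bS h h h; lra. Qed.

Let i_F i w : D w -> ig (lebs R) (fun x : R2 => f i x * w i x).
Proof. by move=> hw; apply: sq_mul => //; apply: tf_sq; exact: Dt. Qed.

Let Fl c u v : D u -> D v -> F (c *: u + v) = c * F u + F v.
Proof.
move=> hu hv; rewrite /F mulr_sumr -big_split /=; apply: eq_bigr => i _.
rewrite -(JZ _ (i_F i hu)) -(JD (igZ c (i_F i hu)) (i_F i hv)); apply: eq_J => x.
have -> : (c *: u + v) i x = c * u i x + v i x by []; ring.
Qed.

Let FC : exists CF, 0 < CF /\ forall v, D v -> F v ^+ 2 <= CF * a v v.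
Proof.
have [C [C0 HC]] := poincareD; pose N := nsq1 f; have N0 : 0 <= N := nsq1_ge0 f.
exists (2 * N * C + 1); split; first by rewrite ltr_pwDr// mulr_ge0// mulr_ge0.
move=> v hv.
have h i : J (lebs R) (fun x : R2 => f i x * v i x) ^+ 2 <= N * sqn (v i).
  apply: le_trans (sq_CS (hf i) (tf_sq (Dt i hv))) _.
  by apply: ler_wpM2r; [exact: sqn_ge0|exact: nsq_le1].
have h2 : F v ^+ 2 <= 2 * (N * s1 v).
  rewrite /F /s1 !sum_I2; have := (h 0, h 1) => -[]; set A := J _ _; set B := J _ _.
  have := sqrB_le A (- B); rewrite opprK sqrrN.
  move: (sqn _) (sqn _) => p q; clearbody N A B => e e1 e2.
  by apply: le_trans e _; rewrite mulrDr mulrDr; apply: lerD; rewrite ler_pM2l.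
apply: le_trans h2 _; rewrite mulrA; apply: le_trans (ler_wpM2l _ (HC v hv)) _; first by rewrite mulr_ge0.
by rewrite mulrA ler_wpM2r ?a0//; lra.
Qed.
(* The products [u_j u_i] depend on [u] compactly: Young's inequality reduces to
   the L^2 norm of the difference, which Rellich controls by finitely many
   functionals, each of them almost represented by a field of [D]. *)
Let bcomp w : D w -> forall r d : R, 0 < d -> exists (s : seq E) (eta : R),
  [/\ 0 < eta, forall z, z \in s -> D z & forall u v, D u -> D v -> a u u <= r -> a v v <= r ->
    (forall z, z \in s -> `|a (u - v) z| <= eta) -> `|b u u w - b v v w| <= d].
Proof.
move=> hw r d d0; pose r1 := `|r| + 1.
have r10 : 0 < r1 by rewrite /r1; have := normr_ge0 r; lra.
have rr1 : r <= r1 by rewrite /r1; have := ler_norm r; lra.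
have [W [W0 HW]] : exists W : R, 0 < W /\ forall i j x, `|grad w i j x| <= W.
  have /choice[C HC] (ij : 'I_2 * 'I_2) := tf_bounded (tf_partial ij.2 (Dt ij.1 hw)).
  exists (C (0, 0) + C (0, 1) + (C (1, 0) + C (1, 1))).
  have [[p1 q1] [p2 q2] [p3 q3] [p4 q4]] := And4 (HC (0, 0)) (HC (0, 1)) (HC (1, 0)) (HC (1, 1)).
  split; first lra.
  move=> i j x; have [_ h] := HC (i, j); apply: le_trans (h x) _.
  by have [->|->] := I2_case i; have [->|->] := I2_case j; lra.
have [C [C0 HC]] := poincareD.
(* Makes [W h (s1 u + s1 v)] at most [d / 2], since [s1] is at most [C r1]; then [de] is chosen to
   bound [W (2 / h) s1 (u - v)] likewise. *)
pose h := d / (4 * W * (C * r1 + 1)).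
have Cr : 0 < C * r1 + 1 by rewrite ltr_wpDl// mulr_ge0// ltW.
have h0 : 0 < h by rewrite divr_gt0// mulr_gt0// mulr_gt0.
pose de := d * h / (4 * W).
have de0 : 0 < de by rewrite divr_gt0// mulr_gt0.
(* The difference will have energy at most [4 r1], so its Dirichlet integral is at most [8 r1] and
   the gradient term of Rellich's inequality at most [de / 2]. *)
have e80 : 0 < de / (16 * r1) by rewrite divr_gt0// mulr_gt0.
have [K [s [K0 hs HK]]] := rellich M0 e80.
pose l (ik : 'I_2 * nat) u := I2 (fun x => u ik.1 x * nth (fun=> 0 : R) s ik.2 x).
have cl ik u : D u -> (ik.2 < size s)%N -> cc (fun x => u ik.1 x * nth (fun=> 0 : R) s ik.2 x).
  move=> hu ks; have [c _] := hs _ ks; exact: ccM (tf_cc (Dt ik.1 hu)) c.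
have ll ik : (ik.2 < size s)%N -> lin D (l ik).
  move=> ks c u v hu hv; apply: b_eq; [exact: cl|exact: cl|] => x.
  have -> : (c *: u + v) ik.1 x = c * u ik.1 x + v ik.1 x by []; ring.
pose N := (size s).+1.
pose e2 := de / (4 * (K + 1) * N%:R).
have N0 : 0 < N%:R :> R by rewrite ltr0n.
have K1 : 0 < K + 1 by lra.
have e20 : 0 < e2 by rewrite divr_gt0// mulr_gt0// mulr_gt0.
(* On the set where [a e e <= 4 r1], the functional [l ik] is [a _ z] up to a small error, for some
   [z] of [D] itself. *)
have repr ik : exists z : E, D z /\ ((ik.2 < size s)%N -> forall e, D e -> a e e <= 4 * r1 -> `|a e z| ^+ 2 <= e2 / 4 -> l ik e ^+ 2 <= e2).
  have [ks|ks] := boolP (ik.2 < size s)%N; last by exists 0; split.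
  have lb u : D u -> l ik u ^+ 2 <= (C * sqn (nth (fun=> 0 : R) s ik.2)) * a u u.
    move=> hu; have := I2_CS (tf_cc (Dt ik.1 hu)) (hs _ ks); move=> /le_trans; apply.
    rewrite -/(sqn (u ik.1)) -/(sqn (nth _ _ _)) mulrAC; apply: ler_wpM2r; first exact: sqn_ge0.
    apply: le_trans (HC u hu); rewrite /s1 sum_I2; have := (sqn_ge0 (u 0), sqn_ge0 (u 1)) => -[p0 p1].
    by have [->|->] := I2_case ik.1; rewrite ?lerDl ?lerDr.
  have [|z [hz Hz]] := riesz_seq D0 DL aC aL a0 _ (ll ik ks) lb; first by rewrite mulr_ge0 ?sqn_ge0.
  have e3 : 0 < e2 / (16 * r1) by apply: divr_gt0 => //; exact: mulr_gt0.
  have rc := near_inv e3.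
  have [n hn] := filter_ex rc; exists (z n); split => // _ e he ae aez.
  have q1 : n.+1%:R^-1 * a e e <= e2 / 4.
    apply: le_trans (ler_wpM2l _ ae) _; first by rewrite invr_ge0.
    move: hn; set q := n.+1%:R^-1; rewrite ltr_pdivlMr ?mulr_gt0//; clearbody q; nra.
  have q2 : (a e (z n) - l ik e) ^+ 2 <= e2 / 4 by rewrite (aC he (hz n)); exact: le_trans (Hz n e he) q1.
  rewrite (real_normK (num_real _)) in aez.
  have q3 : l ik e ^+ 2 <= 2 * a e (z n) ^+ 2 + 2 * (a e (z n) - l ik e) ^+ 2.
    by have := sqrB_le (a e (z n)) (a e (z n) - l ik e); rewrite subKr.
  apply: le_trans q3 _.
  have -> : e2 = 2 * (e2 / 4) + 2 * (e2 / 4) by field.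
  by apply: lerD; rewrite ler_pM2l.
have /choice[z Hz] := repr.
exists [seq z (i, k) | i <- enum 'I_2, k <- iota 0 (size s)], (Num.sqrt (e2 / 4)); split.
- by rewrite sqrtr_gt0 divr_gt0.
- by move=> _ /allpairsP[[i k] [_ _ ->]]; case: (Hz (i, k)).
move=> u v hu hv au av Hs; pose e := u - v.
have he : D e by exact: (DB DL).
have ae : a e e <= 4 * r1.
  have ee : e = -1 *: v + u by rewrite scaleN1r addrC.
  have := a0 (DL 1 hv hu); have := a_expand DL aC aL 1 hu hv; have := a_expand DL aC aL (-1) hu hv.
  rewrite -ee => -> ->.
  by move: (a u u) (a v v) (a u v) au av => A B X; lra.
have se : s1 e <= de.
  have le i k : (k < size s)%N -> l (i, k) e ^+ 2 <= e2.
    move=> ks; case: (Hz (i, k)) => _ /(_ ks e he ae); apply.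
    have /Hs : z (i, k) \in [seq z (i, k) | i <- enum 'I_2, k <- iota 0 (size s)].
      by apply/allpairsP; exists (i, k); split; [rewrite mem_enum|rewrite mem_iota add0n|].
    rewrite -/e -ler_sqr ?nnegrE ?sqrtr_ge0// sqr_sqrtr//; by rewrite divr_ge0// ltW.
  have h1 i : sqn (e i) <= de / (16 * r1) * grn (e i) + K * ((size s)%:R * e2).
    apply: le_trans (HK _ (Dt i he) (fun x => Dout i he)) _; rewrite lerD2l.
    apply: ler_wpM2l => //; rewrite mulr_natl.
    have <- : \sum_(k < size s) e2 = e2 *+ size s by rewrite sumr_const card_ord.
    by apply: ler_sum => k _; exact: (le i k (ltn_ord k)).
  have h2 := energy_lower he.
  have h3 : K * ((size s)%:R * e2) <= de / 4.
    by apply: rellich_constant => //; rewrite ler_nat.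
  have h4 : de / (16 * r1) * \sum_i grn (e i) <= de / 2.
    apply: gradient_constant => //; apply: le_trans h2 _.
    by rewrite (_ : 8 * r1 = 2 * (4 * r1)); [rewrite ler_pM2l|rewrite mulrA -natrM].
  rewrite /s1 sum_I2; apply: rellich_sum (h1 0) (h1 1) _ h3.
  by move: h4; rewrite sum_I2 mulrDr.
have cq (p : R * R -> R) : tf p -> cc (fun x => p x ^+ 2) by move=> /tf_cc/cc_sqr.
pose sp (u : E) x := u 0 x ^+ 2 + u 1 x ^+ 2.
have csp (t : E) : D t -> cc (sp t) by move=> hx; apply: ccD; apply: cq; exact: Dt.
have isp (t : E) : D t -> I2 (sp t) = s1 t by move=> hx; rewrite /s1 sum_I2 I2D//; apply: cq; exact: Dt.
(* Skew-symmetry puts the derivative on [w], fixed and with bounded gradient: [u] and [v] then occur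
   undifferentiated. *)
rewrite bS// (bS hv hv hw) -opprD normrN -I2B; [|exact: bt|exact: bt].
have key x : `|conv_form u (grad w) u x - conv_form v (grad w) v x| <= W * (2 / h * sp e x + h * (sp u x + sp v x)).
  rewrite /conv_form !sum_I2; apply: conv_difference => //; exact: HW.
apply: le_trans (_ : I2 (fun x => W * (2 / h * sp e x + h * (sp u x + sp v x))) <= _).
  have i2 : cc (fun x => W * (2 / h * sp e x + h * (sp u x + sp v x))).
    by apply: ccZ; apply: ccD; apply: ccZ; [exact: csp|apply: ccD; exact: csp].
  apply: J_le_norm; [apply: cc_ig; apply: ccB; exact: bt|exact: cc_ig|exact: key].
have c1 := csp e he; have c2 := csp u hu; have c3 := csp v hv.
have c4 : cc (fun x => sp u x + sp v x) := ccD c2 c3.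
have -> : I2 (fun x => W * (2 / h * sp e x + h * (sp u x + sp v x))) = W * (2 / h * s1 e + h * (s1 u + s1 v)).
  rewrite I2Z; last by apply: ccD; exact: ccZ.
  rewrite I2D; [|exact: ccZ|exact: ccZ].
  congr (W * (_ + _)); first by rewrite I2Z// isp.
  by rewrite (I2Z h c4) I2D// !isp.
have su : s1 u <= C * r1 by apply: le_trans (HC u hu) _; apply: ler_wpM2l => //; exact: le_trans au rr1.
have sv : s1 v <= C * r1 by apply: le_trans (HC v hv) _; apply: ler_wpM2l => //; exact: le_trans av rr1.
have t1 : W * (2 / h * s1 e) <= d / 2.
  have h' : 0 <= 2 / h by rewrite divr_ge0// ltW.
  apply: le_trans (ler_wpM2l (ltW W0) (ler_wpM2l h' se)) _; rewrite /de le_eqVlt; apply/orP; left; apply/eqP; field.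
  by rewrite !gt_eqF.
have t2 : W * (h * (s1 u + s1 v)) <= d / 2.
  by apply: conv_constant => //; rewrite mulr_ge0// ltW.
by rewrite mulrDr (splitr d); exact: lerD.
Qed.

Lemma solenoidal_weak_solution_seq : exists v : nat -> E, [/\ forall n, solenoidal_test_field O (v n),
  forall m n, \sum_i grn (fun x => v m i x - v n i x) <= 4 * m.+1%:R^-1 + 4 * n.+1%:R^-1 &
  forall w, solenoidal_test_field O w -> forall d : R, 0 < d ->
    \forall n \near \oo, `|I2 (visc_form nu (grad (v n)) (grad w)) + I2 (conv_form (v n) (grad (v n)) w)
      - \sum_i J (lebs R) (fun x : R2 => f i x * w i x)| <= d].
Proof.
have [CF [CF0 HF]] := FC.
have [v [v1 v2 v3]] := weak_solution_seq D0 DL aC aL a0 bL1 bL2 bL3 b0 Fl CF0 HF bcomp.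
exists v; split => // k n; have := energy_lower (DB DL (v1 k) (v1 n)).
move/le_trans; apply; apply: le_trans (ler_wpM2l _ (v2 k n)) _ => //.
by rewrite mulrDr !mulrA -natrM.
Qed.

End WeakSolutions.

(** * Sobolev fields *)

Section SobolevGlue.
Variable R : realType.
Local Notation R2 := (measurableTypeR R * measurableTypeR R)%type.
Implicit Types (g h phi : R * R -> R) (u v w : vfield R).

Lemma L2_sq (O : set (R * R)) g : L2 O g <-> sq (lebs R) (g \_ O : R2 -> R).
Proof.
split; first by move=> h; split; [exact: (set_mem (sub_Lfun_mfun h))|exact: Lfun2_integrable_sqr h].
move=> [mg ig2]; rewrite /L2 inE; apply/andP; rewrite !inE; split => //=.
rewrite /finite_norm unlock; apply: poweR_lty.
have E : (\int[leb2 R]_x `|((g \_ O) x)%:E| `^ 2 = \int[lebs R]_x `|((g \_ O) x ^+ 2)%:E|)%E.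
  apply: eq_integral => x _; rewrite /= powR_mulrn// real_normK ?num_real//.
  by rewrite ger0_norm// sqr_ge0.
by rewrite E; have /integrableP[_] := ig2.
Qed.

Lemma Rintegral_ext (O : set (R * R)) g h : (forall x, O x -> g x = h x) -> (forall x, ~ O x -> h x = 0) ->
  \int[leb2 R]_(x in O) g x = J (lebs R) (h : R2 -> R).
Proof.
move=> gh h0; rewrite Rintegral_mkcond; congr (Rintegral _ _ _); apply/funext => x.
by rewrite patchE; have [Ox|Ox] := pselect (O x); [rewrite mem_set// gh|rewrite memNset// h0].
Qed.

Lemma restrict_out (O : set (R * R)) g x : ~ O x -> (g \_ O) x = 0.
Proof. by move=> nO; rewrite patchE memNset. Qed.

Lemma restrict_in (O : set (R * R)) g x : O x -> (g \_ O) x = g x.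
Proof. by move=> Ox; rewrite patchE mem_set. Qed.

Lemma restrict_id (O : set (R * R)) g : (forall x, ~ O x -> g x = 0) -> g \_ O = g.
Proof. by move=> g0; apply/funext => x; have [Ox|Ox] := pselect (O x); [rewrite restrict_in|rewrite restrict_out// g0]. Qed.

Section Domain.
Variables (O : set (R * R)) (M : R).
Hypotheses (oO : open O) (OM : forall x, O x -> `|x| <= M).

Definition zext u : vfield R := fun i => (u i) \_ O.
Definition wgrad u : 'I_2 -> 'I_2 -> R * R -> R := fun i j => (wpartial O j (u i)) \_ O.

Lemma sq_restrict_le g : sq (lebs R) (g : R2 -> R) -> sq (lebs R) (g \_ O : R2 -> R).
Proof.
move=> sg; apply: (sq_le _ _ sg).
  have -> : (g \_ O : R2 -> R) = (fun x : R2 => g x * \1_O x).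
    by apply/funext => x; rewrite patchE indicE; case: (x \in O); rewrite ?mulr1 ?mulr0.
  apply: measurable_funM; first by case: sg.
  by apply: measurable_indic; exact: open_measurable_plane.
by move=> x; rewrite patchE; case: (x \in O); rewrite ?normr0.
Qed.

Lemma sq_ig_bounded g : (forall x, ~ O x -> g x = 0) -> sq (lebs R) (g : R2 -> R) -> ig (lebs R) (g : R2 -> R).
Proof.
move=> g0 sg; have sO : sq (lebs R) (\1_[set x : R * R | `|x| <= M] : R2 -> R).
  have ib := ig_box (M : R); split; first exact: (ig_meas ib).
  by apply: eq_ig ib => x; rewrite !indicE; case: (_ \in _); rewrite ?expr1n ?expr0n.
apply: eq_ig (sq_mul sg sO) => x; have [Ox|Ox] := pselect (O x); last by rewrite g0// mul0r.
by rewrite indicE mem_set ?mulr1//=; exact: OM.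
Qed.

Lemma weak_partialE j g h : is_weak_partial O j g h <-> sq (lebs R) (h \_ O : R2 -> R) /\
  forall phi, test_fun O phi -> I2 (fun x => (g \_ O) x * partial j phi x) = - I2 (fun x => (h \_ O) x * phi x).
Proof.
have E g' phi : \int[leb2 R]_(x in O) (g' x * phi x) = I2 (fun x => (g' \_ O) x * phi x).
  by apply: Rintegral_ext => x Ox; [rewrite restrict_in|rewrite restrict_out// mul0r].
split => [[/L2_sq h1 h2]|[h1 h2]]; split => //; last 2 first.
- exact/L2_sq.
- by move=> phi tp; rewrite !E h2.
by move=> phi tp; have := h2 phi tp; rewrite !E.
Qed.

Lemma weak_partial_unique j g h h' : is_weak_partial O j g h -> is_weak_partial O j g h' ->
  {ae lebs R, forall x, (h \_ O) x = (h' \_ O) x}.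
Proof.
move=> /weak_partialE[s1 H1'] /weak_partialE[s2 H2'].
have out x : ~ O x -> (h \_ O) x - (h' \_ O) x = 0 by move=> nO; rewrite !restrict_out// subrr.
have := @fundamental_lemma _ O (fun x => (h \_ O) x - (h' \_ O) x) M oO OM _ out.
case.
- by apply: igB; apply: sq_ig_bounded => //; exact: restrict_out.
- move=> phi tp; have ts := tf_sq (test_fun_tf tp).
  have -> : I2 (fun x => ((h \_ O) x - (h' \_ O) x) * phi x) = I2 (fun x => (h \_ O) x * phi x) - I2 (fun x => (h' \_ O) x * phi x).
    by rewrite /I2 -JB; [apply: eq_J => x; rewrite mulrBl|exact: sq_mul|exact: sq_mul].
  by have := (H1' phi tp, H2' phi tp) => -[-> /oppr_inj ->]; rewrite subrr.
- by move=> N [mN N0 NS]; exists N; split => // x /= hx; apply: NS => /= /subr0_eq.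
Qed.

Lemma wpartialP j g h : is_weak_partial O j g h -> is_weak_partial O j g (wpartial O j g).
Proof. by move=> hh; apply: (@getPex _ [set h | is_weak_partial O j g h]); exists h. Qed.

Lemma test_weak_partial j phi : test_fun O phi -> is_weak_partial O j phi (partial j phi).
Proof.
move=> tp; have t := test_fun_tf tp.
have t0 x : ~ O x -> phi x = 0 by exact: test_fun0.
have d0 x : ~ O x -> partial j phi x = 0.
  move=> nO; apply: (test_fun0 (O := O)) nO; exact: test_fun_partial.
apply/weak_partialE; rewrite !restrict_id//; split; first exact/tf_sq/tf_partial.
move=> psi tq; rewrite (I2_parts j t) ?opprK//; by case: (test_fun_tf tq).
Qed.

Lemma weak_partialB j g g' h h' : L2 O g -> L2 O g' -> is_weak_partial O j g h -> is_weak_partial O j g' h' ->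
  is_weak_partial O j (fun x => g x - g' x) (fun x => h x - h' x).
Proof.
move=> /L2_sq sg /L2_sq sg' /weak_partialE[s1 H1'] /weak_partialE[s2 H2']; apply/weak_partialE.
have rB f1 f2 : (fun x => f1 x - f2 x) \_ O = (fun x => (f1 \_ O) x - (f2 \_ O) x : R).
  by apply/funext => x; rewrite !patchE; case: (x \in O); rewrite ?subr0.
rewrite !rB; split; first exact: sqB.
move=> phi tp; have ts := tf_sq (test_fun_tf tp); have ts' := tf_sq (tf_partial j (test_fun_tf tp)).
have E (f1 f2 f3 : R * R -> R) : sq (lebs R) (f1 : R2 -> R) -> sq (lebs R) (f2 : R2 -> R) -> sq (lebs R) (f3 : R2 -> R) ->
    I2 (fun x => (f1 x - f2 x) * f3 x) = I2 (fun x => f1 x * f3 x) - I2 (fun x => f2 x * f3 x).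
  by move=> *; rewrite /I2 -JB; [apply: eq_J => x; rewrite mulrBl|exact: sq_mul|exact: sq_mul].
by rewrite !E// H1'// H2'// opprD.
Qed.

Lemma H1_sq1 u : H1 O u -> sq1 (zext u).
Proof. by move=> h i; have [/L2_sq] := h i. Qed.

Lemma H1_wp u i j : H1 O u -> is_weak_partial O j (u i) (wpartial O j (u i)).
Proof. by move=> h; have [_ /(_ j)[k hk]] := h i; exact: wpartialP hk. Qed.

Lemma H1_sq2 u : H1 O u -> sq2 (wgrad u).
Proof. by move=> h i j; have [/L2_sq] := H1_wp i j h. Qed.

Lemma H1normE u : H1 O u -> H1norm O u = (Num.sqrt (nsq1 (zext u) + nsq2 (wgrad u)))%:E.
Proof.
move=> h; have s1 := H1_sq1 h; have s2 := H1_sq2 h.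
pose F (x : R2) := \sum_i ((zext u i x) ^+ 2 + \sum_j (wgrad u i j x) ^+ 2).
have i1 i : ig (lebs R) (fun x : R2 => (zext u i x) ^+ 2) by case: (s1 i).
have i2 i j : ig (lebs R) (fun x : R2 => (wgrad u i j x) ^+ 2) by case: (s2 i j).
have i3 i : ig (lebs R) (fun x : R2 => \sum_j (wgrad u i j x) ^+ 2) by exact: ig_sum.
have i4 i : ig (lebs R) (fun x : R2 => (zext u i x) ^+ 2 + \sum_j (wgrad u i j x) ^+ 2) by exact: igD.
have iF : ig (lebs R) F by exact: ig_sum.
have JF : J (lebs R) F = nsq1 (zext u) + nsq2 (wgrad u).
  by rewrite /nsq1 /nsq2 /F J_sum// -big_split /=; apply: eq_bigr => i _; rewrite JD// J_sum.
rewrite /H1norm integral_mkcond -JF.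
have -> : (\int[leb2 R]_x ((fun x => (\sum_i (u i x ^+ 2 + \sum_j wpartial O j (u i) x ^+ 2))%:E) \_ O) x)%E = (J (lebs R) F)%:E.
  rewrite EFin_J//; apply: eq_integral => x _; rewrite patchE /F /zext /wgrad.
  have [Ox|Ox] := pselect (O x).
    rewrite mem_set//; congr EFin; apply: eq_bigr => i _; rewrite restrict_in//; congr (_ + _).
    by apply: eq_bigr => j _; rewrite restrict_in.
  rewrite memNset//; congr EFin; rewrite big1// => i _; rewrite restrict_out// expr0n add0r big1// => j _.
  by rewrite restrict_out// expr0n.
rewrite poweR_EFin -powR12_sqrt ?JF ?addr_ge0 ?nsq1_ge0 ?nsq2_ge0//.
Qed.

End Domain.
End SobolevGlue.

Section ProductLimits.
Context d (T : measurableType d) (R : realType).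
Variable mu : {measure set T -> \bar R}.
Implicit Types f g h : T -> R.

Lemma eq_nsq_ae f g : measurable_fun setT f -> measurable_fun setT g -> {ae mu, forall x, f x = g x} -> nsq mu f = nsq mu g.
Proof.
move=> mf mg fg; apply: J_ae; [exact: msq|exact: msq|].
by apply: filterS fg => x ->.
Qed.

Lemma sq_prod f g : measurable_fun setT f -> measurable_fun setT g ->
  sq mu (fun x => f x ^+ 2) -> sq mu (fun x => g x ^+ 2) ->
  sq mu (fun x => f x * g x) /\ nsq mu (fun x => f x * g x) ^+ 2 <= nsq mu (fun x => f x ^+ 2) * nsq mu (fun x => g x ^+ 2).
Proof.
move=> mf mg sf sg; split; last first.
  apply: le_trans (sq_CS sf sg); rewrite le_eqVlt; apply/orP; left; apply/eqP; congr (_ ^+ 2).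
  by apply: eq_J => x; rewrite exprMn.
split; first exact: measurable_funM.
by apply: eq_ig (sq_mul sf sg) => x; rewrite exprMn.
Qed.

Lemma J_sq_lim2 (fn gn : nat -> T -> R) f g : sq mu f -> sq mu g -> (forall n, sq mu (fn n)) -> (forall n, sq mu (gn n)) ->
  (forall e : R, 0 < e -> \forall n \near \oo, nsq mu (fun x => f x - fn n x) <= e) ->
  (forall e : R, 0 < e -> \forall n \near \oo, nsq mu (fun x => g x - gn n x) <= e) ->
  (fun n => J mu (fun x => fn n x * gn n x)) @ \oo --> J mu (fun x => f x * g x).
Proof.
move=> sf sg sfn sgn cf cg.
have L1 := J_sq_lim sf sg sfn cf; have L2 := J_sq_lim sg sf sgn cg.
have L3 : (fun n => J mu (fun x => (f x - fn n x) * (g x - gn n x))) @ \oo --> (0 : R).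
  apply/cvgrPdist_le => e e0; near=> n; rewrite sub0r normrN.
  rewrite -ler_sqr ?nnegrE ?(ltW e0)// (real_normK (num_real _)).
  apply: le_trans (sq_CS (sqB sf (sfn n)) (sqB sg (sgn n))) _; rewrite expr2.
  by apply: ler_pM; rewrite ?nsq_ge0//; near: n; [exact: cf|exact: cg].
have -> : (fun n => J mu (fun x => fn n x * gn n x)) =
    (fun n => J mu (fun x => (f x - fn n x) * (g x - gn n x)) + (J mu (fun x => fn n x * g x) + J mu (fun x => gn n x * f x)) - J mu (fun x => f x * g x)).
  apply/funext => n.
  have h0 := sq_mul sf sg; have h1 := sq_mul (sqB sf (sfn n)) (sqB sg (sgn n)).
  have h2 := sq_mul (sfn n) sg; have h3 := sq_mul (sgn n) sf.
  rewrite -(JD h2 h3) -(JD h1 (igD h2 h3)) -(JB (igD h1 (igD h2 h3)) h0).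
  by apply: eq_J => x; ring.
have L : J mu (fun x => (f x - fn n x) * (g x - gn n x)) + (J mu (fun x => fn n x * g x) + J mu (fun x => gn n x * f x)) - J mu (fun x => f x * g x) @[n --> \oo]
    --> 0 + (J mu (fun x => f x * g x) + J mu (fun x => g x * f x)) - J mu (fun x => f x * g x).
  by apply: cvgB; [apply: cvgD => //; exact: cvgD|exact: cvg_cst].
have E : 0 + (J mu (fun x => f x * g x) + J mu (fun x => g x * f x)) - J mu (fun x => f x * g x) = J mu (fun x => f x * g x).
  have -> : J mu (fun x => g x * f x) = J mu (fun x => f x * g x) by apply: eq_J => x; rewrite mulrC.
  by rewrite add0r addrK.
by rewrite -[X in _ --> X]E.
Unshelve. all: by end_near. Qed.

Lemma nsq_subl f g h : nsq mu (fun x => f x - g x - (f x - h x)) = nsq mu (fun x => h x - g x).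
Proof. by apply: eq_J => x; congr (_ ^+ 2); ring. Qed.

Lemma nsq_subr f g h : nsq mu (fun x => f x - g x - (h x - g x)) = nsq mu (fun x => f x - h x).
Proof. by apply: eq_J => x; congr (_ ^+ 2); ring. Qed.

End ProductLimits.

(** * Approximation by test fields in the Sobolev norm *)

Section SobolevClosure.
Variable R : realType.
Local Notation R2 := (measurableTypeR R * measurableTypeR R)%type.
Implicit Types (g h phi : R * R -> R) (u v w : vfield R).
Variables (O : set (R * R)) (M : R).
Hypotheses (oO : open O) (OM : forall x, O x -> `|x| <= M).

(** Squared Sobolev distance to a test field, with the classical gradient of the latter. It is the
    square of [H1norm] by [H1norm_sub], the two gradients agreeing almost everywhere. *)
Definition dist2 u v : R :=
  nsq1 (fun i x => zext O u i x - v i x) + nsq2 (fun i j x => wgrad O u i j x - grad v i j x).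

Lemma test_zext v : test_field O v -> zext O v = v.
Proof. by move=> tv; apply/funext => i; apply: restrict_id => x; exact: test_fun0 (tv i). Qed.

Lemma test_tf v i : test_field O v -> tf (v i). Proof. by move=> /(_ i)/test_fun_tf. Qed.

Lemma test_H1 v : test_field O v -> H1 O v.
Proof.
move=> tv i; split; last by move=> j; exists (partial j (v i)); exact: test_weak_partial.
apply/L2_sq; have := congr1 (fun f => f i) (test_zext tv); rewrite /zext => ->.
exact/tf_sq/test_tf.
Qed.

Lemma wgrad_ae u i j h : is_weak_partial O j (u i) h -> {ae lebs R, forall x, wgrad O u i j x = (h \_ O) x}.
Proof. by move=> hh; apply: (weak_partial_unique oO OM (wpartialP hh) hh). Qed.

Lemma H1norm_sub u v : H1 O u -> test_field O v ->
  H1 O (fun i x => u i x - v i x) /\ H1norm O (fun i x => u i x - v i x) = (Num.sqrt (dist2 u v))%:E.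
Proof.
move=> hu tv; have hv := test_H1 tv; have su := H1_sq1 hu; have gu := H1_sq2 hu.
have wp i j : is_weak_partial O j (fun x => u i x - v i x) (fun x => wpartial O j (u i) x - partial j (v i) x).
  apply: weak_partialB; [by have [] := hu i|by have [] := hv i|exact: H1_wp|exact: test_weak_partial].
have rB f1 f2 : (fun x => f1 x - f2 x) \_ O = (fun x => (f1 \_ O) x - (f2 \_ O) x : R).
  by apply/funext => x; rewrite !patchE; case: (x \in O); rewrite ?subr0.
have pr i j : (partial j (v i)) \_ O = partial j (v i).
  by apply: restrict_id => x; apply: test_fun0; exact: test_fun_partial.
have hd : H1 O (fun i x => u i x - v i x).
  move=> i; split; last by move=> j; exists (fun x => wpartial O j (u i) x - partial j (v i) x).
  apply/L2_sq; rewrite rB; apply: sqB; first exact: su.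
  by have [/L2_sq] := hv i.
split => //; rewrite (H1normE hd); congr (Num.sqrt _)%:E; congr (_ + _).
  apply: eq_bigr => i _; congr (nsq _ _); rewrite /zext rB.
  by have := congr1 (fun f => f i) (test_zext tv); rewrite /zext => ->.
have sd := H1_sq2 hd.
apply: eq_bigr => i _; apply: eq_bigr => j _; apply: eq_nsq_ae.
- by case: (sd i j).
- by apply: measurable_funB; [case: (gu i j)|case: (tf_sq (tf_partial j (test_tf i tv)))].
- have := @wgrad_ae (fun i x => u i x - v i x) i j _ (wp i j).
  by rewrite rB pr.
Qed.

Lemma dist2_ge0 u v : 0 <= dist2 u v.
Proof. by rewrite addr_ge0 ?nsq1_ge0 ?nsq2_ge0. Qed.

Lemma closure_seq (B : set (vfield R)) u : B `<=` test_field O -> H1closure O B u ->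
  exists v : nat -> vfield R, forall n, B (v n) /\ dist2 u (v n) <= n.+1%:R^-1.
Proof.
move=> BT [hu h].
have /choice[v hv] (n : nat) : exists v, B v /\ dist2 u v <= n.+1%:R^-1; last by exists v.
have n0 : 0 < n.+1%:R^-1 :> R by rewrite invr_gt0.
have [v Bv] := h _ n0; rewrite (H1norm_sub hu (BT _ Bv)).2 lte_fin => lt.
exists v; split => //; have := lt; rewrite -ltr_sqr ?nnegrE ?sqrtr_ge0 ?(ltW n0)// sqr_sqrtr ?dist2_ge0// => /ltW /le_trans; apply.
by rewrite expr2 ler_piMl ?(ltW n0)// invf_le1 ?ler1n.
Qed.

Lemma seq_closure (B : set (vfield R)) u (v : nat -> vfield R) : B `<=` test_field O -> H1 O u ->
  (forall n, B (v n)) -> (forall e : R, 0 < e -> \forall n \near \oo, dist2 u (v n) <= e) -> H1closure O B u.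
Proof.
move=> BT hu Bv cv; split => // e e0.
have e2 : 0 < e ^+ 2 / 2 by rewrite divr_gt0// exprn_gt0.
have [n hn] := filter_ex (cv _ e2); exists (v n) => //.
rewrite (H1norm_sub hu (BT _ (Bv n))).2 lte_fin -ltr_sqr ?nnegrE ?sqrtr_ge0 ?(ltW e0)// sqr_sqrtr ?dist2_ge0//.
by apply: le_lt_trans hn _; have := exprn_gt0 2 e0; move: (e ^+ 2) => q; lra.
Qed.

(** A subsequence converges to [h] almost everywhere, and Ladyzhenskaya's inequality bounds its L^4
    norms: Fatou's lemma applies to the squares. *)
Lemma L4_limit (phi : nat -> R * R -> R) h (A B : R) : (forall n, tf (phi n)) -> sq (lebs R) (h : R2 -> R) ->
  (forall e : R, 0 < e -> \forall n \near \oo, nsq (lebs R) (fun x : R2 => h x - phi n x) <= e) ->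
  (forall n, sqn (phi n) <= A) -> (forall n, grn (phi n) <= B) ->
  sq (lebs R) (fun x : R2 => h x ^+ 2) /\ nsq (lebs R) (fun x : R2 => h x ^+ 2) <= 2 * (A * B).
Proof.
move=> tp sh cv hA hB; have sp n := tf_sq (tp n).
have cau (e : R) : 0 < e -> exists N, forall m n, (N <= m)%N -> (N <= n)%N -> nsq (lebs R) (fun x : R2 => phi m x - phi n x) <= e.
  move=> e0; have e4 : 0 < e / 4 by rewrite divr_gt0.
  have [N _ HN] := cv _ e4; exists N => m n Nm Nn.
  have := nsqB (sqB sh (sp n)) (sqB sh (sp m)).
  rewrite nsq_subl; have := HN m Nm; have := HN n Nn; rewrite /=.
  by move: (nsq _ _) (nsq _ _) (nsq _ _) => x y z; lra.
have [f [nk [sf nkk aef cf]]] := L2_complete sp cau.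
have fh : {ae lebs R, forall x, f x = h x}.
  have : nsq (lebs R) (fun x : R2 => f x - h x) = 0.
    apply/eqP; rewrite eq_le nsq_ge0 andbT; apply/ler_addgt0Pr => e e0; rewrite add0r.
    have e4 : 0 < e / 4 by rewrite divr_gt0.
    have [n [h1 h2]] := filter_ex (filterI (cf _ e4) (cv _ e4)).
    have := nsqB (sqB sf (sp n)) (sqB sh (sp n)).
    rewrite nsq_subr; move: (nsq _ _) (nsq _ _) (nsq _ _) h1 h2 => x y z; lra.
  move=> /(nsq_ae (sqB sf sh)); apply: filterS => x; exact: subr0_eq.
have t2 n : tf (fun x => phi n x ^+ 2).
  by have := tfM (tp n) (tp n).1; rewrite (_ : (fun x => phi n x * phi n x) = fun x => phi n x ^+ 2)//; apply/funext => x; rewrite expr2.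
apply: (@fatou_sq _ _ _ _ (fun k (x : R2) => phi (nk k) x ^+ 2)).
- by move=> k; exact: tf_sq.
- by apply: msq; case: sh.
- apply: filterS (filterI aef fh) => x [c <-].
  by rewrite /=; under eq_fun do rewrite expr2; rewrite expr2; apply: cvgM.
- move=> k; have -> : nsq (lebs R) (fun x : R2 => phi (nk k) x ^+ 2) = I2 (fun x => phi (nk k) x ^+ 4).
    by apply: eq_J => x; rewrite -exprM.
  apply: le_trans (ladyzhenskaya (tp _)) _; rewrite ler_pM2l//.
  by apply: ler_pM; rewrite ?sqn_ge0 ?grn_ge0.
Qed.

End SobolevClosure.

(** * The convection term for Sobolev fields *)

Section VelocityField.
Variable R : realType.
Local Notation R2 := (measurableTypeR R * measurableTypeR R)%type.
Implicit Types (g h phi : R * R -> R) (u v w : vfield R) (G : 'I_2 -> 'I_2 -> R * R -> R).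

Lemma conv_formE u G w x : conv_form u G w x = \sum_i \sum_j u j x * (G i j x * w i x).
Proof.
by apply: eq_bigr => i _; rewrite mulr_suml; apply: eq_bigr => j _; rewrite mulrA.
Qed.

Lemma conv_form_sum u G w : (forall i j, ig (lebs R) (fun x : R2 => u j x * (G i j x * w i x))) ->
  ig (lebs R) (conv_form u G w : R2 -> R) /\
  I2 (conv_form u G w) = \sum_i \sum_j J (lebs R) (fun x : R2 => u j x * (G i j x * w i x)).
Proof.
move=> i0.
have i1 i : ig (lebs R) (fun x : R2 => \sum_j u j x * (G i j x * w i x)) by exact: ig_sum.
split.
  apply: (@eq_ig _ _ _ (lebs R) (fun x : R2 => \sum_i \sum_j u j x * (G i j x * w i x))); last exact: ig_sum.
  by move=> x; rewrite conv_formE.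
rewrite /I2 (eq_J (lebs R) (conv_formE u G w)) J_sum//; apply: eq_bigr => i _; by rewrite J_sum.
Qed.

Lemma le_sum_I2 (s : 'I_2 -> R) i : (forall j, 0 <= s j) -> s i <= \sum_j s j.
Proof. by move=> h; rewrite sum_I2; have [->|->] := I2_case i; rewrite ?lerDl ?lerDr. Qed.

Lemma cvg_sum2 (F : nat -> 'I_2 -> 'I_2 -> R) (L : 'I_2 -> 'I_2 -> R) :
  (forall i j, (fun n => F n i j) @ \oo --> L i j) -> (fun n => \sum_i \sum_j F n i j) @ \oo --> \sum_i \sum_j L i j.
Proof.
move=> h; rewrite sum_I2 !sum_I2.
have -> : (fun n => \sum_i \sum_j F n i j) = fun n => F n 0 0 + F n 0 1 + (F n 1 0 + F n 1 1).
  by apply/funext => n; rewrite sum_I2 !sum_I2.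
by apply: cvgD; apply: cvgD.
Qed.

Lemma sq_mul_tf phi : tf phi ->
  exists W : R, 0 < W /\ forall h, sq (lebs R) (h : R2 -> R) -> sq (lebs R) (fun x : R2 => h x * phi x) /\
    nsq (lebs R) (fun x : R2 => h x * phi x) <= W * nsq (lebs R) (h : R2 -> R).
Proof.
move=> tp; have [C [C0 HC]] := tf_bounded tp; exists (C ^+ 2); split; first exact: exprn_gt0.
move=> k sk; have mk : measurable_fun setT (fun x : R2 => k x * phi x).
  by apply: measurable_funM; [case: sk|exact: cc_meas (tf_cc tp)].
have s : sq (lebs R) (fun x : R2 => k x * phi x).
  apply: (sq_le mk _ (sqZ C sk)) => x; rewrite !normrM mulrC ler_wpM2r// (gtr0_norm C0); exact: HC.
split => //; have [_ i1] := s; have [_ i2] := sk; rewrite /nsq -(JZ _ i2); apply: J_le => //; first exact: igZ.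
move=> x; rewrite exprMn mulrC ler_wpM2r ?sqr_ge0// -(real_normK (num_real (phi x))).
by rewrite ler_sqr ?nnegrE ?(ltW C0).
Qed.

Variable O : set (R * R).

Lemma dist2_nsq1 u v i : nsq (lebs R) (fun x : R2 => zext O u i x - v i x) <= dist2 O u v.
Proof.
apply: le_trans (_ : nsq1 (fun i x => zext O u i x - v i x) <= _); last by rewrite lerDl nsq2_ge0.
exact: (nsq_le1 (fun i x => zext O u i x - v i x)).
Qed.

Lemma dist2_nsq2 u v : nsq2 (fun i j x => wgrad O u i j x - grad v i j x) <= dist2 O u v.
Proof. by rewrite lerDr nsq1_ge0. Qed.

Lemma dist2_nsq u v i j : nsq (lebs R) (fun x : R2 => wgrad O u i j x - grad v i j x) <= dist2 O u v.
Proof.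
by apply: le_trans (dist2_nsq2 u v); exact: (nsq_le2 (fun i j x => wgrad O u i j x - grad v i j x)).
Qed.

Lemma test_diff_sqn u v w i : H1 O u -> test_field O v -> test_field O w ->
  sqn (fun x => v i x - w i x) <= 2 * dist2 O u v + 2 * dist2 O u w.
Proof.
move=> hu tv tw; have su := H1_sq1 hu i.
have sv := tf_sq (test_tf i tv); have sw := tf_sq (test_tf i tw).
have := nsqB (sqB su sw) (sqB su sv); rewrite nsq_subl => /le_trans; apply.
by rewrite addrC; apply: lerD; rewrite ler_pM2l//; exact: dist2_nsq1.
Qed.

Lemma test_diff_grn u v w i : H1 O u -> test_field O v -> test_field O w ->
  grn (fun x => v i x - w i x) <= 2 * dist2 O u v + 2 * dist2 O u w.
Proof.
move=> hu tv tw.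
pose N (v' : vfield R) j := nsq (lebs R) (fun x : R2 => wgrad O u i j x - grad v' i j x).
pose A j := sqn (partial j (fun x => v i x - w i x)).
have E j : A j <= 2 * N w j + 2 * N v j.
  have su := H1_sq2 hu i j.
  have sv : sq (lebs R) (grad v i j : R2 -> R) := tf_sq (tf_partial j (test_tf i tv)).
  have sw : sq (lebs R) (grad w i j : R2 -> R) := tf_sq (tf_partial j (test_tf i tw)).
  have -> : A j = nsq (lebs R) (fun x : R2 => grad v i j x - grad w i j x).
    by apply: eq_J => x; rewrite partialB//; [case: (test_tf i tv)|case: (test_tf i tw)].
  by have := nsqB (sqB su sw) (sqB su sv); rewrite nsq_subl.
have F v' : \sum_j N v' j <= dist2 O u v'.
  apply: le_trans (dist2_nsq2 u v').
  apply: (@le_sum_I2 (fun a => \sum_j nsq (lebs R) (fun x : R2 => wgrad O u a j x - grad v' a j x)) i) => a.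
  by apply: sumr_ge0 => j _; exact: nsq_ge0.
rewrite -[leLHS]/(\sum_j A j); have Fv := F v; have Fw := F w; move: (dist2 O u v) (dist2 O u w) Fv Fw => p q.
clear F; clearbody A N; rewrite !sum_I2 => Fv Fw.
have := (E 0, E 1) => -[]; move: (A 0) (A 1) (N w 0) (N w 1) (N v 0) (N v 1) Fv Fw; clear => *; lra.
Qed.

(** The differences [v (k + n) - v n] are test fields converging to [u - v n]; Ladyzhenskaya's
    inequality converts their smallness in the Sobolev norm into smallness in L^4. *)
Lemma L4_diff u (v : nat -> vfield R) n i : H1 O u -> (forall n, test_field O (v n)) -> (forall n, dist2 O u (v n) <= n.+1%:R^-1) ->
  sq (lebs R) (fun x : R2 => (zext O u i x - v n i x) ^+ 2) /\
  nsq (lebs R) (fun x : R2 => (zext O u i x - v n i x) ^+ 2) <= 32 * n.+1%:R^-1.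
Proof.
move=> hu tv hv; pose q : R := n.+1%:R^-1.
have q0 : 0 < q by rewrite invr_gt0.
have q1 : q <= 1 by rewrite invf_le1 ?ler1n.
have qk k : dist2 O u (v (k + n)%N) <= q.
  by apply: le_trans (hv _) _; rewrite lef_pV2 ?posrE// ler_nat ltnS leq_addl.
have tk k : tf (fun x => v (k + n)%N i x - v n i x) by apply: (test_fun_tf (O := O)); apply: test_funB; exact: tv.
have s0 := H1_sq1 hu i; have s1 := tf_sq (test_tf i (tv n)).
have b1 k : 2 * dist2 O u (v (k + n)%N) + 2 * dist2 O u (v n) <= 4 * q.
  by have := (qk k, hv n) => -[]; rewrite -/q; move: (dist2 _ _ _) (dist2 _ _ _) => x y; clearbody q; lra.
have := @L4_limit _ (fun k x => v (k + n)%N i x - v n i x) (fun x => zext O u i x - v n i x) (4 * q) (4 * q) tk (sqB s0 s1).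
case.
- move=> e e0; near=> k; rewrite nsq_subr; apply: le_trans (dist2_nsq1 _ _ _) _; apply: le_trans (hv _) _.
  have : k.+1%:R^-1 < e by near: k; exact: near_inv.
  by move=> /ltW; apply: le_trans; rewrite lef_pV2 ?posrE// ler_nat ltnS leq_addr.
- by move=> k; apply: le_trans (b1 k); apply: test_diff_sqn.
- by move=> k; apply: le_trans (b1 k); apply: test_diff_grn.
(* [2 * (4 q) ^ 2 = 32 q ^ 2], at most [32 q] since [q <= 1]. *)
move=> h1 h2; split => //; apply: le_trans h2 _; rewrite -/q; clearbody q; nra.
Unshelve. all: by end_near. Qed.

Lemma L4_field u (v : nat -> vfield R) i : H1 O u -> (forall n, test_field O (v n)) -> (forall n, dist2 O u (v n) <= n.+1%:R^-1) ->
  sq (lebs R) (fun x : R2 => (zext O u i x) ^+ 2).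
Proof.
move=> hu tv hv; have [h _] := L4_diff 0 i hu tv hv.
have s0 := H1_sq1 hu i; have t := test_tf i (tv 0%N).
have t2 : sq (lebs R) (fun x : R2 => v 0%N i x ^+ 2) by apply: tf_sq; have := tfM t t.1.
apply: (sq_le _ _ (sqD (sqZ 2 h) (sqZ 2 t2))); first by apply: msq; case: s0.
move=> x; rewrite ger0_norm ?sqr_ge0// [leRHS]ger0_norm; last by apply: addr_ge0; apply: mulr_ge0 => //; exact: sqr_ge0.
have := sqrB_le (zext O u i x - v 0%N i x) (- v 0%N i x); by rewrite opprK subrK sqrrN.
Qed.

Lemma conv_form_test_lim u (v : nat -> vfield R) w : H1 O u -> (forall n, test_field O (v n)) ->
  (forall e : R, 0 < e -> \forall n \near \oo, dist2 O u (v n) <= e) -> test_field O w ->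
  (fun n => I2 (conv_form (v n) (grad (v n)) w)) @ \oo --> I2 (conv_form (zext O u) (wgrad O u) w).
Proof.
move=> hu tv cv tw; have su := H1_sq1 hu; have gu := H1_sq2 hu.
have sv n i := tf_sq (test_tf i (tv n)); have gv n i j := tf_sq (tf_partial j (test_tf i (tv n))).
have /choice[W HW] i := sq_mul_tf (test_tf i tw).
have W0 i : 0 < W i by case: (HW i).
have S1 i k : sq (lebs R) (k : R2 -> R) -> sq (lebs R) (fun x : R2 => k x * w i x) by move=> sk; case: (HW i) => _ /(_ k sk) [].
have S2 i k : sq (lebs R) (k : R2 -> R) -> nsq (lebs R) (fun x : R2 => k x * w i x) <= W i * nsq (lebs R) (k : R2 -> R).
  by move=> sk; case: (HW i) => _ /(_ k sk) [].
have I0 i j : ig (lebs R) (fun x : R2 => zext O u j x * (wgrad O u i j x * w i x)) by apply: sq_mul => //; exact: S1.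
have In n i j : ig (lebs R) (fun x : R2 => v n j x * (grad (v n) i j x * w i x)) := sq_mul (sv n j) (S1 i _ (gv n i j)).
rewrite (conv_form_sum I0).2.
have -> : (fun n => I2 (conv_form (v n) (grad (v n)) w)) =
    fun n => \sum_i \sum_j J (lebs R) (fun x : R2 => v n j x * (grad (v n) i j x * w i x)).
  by apply/funext => n; rewrite (conv_form_sum (In n)).2.
apply: cvg_sum2 => i j; apply: J_sq_lim2; [exact: su|exact/S1/gu|by move=> n; exact: sv|by move=> n; apply: S1; exact: gv| |].
  by move=> e e0; apply: filterS (cv e e0) => n; apply: le_trans; exact: dist2_nsq1.
move=> e e0; have e1 : 0 < e / W i by exact: divr_gt0.
apply: filterS (cv _ e1) => n h.
have -> : nsq (lebs R) (fun x : R2 => wgrad O u i j x * w i x - grad (v n) i j x * w i x) =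
    nsq (lebs R) (fun x : R2 => (wgrad O u i j x - grad (v n) i j x) * w i x) by apply: eq_J => x; rewrite mulrBl.
apply: le_trans (S2 i _ (sqB (gu i j) (gv n i j))) _.
by rewrite -ler_pdivlMl// mulrC; apply: le_trans (dist2_nsq _ _ _ _) h.
Qed.

(** Factors are grouped as [(u_j w_i)] times the gradient: a product of two functions of L^4 is in
    L^2, and [z n] tends to [w] in L^4 by [L4_diff]. *)
Lemma conv_form_weak u (v : nat -> vfield R) w (z : nat -> vfield R) : H1 O u -> H1 O w ->
  (forall n, test_field O (v n)) -> (forall n, dist2 O u (v n) <= n.+1%:R^-1) ->
  (forall n, test_field O (z n)) -> (forall n, dist2 O w (z n) <= n.+1%:R^-1) ->
  ig (lebs R) (conv_form (zext O u) (wgrad O u) (zext O w) : R2 -> R) /\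
  (fun n => I2 (conv_form (zext O u) (wgrad O u) (z n))) @ \oo --> I2 (conv_form (zext O u) (wgrad O u) (zext O w)).
Proof.
move=> hu hw tv hv tz hz; have su := H1_sq1 hu; have gu := H1_sq2 hu; have sw := H1_sq1 hw.
have mu' i : measurable_fun setT (zext O u i : R2 -> R) by case: (su i).
have u4 i := L4_field i hu tv hv; have w4 i := L4_field i hw tz hz.
have P i j : sq (lebs R) (fun x : R2 => zext O u j x * zext O w i x).
  by have [] := sq_prod (mu' j) (sq_meas (sw i)) (u4 j) (w4 i).
have tz4 n i : sq (lebs R) (fun x : R2 => z n i x ^+ 2) by apply: tf_sq; have t := test_tf i (tz n); have := tfM t t.1.
have Pn n i j : sq (lebs R) (fun x : R2 => zext O u j x * z n i x).
  by have [] := sq_prod (mu' j) (sq_meas (tf_sq (test_tf i (tz n)))) (u4 j) (tz4 n i).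
have A (w' : vfield R) i j x : zext O u j x * (wgrad O u i j x * w' i x) = zext O u j x * w' i x * wgrad O u i j x by ring.
have I0 i j : ig (lebs R) (fun x : R2 => zext O u j x * (wgrad O u i j x * zext O w i x)).
  by apply: eq_ig (sq_mul (P i j) (gu i j)) => x; rewrite A.
have In n i j : ig (lebs R) (fun x : R2 => zext O u j x * (wgrad O u i j x * z n i x)).
  by apply: eq_ig (sq_mul (Pn n i j) (gu i j)) => x; rewrite A.
split; first by case: (conv_form_sum I0).
rewrite (conv_form_sum I0).2.
have -> : (fun n => I2 (conv_form (zext O u) (wgrad O u) (z n))) =
    fun n => \sum_i \sum_j J (lebs R) (fun x : R2 => zext O u j x * z n i x * wgrad O u i j x).
  apply/funext => n; rewrite (conv_form_sum (In n)).2; apply: eq_bigr => i _; apply: eq_bigr => j _.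
  by apply: eq_J => x; rewrite A.
apply: cvg_sum2 => i j.
have -> : J (lebs R) (fun x : R2 => zext O u j x * (wgrad O u i j x * zext O w i x)) =
    J (lebs R) (fun x : R2 => zext O u j x * zext O w i x * wgrad O u i j x) by apply: eq_J => x; rewrite A.
apply: J_sq_lim; [exact: P|exact: gu|by move=> n; exact: Pn|] => e e0.
pose N := nsq (lebs R) (fun x : R2 => (zext O u j x) ^+ 2); have N0 : 0 <= N := nsq_ge0 _ _.
have e1 : 0 < e ^+ 2 / (32 * (N + 1)) by rewrite divr_gt0 ?exprn_gt0// mulr_gt0// ltr_wpDl.
apply: filterS (near_inv e1) => n hn.
have [d1 d2] := L4_diff n i hw tz hz.
have md : measurable_fun setT (fun x : R2 => zext O w i x - z n i x).
  by apply: measurable_funB; [exact: sq_meas (sw i)|exact: sq_meas (tf_sq (test_tf i (tz n)))].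
have [_ h] := sq_prod (mu' j) md (u4 j) d1.
have -> : nsq (lebs R) (fun x : R2 => zext O u j x * zext O w i x - zext O u j x * z n i x) =
    nsq (lebs R) (fun x : R2 => zext O u j x * (zext O w i x - z n i x)) by apply: eq_J => x; rewrite mulrBr.
rewrite -ler_sqr ?nnegrE ?nsq_ge0 ?(ltW e0)//; apply: le_trans h _; rewrite -/N.
apply: le_trans (ler_wpM2l N0 d2) _.
move: hn; rewrite ltr_pdivlMr; last by rewrite mulr_gt0// ltr_wpDl.
have q0 : 0 < n.+1%:R^-1 :> R by rewrite invr_gt0.
by move: (n.+1%:R^-1) q0 (e ^+ 2) => q q0 E; clearbody N; nra.
Qed.

End VelocityField.

(** * Existence of the velocity *)

Lemma eighths (R : realFieldType) (e : R) : 0 < e -> 2 * (e / 8) + 2 * (2 * (e / 8)) <= e.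
Proof. by move=> e0; lra. Qed.

Section LimitField.
Variable R : realType.
Local Notation R2 := (measurableTypeR R * measurableTypeR R)%type.
Implicit Types (g h phi : R * R -> R) (u v w : vfield R).
Variables (O : set (R * R)) (M : R).
Hypotheses (oO : open O) (M0 : 0 < M) (OM : forall x, O x -> `|x| <= M).

Lemma cauchy_harmonic (x : nat -> nat -> R) (C : R) : 0 <= C ->
  (forall m n, x m n <= C * (4 * m.+1%:R^-1 + 4 * n.+1%:R^-1)) ->
  forall e : R, 0 < e -> exists N, forall m n, (N <= m)%N -> (N <= n)%N -> x m n <= e.
Proof.
move=> C0 h e e0; have e1 : 0 < e / (8 * (C + 1)) by rewrite divr_gt0// mulr_gt0// ltr_wpDl.
have [N _ HN] := near_inv e1; exists N => m n Nm Nn; apply: le_trans (h m n) _.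
have := HN m Nm; have := HN n Nn; rewrite /= !ltr_pdivlMr ?mulr_gt0 ?ltr_wpDl//.
have p0 : 0 < m.+1%:R^-1 :> R by rewrite invr_gt0.
have q0 : 0 < n.+1%:R^-1 :> R by rewrite invr_gt0.
by move: (m.+1%:R^-1) (n.+1%:R^-1) p0 q0 => p q p0 q0; clear h HN; nra.
Qed.

Lemma sum_I2_le (s : 'I_2 -> R) (c : R) : (forall i, s i <= c) -> \sum_i s i <= 2 * c.
Proof. by move=> h; rewrite sum_I2 mulr_natl mulr2n; apply: lerD. Qed.

Lemma near_I2 (P : 'I_2 -> nat -> Prop) : (forall i, \forall n \near \oo, P i n) -> \forall n \near \oo, forall i, P i n.
Proof.
move=> h; apply: filterS2 (h 0) (h 1) => n h0 h1 i; by have [->|->] := I2_case i.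
Qed.

Lemma nsq_restrict g phi : sq (lebs R) (g : R2 -> R) -> sq (lebs R) (phi : R2 -> R) -> (forall x, ~ O x -> phi x = 0) ->
  nsq (lebs R) (fun x : R2 => (g \_ O) x - phi x) <= nsq (lebs R) (fun x : R2 => g x - phi x).
Proof.
move=> sg sp p0; have [_ i1] := sqB (sq_restrict_le oO sg) sp; have [_ i2] := sqB sg sp.
apply: J_le => // x; have [Ox|Ox] := pselect (O x); first by rewrite restrict_in.
by rewrite restrict_out// p0// subrr expr0n sqr_ge0.
Qed.

(** Gradients, and by Poincare's inequality the fields, are Cauchy in L^2. Integration by parts
    passes to the limit and identifies the limits of the gradients as weak derivatives. *)
Lemma limit_field (v : nat -> vfield R) : (forall n, test_field O (v n)) ->
  (forall m n, \sum_i grn (fun x => v m i x - v n i x) <= 4 * m.+1%:R^-1 + 4 * n.+1%:R^-1) ->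
  exists u, H1 O u /\ forall e : R, 0 < e -> \forall n \near \oo, dist2 O u (v n) <= e.
Proof.
move=> tv cau; have tvn n i := test_tf i (tv n).
have out n i x : ~ O x -> v n i x = 0 by exact: test_fun0 (tv n i).
have dout n i j x : ~ O x -> partial j (v n i) x = 0.
  by apply: (test_fun0 (O := O)); apply: test_fun_partial; exact: tv.
have cg i m n : grn (fun x => v m i x - v n i x) <= 4 * m.+1%:R^-1 + 4 * n.+1%:R^-1.
  by apply: le_trans (cau m n); apply: (@le_sum_I2 R (fun i => grn (fun x => v m i x - v n i x))) => a; exact: grn_ge0.
have tB i m n : tf (fun x => v m i x - v n i x) by apply: (test_fun_tf (O := O)); apply: test_funB; exact: tv.
have [C [C0 HC]] := poincare M0.
have /choice[U HU] i : exists g, sq (lebs R) (g : R2 -> R) /\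
    forall e : R, 0 < e -> \forall n \near \oo, nsq (lebs R) (fun x : R2 => g x - v n i x) <= e.
  have [] := @L2_complete _ _ _ (lebs R) (fun n => v n i : R2 -> R).
  - by move=> n; apply: tf_sq; exact: tvn.
  - apply: (cauchy_harmonic C0) => k n; apply: le_trans (HC _ (tB i k n) _) _.
      by move=> x Mx; rewrite !out ?subrr// => /OM; rewrite leNgt Mx.
    by apply: ler_wpM2l.
  by move=> g [_ [sg _ _ cvg]]; exists g.
have /choice[G HG] (ij : 'I_2 * 'I_2) : exists g, sq (lebs R) (g : R2 -> R) /\
    forall e : R, 0 < e -> \forall n \near \oo, nsq (lebs R) (fun x : R2 => g x - partial ij.2 (v n ij.1) x) <= e.
  have [] := @L2_complete _ _ _ (lebs R) (fun n => partial ij.2 (v n ij.1) : R2 -> R).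
  - by move=> n; apply: tf_sq; apply: tf_partial; exact: tvn.
  - apply: (cauchy_harmonic ler01) => k n; rewrite mul1r; apply: le_trans (cg ij.1 k n).
    have -> : nsq (lebs R) (fun x : R2 => partial ij.2 (v k ij.1) x - partial ij.2 (v n ij.1) x) =
        sqn (partial ij.2 (fun x => v k ij.1 x - v n ij.1 x)).
      by apply: eq_J => x; rewrite partialB//; [case: (tvn k ij.1)|case: (tvn n ij.1)].
    apply: (@le_sum_I2 R (fun j => sqn (partial j (fun x => v k ij.1 x - v n ij.1 x)))) => a; exact: sqn_ge0.
  by move=> g [_ [sg _ _ cvg]]; exists g.
pose u : vfield R := fun i => U i \_ O.
have sU i : sq (lebs R) (U i : R2 -> R) by case: (HU i).
have sG ij : sq (lebs R) (G ij : R2 -> R) by case: (HG ij).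
have su i : sq (lebs R) (u i : R2 -> R) by exact: (sq_restrict_le oO).
have sh ij : sq (lebs R) (G ij \_ O : R2 -> R) by exact: (sq_restrict_le oO).
have cu i (e : R) : 0 < e -> \forall n \near \oo, nsq (lebs R) (fun x : R2 => u i x - v n i x) <= e.
  move=> e0; have [_ /(_ e e0)] := HU i; apply: filterS => n; apply: le_trans.
  by apply: nsq_restrict => //; [apply: tf_sq; exact: tvn|exact: out].
have ch i j (e : R) : 0 < e -> \forall n \near \oo, nsq (lebs R) (fun x : R2 => (G (i, j) \_ O) x - partial j (v n i) x) <= e.
  move=> e0; have [_ /(_ e e0)] := HG (i, j); apply: filterS => n; apply: le_trans.
  by apply: nsq_restrict => //; [apply: tf_sq; apply: tf_partial; exact: tvn|exact: dout].
have uO i : u i \_ O = u i by apply: restrict_id => x; exact: restrict_out.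
have wp i j : is_weak_partial O j (u i) (G (i, j)).
  apply/weak_partialE; split => // phi tp; rewrite uO.
  have t := test_fun_tf tp; have t' := tf_partial j t.
  have L1 := J_sq_lim (su i) (tf_sq t') (fun n => tf_sq (tvn n i)) (cu i).
  have L2 := J_sq_lim (sh (i, j)) (tf_sq t) (fun n => tf_sq (tf_partial j (tvn n i))) (ch i j).
  have E : (fun n => J (lebs R) (fun x : R2 => v n i x * partial j phi x)) =
      (fun n => - J (lebs R) (fun x : R2 => partial j (v n i) x * phi x)).
    by apply/funext => n; have := I2_parts j (tvn n i) t.1; rewrite /I2 => ->; rewrite opprK.
  by rewrite E in L1; exact: (cvg_unique _ L1 (cvgN L2)).
have hu : H1 O u.
  move=> i; split; first by apply/L2_sq; rewrite uO.
  by move=> j; exists (G (i, j)).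
have cw i j (e : R) : 0 < e -> \forall n \near \oo, nsq (lebs R) (fun x : R2 => wgrad O u i j x - grad (v n) i j x) <= e.
  move=> e0; apply: filterS (ch i j e e0) => n; apply: le_trans.
  rewrite le_eqVlt; apply/orP; left; apply/eqP; apply: eq_nsq_ae.
  - by apply: measurable_funB; [exact: sq_meas (H1_sq2 hu i j)|exact: sq_meas (tf_sq (tf_partial j (tvn n i)))].
  - by apply: measurable_funB; [exact: sq_meas (sh (i, j))|exact: sq_meas (tf_sq (tf_partial j (tvn n i)))].
  - by have [N [mN N0 NS]] := wgrad_ae oO OM (wp i j); exists N; split => // x /= hx; apply: NS => /= e1; apply: hx; rewrite e1.
exists u; split => // e e0; have e8 : 0 < e / 8 by rewrite divr_gt0.
have A := near_I2 (fun i => cu i _ e8); have B := near_I2 (fun i => near_I2 (fun j => cw i j _ e8)).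
apply: filterS2 A B => n a b.
have t1 : nsq1 (fun i x => zext O u i x - v n i x) <= 2 * (e / 8) by apply: sum_I2_le => i; rewrite /zext uO; exact: a.
have t2 : nsq2 (fun i j x => wgrad O u i j x - grad (v n) i j x) <= 2 * (2 * (e / 8)) by apply: sum_I2_le => i; apply: sum_I2_le => j; exact: b.
exact: le_trans (lerD t1 t2) (eighths e0).
Qed.

End LimitField.

(** * The weak equation, on solenoidal test fields and then on [V] *)

Section WeakEquation.
Variable R : realType.
Local Notation R2 := (measurableTypeR R * measurableTypeR R)%type.
Implicit Types (u v w : vfield R).
Variables (O : set (R * R)) (M : R) (nu : R * R -> R) (m : R) (f : vfield R).
Hypotheses (oO : open O) (M0 : 0 < M) (OM : forall x, O x -> `|x| <= M).
Hypotheses (mnu : measurable_fun setT (nu : R2 -> R)) (nu1 : forall x, 1 <= nu x) (num : forall x, nu x <= m).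
Hypothesis (hf : sq1 f).

Definition load w : R := \sum_i J (lebs R) (fun x : R2 => f i x * w i x).

Lemma exists_weak_solution : exists u, V O u /\
  forall w, solenoidal_test_field O w ->
    I2 (conv_form (zext O u) (wgrad O u) w) + I2 (visc_form nu (wgrad O u) (grad w)) = load w.
Proof.
have [v [v1 v2 v3]] := solenoidal_weak_solution_seq M0 OM mnu nu1 num hf.
have tv n : test_field O (v n) by case: (v1 n).
have [u [hu cu]] := limit_field oO M0 OM tv v2.
have ST : solenoidal_test_field O `<=` test_field O by move=> w [].
exists u; split; first by split; [exact: (seq_closure oO OM _ hu tv cu)|exact: (seq_closure oO OM ST hu v1 cu)].
move=> w hw; have tw : test_field O w by case: hw.
have sgw : sq2 (grad w) by apply: sq2_grad => i; exact: test_tf.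
have sgv n : sq2 (grad (v n)) by apply: sq2_grad => i; exact: test_tf.
have L1 := conv_form_test_lim hu tv cu tw.
have L2 : (fun n => I2 (visc_form nu (grad (v n)) (grad w))) @ \oo --> I2 (visc_form nu (wgrad O u) (grad w)).
  apply: (visc_form_lim mnu nu1 num (H1_sq2 hu) sgw sgv) => e e0.
  by apply: filterS (cu e e0) => n; apply: le_trans; exact: dist2_nsq2.
have L3 : (fun n => I2 (visc_form nu (grad (v n)) (grad w)) + I2 (conv_form (v n) (grad (v n)) w)) @ \oo --> load w.
  apply/cvgrPdist_le => e e0; apply: filterS (v3 w hw e e0) => n; by rewrite distrC.
by rewrite addrC; exact: (cvg_unique _ (cvgD L2 L1) L3).
Qed.

Lemma weak_equation_extends u : V O u ->
  (forall w, solenoidal_test_field O w ->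
    I2 (conv_form (zext O u) (wgrad O u) w) + I2 (visc_form nu (wgrad O u) (grad w)) = load w) ->
  forall w, V O w ->
    I2 (conv_form (zext O u) (wgrad O u) (zext O w)) + I2 (visc_form nu (wgrad O u) (wgrad O w)) = load (zext O w).
Proof.
move=> [_ Vu] eqn w [_ Vw]; have [hu hw] := (Vu.1, Vw.1).
have ST : solenoidal_test_field O `<=` test_field O by move=> w' [].
have [v hv] := closure_seq oO OM ST Vu; have [z hz] := closure_seq oO OM ST Vw.
have tv n : test_field O (v n) by apply: ST; case: (hv n).
have tz n : test_field O (z n) by apply: ST; case: (hz n).
have dv n : dist2 O u (v n) <= n.+1%:R^-1 by case: (hv n).
have dz n : dist2 O w (z n) <= n.+1%:R^-1 by case: (hz n).
have sz n i := tf_sq (test_tf i (tz n)).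
have sgz n : sq2 (grad (z n)) by apply: sq2_grad => i; exact: test_tf.
have cz (e : R) : 0 < e -> \forall n \near \oo, dist2 O w (z n) <= e.
  by move=> e0; apply: filterS (near_inv e0) => n /ltW; exact: le_trans.
have [_ L1] := conv_form_weak hu hw tv dv tz dz.
have L2 : (fun n => I2 (visc_form nu (grad (z n)) (wgrad O u))) @ \oo --> I2 (visc_form nu (wgrad O w) (wgrad O u)).
  apply: (visc_form_lim mnu nu1 num (H1_sq2 hw) (H1_sq2 hu) sgz) => e e0.
  by apply: filterS (cz e e0) => n; apply: le_trans; exact: dist2_nsq2.
have L3 : (fun n => load (z n)) @ \oo --> load (zext O w).
  have K i : (fun n => J (lebs R) (fun x : R2 => z n i x * f i x)) @ \oo --> J (lebs R) (fun x : R2 => zext O w i x * f i x).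
    apply: J_sq_lim; [exact: H1_sq1|exact: hf|by move=> n; exact: sz|] => e e0.
    by apply: filterS (cz e e0) => n; apply: le_trans; exact: dist2_nsq1.
  have E w' : load w' = J (lebs R) (fun x : R2 => w' 0 x * f 0 x) + J (lebs R) (fun x : R2 => w' 1 x * f 1 x).
    by rewrite /load sum_I2; congr (_ + _); apply: eq_J => x; rewrite mulrC.
  rewrite E; under eq_fun do rewrite E; exact: cvgD.
have C G H : I2 (visc_form nu G H) = I2 (visc_form nu H G) by apply: eq_J => x; exact: visc_formC.
rewrite C.
have E : (fun n => load (z n)) = (fun n => I2 (conv_form (zext O u) (wgrad O u) (z n)) + I2 (visc_form nu (grad (z n)) (wgrad O u))).
  by apply/funext => n; rewrite C eqn//; case: (hz n).
by rewrite E in L3; exact: (cvg_unique _ (cvgD L1 L2) L3).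
Qed.

End WeakEquation.

(** * The pressure *)

Section Pressure.
Variable R : realType.
Local Notation R2 := (measurableTypeR R * measurableTypeR R)%type.
Local Notation E := ('I_2 -> R * R -> R).
Implicit Types (u v w phi psi : E).
Variables (O : set (R * R)) (M : R).
Hypotheses (oO : open O) (M0 : 0 < M) (OM : forall x, O x -> `|x| <= M).

Definition divg phi : R * R -> R := fun x => \sum_i partial i (phi i) x.
Definition dirichlet phi : R := \sum_i grn (phi i).
Definition dirichlet_bounded (l : E -> R) :=
  exists C, 0 <= C /\ forall phi, test_field O phi -> l phi ^+ 2 <= C * dirichlet phi.

Lemma dirichlet_ge0 phi : 0 <= dirichlet phi.
Proof. by apply: sumr_ge0 => i _; exact: grn_ge0. Qed.

Lemma dirichlet_boundedD l l' : dirichlet_bounded l -> dirichlet_bounded l' -> dirichlet_bounded (fun phi => l phi + l' phi).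
Proof.
move=> [C [C0 h]] [C' [C'0 h']]; exists (2 * C + 2 * C'); split; first by rewrite addr_ge0 ?mulr_ge0.
move=> phi tp; have := sqrB_le (l phi) (- l' phi); rewrite opprK sqrrN => /le_trans; apply.
by rewrite [leRHS]mulrDl -[2 * C * _]mulrA -[2 * C' * _]mulrA; apply: lerD; rewrite ler_pM2l//; [exact: h|exact: h'].
Qed.

Lemma dirichlet_boundedB l l' : dirichlet_bounded l -> dirichlet_bounded l' -> dirichlet_bounded (fun phi => l phi - l' phi).
Proof.
move=> h [C [C0 h']]; apply: dirichlet_boundedD => //; exists C; split => // phi tp; rewrite sqrrN; exact: h'.
Qed.

Lemma dirichlet_bounded_sum (l : 'I_2 -> E -> R) : (forall i, dirichlet_bounded (l i)) -> dirichlet_bounded (fun phi => \sum_i l i phi).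
Proof.
move=> h; have -> : (fun phi => \sum_i l i phi) = fun phi => l 0 phi + l 1 phi by apply/funext => phi; rewrite sum_I2.
exact: dirichlet_boundedD.
Qed.

Lemma dirichlet_bounded_J (h : R * R -> R) (X : E -> R * R -> R) (C : R) : sq (lebs R) (h : R2 -> R) -> 0 <= C ->
  (forall phi, test_field O phi -> sq (lebs R) (X phi : R2 -> R) /\ nsq (lebs R) (X phi : R2 -> R) <= C * dirichlet phi) ->
  dirichlet_bounded (fun phi => J (lebs R) (fun x : R2 => h x * X phi x)).
Proof.
move=> sh C0 H; pose N := nsq (lebs R) (h : R2 -> R); have N0 : 0 <= N := nsq_ge0 _ _.
exists (N * C); split; first exact: mulr_ge0.
move=> phi tp; have [sX bX] := H phi tp; apply: le_trans (sq_CS sh sX) _.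
by rewrite -mulrA; apply: ler_wpM2l.
Qed.

Lemma dirichlet_poincare : exists C, 0 <= C /\ forall phi i, test_field O phi -> sqn (phi i) <= C * dirichlet phi.
Proof.
have [C [C0 HC]] := poincare M0; exists C; split => // phi i tp.
apply: le_trans (HC _ (test_tf i tp) _) _.
  by move=> x Mx; rewrite (test_fun0 (tp i))// => /OM; rewrite leNgt Mx.
by apply: ler_wpM2l => //; apply: (@le_sum_I2 R (fun i => grn (phi i))) => a; exact: grn_ge0.
Qed.

Lemma sqn_partial_dirichlet phi i j : sqn (partial j (phi i)) <= dirichlet phi.
Proof.
apply: le_trans (_ : grn (phi i) <= _); first by apply: (@le_sum_I2 R (fun j => sqn (partial j (phi i)))) => a; exact: sqn_ge0.
by apply: (@le_sum_I2 R (fun i => grn (phi i))) => a; exact: grn_ge0.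
Qed.

(** [a + 1] dominates the square root of [a]. *)
Lemma le_of_sqr (a x y : R) : 0 <= a -> 0 <= y -> x ^+ 2 <= a * y ^+ 2 -> x <= (a + 1) * y.
Proof.
move=> a0 y0 h; have z0 : 0 <= (a + 1) * y by rewrite mulr_ge0// addr_ge0.
have [x0|x0] := leP x 0; first exact: le_trans x0 z0.
rewrite -ler_sqr ?nnegrE ?(ltW x0)//; apply: le_trans h _.
by rewrite exprMn ler_wpM2r ?sqr_ge0// expr2; nra.
Qed.

Section Residual.
Variables (nu : R * R -> R) (m : R) (f u : vfield R).
Hypotheses (mnu : measurable_fun setT (nu : R2 -> R)) (nu1 : forall x, 1 <= nu x) (num : forall x, nu x <= m).
Hypotheses (hf : sq1 f) (hu : H1 O u) (u4 : forall i, sq (lebs R) (fun x : R2 => zext O u i x ^+ 2)).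

Definition residual phi : R :=
  load f phi - I2 (conv_form (zext O u) (wgrad O u) phi) - I2 (visc_form nu (wgrad O u) (grad phi)).

Let su i : sq (lebs R) (zext O u i : R2 -> R). Proof. exact: H1_sq1. Qed.
Let gu : sq2 (wgrad O u). Proof. exact: H1_sq2. Qed.

Let prod_sq phi i j : test_field O phi -> sq (lebs R) (fun x : R2 => zext O u j x * phi i x) /\
  nsq (lebs R) (fun x : R2 => zext O u j x * phi i x) ^+ 2 <= nsq (lebs R) (fun x : R2 => zext O u j x ^+ 2) * I2 (fun x => phi i x ^+ 4).
Proof.
move=> tp; have t := test_tf i tp.
have t4 : sq (lebs R) (fun x : R2 => phi i x ^+ 2) by apply: tf_sq; exact: tfM t t.1.
have [h1 h2] := sq_prod (sq_meas (su j)) (sq_meas (tf_sq t)) (u4 j) t4; split => //.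
apply: le_trans h2 _; rewrite [X in _ * X <= _](_ : _ = I2 (fun x => phi i x ^+ 4))//.
by apply: eq_J => x; rewrite -exprM.
Qed.

Let conv_terms phi : test_field O phi -> ig (lebs R) (conv_form (zext O u) (wgrad O u) phi : R2 -> R) /\
  I2 (conv_form (zext O u) (wgrad O u) phi) =
  \sum_i \sum_j J (lebs R) (fun x : R2 => wgrad O u i j x * (zext O u j x * phi i x)).
Proof.
move=> tp.
have A i j x : zext O u j x * (wgrad O u i j x * phi i x) = wgrad O u i j x * (zext O u j x * phi i x) by ring.
have I0 i j : ig (lebs R) (fun x : R2 => zext O u j x * (wgrad O u i j x * phi i x)).
  by apply: eq_ig (sq_mul (gu i j) (prod_sq i j tp).1) => x; rewrite A.
split; first by case: (conv_form_sum I0).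
rewrite (conv_form_sum I0).2; apply: eq_bigr => i _; apply: eq_bigr => j _; by apply: eq_J => x; rewrite A.
Qed.

Lemma residual_lin : lin (test_field O : E -> Prop) residual.
Proof.
move=> c phi psi tp tq; have tvp i := test_tf i tp; have tvq i := test_tf i tq.
have sgp := sq2_grad tvp; have sgq := sq2_grad tvq.
have e i x : (c *: phi + psi) i x = c * phi i x + psi i x by [].
have Lf : load f (c *: phi + psi) = c * load f phi + load f psi.
  rewrite /load mulr_sumr -big_split /=; apply: eq_bigr => i _.
  have i1 := sq_mul (hf i) (tf_sq (tvp i)); have i2 := sq_mul (hf i) (tf_sq (tvq i)).
  rewrite -(JZ _ i1) -(JD (igZ c i1) i2); apply: eq_J => x; rewrite e; ring.
have Lc : I2 (conv_form (zext O u) (wgrad O u) (c *: phi + psi)) = c * I2 (conv_form (zext O u) (wgrad O u) phi) + I2 (conv_form (zext O u) (wgrad O u) psi).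
  have i1 := (conv_terms tp).1; have i2 := (conv_terms tq).1.
  rewrite /I2 -(JZ _ i1) -(JD (igZ c i1) i2); apply: eq_J => x.
  pose A i := \sum_j zext O u j x * wgrad O u i j x.
  have cf w : conv_form (zext O u) (wgrad O u) w x = A 0 * w 0 x + A 1 * w 1 x by rewrite /conv_form sum_I2.
  rewrite !cf !e; clearbody A; ring.
have C G H : I2 (visc_form nu G H) = I2 (visc_form nu H G) by apply: eq_J => x; exact: visc_formC.
have Lv : I2 (visc_form nu (wgrad O u) (grad (c *: phi + psi))) = c * I2 (visc_form nu (wgrad O u) (grad phi)) + I2 (visc_form nu (wgrad O u) (grad psi)).
  rewrite C grad_lin// (visc_form_lin mnu nu1 num c sgp sgq gu).
  by rewrite (C (grad phi)) (C (grad psi)).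
rewrite /residual Lf Lc Lv.
by move: (load f phi) (load f psi) (I2 _) (I2 _) (I2 _) (I2 _) => *; ring.
Qed.

(** The load is bounded by Poincare's inequality and the viscous term through [nu <= m]. For
    convection, [u] in L^4 and Ladyzhenskaya's inequality for [phi] bound [u_j phi_i] in L^2 by the
    Dirichlet norm. *)
Lemma residual_bounded : dirichlet_bounded residual.
Proof.
have [P [P0 HP]] := dirichlet_poincare.
apply: dirichlet_boundedB; first apply: dirichlet_boundedB.
- apply: dirichlet_bounded_sum => i; apply: (dirichlet_bounded_J (hf i) P0) => phi tp; split.
    exact/tf_sq/test_tf.
  exact: HP.
- have B i j : dirichlet_bounded (fun phi => J (lebs R) (fun x : R2 => wgrad O u i j x * (zext O u j x * phi i x))).
    pose N := nsq (lebs R) (fun x : R2 => zext O u j x ^+ 2); have N0 : 0 <= N := nsq_ge0 _ _.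
    have K0 : 0 <= N * (2 * P) by rewrite mulr_ge0// mulr_ge0.
    apply: (dirichlet_bounded_J (C := N * (2 * P) + 1) (gu i j)); first by rewrite addr_ge0.
    move=> phi tp; have [s b] := prod_sq i j tp; split => //.
    apply: le_of_sqr => //; first exact: dirichlet_ge0.
    apply: le_trans b _; rewrite -/N -mulrA; apply: ler_wpM2l => //.
    apply: le_trans (ladyzhenskaya (test_tf i tp)) _; rewrite -mulrA ler_pM2l// expr2 mulrA.
    apply: ler_pM; rewrite ?sqn_ge0 ?grn_ge0//; first exact: HP.
    by apply: (@le_sum_I2 R (fun i => grn (phi i))) => a; exact: grn_ge0.
  have [C [C0 HC]] := dirichlet_bounded_sum (fun i => dirichlet_bounded_sum (B i)).
  by exists C; split => // phi tp; rewrite (conv_terms tp).2; exact: HC.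
- have B i j : dirichlet_bounded (fun phi => J (lebs R) (fun x : R2 => symm (wgrad O u) i j x * (nu x * symm (grad phi) i j x))).
    apply: (dirichlet_bounded_J (C := m ^+ 2) (sq2_symm gu i j)); first exact: sqr_ge0.
    move=> phi tp; have ss := sq2_symm (sq2_grad (fun i => test_tf i tp)) i j; have s := sq_nu mnu nu1 num ss.
    split => //; apply: le_trans (_ : m ^+ 2 * nsq (lebs R) (symm (grad phi) i j : R2 -> R) <= _).
      have [_ i1] := s; have [_ i2] := ss; rewrite /nsq -(JZ _ i2); apply: J_le => //; first exact: igZ.
      move=> x; rewrite exprMn ler_wpM2r ?sqr_ge0// ler_sqr ?nnegrE//.
        by apply: le_trans (nu1 x).
      by apply: le_trans (num x); apply: le_trans (nu1 x).
    apply: ler_wpM2l; first exact: sqr_ge0.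
    have g1 : sq (lebs R) (grad phi i j : R2 -> R) by exact: sq2_grad (fun i => test_tf i tp) i j.
    have g2 : sq (lebs R) (grad phi j i : R2 -> R) by exact: sq2_grad (fun i => test_tf i tp) j i.
    have [_ g3] := sqD g1 g2.
    have -> : nsq (lebs R) (symm (grad phi) i j : R2 -> R) = (2^-1) ^+ 2 * nsq (lebs R) (fun x : R2 => grad phi i j x + grad phi j i x).
      by rewrite -(JZ _ g3); apply: eq_J => x; rewrite /symm exprMn.
    have := nsqD g1 g2; have := sqn_partial_dirichlet phi i j; have := sqn_partial_dirichlet phi j i.
    rewrite -/(nsq (lebs R) (grad phi i j : R2 -> R)).
    rewrite -[sqn (partial j (phi i))]/(nsq (lebs R) (grad phi i j : R2 -> R)) -[sqn (partial i (phi j))]/(nsq (lebs R) (grad phi j i : R2 -> R)).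
    by move: (nsq _ _) (nsq _ _) (nsq _ _) (dirichlet phi) => a b c d' *; lra.
  have [C [C0 HC]] := dirichlet_bounded_sum (fun i => dirichlet_bounded_sum (B i)).
  exists C; split => // phi tp.
  by rewrite (visc_form_sum mnu nu1 num gu (sq2_grad (fun i => test_tf i tp))).2; exact: HC.
Qed.

End Residual.

Lemma divg_tf phi : test_field O phi -> test_fun O (divg phi).
Proof. by move=> tp; apply: test_fun_sum => i; exact: test_fun_partial. Qed.

Lemma divg_lin c phi psi x : test_field O phi -> test_field O psi -> divg (c *: phi + psi) x = c * divg phi x + divg psi x.
Proof.
move=> tp tq; rewrite /divg mulr_sumr -big_split /=; apply: eq_bigr => i _.
by have := congr1 (fun G => G i i x) (grad_lin c (fun i => test_tf i tp) (fun i => test_tf i tq)).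
Qed.

Lemma test_field_lin c phi psi : test_field O phi -> test_field O psi -> test_field O (c *: phi + psi : E).
Proof. by move=> tp tq i; apply: test_funD; [apply: test_funZ; exact: tp|exact: tq]. Qed.

Lemma test_field0 : test_field O (0 : E).
Proof. by move=> i; exact: test_fun_cst0. Qed.

Hypotheses (neO : O !=set0) (conO : connected O) (cO : compact (closure O)) (coneO : forall x0, closure O x0 -> cone_at O x0).

(* De Rham's theorem for functionals bounded by the Dirichlet norm: the pressure is the
   L^2 limit of the divergences of fields almost representing [l]. *)
Lemma de_rham (l : E -> R) : lin (test_field O : E -> Prop) l -> dirichlet_bounded l ->
  (forall w, solenoidal_test_field O w -> l w = 0) ->
  exists q, sq (lebs R) (q : R2 -> R) /\ forall phi, test_field O phi -> l phi = J (lebs R) (fun x : R2 => q x * divg phi x).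
Proof.
move=> hl [K [K0 HK]] l0.
have [C [C0 HC]] := div_solve oO neO conO cO coneO.
pose a phi psi := I2 (fun x => divg phi x * divg psi x).
have cd phi psi : test_field O phi -> test_field O psi -> cc (fun x => divg phi x * divg psi x).
  by move=> tp tq; apply: ccM; [exact/tf_cc/test_fun_tf/divg_tf|exact: (tf_cc (test_fun_tf (divg_tf tq))).1].
have aC phi psi : test_field O phi -> test_field O psi -> a phi psi = a psi phi.
  by move=> _ _; apply: eq_J => x; rewrite mulrC.
have aL c phi psi w : test_field O phi -> test_field O psi -> test_field O w -> a (c *: phi + psi) w = c * a phi w + a psi w.
  move=> tp tq tw; have i1 := cc_ig (cd _ _ tp tw); have i2 := cc_ig (cd _ _ tq tw).
  rewrite /a /I2 -(JZ _ i1) -(JD (igZ c i1) i2); apply: eq_J => x; rewrite divg_lin//; ring.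
have a0 phi : test_field O phi -> 0 <= a phi phi.
  by move=> _; apply: J_ge0 => x; rewrite -expr2 sqr_ge0.
(* [v] has the divergence of [phi] and a gradient controlled by it, and [phi - v] is solenoidal, so
   [l phi = l v]. The factor 4 counts the entries of the gradient. *)
have bl phi : test_field O phi -> l phi ^+ 2 <= (K * (4 * C)) * a phi phi.
  move=> tp; have td := divg_tf tp.
  have z : I2 (divg phi) = 0.
    transitivity (I2 (fun x => partial 0 (phi 0) x + partial 1 (phi 1) x)); first by apply: eq_J => x; rewrite /divg sum_I2.
    have t i := tf_partial i (test_tf i tp).
    by rewrite I2D ?I2_partial ?addr0//; [exact: test_tf|exact: test_tf|exact: tf_cc|exact: tf_cc].
  have [v [tv dv bv]] := HC _ td z.
  have Dd : solenoidal_test_field O (-1 *: v + phi : E).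
    split; first exact: test_field_lin.
    by move=> x; rewrite -/(divg _ x) divg_lin// mulN1r dv addrC subrr.
  have -> : l phi = l v by have := hl (-1) v phi tv tp; rewrite (l0 _ Dd); move: (l v) (l phi) => x y; lra.
  apply: le_trans (HK v tv) _; rewrite -mulrA; apply: ler_wpM2l => //.
  have -> : a phi phi = I2 (fun x => divg phi x ^+ 2) by apply: eq_J => x; rewrite expr2.
  have -> : 4 * C * I2 (fun x => divg phi x ^+ 2) = 2 * (2 * (C * I2 (fun x => divg phi x ^+ 2))).
    by move: (I2 _) => y; ring.
  by apply: sum_I2_le => i; apply: sum_I2_le => j; exact: bv.
have KC : 0 <= K * (4 * C) by rewrite mulr_ge0// mulr_ge0.
have [z [hz Hz]] := riesz_seq test_field0 test_field_lin aC aL a0 KC hl bl.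
have Cz := riesz_cauchy test_field_lin aL a0 hz hl Hz.
have tz n := test_fun_tf (divg_tf (hz n)).
have [] := @L2_complete _ _ _ (lebs R) (fun n => divg (z n) : R2 -> R).
- by move=> n; exact: tf_sq.
- apply: (cauchy_harmonic ler01) => k n; rewrite mul1r; apply: le_trans (_ : a (z k - z n) (z k - z n) <= _).
    rewrite le_eqVlt; apply/orP; left; apply/eqP; apply: eq_J => x; rewrite -expr2.
    have -> : z k - z n = -1 *: z n + z k by rewrite scaleN1r addrC.
    by rewrite divg_lin//; congr (_ ^+ 2); ring.
  by apply: le_trans (Cz k n) _; apply: lerD; rewrite ler_pM2r ?invr_gt0// ler_nat.
move=> q [_ [sq' _ _ cq]]; exists q; split => // phi tp.
have L1 := J_sq_lim sq' (tf_sq (test_fun_tf (divg_tf tp))) (fun n => tf_sq (tz n)) cq.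
have L2 : (fun n => a (z n) phi) @ \oo --> l phi.
  apply/cvgrPdist_le => e e0.
  have e1 : 0 < e ^+ 2 / (a phi phi + 1) by rewrite divr_gt0 ?exprn_gt0// ltr_wpDl// a0.
  apply: filterS (near_inv e1) => n hn; rewrite distrC -ler_sqr ?nnegrE ?(ltW e0)// (real_normK (num_real _)).
  apply: le_trans (Hz n phi tp) _; move: hn; rewrite ltr_pdivlMr ?ltr_wpDl ?a0// => /ltW; apply: le_trans.
  by rewrite ler_wpM2l ?invr_ge0// lerDl.
exact: (cvg_unique _ L2 L1).
Qed.

End Pressure.

Lemma symgradE (R : realType) (O : set (R * R)) (u : vfield R) i j x : O x -> symgrad O u i j x = symm (wgrad O u) i j x.
Proof. by move=> Ox; congr (_ * (_ + _)); exact/esym/restrict_in. Qed.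

Lemma symm_wgrad_out (R : realType) (O : set (R * R)) (u : vfield R) i j x : ~ O x -> symm (wgrad O u) i j x = 0.
Proof.
move=> nO; have out k l : wgrad O u k l x = 0 := restrict_out _ nO.
by rewrite /symm !out addr0 mulr0.
Qed.

(** Contracted with a symmetric tensor, the symmetrized gradient of an axis field acts as the plain
    gradient: this passes from the double product to row [i] of the divergence. *)
Lemma symm_axis (R : realFieldType) (i : 'I_2) (H : 'I_2 -> 'I_2 -> R) (d : 'I_2 -> R) :
  \sum_k \sum_j 2^-1 * (H k j + H j k) * (2^-1 * ((if k == i then d j else 0) + (if j == i then d k else 0))) =
  \sum_j 2^-1 * (H i j + H j i) * d j.
Proof.
have sum2 (F : 'I_2 -> R) : \sum_i F i = F 0 + F 1.
  by rewrite big_ord_recl (big_ord_recl 0) big_ord0 addr0; congr (_ + F _); exact/val_inj.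
have [e01 e10] : ((0 == 1 :> 'I_2) = false) * ((1 == 0 :> 'I_2) = false) by [].
by rewrite !sum2; have [->|->] := I2_case i; rewrite !eqxx ?e01 ?e10; field.
Qed.

(** * The momentum equation in the sense of distributions *)

Section MomentumEquation.
Variable R : realType.
Local Notation R2 := (measurableTypeR R * measurableTypeR R)%type.
Variables (O : set (R * R)) (M : R).
Hypotheses (oO : open O) (M0 : 0 < M) (OM : forall x, O x -> `|x| <= M).
Hypotheses (neO : O !=set0) (conO : connected O) (cO : compact (closure O)) (coneO : forall x0, closure O x0 -> cone_at O x0).
Variables (nu : R * R -> R) (m : R) (f u : vfield R).
Hypotheses (mnu : measurable_fun setT (nu : R2 -> R)) (nu1 : forall x, 1 <= nu x) (num : forall x, nu x <= m).
Hypotheses (hf : forall i, L2 O (f i)) (Vu : V O u).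
Hypothesis weak : forall w, solenoidal_test_field O w ->
  I2 (conv_form (zext O u) (wgrad O u) w) + I2 (visc_form nu (wgrad O u) (grad w)) = load (zext O f) w.

(** Tests the vector equation one component at a time. *)
Definition axis_field (i : 'I_2) (phi : R * R -> R) : vfield R := fun k => if k == i then phi else fun=> 0.

Lemma axis_field_test i phi : test_fun O phi -> test_field O (axis_field i phi).
Proof. by move=> tp k; rewrite /axis_field; case: ifP => _ //; exact: test_fun_cst0. Qed.

Lemma partial_axis_field i phi j k x : partial j (axis_field i phi k) x = if k == i then partial j phi x else 0.
Proof. by rewrite /axis_field; case: ifP => _ //; exact: partial_cst. Qed.

Lemma sum_axis (i : 'I_2) (F : 'I_2 -> R) : (forall k, k != i -> F k = 0) -> \sum_k F k = F i.
Proof. by move=> h; rewrite (bigD1 i)//= big1 ?addr0// => k /h. Qed.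

Lemma momentum_equation : exists p, L2 O p /\ momentum_eq O nu f u p.
Proof.
have ST : solenoidal_test_field O `<=` test_field O by move=> w [].
have hu : H1 O u by case: Vu => [[]].
have hf' : sq1 (zext O f) by move=> i; exact/L2_sq.
have [v hv] := closure_seq oO OM ST Vu.2.
have tv n : test_field O (v n) by apply: ST; case: (hv n).
have dv n : dist2 O u (v n) <= n.+1%:R^-1 by case: (hv n).
have u4 i := L4_field i hu tv dv.
have rl := residual_lin (O := O) mnu nu1 num hf' hu u4.
have rb := residual_bounded M0 OM mnu nu1 num hf' hu u4.
have [|q [sq' hq]] := de_rham oO neO conO cO coneO rl rb.
  by move=> w hw; rewrite /residual -weak//; move: (I2 _) (I2 _) => x y; ring.
(* [q] represents the residual against the divergence, whereas the distributional gradient of [p] is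
   minus the pairing of [p] with the divergence: hence the sign. *)
exists (fun x => - q x); split; first by apply/L2_sq; apply: sq_restrict_le => //; exact: sqN.
move=> i phi tp; have t := test_fun_tf tp; have := hq _ (axis_field_test i tp).
have out x : ~ O x -> phi x = 0 by exact: test_fun0.
have dout j x : ~ O x -> partial j phi x = 0 by apply: test_fun0; exact: test_fun_partial.
have E1 : regular_distrib O (f i) phi = load (zext O f) (axis_field i phi).
  rewrite /load (sum_axis (i := i)); last first.
    move=> k ki; rewrite -[RHS](J0 (lebs R)); apply: eq_J => x.
    by rewrite /axis_field (negPf ki) mulr0.
  rewrite /axis_field eqxx; apply: Rintegral_ext => x Ox; first by rewrite /zext restrict_in.
  by rewrite out// mulr0.
have E2 : regular_distrib O (convection O u i) phi = I2 (conv_form (zext O u) (wgrad O u) (axis_field i phi)).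
  apply: Rintegral_ext => x Ox; rewrite /conv_form (sum_axis (i := i)); last 3 first.
  - by move=> k ki; rewrite /axis_field (negPf ki) mulr0.
  - by rewrite /axis_field eqxx out// mulr0.
  - by move=> k ki; rewrite /axis_field (negPf ki) mulr0.
  rewrite /axis_field eqxx /convection; congr (_ * _); apply: eq_bigr => j _.
  by rewrite /zext /wgrad !restrict_in.
have ss := sq2_symm (H1_sq2 hu); have st j := tf_sq (tf_partial j t).
have iT j : ig (lebs R) (fun x : R2 => nu x * symm (wgrad O u) i j x * partial j phi x).
  exact: sq_mul (sq_nu mnu nu1 num (ss i j)) (st j).
have E3 : - \sum_j distrib_partial j (regular_distrib O (fun x => nu x * symgrad O u i j x)) phi =
    I2 (visc_form nu (wgrad O u) (grad (axis_field i phi))).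
  transitivity (\sum_j J (lebs R) (fun x : R2 => nu x * symm (wgrad O u) i j x * partial j phi x)).
    rewrite -sumrN; apply: eq_bigr => j _; rewrite /distrib_partial opprK.
    apply: Rintegral_ext => x Ox; last by rewrite dout// mulr0.
    by rewrite symgradE.
  rewrite -J_sum//; apply: eq_J => x.
  have D : double_dot (symm (wgrad O u)) (symm (grad (axis_field i phi))) x = \sum_j symm (wgrad O u) i j x * partial j phi x.
    rewrite -(symm_axis i (fun k j => wgrad O u k j x) (fun j => partial j phi x)).
    by apply: eq_bigr => k _; apply: eq_bigr => j _; rewrite /symm /grad !partial_axis_field.
  by rewrite /visc_form D mulr_sumr; apply: eq_bigr => j _; rewrite mulrA.
have E4 : distrib_partial i (regular_distrib O (fun x => - q x)) phi = J (lebs R) (fun x : R2 => q x * divg (axis_field i phi) x).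
  rewrite /distrib_partial; have -> : regular_distrib O (fun x => - q x) (partial i phi) = J (lebs R) (fun x : R2 => -1 * (q x * partial i phi x)).
    by apply: Rintegral_ext => x Ox; [rewrite mulN1r mulNr|rewrite dout// !mulr0].
  rewrite JZ; last exact: sq_mul.
  rewrite mulN1r opprK; apply: eq_J => x; congr (_ * _).
  rewrite /divg (sum_axis (i := i)); last by move=> k ki; rewrite partial_axis_field (negPf ki).
  by rewrite partial_axis_field eqxx.
rewrite E1 E2 E3 E4 => <-; rewrite /residual.
by move: (load _ _) (I2 _) (I2 _) => x y z; ring.
Qed.

End MomentumEquation.

Lemma visc_measurable (R : realType) (S : set (R * R)) (m : R) : open S ->
  measurable_fun setT (visc S m : (measurableTypeR R * measurableTypeR R)%type -> R).
Proof.
move=> oS; have -> : (visc S m : (measurableTypeR R * measurableTypeR R)%type -> R) = fun x => 1 + (m - 1) * \1_S x.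
  apply/funext => x; rewrite /visc indicE; case: (x \in S); last by rewrite mulr0 addr0.
  by rewrite mulr1 addrC subrK.
apply: measurable_funD => //; apply: measurable_funM => //.
by apply: measurable_indic; exact: open_measurable_plane.
Qed.

Theorem theorem2p1 (R : realType) (Omega S : set (R * R)) (m : R)
    (f : vfield R)
    (hOmega : is_domain Omega) (hbounded : bounded_set Omega)
    (hC2 : C2_boundary Omega)
    (hS : is_domain S) (hSOmega : S `<=` Omega) (hm : 1 <= m)
    (hf : forall i, L2 Omega (f i)) :
  exists u : vfield R,
    [/\ V Omega u,
        forall w : vfield R, V Omega w ->
          \int[leb2 R]_(x in Omega) dot (convection Omega u) w x
          + \int[leb2 R]_(x in Omega)
              (visc S m x * double_dot (symgrad Omega u) (symgrad Omega w) x)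
          = \int[leb2 R]_(x in Omega) dot f w x
      & exists p : sfield R,
          L2 Omega p /\ momentum_eq Omega (visc S m) f u p].
Proof.
have [oO neO conO] := hOmega; have [oS _ _] := hS.
have [M [M0 OM]] : exists M : R, 0 < M /\ forall x, Omega x -> `|x| <= M.
  have [N [_ HN]] := hbounded; exists (`|N| + 1); split; first by have := normr_ge0 N; lra.
  by apply: HN; have := ler_norm N; lra.
have cO : compact (closure Omega).
  have cB : compact [set x : R * R | `|x| <= M] by exact: compact_box.
  have clB : closed [set x : R * R | `|x| <= M] by apply: compact_closed => //; exact: norm_hausdorff.
  have sB : closure Omega `<=` [set x : R * R | `|x| <= M] by move/closure_id: clB => ->; exact: closureS.
  by rewrite -(setIidr sB); apply: compact_closedI => //; exact: closed_closure.
have mnu := visc_measurable m oS.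
have nu1 x : 1 <= visc S m x by rewrite /visc; case: ifP.
have num x : visc S m x <= m by rewrite /visc; case: ifP.
have hf' : sq1 (zext Omega f) by move=> i; exact/L2_sq.
have [u [Vu eqn]] := exists_weak_solution oO M0 OM mnu nu1 num hf'.
exists u; split => //; last exact: (momentum_equation oO M0 OM neO conO cO (cone_closure oO hC2) mnu nu1 num hf Vu eqn).
move=> w Vw; have hw : H1 Omega w by case: Vw => [[]].
have := weak_equation_extends oO OM mnu nu1 num hf' Vu eqn Vw.
have E1 : \int[leb2 R]_(x in Omega) dot (convection Omega u) w x = I2 (conv_form (zext Omega u) (wgrad Omega u) (zext Omega w)).
  apply: Rintegral_ext => x Ox; last first.
    by rewrite /conv_form big1// => i _; rewrite /zext [X in _ * X]restrict_out// mulr0.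
  apply: eq_bigr => i _; rewrite /convection /zext /wgrad; congr (_ * _); last by rewrite restrict_in.
  by apply: eq_bigr => j _; rewrite !restrict_in.
have E2 : \int[leb2 R]_(x in Omega) (visc S m x * double_dot (symgrad Omega u) (symgrad Omega w) x) =
    I2 (visc_form (visc S m) (wgrad Omega u) (wgrad Omega w)).
  apply: Rintegral_ext => x Ox; rewrite /visc_form /double_dot.
    by congr (_ * _); apply: eq_bigr => i _; apply: eq_bigr => j _; rewrite !symgradE.
  by rewrite big1 ?mulr0// => i _; rewrite big1// => j _; rewrite symm_wgrad_out// mul0r.
have E3 : \int[leb2 R]_(x in Omega) dot f w x = load (zext Omega f) (zext Omega w).
  rewrite /load -J_sum; last by move=> i; apply: sq_mul; [exact: hf'|exact: H1_sq1].
  apply: Rintegral_ext => x Ox; first by apply: eq_bigr => i _; rewrite /zext !restrict_in.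
  by rewrite big1// => i _; rewrite /zext restrict_out// mul0r.
by rewrite E1 E2 E3.
Qed.
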